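(* The action of $Mod(\Sigma_{0,4})$ on each non-extremal connected component of $\mathcal M(\Sigma_{0,4})$ is ergodic, with respect to the measure induced by the Goldman symplectic form.
   Context: $\Sigma_{0,4}$ is the oriented sphere with punctures $v_1,\dots,v_4$. A representation $\rho:\pi_1(\Sigma_{0,4})\to PSL(2,\mathbb R)$ is type-preserving if it sends every (non-trivial) peripheral element (one freely homotopic to a circle around a single puncture) to a parabolic element; it is non-elementary if its image is Zariski-dense. $\mathcal M(\Sigma_{0,4})$ is the space of $PSL(2,\mathbb R)$-conjugacy classes of non-elementary type-preserving representations; it is a smooth $2$-dimensional manifold carrying the Goldman symplectic form $\omega_{WP}$, which restricts to the Weil–Petersson form on the Teichmüller component. The measure induced by $\omega_{WP}$ is in the class of Lebesgue measure on this $2$-manifold. Relative Euler class: $e(\rho)=\frac1{2\pi}\int_{\Sigma_{0,4}}(D_\rho)^*\omega$, where $\omega$ is the hyperbolic area form and $D_\rho:\widetilde{\Sigma_{0,4}}\to\mathbb H^2$ is a piecewise smooth $\rho$-equivariant map which sends each lift of a puncture to the fixed point in $\partial\mathbb H^2$ of the $\rho$-image of the corresponding peripheral subgroup. Equivalently: write $\pi_1(\Sigma_{0,4})=\langle c_1,\dots,c_4\mid c_1c_2c_3c_4=1\rangle$ with $c_i$ going once counterclockwise around $v_i$, let $\tilde c_i$ be the lift of $\rho(c_i)$ to the universal cover of $PSL(2,\mathbb R)$ having fixed points on the universal cover of $\partial\mathbb H^2$; then $\tilde c_1\tilde c_2\tilde c_3\tilde c_4=z^{e(\rho)}$, $z$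 the generator of the centre given by one positive full turn. One has $|e(\rho)|\leqslant 2$; a connected component of $\mathcal M(\Sigma_{0,4})$ is extremal if $|e(\rho)|=2$ on it, and non-extremal if $e(\rho)\in\{-1,0,1\}$ on it. $Mod(\Sigma_{0,4})$ is the group of relative isotopy classes of orientation preserving self-diffeomorphisms of $\Sigma_{0,4}$ that fix each puncture. It acts on $\mathcal M(\Sigma_{0,4})$ by precomposition through its identification with a group of outer automorphisms of $\pi_1(\Sigma_{0,4})$, preserving each connected component. An action on a measure space is ergodic if every invariant measurable set is null or co-null. *)

(* Defs.v *)
From HB Require Import structures.
From mathcomp Require Import all_boot all_order all_algebra.
From mathcomp Require Import generic_quotient.
From mathcomp Require Import all_classical all_reals all_analysis.
From mathcomp Require mpoly.

Set Implicit Arguments.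
Unset Strict Implicit.
Unset Printing Implicit Defensive.

Import Order.TTheory GRing.Theory Num.Theory.
Import numFieldNormedType.Exports.

Local Open Scope classical_set_scope.
Local Open Scope ring_scope.
Local Open Scope quotient_scope.

(* The fundamental group < c_1, ..., c_4 | c_1 c_2 c_3 c_4 = 1 > of the       *)
(* four-punctured sphere, as a quotient of the set of words: the letter       *)
(* (i, true) stands for c_(i+1) and (i, false) for its inverse.               *)
Definition word : Type := seq ('I_4 * bool).

Definition relator : word := [seq (i, true) | i <- enum 'I_4].

Inductive word_eq : word -> word -> Prop :=
| word_eq_refl u : word_eq u u
| word_eq_sym u v : word_eq u v -> word_eq v u
| word_eq_trans u v w : word_eq u v -> word_eq v w -> word_eq u w
| word_eq_cat u u' v v' :
    word_eq u u' -> word_eq v v' -> word_eq (u ++ v) (u' ++ v')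
| word_eq_cancel i b : word_eq [:: (i, b); (i, ~~ b)] [::]
| word_eq_relator : word_eq relator [::].

Definition word_eqb (u v : word) : bool := `[< word_eq u v >].

Lemma word_eqb_refl : reflexive word_eqb.
Proof. by move=> u; apply/asboolP; exact: word_eq_refl. Qed.

Lemma word_eqb_sym : symmetric word_eqb.
Proof.
by move=> u v; apply/asboolP/asboolP => uv; exact: word_eq_sym.
Qed.

Lemma word_eqb_trans : transitive word_eqb.
Proof.
move=> v u w /asboolP uv /asboolP vw; apply/asboolP.
exact: word_eq_trans uv vw.
Qed.

Canonical word_equiv :=
  EquivRel word_eqb word_eqb_refl word_eqb_sym word_eqb_trans.

Definition pi1 : Type := {eq_quot word_equiv}.
HB.instance Definition _ := EqQuotient.on pi1.
HB.instance Definition _ := Choice.on pi1.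

Definition word_inv (u : word) : word := rev [seq (l.1, ~~ l.2) | l <- u].

Lemma word_invK : involutive word_inv.
Proof.
move=> u; rewrite /word_inv map_rev revK -map_comp -[RHS]map_id.
by apply: eq_map => -[i b] /=; rewrite negbK.
Qed.

Lemma word_eq_invr (u : word) : word_eq (u ++ word_inv u) [::].
Proof.
elim: u => [|[i b] u IH]; first exact: word_eq_refl.
have -> : word_inv ((i, b) :: u) = word_inv u ++ [:: (i, ~~ b)].
  by rewrite /word_inv /= rev_cons cats1.
have -> : ((i, b) :: u) ++ word_inv u ++ [:: (i, ~~ b)] =
    [:: (i, b)] ++ ((u ++ word_inv u) ++ [:: (i, ~~ b)]) by rewrite -!catA.
apply: word_eq_trans (word_eq_cancel i b).
apply: (@word_eq_cat [:: (i, b)] [:: (i, b)]); first exact: word_eq_refl.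
apply: (@word_eq_cat _ [::] [:: (i, ~~ b)]) => //; exact: word_eq_refl.
Qed.

Lemma word_eq_invl (u : word) : word_eq (word_inv u ++ u) [::].
Proof. by rewrite -{2}[u]word_invK; exact: word_eq_invr. Qed.

Lemma word_eq_inv (u v : word) :
  word_eq u v -> word_eq (word_inv u) (word_inv v).
Proof.
move=> uv; apply: word_eq_trans (_ : word_eq _ (word_inv u ++ v ++ word_inv v)) _.
  rewrite -{1}[word_inv u]cats0; apply: word_eq_cat; first exact: word_eq_refl.
  exact/word_eq_sym/word_eq_invr.
rewrite catA -{2}[word_inv v]cat0s; apply: word_eq_cat; last exact: word_eq_refl.
apply: word_eq_trans (word_eq_invl u); apply: word_eq_cat; first exact: word_eq_refl.
exact: word_eq_sym.
Qed.

Lemma pi1P (u v : word) : reflect (\pi_pi1 u = \pi_pi1 v) `[< word_eq u v >].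
Proof. exact: (@eqquotP _ word_equiv pi1). Qed.

Lemma word_eq_repr (u : word) : word_eq (repr (\pi_pi1 u)) u.
Proof. by apply/asboolP/pi1P; rewrite reprK. Qed.

Definition pi1_one : pi1 := \pi_pi1 [::].
Definition pi1_mul (x y : pi1) : pi1 := \pi_pi1 (repr x ++ repr y).
Definition pi1_inv (x : pi1) : pi1 := \pi_pi1 (word_inv (repr x)).

Lemma pi1_mulE (u v : word) : pi1_mul (\pi_pi1 u) (\pi_pi1 v) = \pi_pi1 (u ++ v).
Proof. by apply/pi1P/asboolP; apply: word_eq_cat; exact: word_eq_repr. Qed.

Lemma pi1_invE (u : word) : pi1_inv (\pi_pi1 u) = \pi_pi1 (word_inv u).
Proof. by apply/pi1P/asboolP; apply: word_eq_inv; exact: word_eq_repr. Qed.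

Lemma pi1_mulA : associative pi1_mul.
Proof.
suff H u v w : pi1_mul (\pi u) (pi1_mul (\pi v) (\pi w)) =
    pi1_mul (pi1_mul (\pi u) (\pi v)) (\pi w).
  by move=> x y z; rewrite -[x]reprK -[y]reprK -[z]reprK.
rewrite (pi1_mulE v w) (pi1_mulE u (v ++ w)) (pi1_mulE u v).
by rewrite (pi1_mulE (u ++ v) w) catA.
Qed.

Lemma pi1_mul1 : left_id pi1_one pi1_mul.
Proof. by move=> x; rewrite -[x]reprK (pi1_mulE _ _). Qed.

Lemma pi1_mulr1 : right_id pi1_one pi1_mul.
Proof. by move=> x; rewrite -[x]reprK (pi1_mulE _ _) cats0. Qed.

Lemma pi1_mulV : left_inverse pi1_one pi1_inv pi1_mul.
Proof.
move=> x; rewrite -[x]reprK pi1_invE pi1_mulE.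
by apply/pi1P/asboolP; exact: word_eq_invl.
Qed.

Lemma pi1_mulrV : right_inverse pi1_one pi1_inv pi1_mul.
Proof.
move=> x; rewrite -[x]reprK pi1_invE pi1_mulE.
by apply/pi1P/asboolP; exact: word_eq_invr.
Qed.

HB.instance Definition _ :=
  isGroup.Build pi1 pi1_mulA pi1_mul1 pi1_mulr1 pi1_mulV pi1_mulrV.

Definition loop (i : 'I_4) : pi1 := \pi_pi1 [:: (i, true)].

(* The elements of the conjugates of the cyclic subgroups <c_i>.              *)
Definition peripheral (x : pi1) : Prop :=
  exists (i : 'I_4) (h : pi1) (n : nat),
    x = (h * loop i ^+ n * h^-1)%g \/ x = (h * loop i ^- n * h^-1)%g.

Section PSL2.
Variable R : realType.

Definition SL2 : Type := {A : 'M[R]_2 | \det A == 1}.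
Definition mkSL2 (A : 'M[R]_2) (dA : \det A == 1) : SL2 := exist _ A dA.
HB.instance Definition _ := SubChoice.on SL2.
HB.instance Definition _ :=
  Topological.copy SL2 (initial_topology (val : SL2 -> 'M[R]_2)).

Definition sl2_eq (A B : SL2) : bool :=
  (val A == val B) || (val A == - val B).

Lemma sl2_eq_refl : reflexive sl2_eq.
Proof. by move=> A; rewrite /sl2_eq eqxx. Qed.

Lemma sl2_eq_sym : symmetric sl2_eq.
Proof. by move=> A B; rewrite /sl2_eq eq_sym -eqr_oppLR [- _ == _]eq_sym. Qed.

Lemma sl2_eq_trans : transitive sl2_eq.
Proof.
move=> B A C; rewrite /sl2_eq => /orP[] /eqP-> /orP[] /eqP->;
  by rewrite ?opprK eqxx ?orbT.
Qed.

Canonical sl2_equiv := EquivRel sl2_eq sl2_eq_refl sl2_eq_sym sl2_eq_trans.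

Definition PSL2 : Type := quotient_topology {eq_quot sl2_equiv}.
HB.instance Definition _ := Topological.on PSL2.
HB.instance Definition _ := Quotient.on PSL2.

Lemma psl2P (A B : SL2) : reflect (\pi_PSL2 A = \pi_PSL2 B) (sl2_eq A B).
Proof. exact: (@eqquotP _ sl2_equiv {eq_quot sl2_equiv}). Qed.

Lemma sl2_repr (A : SL2) : sl2_eq (repr (\pi_PSL2 A)) A.
Proof. by apply/psl2P; rewrite reprK. Qed.

Lemma sl2_one_proof : \det (1%:M : 'M[R]_2) == 1.
Proof. by rewrite det1. Qed.
Definition sl2_one : SL2 := mkSL2 sl2_one_proof.

Lemma sl2_mul_proof (A B : SL2) : \det (val A *m val B) == 1.
Proof. by rewrite det_mulmx (eqP (valP A)) (eqP (valP B)) mulr1. Qed.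
Definition sl2_mul (A B : SL2) : SL2 := mkSL2 (sl2_mul_proof A B).

Lemma sl2_inv_proof (A : SL2) : \det (invmx (val A)) == 1.
Proof. by rewrite det_inv (eqP (valP A)) invr1. Qed.
Definition sl2_inv (A : SL2) : SL2 := mkSL2 (sl2_inv_proof A).

Lemma sl2_unit (A : SL2) : val A \in unitmx.
Proof. by rewrite unitmxE (eqP (valP A)) unitr1. Qed.

Lemma sl2_eq_mul (A A' B B' : SL2) :
  sl2_eq A A' -> sl2_eq B B' -> sl2_eq (sl2_mul A B) (sl2_mul A' B').
Proof.
rewrite /sl2_eq /= => /orP[] /eqP-> /orP[] /eqP->;
  by rewrite ?mulmxN ?mulNmx ?opprK eqxx ?orbT.
Qed.

Lemma sl2_eq_inv (A B : SL2) : sl2_eq A B -> sl2_eq (sl2_inv A) (sl2_inv B).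
Proof.
rewrite /sl2_eq /= => /orP[] /eqP->; first by rewrite eqxx.
apply/orP; right; apply/eqP; apply: (can_inj (mulKmx (sl2_unit B))).
rewrite mulmxN mulmxV ?sl2_unit // -[X in X *m _]opprK mulNmx mulmxV //.
by rewrite -scaleN1r unitmxZ ?unitrN1 ?sl2_unit.
Qed.

Definition psl2_one : PSL2 := \pi_PSL2 sl2_one.
Definition psl2_mul (x y : PSL2) : PSL2 := \pi_PSL2 (sl2_mul (repr x) (repr y)).
Definition psl2_inv (x : PSL2) : PSL2 := \pi_PSL2 (sl2_inv (repr x)).

Lemma psl2_mulE (A B : SL2) :
  psl2_mul (\pi_PSL2 A) (\pi_PSL2 B) = \pi_PSL2 (sl2_mul A B).
Proof. by apply/psl2P/sl2_eq_mul; exact: sl2_repr. Qed.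

Lemma psl2_invE (A : SL2) : psl2_inv (\pi_PSL2 A) = \pi_PSL2 (sl2_inv A).
Proof. by apply/psl2P/sl2_eq_inv; exact: sl2_repr. Qed.

Lemma psl2_mulA : associative psl2_mul.
Proof.
suff H A B C : psl2_mul (\pi A) (psl2_mul (\pi B) (\pi C)) =
    psl2_mul (psl2_mul (\pi A) (\pi B)) (\pi C).
  by move=> x y z; rewrite -[x]reprK -[y]reprK -[z]reprK.
rewrite (psl2_mulE B C) (psl2_mulE A (sl2_mul B C)) (psl2_mulE A B).
rewrite (psl2_mulE (sl2_mul A B) C).
by congr (\pi_PSL2 _); apply: val_inj; rewrite /= mulmxA.
Qed.

Lemma psl2_mul1 : left_id psl2_one psl2_mul.
Proof.
move=> x; rewrite -[x]reprK psl2_mulE.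
by congr (\pi_PSL2 _); apply: val_inj; rewrite /= mul1mx.
Qed.

Lemma psl2_mulr1 : right_id psl2_one psl2_mul.
Proof.
move=> x; rewrite -[x]reprK psl2_mulE.
by congr (\pi_PSL2 _); apply: val_inj; rewrite /= mulmx1.
Qed.

Lemma psl2_mulV : left_inverse psl2_one psl2_inv psl2_mul.
Proof.
move=> x; rewrite -[x]reprK psl2_invE psl2_mulE.
by congr (\pi_PSL2 _); apply: val_inj; rewrite /= mulVmx ?sl2_unit.
Qed.

Lemma psl2_mulrV : right_inverse psl2_one psl2_inv psl2_mul.
Proof.
move=> x; rewrite -[x]reprK psl2_invE psl2_mulE.
by congr (\pi_PSL2 _); apply: val_inj; rewrite /= mulmxV ?sl2_unit.
Qed.

HB.instance Definition _ :=
  isGroup.Build PSL2 psl2_mulA psl2_mul1 psl2_mulr1 psl2_mulV psl2_mulrV.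

(* One of the two matrices A, - A representing g; it is only used in ways     *)
(* that do not depend on the sign.                                            *)
Definition psl2_mx (g : PSL2) : 'M[R]_2 := val (repr g).

Definition parabolic (g : PSL2) : Prop := g <> 1%g /\ \tr (psl2_mx g) ^+ 2 = 4.

(* The Zariski topology of PSL(2,R) is the quotient of that of SL(2,R), so S  *)
(* is dense iff a polynomial in the matrix entries vanishes on SL(2,R) as     *)
(* soon as it vanishes on the preimage of S.                                  *)
Definition zariski_dense (S : set PSL2) : Prop :=
  forall p : mpoly.mpoly (2 * 2) R,
    (forall A : SL2, S (\pi_PSL2 A) ->
       mpoly.meval (fun k => mxvec (val A) 0 k) p = 0) ->
    forall A : SL2, mpoly.meval (fun k => mxvec (val A) 0 k) p = 0.

Definition type_preserving (rho : pi1 -> PSL2) : Prop :=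
  forall x, peripheral x -> x <> 1%g -> parabolic (rho x).

Definition non_elementary (rho : pi1 -> PSL2) : Prop :=
  zariski_dense (range rho).

(* The angle t represents the point tan t = sin t / cos t of the boundary     *)
(* RP^1 of the upper half-plane; increasing t is the positive direction and   *)
(* one full turn is a translation by pi.                                      *)
Definition dir (t : R) : 'cV[R]_2 :=
  \col_(i < 2) (if i == 0 then sin t else cos t).

(* The elements of the universal cover of PSL(2,R) above g, as maps of the    *)
(* universal cover of the boundary of the hyperbolic plane.                   *)
Definition is_lift (g : PSL2) (f : R -> R) : Prop :=
  continuous f /\
  forall t, exists k : R, psl2_mx g *m dir t = k *: dir (f t).

(* e(rho) = k; the lift of a parabolic element with a fixed point is unique,  *)
(* hence so is k.                                                             *)
Definition euler_class (rho : pi1 -> PSL2) (k : int) : Prop :=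
  exists f : 'I_4 -> R -> R,
    (forall i, is_lift (rho (loop i)) (f i) /\ exists t, f i t = t) /\
    forall t, f (inord 0) (f (inord 1) (f (inord 2) (f (inord 3) t)))
              = t + k%:~R * pi.

Record rep : Type := Rep {
  rep_hom :> {multiplicative pi1 -> PSL2};
  rep_type_preserving : type_preserving rep_hom;
  rep_non_elementary : non_elementary rep_hom }.

HB.instance Definition _ := gen_eqMixin rep.
HB.instance Definition _ := gen_choiceMixin rep.

(* The topology of pointwise convergence, i.e. that of a subspace of          *)
(* PSL(2,R)^4.                                                                *)
HB.instance Definition _ := Topological.copy rep
  (initial_topology (fun rho : rep => (fun i => rho (loop i)) : {ptws 'I_4 -> PSL2})).

Definition conjugate (rho sigma : rep) : bool :=
  `[< exists g : PSL2, forall x, sigma x = (g * rho x * g^-1)%g >].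

Lemma conjugate_refl : reflexive conjugate.
Proof. by move=> rho; apply/asboolP; exists 1%g => x; rewrite mul1g invg1 mulg1. Qed.

Lemma conjugate_sym : symmetric conjugate.
Proof.
suff H rho sigma : conjugate rho sigma -> conjugate sigma rho.
  by move=> rho sigma; apply/idP/idP; exact: H.
move=> /asboolP[g e]; apply/asboolP; exists g^-1%g => x.
by rewrite e invgK !mulgA mulVg mul1g -mulgA mulVg mulg1.
Qed.

Lemma conjugate_trans : transitive conjugate.
Proof.
move=> sigma rho tau /asboolP[g e] /asboolP[h e']; apply/asboolP.
by exists (h * g)%g => x; rewrite e' e invgM !mulgA.
Qed.

Canonical conjugate_equiv :=
  EquivRel conjugate conjugate_refl conjugate_sym conjugate_trans.

Definition moduli : Type := quotient_topology {eq_quot conjugate_equiv}.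
HB.instance Definition _ := Topological.on moduli.
HB.instance Definition _ := Quotient.on moduli.

Lemma moduliP (rho sigma : rep) :
  reflect (\pi_moduli rho = \pi_moduli sigma) (conjugate rho sigma).
Proof. exact: (@eqquotP _ conjugate_equiv {eq_quot conjugate_equiv}). Qed.

Definition is_component (C : set moduli) : Prop :=
  exists x : moduli, C = connected_component setT x.

Definition non_extremal (C : set moduli) : Prop :=
  forall rho : rep, C (\pi_moduli rho) ->
    exists2 k : int, euler_class rho k & k \in [:: -1; 0; 1].

End PSL2.

(* The automorphisms of the fundamental group that send each c_i to a         *)
(* conjugate of itself. By the Dehn-Nielsen-Baer theorem their classes modulo *)
(* inner automorphisms are the mapping classes that fix each puncture and     *)
(* preserve the orientation.                                                  *)
Record mcg : Type := Mcg {
  mcg_aut :> {multiplicative pi1 -> pi1};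
  mcg_bij : bijective mcg_aut;
  mcg_peripheral : forall i, exists h : pi1, mcg_aut (loop i) = (h * loop i * h^-1)%g }.

Lemma gmorph1 (G H : groupType) (f : {multiplicative G -> H}) : f 1%g = 1%g.
Proof. by apply: (mulgI (f 1%g)); rewrite -gmulfM !mulg1. Qed.

Lemma gmorphV (G H : groupType) (f : {multiplicative G -> H}) x :
  f (x^-1)%g = ((f x)^-1)%g.
Proof. by apply: (mulgI (f x)); rewrite -gmulfM !mulgV gmorph1. Qed.

Lemma gmorphX (G H : groupType) (f : {multiplicative G -> H}) x n :
  f (x ^+ n)%g = ((f x) ^+ n)%g.
Proof.
elim: n => [|n IH]; first by rewrite !expg0 gmorph1.
by rewrite !expgS gmulfM IH.
Qed.

Lemma conj_expg (G : groupType) (h x : G) n :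
  ((h * x * h^-1) ^+ n = h * x ^+ n * h^-1)%g.
Proof.
elim: n => [|n IH]; first by rewrite !expg0 mulg1 mulgV.
by rewrite !expgS IH !mulgA -(mulgA (h * x)%g) mulVg mulg1.
Qed.

Lemma mcg_peripheral_elt (phi : mcg) x : peripheral x -> peripheral (phi x).
Proof.
move=> [i [h [n E]]]; have [g e] := mcg_peripheral phi i.
exists i, (phi h * g)%g, n; case: E => ->; [left|right];
  by rewrite !gmulfM !gmorphV gmorphX e conj_expg !invgM ?invgK !mulgA.
Qed.

Section Action.
Variable R : realType.

Lemma precomp_type_preserving (phi : mcg) (rho : rep R) :
  type_preserving (rho \o phi).
Proof.
move=> x px x1; apply: (rep_type_preserving rho).
  exact: mcg_peripheral_elt.
by move=> e; apply: x1; apply: (bij_inj (mcg_bij phi)); rewrite gmorph1.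
Qed.

Lemma precomp_non_elementary (phi : mcg) (rho : rep R) :
  non_elementary (rho \o phi).
Proof.
rewrite /non_elementary; have -> : range (rho \o phi) = range rho.
  apply/seteqP; split => y [x _ <-]; first by exists (phi x).
  by have [psi _ K] := mcg_bij phi; exists (psi x) => //=; rewrite K.
exact: rep_non_elementary.
Qed.

Definition precomp (phi : mcg) (rho : rep R) : rep R :=
  @Rep R (rho \o phi : {multiplicative pi1 -> PSL2 R})
    (@precomp_type_preserving phi rho) (@precomp_non_elementary phi rho).

Definition mcg_act (phi : mcg) (x : moduli R) : moduli R :=
  \pi_(moduli R) (precomp phi (repr x)).

Lemma mcg_actE (phi : mcg) (rho : rep R) :
  mcg_act phi (\pi_(moduli R) rho) = \pi_(moduli R) (precomp phi rho).
Proof.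
apply/moduliP.
have /moduliP/asboolP[g e] : repr (\pi_(moduli R) rho) = rho %[mod moduli R].
  by rewrite reprK.
by apply/asboolP; exists g => x /=; rewrite e.
Qed.

End Action.

Section Goldman.
Variable R : realType.

Definition Ad (A X : 'M[R]_2) : 'M[R]_2 := A *m X *m invmx A.

Definition prefix (A : 'I_4 -> 'M[R]_2) (i : 'I_4) : 'M[R]_2 :=
  \prod_(j < 4 | (j < i)%N) A j.

(* A tangent vector at rho is a cocycle u : pi1 -> sl(2,R), i.e.              *)
(* u (x y) = u x + Ad (rho x) (u y), determined by its values u i at the c_i; *)
(* this is its value at c_1 ... c_(i-1).                                      *)
Definition prefix_cocycle (A u : 'I_4 -> 'M[R]_2) (i : 'I_4) : 'M[R]_2 :=
  \sum_(j < 4 | (j < i)%N) Ad (prefix A j) (u j).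

(* The value w of the Goldman form on the parabolic cocycles u and v at the   *)
(* representation c_i |-> +- A i: the cup product of u and v for the trace    *)
(* form, evaluated on the relative fundamental class. The latter is           *)
(* represented by the 2-chain z = sum_i (c_1 ... c_(i-1), c_i), with boundary *)
(* sum_i (c_i), on which u \cup v gives the first sum; the second one is the  *)
(* boundary correction that makes the result depend only on the classes of u  *)
(* and v, where X i is a primitive of the restriction of v to <c_i>. The      *)
(* value does not depend on the choice of X. Other normalisations of the form *)
(* differ from this one by a nonzero constant.                                *)
Definition goldman_form (A u v : 'I_4 -> 'M[R]_2) (w : R) : Prop :=
  exists X : 'I_4 -> 'M[R]_2,
    (forall i, \tr (X i) = 0 /\ v i = Ad (A i) (X i) - X i) /\
    w = \sum_(i < 4) \tr (prefix_cocycle A u i *m Ad (prefix A i) (v i))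
        + \sum_(i < 4) \tr (u i *m Ad (A i) (X i)).

(* The cocycle of the derivative of a family of representations.              *)
Definition velocity (A : 'I_4 -> R * R -> 'M[R]_2) (e t : R * R) (i : 'I_4)
  : 'M[R]_2 := 'D_e (A i) t *m invmx (A i t).

(* The injective C^1 maps from open subsets of R^2 to the moduli space, given *)
(* by a family fam of representations that is C^1 after lifting the images of *)
(* the c_i to matrices lft i, together with the density jac of the pullback   *)
(* of the Goldman form.                                                       *)
Record parametrization : Type := Parametrization {
  dom : set (R * R);
  fam : R * R -> rep R;
  lft : 'I_4 -> R * R -> 'M[R]_2;
  jac : R * R -> R;
  dom_open : open dom;
  lft_fam : forall i t, dom t ->
    exists2 B : SL2 R, val B = lft i t & \pi_(PSL2 R) B = fam t (loop i);
  lft_C1 : forall i t e, dom t -> e = (1, 0) \/ e = (0, 1) ->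
    derivable (lft i) t e /\ {for t, continuous ('D_e (lft i))};
  fam_inj : {in dom &, injective (fun t => \pi_(moduli R) (fam t))};
  jac_goldman : forall t, dom t ->
    goldman_form (lft ^~ t) (velocity lft (1, 0) t) (velocity lft (0, 1) t)
      (jac t) }.

Definition lebesgue2 := (@lebesgue_measure R \x @lebesgue_measure R)%E.

(* The measure of the area form |omega|: by the change of variables formula,  *)
(* which holds for all injective C^1 maps, the image of B under a             *)
(* parametrization has measure the integral of |jac| over B; the measure of a *)
(* Borel set is the infimum over its countable covers by such images.         *)
Definition goldman_measure (S : set (moduli R)) : \bar R :=
  ereal_inf [set m | exists (p : nat -> parametrization) (B : nat -> set (R * R)),
    [/\ forall n, measurable (B n) /\ B n `<=` dom (p n),
        S `<=` \bigcup_n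
          [set \pi_(moduli R) (fam (p n) t) | t in B n] &
        m = (\sum_(0 <= n <oo)
          \int[lebesgue2]_(t in B n) (`|jac (p n) t|%:E))%E]].

Definition borel (S : set (moduli R)) : Prop := <<s @open (moduli R) >> S.

End Goldman.

Definition ergodic (R : realType) (G T : Type) (act : G -> T -> T)
    (meas : set T -> Prop) (mu : set T -> \bar R) (C : set T) : Prop :=
  forall S : set T, S `<=` C -> meas S ->
    (forall g, act g @^-1` S = S) ->
    mu S = 0%E \/ mu (C `\` S) = 0%E.

(* Main.v *)
Require Import Defs.
From HB Require Import structures.
From mathcomp Require Import all_boot all_order all_algebra.
From mathcomp Require Import generic_quotient ring lra zify.
From mathcomp Require Import all_classical all_reals all_analysis.
From mathcomp Require Import measurable_realfun.
From mathcomp Require mpoly.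

Set Implicit Arguments.
Unset Strict Implicit.
Unset Printing Implicit Defensive.

Import Order.TTheory GRing.Theory Num.Theory.
Import numFieldNormedType.Exports.

Local Open Scope classical_set_scope.
Local Open Scope ring_scope.
Local Open Scope quotient_scope.

(** A parabolic matrix of trace 2 is [1 + e v v^T J] with a sign [e] and a vector
    [v], unique up to sign, where [u^T J v = det (u, v)]. So a representation amounts
    to signs [e_i] and vectors [v_i], and its class is determined, once the signs are
    fixed, by [a = det (v1, v2)], [b = det (v2, v3)] and [c = det (v1, v3)] up to two
    sign changes. The only relation is
      [e1 e2 a^2 + e2 e3 b^2 + e1 e3 c^2 + e1 e2 e3 a b c = 0] or [4],
    according to whether the trace 2 lifts of the four parabolics have product [1] or
    [-1]. The signs and the product are constant on each component, and the twists
    about two curves act by polynomial maps; their group is already ergodic.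

    If the product is [-1], hyperbolic functions (or cosines, when all signs agree)
    turn the two twists into the linear maps [(s, t + 2 s)] and [(s + 2 t, t)] of the
    plane (or of a torus). On the torus they restrict to rotations of almost all
    horizontal and vertical circles. On the plane, invariance along the orbits of
    long primitive vectors, with Dirichlet approximation, shows that almost every
    line through the origin is null or conull; the set of directions of the latter is
    invariant under a lattice, and a density point of it can be blown up.

    If the product is [1] and [e1 = e2 = e3], lifting to the universal cover shows
    that the Euler class is [2] or [-2]. Otherwise the coordinates can be permuted so
    that [x^2 + x y z = y^2 + z^2] with [x > 0]. One twist preserves [x] and, for
    [x < 2], rotates the ellipses [x = const] by an angle that is irrational for
    almost all [x]; another one mixes the ellipses. Finally an explicit reduction
    moves every point with [y z <> 0] into the region [x < 2].

    No formula for the symplectic form is needed: in charts [(a, b, c)] is a C^1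
    function of two parameters, and the images of Lebesgue negligible sets have
    measure 0 because the density is integrated over a negligible set. *)

(** * Lebesgue measure on the line and in the plane *)

(** Together with the central symmetry, the two linear maps generate only a level two group, since
    the shears move by even steps. This is why the cusp coordinates come in four kinds, with period
    2. The transvection along every primitive vector still acts, up to sign, and supplies the long
    translations on which the density arguments rest.

    In the even case the twist that preserves [x] is an elliptic rotation only for [x < 2]; for
    larger [x] it moves points along branches of hyperbolas, and its invariance gives no alternative
    on a single fibre. Hence the descent to [x < 2]. It is an algebraic statement about every point,
    so it can be applied to a set from which an invariant null class has been removed.

    Changes of variables in the plane are always reduced to sections, where Lipschitz or pointwise
    derivable maps of the line are enough; outer measure is used because images and exceptional sets
    need not be known to be measurable. *)

Section RealLine.
Variable R : realType.
Notation mu := (@lebesgue_measure R).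

(** In a cover of [A] by open intervals, the part of [A] in an interval of length [L] has an image
    of diameter at most [K L], which fits into a closed interval of that length starting at its
    infimum. *)
Lemma lipschitz_outer_measure (f : R -> R) (A : set R) (K : R) :
  0 < K -> (forall x y, A x -> A y -> `|f x - f y| <= K * `|x - y|) ->
  (mu (f @` A) <= K%:E * mu A)%E.
Proof.
move=> K0 fK; rewrite -lee_pdivrMl//.
rewrite {2}/lebesgue_measure /lebesgue_stieltjes_measure.
rewrite [leRHS](@outer_measure_open_itv_cover R A).
apply: le_ereal_inf_tmp => _ [F [oF AF] <-].
rewrite lee_pdivrMl// -nneseriesZl//.
pose J n : set R := f @` (A `&` F n).
apply: (@le_trans _ _ (\sum_(0 <= k <oo) mu (J k))%E).
  apply: le_trans (outer_measure_sigma_subadditive mu J).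
  apply: le_outer_measure => _ [x Ax <-].
  by have [n _ Fnx] := AF x Ax; exists n => //; exists x.
apply: lee_nneseries => [n _ _|n _]; first exact: outer_measure_ge0.
have [[a b] Fab] := oF n; rewrite Fab /=.
have [ab|ba] := leP b a.
  rewrite (_ : J n = set0) ?measure0 ?mule_ge0 ?wlength_ge0 ?lee_fin ?ltW//.
  apply/seteqP; split => // y [x [_ Fx] _]; move: Fx.
  by rewrite Fab /= in_itv/= => /andP[ax /(lt_trans ax)]; rewrite ltNge ab.
rewrite wlength_itv/= lte_fin ba -EFinB -EFinM.
have [J0|/set0P[y0 Jy0]] := eqVneq (J n) set0.
  by rewrite J0 measure0 lee_fin mulr_ge0 ?subr_ge0 ?ltW.
have bnd y y' : J n y -> J n y' -> y' - K * (b - a) <= y.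
  move=> [x [Ax]]; rewrite Fab /= in_itv/= => /andP[x1 x2] <-.
  move=> [x' [Ax']]; rewrite Fab /= in_itv/= => /andP[x1' x2'] <-.
  rewrite lerBlDr -lerBlDl (le_trans (ler_norm _))// (le_trans (fK _ _ Ax' Ax))//.
  rewrite ler_pM2l// ler_norml; lra.
have Jlb : has_inf (J n) by split; [exists y0|exists (y0 - K * (b - a)) => y Jy; exact: bnd].
set i := inf (J n).
apply: (@le_trans _ _ (mu `[i, i + K * (b - a)]%classic)).
  apply: le_outer_measure => y Jy /=; rewrite in_itv/= ge_inf//; last by case: Jlb.
  rewrite /= -lerBlDr; apply: lb_le_inf; first by exists y0.
  by move=> z Jz; exact: bnd.
rewrite lebesgue_measure_itv/= lte_fin; case: ifPn => _.
  by rewrite -EFinB lee_fin addrAC subrr add0r.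
by rewrite lee_fin mulr_ge0 ?subr_ge0 ?ltW.
Qed.

Lemma ae_imply (d : measure_display) (T : measurableType d)
    (m : {measure set T -> \bar R}) (P Q : T -> Prop) :
  (forall x, P x -> Q x) -> {ae m, forall x, P x} -> {ae m, forall x, Q x}.
Proof. by move=> PQ; apply: negligibleS => x /= nQ /PQ. Qed.

Lemma ae_and (d : measure_display) (T : measurableType d)
    (m : {measure set T -> \bar R}) (P Q : T -> Prop) :
  {ae m, forall x, P x} -> {ae m, forall x, Q x} -> {ae m, forall x, P x /\ Q x}.
Proof.
move=> Pm Qm; apply: negligibleS (negligibleU Pm Qm) => x /= /not_andP.
by [].
Qed.

Lemma negligible_mu (N : set R) : mu.-negligible N <-> mu N = 0.
Proof. exact: negligible_outer_measure. Qed.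

Lemma negligible_lipschitz_image (f : R -> R) (A : set R) (K : R) :
  0 < K -> (forall x y, A x -> A y -> `|f x - f y| <= K * `|x - y|) ->
  mu.-negligible A -> mu.-negligible (f @` A).
Proof.
move=> K0 fK /negligible_mu A0; apply/negligible_mu/eqP.
by rewrite eq_le outer_measure_ge0 andbT -(mule0 K%:E) -A0 lipschitz_outer_measure.
Qed.

(** A pointwise derivable map need not be locally Lipschitz, so [A] is cut into countably many
    pieces [B n k s]. On a piece, difference quotients at scale below [1 / (n + 1)] are bounded by
    [n + 1], and the cell index [k] with the sign [s] keeps any two points within that scale. *)
Lemma negligible_derivable_image (f : R -> R) (A : set R) :
  (forall x, A x -> derivable f x 1) ->
  mu.-negligible A -> mu.-negligible (f @` A).
Proof.
move=> df A0.
pose B (n k : nat) (s : bool) := [set x | A x /\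
  (forall y, `|y - x| < n.+1%:R^-1 -> `|f y - f x| <= n.+1%:R * `|y - x|) /\
  k%:R / n.+1%:R <= (-1) ^+ s * x < k.+1%:R / n.+1%:R].
apply: (@negligibleS _ _ _ mu (\bigcup_n \bigcup_k \bigcup_(s in setT) f @` (B n k s))).
  move=> _ [x Ax <-].
  have /derivable1_diffP/differentiable_continuous fc := df _ Ax.
  have /cvg_ex[/= l fl] : cvg (h^-1 *: (f (h *: 1 + x) - f x) @[h --> 0^']) := df _ Ax.
  move/cvgrPdist_lt/(_ 1 ltr01): fl.
  move=> -[/= d d0 H].
  (* Exceeding [|l| + 1] bounds the difference quotients near the derivative [l]; exceeding [1 / d]
     makes the scale [1 / (m + 1)] smaller than [d]. *)
  pose m := Num.bound (`|l| + 1 + d^-1).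
  have m1 : `|l| + 1 + d^-1 < m%:R.
    by rewrite archi_boundP// !addr_ge0// invr_ge0 ltW.
  have mS : (m%:R < m.+1%:R :> R) by rewrite ltr_nat.
  have d'0 : 0 < d^-1 by rewrite invr_gt0.
  exists m => //; pose s := x < 0; exists (Num.truncn (`|x| * m.+1%:R)) => //.
  exists s => //; exists x => //; split => //; split; last first.
    have -> : (-1) ^+ s * x = `|x|.
      by rewrite /s -normrEsign.
    have := truncn_itv (mulr_ge0 (normr_ge0 x) (ler0n R m.+1)).
    by rewrite ler_pdivrMr// ltr_pdivlMr.
  move=> y yx; have [->|xy] := eqVneq y x; first by rewrite !subrr normr0 mulr0.
  have yx0 : y - x != 0 by rewrite subr_eq0.
  have : `|0 - (y - x)| < d.
    rewrite sub0r normrN (lt_trans yx)// invf_plt ?posrE//.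
    have := normr_ge0 l; lra.
  move=> /H/(_ yx0); rewrite /= /GRing.scale/= mulr1 subrK => h.
  have : `|(y - x)^-1 * (f y - f x)| < m.+1%:R.
    have : `|(y - x)^-1 * (f y - f x)| <= `|l| + 1.
      rewrite -[X in `|X|](subKr l) (le_trans (ler_normB _ _))// lerD2l ltW//.
    by move=> h'; lra.
  rewrite normrM normfV mulrC ltr_pdivrMr ?normr_gt0// => /ltW; exact.
have Bn n k s : mu.-negligible (f @` B n k s).
  apply: (@negligible_lipschitz_image _ _ n.+1%:R) => //; last first.
    by apply: negligibleS A0 => x [].
  move=> x y [_ [_ /andP[x1 x2]]] [_ [H /andP[y1 y2]]]; apply: H.
  have -> : `|x - y| = `|(-1) ^+ s * x - (-1) ^+ s * y|.
    by rewrite -mulrBr normrM normr_sign mul1r.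
  have e : (k.+1%:R / n.+1%:R = k%:R / n.+1%:R + n.+1%:R^-1 :> R).
    by rewrite -natr1 mulrDl mul1r.
  have h (u v c g : R) : c <= u -> u < c + g -> c <= v -> v < c + g -> `|u - v| < g.
    by move=> *; rewrite ltr_norml; lra.
  by apply: (h _ _ (k%:R / n.+1%:R)); rewrite -?e.
apply: negligible_bigcup => n; apply: negligible_bigcup => k.
have -> : \bigcup_(s in [set: bool]) (f @` B n k s) = f @` B n k true `|` f @` B n k false.
  apply/seteqP; split => [y [[|] _ h]|y [h|h]]; [by left|by right| |].
    by exists true.
  by exists false.
exact: negligibleU.
Qed.

(** The map and its inverse are Lipschitz with reciprocal constants. *)
Lemma mu_image_affine (a b : R) (A : set R) : a != 0 ->
  mu ((fun x => a * x + b) @` A) = (`|a|%:E * mu A)%E.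
Proof.
move=> a0; have na0 : 0 < `|a| by rewrite normr_gt0.
apply/eqP; rewrite eq_le; apply/andP; split.
  apply: lipschitz_outer_measure => // x y _ _.
  by rewrite opprD addrACA subrr addr0 -mulrBr normrM.
rewrite -lee_pdivlMl//.
have {1}-> : A = (fun x => a^-1 * x - a^-1 * b) @` ((fun x => a * x + b) @` A).
  rewrite image_comp -[LHS]image_id; apply: eq_imagel => x _ /=.
  by rewrite mulrDr mulrA mulVf// mul1r addrK.
apply: lipschitz_outer_measure => [|x y _ _]; first by rewrite invr_gt0.
by rewrite opprD addrACA subrr addr0 -mulrBr normrM normfV.
Qed.

(** Lebesgue's density theorem: a ball of radius [r] has length [2 r], so a relative defect below
    [e / 2] is an absolute defect below [e r]. *)
Lemma density_ae (A : set R) : measurable A ->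
  {ae mu, forall x, A x -> forall e : R, 0 < e -> exists2 d : R, 0 < d &
     forall r : R, 0 < r < d -> (mu (ball x r `\` A) <= (e * r)%:E)%E}.
Proof.
move=> mA; have := lebesgue_density mA.
apply: filter_app; first exact: (ae_filter_ringOfSetsType mu).
apply: aeW => /= x + Ax e e0; rewrite indicE mem_set//= => H.
have /fine_cvgP[fn] := H.
move=> /cvgrPdist_lt/(_ (e / 2)); rewrite divr_gt0// => /(_ isT) H1.
have [d /= d0 dH] : \forall r \near (0:R)^'+,
    (mu (A `&` ball x r) * (mu (ball x r))^-1)%E \is a fin_num /\
    `|1 - fine (mu (A `&` ball x r) * (mu (ball x r))^-1)%E| < e / 2.
  by near=> r; split; near: r.
exists d => // r /andP[r0 rd].
have [|f1 f2] := dH r _ r0; first by rewrite /= sub0r normrN gtr0_norm.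
have mub : mu (ball x r) = (r *+ 2)%:E by rewrite lebesgue_measure_ball// ltW.
have mI : (mu (A `&` ball x r) <= (r *+ 2)%:E)%E by rewrite -mub le_outer_measure.
have fI : mu (A `&` ball x r) \is a fin_num.
  by rewrite ge0_fin_numE ?outer_measure_ge0// (le_lt_trans mI)// ltry.
rewrite measureD//; last 2 first.
- exact: measurable_ball.
- by apply: le_lt_trans (ltry (r *+ 2)); rewrite -mub.
rewrite [X in (X - _)%E]mub [X in (_ - X)%E](_ : _ = (fine (mu (A `&` ball x r)))%:E); last first.
  by rewrite setIC fineK.
rewrite -EFinB lee_fin; move: f2; rewrite mub inver mulrn_eq0/= gt_eqF//.
rewrite -[X in fine (X * _)%E](fineK fI) -EFinM/= => f2.
have {f2} := le_lt_trans (ler_norm _) f2.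
have r2 : r *+ 2 != 0 by rewrite gt_eqF ?mulrn_wgt0.
rewrite -[X in _ -> _ - X <= _](divfK r2); move: (fine (mu (A `&` ball x r)) / (r *+ 2)) => u.
rewrite mulr2n => f2; have : 0 <= r * (e / 2 - (1 - u)).
  by rewrite mulr_ge0 ?subr_ge0 ?ltW.
lra.
Unshelve. all: by end_near. Qed.

Lemma density_point (A : set R) : measurable A -> ~ mu.-negligible A ->
  exists2 x, A x & forall e : R, 0 < e -> exists2 d : R, 0 < d &
     forall r : R, 0 < r < d -> (mu (ball x r `\` A) <= (e * r)%:E)%E.
Proof.
move=> mA nA; have H := density_ae mA; apply: contrapT => H'; apply: nA.
apply: negligibleS H => x Ax /= h; apply: H'; exists x => //; exact: h.
Qed.

End RealLine.

(** * Diophantine approximation and sets of reals with small periods *)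

Section Periods.
Variable R : realType.
Notation mu := (@lebesgue_measure R).

(** Pigeonhole: [N + 1] fractional parts fall into [N] cells of length [1 / N]. *)
Lemma dirichlet (theta : R) (N : nat) : (0 < N)%N ->
  exists (q : nat) (p : int),
    (0 < q <= N)%N /\ `|q%:R * theta - p%:~R| < N%:R^-1.
Proof.
move=> N0; have NR : 0 < N%:R :> R by rewrite ltr0n.
pose fr (i : nat) : R := i%:R * theta - (Num.floor (i%:R * theta))%:~R.
have fr01 i : 0 <= fr i < 1.
  have := floor_itv (i%:R * theta); rewrite /fr intrD => h; lra.
have fN i : (Num.truncn (N%:R * fr i) < N)%N.
  have /andP[h0 h1] := fr01 i.
  rewrite -(ltr_nat R) (@le_lt_trans _ _ (N%:R * fr i)) ?truncn_le ?mulr_ge0//.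
  by rewrite gtr_pMr.
pose f (i : 'I_N.+1) : 'I_N := Ordinal (fN i).
have [|/injectivePn[i [j ij fij]]] := boolP (injectiveb f).
  by move/injectiveP/leq_card; rewrite !card_ord ltnn.
wlog ltij : i j ij fij / (i < j)%N.
  move=> W; have : (i != j :> nat) by [].
  rewrite neq_ltn => /orP[|ji]; first exact: W.
  by apply: (W j i) => //; rewrite eq_sym.
exists (j - i)%N, (Num.floor (j%:R * theta) - Num.floor (i%:R * theta)).
split.
  by rewrite subn_gt0 ltij/= (leq_trans (leq_subr _ _))// -ltnS.
have -> : (j - i)%:R * theta - (Num.floor (j%:R * theta) - Num.floor (i%:R * theta))%:~R
    = fr j - fr i.
  have aux (x y u v : R) : x - y - (u - v) = x - u - (y - v) by ring.
  rewrite (natrB _ (ltnW ltij)) intrB mulrBl; exact: aux.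
rewrite -[ltRHS]mul1r ltr_pdivlMr// -[X in _ * X](gtr0_norm NR) -normrM mulrBl.
move: fij => /(congr1 val)/= => e.
have /andP[ti1 ti2] := truncn_itv (mulr_ge0 (ltW NR) (andP (fr01 i)).1).
have /andP[tj1 tj2] := truncn_itv (mulr_ge0 (ltW NR) (andP (fr01 j)).1).
rewrite -natr1 in ti2; rewrite -natr1 in tj2; rewrite -e in tj1 tj2.
rewrite ltr_norml; lra.
Qed.

Definition irrational_real (x : R) := forall (q : nat) (p : int), (0 < q)%N ->
  q%:R * x != p%:~R.

Lemma irrational_ae (c : R) : c != 0 -> {ae mu, forall x, irrational_real (x / c)}.
Proof.
move=> c0; apply: (@negligibleS _ _ _ mu (range (fun q : rat => c * ratr q))).
  move=> x /= /existsNP[q /existsNP[p /not_implyP[q0 /negP]]].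
  rewrite negbK => /eqP e; exists (p%:~R / q%:R) => //.
  have qR : q%:R != 0 :> R by rewrite pnatr_eq0 -lt0n.
  rewrite fmorph_div/= ratr_int ratr_nat -e; field; exact/andP.
apply/negligible_mu/countable_lebesgue_measure0.
exact: sub_countable (card_image_le _ _) (countableP _).
Qed.

Lemma period_int (A : set R) (p : R) : (forall x, A x <-> A (x + p)) ->
  forall (n : int) x, A x <-> A (x + n%:~R * p).
Proof.
move=> Ap; have An (n : nat) x : A x <-> A (x + n%:R * p).
  elim: n x => [|n IH] x; first by rewrite mul0r addr0.
  by rewrite -natr1 mulrDl mul1r addrA -Ap.
case=> n x; first exact: An.
rewrite NegzE mulrNz mulNr; have := An n.+1 (x - n.+1%:R * p).
by rewrite subrK => ->.
Qed.

(** Density points [x] of [A] and [y] of its complement cannot coexist: a multiple of a small period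
    carries the ball around [x] almost onto the ball around [y], and [A] and its complement would
    both fill more than half of it. *)
Lemma small_periods_zero_one (A : set R) : measurable A ->
  (forall e : R, 0 < e -> exists2 p : R, 0 < p < e & forall x, A x <-> A (x + p)) ->
  mu.-negligible A \/ mu.-negligible (~` A).
Proof.
move=> mA per; apply: contrapT => /not_orP[nA nC].
have [x Ax /(_ (1/2))[|d1 d10 H1]] := density_point mA nA; first lra.
have [y Ay /(_ (1/2))[|d2 d20 H2]] := density_point (measurableC mA) nC; first lra.
pose r := Num.min d1 d2 / 2.
have r0 : 0 < r by rewrite divr_gt0// lt_min d10.
have [h1 h2] : Num.min d1 d2 <= d1 /\ Num.min d1 d2 <= d2.
  by rewrite !ge_min !lexx orbT.
have rd1 : r < d1 by rewrite /r in r0 *; lra.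
have rd2 : r < d2 by rewrite /r in r0 *; lra.
(* With [p < r / 4] the ball of radius [r - p] around [y] has length above [3 r / 2], while the two
   exceptional parts that cover it have total measure at most [r]. *)
have [|p /andP[p0 pr] Ap] := per (r / 4); first lra.
pose n := Num.floor ((y - x) / p).
have np : `|x + n%:~R * p - y| <= p.
  have := floor_itv ((y - x) / p); rewrite -/n intrD ler_pdivlMr// ltr_pdivrMr// => h.
  rewrite ler_norml; nra.
have {}H1 := H1 r; rewrite r0 rd1 in H1; have {}H1 := H1 isT.
have {}H2 := H2 r; rewrite r0 rd2 in H2; have {}H2 := H2 isT.
have H3 : (mu (ball (x + n%:~R * p)%R r `\` A) <= (1 / 2 * r)%:E)%E.
  have -> : ball (x + n%:~R * p) r `\` A = (fun z => 1 * z + n%:~R * p) @` (ball x r `\` A).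
    apply/seteqP; split => z /=.
      move=> [zb Az]; exists (z - n%:~R * p); last by rewrite mul1r subrK.
      split; first by move: zb; rewrite /ball/=; congr (`|_| < _); ring.
      by move=> /(period_int Ap n); rewrite subrK.
    move=> [w [wb Aw] <-]; rewrite mul1r; split; last by move/(period_int Ap n _).2.
    by move: wb; rewrite /ball/=; congr (`|_| < _); ring.
  by rewrite mu_image_affine ?oner_eq0// normr1 mul1e.
have : (mu (ball y (r - p)) <= mu (ball (x + n%:~R * p)%R r `\` A) + mu (ball y r `\` ~` A))%E.
  apply: le_trans (outer_measureU2 _ _ _).
  apply: le_outer_measure => z; rewrite /ball/= => yz.
  have [Az|nAz] := pselect (A z).
    by right; split; [rewrite (lt_le_trans yz)// lerBlDr lerDl ltW|exact].
  left; split => //; move: yz np; rewrite ltr_norml ler_norml ltr_norml; lra.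
rewrite lebesgue_measure_ball; last lra.
move/le_trans => /(_ _ (leeD H3 H2)); rewrite -EFinD lee_fin mulr2n; lra.
Qed.

(** Approximating the irrational ratio [a / b] within [1 / N] gives a period [q a - p b] that is
    nonzero and smaller than [b / N < e]. *)
Lemma two_periods_zero_one (A : set R) (a b : R) : measurable A -> 0 < b ->
  irrational_real (a / b) ->
  (forall x, A x <-> A (x + a)) -> (forall x, A x <-> A (x + b)) ->
  mu.-negligible A \/ mu.-negligible (~` A).
Proof.
move=> mA b0 irr Aa Ab; apply: small_periods_zero_one => // e e0.
pose N := (Num.truncn (b / e)).+1.
have bN : b / e < N%:R by have /andP[] := truncn_itv (ltW (divr_gt0 b0 e0)).
have [q [p [/andP[q0 _] H]]] := dirichlet (a / b) (ltn0Sn (Num.truncn (b / e))).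
pose t := q%:R * a - p%:~R * b.
have At x : A x <-> A (x + t).
  rewrite /t addrA (period_int Aa q) (period_int Ab (- p)).
  by rewrite mulrNz mulNr.
have tE : t = (q%:R * (a / b) - p%:~R) * b by rewrite /t; field; rewrite gt_eqF.
have t0 : 0 < `|t|.
  by rewrite normr_gt0 tE mulf_neq0 ?(gt_eqF b0)// subr_eq0 irr.
exists `|t|; rewrite ?t0/=.
  rewrite tE normrM (gtr0_norm b0).
  have NR : 0 < N%:R :> R by rewrite ltr0n.
  have : b < e * N%:R by move: bN; rewrite ltr_pdivrMr// mulrC.
  have : `|q%:R * (a / b) - p%:~R| * N%:R < 1 by rewrite -ltr_pdivlMr// mul1r.
  move: (`|_|) (N%:R) NR => u w; nra.
move=> x; have [tp|tn] := ltrP 0 t; first by rewrite gtr0_norm.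
by rewrite ler0_norm// (At (x - t)) subrK.
Qed.

End Periods.

(** * Null sets of the plane and their sections *)

Section Planar.
Variable R : realType.
Notation mu := (@lebesgue_measure R).
Notation plane := (measurableTypeR R * measurableTypeR R)%type.
Notation mu2 := (@lebesgue_measure R \x @lebesgue_measure R)%E.

Lemma integral_eq0_ae (f : measurableTypeR R -> \bar R) : measurable_fun setT f ->
  (forall x, 0 <= f x)%E -> (\int[mu]_x f x = 0)%E <-> {ae mu, forall x, f x = 0%E}.
Proof.
move=> mf f0; have := ae_eq_integral_abs mu measurableT mf.
under eq_integral do rewrite gee0_abs//.
move=> ->; split; apply: ae_imply => x //=; exact.
Qed.

Lemma measurable_negligible_xsection (N : set plane) : measurable N ->
  mu2.-negligible N <-> {ae mu, forall x, mu.-negligible (xsection N x)}.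
Proof.
move=> mN; rewrite (negligibleP _ mN).
have mf := measurable_fun_xsection mu mN.
have /(_ (fun x => measure_ge0 _ _)) H := integral_eq0_ae mf.
apply: (iff_trans H); split; apply: ae_imply => x /=.
  by move/negligible_mu.
by move/negligible_mu.
Qed.

Lemma measurable_negligible_ysection (N : set plane) : measurable N ->
  mu2.-negligible N <-> {ae mu, forall y, mu.-negligible (ysection N y)}.
Proof.
move=> mN; rewrite (negligibleP _ mN).
rewrite -[X in X = 0%E]/(mu2 N).
(* The product measure is built from vertical sections; by uniqueness it can also be computed from
   horizontal ones. *)
have -> : mu2 N = (mu \x^ mu)%E N.
  by apply: product_measure_unique => //= A B mA mB; rewrite product_measure2E.
have mf := measurable_fun_ysection mu mN.
have /(_ (fun x => measure_ge0 _ _)) H := integral_eq0_ae mf.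
apply: (iff_trans H); split; apply: ae_imply => x /=.
  by move/negligible_mu.
by move/negligible_mu.
Qed.

Lemma negligible_xsection (N : set plane) : mu2.-negligible N ->
  {ae mu, forall x, mu.-negligible (xsection N x)}.
Proof.
move=> [M [mM M0 NM]].
have /(measurable_negligible_xsection mM) : mu2.-negligible M by apply/negligibleP.
by apply: ae_imply => x; apply: negligibleS; exact: le_xsection.
Qed.

Lemma negligible_ysection (N : set plane) : mu2.-negligible N ->
  {ae mu, forall y, mu.-negligible (ysection N y)}.
Proof.
move=> [M [mM M0 NM]].
have /(measurable_negligible_ysection mM) : mu2.-negligible M by apply/negligibleP.
by apply: ae_imply => x; apply: negligibleS; exact: le_ysection.
Qed.

(** The product sigma-algebra is generated by rectangles; an open set is the union of the countably
    many rational rectangles that it contains. *)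
Lemma open_prod_measurable (U : set plane) : open (U : set (R * R)) -> measurable U.
Proof.
move=> oU.
pose I (a : rat * rat * (rat * rat)) : set plane :=
  (`]ratr a.1.1, ratr a.1.2[ `*` `]ratr a.2.1, ratr a.2.2[)%classic.
have -> : U = \bigcup_(a in [set a | I a `<=` U]) I a.
  apply/seteqP; split => [[x y] Uxy|z [a /= aU /aU]//].
  have : nbhs (x, y) U by exact: open_nbhs_nbhs.
  move=> [[A B] /= [/nbhs_ballP[e /= e0 eA] /nbhs_ballP[d /= d0 dB]] AB].
  have rl (u v : R) : 0 < v -> exists2 q : rat, u - v < ratr q & ratr q < u.
    move=> v0; have [|q] := @rat_in_itvoo R (u - v) u; first lra.
    by rewrite in_itv/= => /andP[]; exists q.
  have [p1 p1x xp1] := rl x e e0; have [p2 p2x xp2] := rl (x + e) e e0.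
  have [q1 q1y yq1] := rl y d d0; have [q2 q2y yq2] := rl (y + d) d d0.
  exists ((p1, p2), (q1, q2)); last by rewrite /I /= !in_itv/=; split; lra.
  move=> [u v] /=; rewrite /I /= !in_itv/= => -[/andP[u1 u2] /andP[v1 v2]].
  apply: AB; split => /=; [apply: eA|apply: dB];
    rewrite /ball/= ltr_norml; lra.
rewrite bigcup_mkcond; apply: countable_bigcupT_measurable; first exact: countableP.
move=> a; case: ifP => // _; apply: measurableX; exact: measurable_itv.
Qed.

End Planar.

Section PlaneSets.
Variable R : realType.
Notation mu := (@lebesgue_measure R).
Notation plane := (measurableTypeR R * measurableTypeR R)%type.
Notation mu2 := (@lebesgue_measure R \x @lebesgue_measure R)%E.

Lemma measurable_preimage_open (D : set plane) (f : R * R -> R * R) :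
  open (D : set (R * R)) -> (forall v, D v -> {for v, continuous f}) ->
  forall S : set plane, measurable S -> measurable (D `&` (f @^-1` S : set plane)).
Proof.
move=> oD cf S mS.
have open_pre (U : set (R * R)) : open U -> open (D `&` f @^-1` U : set (R * R)).
  move=> oU; rewrite openE => v [Dv Ufv].
  have DN : nbhs v (D : set (R * R)) by exact: open_nbhs_nbhs.
  apply: filterI; first exact: open_nbhs_nbhs.
  by apply: cf => //; exact: open_nbhs_nbhs.
have mf1 (g : R * R -> R) : continuous g ->
    measurable_fun (D : set plane) (g \o f : plane -> measurableTypeR R).
  move=> cg; apply: (measurability (@RGenOInfty.G R)).
    exact: RGenOInfty.measurableE.
  move=> _ /= [_ [x ->] <-]; apply: open_prod_measurable.
  rewrite comp_preimage; apply: open_pre.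
  by apply: open_comp; [move=> *; exact: cg|exact: interval_open].
have mf : measurable_fun (D : set plane) (f : plane -> plane).
  apply: (measurability _ (measurable_prod_measurableType _ _)).
  move=> _ [_ [A mA [B mB <-]] <-].
  have -> : D `&` f @^-1` (A `*` B) =
    (D `&` (fst \o f) @^-1` A) `&` (D `&` (snd \o f) @^-1` B).
    by apply/seteqP; split => [v [? []]|v [[? ?] []]].
  by apply: measurableI; apply: mf1 => //; try exact: open_prod_measurable;
    move=> v; [exact: cvg_fst|exact: cvg_snd].
exact: mf (open_prod_measurable oD) _ mS.
Qed.

Lemma mu2_ysectionE (A : set plane) : measurable A ->
  mu2 A = (\int[mu]_y mu (ysection A y))%E.
Proof.
move=> mA; have -> : mu2 A = (mu \x^ mu)%E A.
  by apply: product_measure_unique => //= B C mB mC; rewrite product_measure2E.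
by [].
Qed.

Lemma mu2_le_ysection (A B : set plane) (c : R) : measurable A -> measurable B ->
  0 <= c -> (forall y, mu (ysection A y) <= c%:E * mu (ysection B y))%E ->
  (mu2 A <= c%:E * mu2 B)%E.
Proof.
move=> mA mB c0 H; rewrite !mu2_ysectionE// -ge0_integralZl//; last exact: (measurable_fun_ysection mu mB).
apply: ge0_le_integral => //.
- exact: (measurable_fun_ysection mu mA).
- apply: measurable_funeM; exact: (measurable_fun_ysection mu mB).
Qed.

Lemma mu2_le_xsection (A B C : set plane) : measurable A -> measurable B ->
  measurable C ->
  (forall x, mu (xsection A x) <= mu (xsection B x) + mu (xsection C x))%E ->
  (mu2 A <= mu2 B + mu2 C)%E.
Proof.
move=> mA mB mC H; rewrite /product_measure1 -ge0_integralD//=; last 2 first.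
- exact: (measurable_fun_xsection mu mB).
- exact: (measurable_fun_xsection mu mC).
apply: ge0_le_integral => //.
- exact: (measurable_fun_xsection mu mA).
- apply: emeasurable_funD; [exact: (measurable_fun_xsection mu mB)|].
  exact: (measurable_fun_xsection mu mC).
Qed.

Lemma measurable_null_xsection (A : set plane) : measurable A ->
  measurable [set x : measurableTypeR R | mu (xsection A x) = 0%E].
Proof.
move=> mA; have mf := measurable_fun_xsection mu mA.
have := mf measurableT [set 0%E] (emeasurable_set1 0%E).
by rewrite setTI.
Qed.

(** Up to null sets, [S] is the part of [D] over the set [P] of points whose fibre is conull. [P] is
    measurable because the measure of a section depends measurably on the base point. *)
Lemma fiber_zero_one (S D : set plane) : measurable S -> measurable D ->
  S `<=` D ->
  {ae mu, forall x, mu.-negligible (xsection S x) \/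
     mu.-negligible (xsection (D `\` S) x)} ->
  exists P : set R, [/\ measurable (P : set (measurableTypeR R)),
    mu2.-negligible (S `&` [set v | ~ P v.1]),
    mu2.-negligible ((D `\` S) `&` [set v | P v.1]) &
    forall x, P x <-> mu.-negligible (xsection (D `\` S) x)].
Proof.
move=> mS mD SD H; pose P := [set x : measurableTypeR R | mu (xsection (D `\` S) x) = 0%E].
have mDS : measurable (D `\` S) by exact: measurableD.
have mP : measurable P by exact: measurable_null_xsection.
have mP1 : measurable ([set v | P v.1] : set plane).
  by rewrite -[X in measurable X]setTI; exact: measurable_fst.
exists P; split => //; last by move=> x; split=> [/negligible_mu|/negligible_mu].
- apply/measurable_negligible_xsection.
    by apply: measurableI => //; exact: measurableC.
  apply: ae_imply H => x; rewrite xsectionI => -[Sx|/negligible_mu DSx].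
    by apply: negligibleS Sx => y [].
  rewrite (_ : _ `&` _ = set0); first exact: negligible_set0.
  by rewrite -subset0 => y [_ /xsectionP/=]; apply.
- apply/measurable_negligible_xsection; first exact: measurableI.
  apply: aeW => x; rewrite xsectionI.
  have [Px|nPx] := pselect (P x).
    by apply: (@negligibleS _ _ _ _ (xsection (D `\` S) x)) => [y []//|]; exact/negligible_mu.
  rewrite (_ : _ `&` _ = set0); first exact: negligible_set0.
  by rewrite -subset0 => y [_ /xsectionP/=].
Qed.

Lemma negligible_fst (P : set R) : mu.-negligible P ->
  mu2.-negligible [set v : plane | P v.1].
Proof.
move=> [Q [mQ Q0 PQ]]; apply: (@negligibleS _ _ _ _ [set v : plane | Q v.1]).
  by move=> v /PQ.
have mQ1 : measurable ([set v | Q v.1] : set plane).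
  by rewrite -[X in measurable X]setTI; exact: measurable_fst.
apply/measurable_negligible_xsection => //.
exists Q; split => // x /= nx; apply: contrapT => nQ; apply: nx.
rewrite (_ : xsection _ _ = set0); first exact: negligible_set0.
by rewrite -subset0 => y /xsectionP/=.
Qed.

Lemma ae_exists (P : R -> Prop) : {ae mu, forall x, P x} -> exists x, P x.
Proof.
move=> H; apply: contrapT => /forallNP nP.
have /negligible_mu : mu.-negligible [set: R].
  by apply: negligibleS H => x _ /=; exact: nP.
have -> : [set: R] = `]-oo, +oo[%classic by apply/seteqP; split.
by rewrite lebesgue_measure_itv.
Qed.

(* The shears generate, together with the lattice, enough of an irrational
   rotation on almost every horizontal and almost every vertical circle. *)
Lemma torus_zero_one (S : set plane) (c : R) : measurable S -> 0 < c ->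
  (forall x y, S (x, y) <-> S (x, y + 2 * x)) ->
  (forall x y, S (x, y) <-> S (x + 2 * y, y)) ->
  (forall x y, S (x, y) <-> S (x, y + c)) ->
  (forall x y, S (x, y) <-> S (x + c, y)) ->
  mu2.-negligible S \/ mu2.-negligible (~` S).
Proof.
move=> mS c0 S1 S2 S3 S4.
have irr : {ae mu, forall x, irrational_real (2 * x / c)}.
  have := @irrational_ae R (c / 2); rewrite mulf_neq0 ?gt_eqF// ?invr_gt0// => /(_ isT).
  by apply: ae_imply => x; rewrite invf_div mulrA [x * 2]mulrC.
have [||P [mP N1 N2 _]] := @fiber_zero_one S setT mS measurableT; [by []| |].
  apply: ae_imply irr => x ix; rewrite setTD.
  have [|||h|h] := @two_periods_zero_one R (xsection S x) (2 * x) c _ c0 ix; last 2 first.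
  + by left.
  + by right; apply: negligibleS h => y /xsectionP nS /xsectionP.
  + exact: measurable_xsection.
  + by move=> y; rewrite !xsectionP; exact: S1.
  + by move=> y; rewrite !xsectionP; exact: S3.
(* One horizontal line that meets both error sets in null sets is enough: on it [S] and [P] agree
   almost everywhere, so the alternative for its section is the alternative for [P]. *)
have [y [iy [N1y N2y]]] := ae_exists (ae_and irr (ae_and (negligible_ysection N1) (negligible_ysection N2))).
have [|||h|h] := @two_periods_zero_one R (ysection S y) (2 * y) c _ c0 iy.
- exact: measurable_ysection.
- by move=> x; rewrite !ysectionP; exact: S2.
- by move=> x; rewrite !ysectionP; exact: S4.
- left; have P0 : mu.-negligible P.
    apply: negligibleS (negligibleU h N2y) => x Px.
    have [Sx|nSx] := pselect (S (x, y)); [left|right]; exact/ysectionP.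
  apply: negligibleS (negligibleU N1 (negligible_fst P0)) => -[u v] Suv.
  by have [Pu|nPu] := pselect (P u); [right|left].
- right; have P0 : mu.-negligible (~` P).
    apply: negligibleS (negligibleU h N1y) => x nPx.
    have [Sx|nSx] := pselect (S (x, y)); [right|left]; first exact/ysectionP.
    by move=> /ysectionP.
  apply: negligibleS (negligibleU N2 (negligible_fst P0)) => -[u v] Suv.
  by have [Pu|nPu] := pselect (P u); [left|right].
Qed.

End PlaneSets.

(** * The linear action on the plane *)

Section PrimitiveVectors.

Definition primitive (p q : int) := exists u v : int, u * p + v * q = 1.

Lemma mulz_eq1 (u p : int) : u * p = 1 -> p = 1 \/ p = -1.
Proof.
move=> /(congr1 absz); rewrite abszM => /eqP; rewrite muln_eq1 => /andP[_ /eqP]; lia.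
Qed.

(** Euclid's algorithm with even steps: adding or subtracting twice the smaller coordinate shrinks
    the larger one until a coordinate vanishes or the two agree up to sign. Parities never change,
    so one base case cannot be enough. *)
Lemma primitive_ind (P : int -> int -> Prop) :
  P 1 0 -> P 0 1 -> P 1 1 -> P 1 (-1) ->
  (forall p q, P p q -> P (- p) (- q)) ->
  (forall p q, P p q -> P (p + 2 * q) q) -> (forall p q, P p q -> P (p - 2 * q) q) ->
  (forall p q, P p q -> P p (q + 2 * p)) -> (forall p q, P p q -> P p (q - 2 * p)) ->
  forall p q, primitive p q -> P p q.
Proof.
move=> P10 P01 P11 P1N PN Pa Pb Pc Pd p q.
have [n] := ubnP (absz p + absz q)%N; elim: n p q => // n IH p q pqn [u [v uv]].
have [q0|q0] := eqVneq q 0.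
  move: uv; rewrite q0 mulr0 addr0 => /mulz_eq1[]->//.
  by have := PN _ _ P10; rewrite oppr0.
have [p0|p0] := eqVneq p 0.
  move: uv; rewrite p0 mulr0 add0r => /mulz_eq1[]->//.
  by have := PN _ _ P01; rewrite oppr0.
have [pq|pq] := eqVneq p q.
  move: uv; rewrite pq -mulrDl => /mulz_eq1[]->//; exact: (PN _ _ P11).
have [pNq|pNq] := eqVneq p (- q).
  move: uv; rewrite pNq mulrN -mulNr -mulrDl => /mulz_eq1[]->; rewrite ?opprK//.
  exact: (PN _ _ P1N).
have [lpq|lqp] := ltnP (absz q) (absz p).
  have [s|s] := ltP 0 (p * q).
    rewrite -(subrK (2 * q) p); apply: Pa; apply: IH; first by nia.
    by exists u, (v + 2 * u); rewrite -uv; ring.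
  rewrite -(addrK (2 * q) p); apply: Pb; apply: IH; first by nia.
  by exists u, (v - 2 * u); rewrite -uv; ring.
have [s|s] := ltP 0 (p * q).
  rewrite -(subrK (2 * p) q); apply: Pc; apply: IH; first by nia.
  by exists (u + 2 * v), v; rewrite -uv; ring.
rewrite -(addrK (2 * p) q); apply: Pd; apply: IH; first by nia.
by exists (u - 2 * v), v; rewrite -uv; ring.
Qed.

Variable R : realType.

(** For each denominator [q] only the two integers around [q theta] compete, so [d] is a minimum of
    finitely many positive numbers. *)
Lemma irrational_gap (theta : R) (Q : nat) : irrational_real theta ->
  exists2 d : R, 0 < d & forall (q : nat) (p : int), (0 < q <= Q)%N ->
    d <= `|q%:R * theta - p%:~R|.
Proof.
move=> irr; elim: Q => [|Q [d d0 H]]; first by exists 1 => // q p; case: q.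
pose f := Num.floor (Q.+1%:R * theta).
have /andP[f1 f2] := floor_itv (Q.+1%:R * theta).
have f3 : Q.+1%:R * theta != f%:~R by exact: irr.
exists (Num.min d (Num.min (Q.+1%:R * theta - f%:~R) (f%:~R + 1 - Q.+1%:R * theta))).
  rewrite !lt_min d0/= !subr_gt0; rewrite intrD in f2.
  by rewrite f2 andbT lt_neqAle eq_sym f3.
move=> q p /andP[q0]; rewrite leq_eqVlt => /orP[/eqP->|qQ]; last first.
  by rewrite ge_min H ?q0//.
rewrite !ge_min; apply/orP; right.
have [pf|fp] := lerP p f.
  have : p%:~R <= f%:~R :> R by rewrite ler_int.
  move=> pf'; apply/orP; left; apply: le_trans (ler_norm _); lra.
have : (f + 1)%:~R <= p%:~R :> R by rewrite ler_int; lia.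
rewrite intrD => pf'; apply/orP; right; rewrite distrC; apply: le_trans (ler_norm _); lra.
Qed.

(** Cancelling the common factor [g] divides the error by [g], so the reduced fraction still
    approximates. Asking for an accuracy below the gap of all denominators up to [Q] forces [q] to
    be larger. *)
Lemma dirichlet_primitive (theta : R) (Q : nat) : irrational_real theta ->
  exists (q : nat) (p : int), [/\ (Q < q)%N, primitive p q%:Z &
    `|theta - p%:~R / q%:R| < (q%:R ^+ 2)^-1].
Proof.
move=> irr; have [d d0 dH] := irrational_gap Q irr.
pose N := (Num.truncn d^-1).+1.
have d'0 : 0 <= d^-1 by rewrite invr_ge0 ltW.
have dN : d^-1 < N%:R by have /andP[] := truncn_itv d'0.
have NR : 0 < N%:R :> R by rewrite ltr0n.
have [q [p [/andP[q0 qN] H]]] := dirichlet theta (ltn0Sn (Num.truncn d^-1)).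
have [u [v uv]] := Bezoutz p q%:Z.
set g := gcdz p q in uv; have g0 : 0 < g by rewrite /g /gcdz ltz_nat gcdn_gt0 [X in _ || X]q0 orbT.
pose p' := (p %/ g)%Z; pose q' := absz (q%:Z %/ g)%Z.
have pE : p = p' * g by rewrite divzK// dvdz_gcdl.
have qE : q%:Z = q'%:Z * g.
  by rewrite /q' gez0_abs ?divzK ?dvdz_gcdr// divz_ge0.
have q'0 : (0 < q')%N.
  case: (posnP q') => // e; move: qE; rewrite e mul0r => /eqP.
  by rewrite eqz_nat => /eqP e0; rewrite e0 in q0.
have q'q : (q' <= q)%N by rewrite -lez_nat qE ler_peMr// -gtz0_ge1.
have gR : 1 <= g%:~R :> R by rewrite (ler_int _ 1); lia.
have H' : `|q'%:R * theta - p'%:~R| < N%:R^-1.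
  apply: le_lt_trans H.
  have -> : q%:R * theta - p%:~R = (q'%:R * theta - p'%:~R) * g%:~R.
    rewrite pE intrM -[q%:R]/(q%:Z%:~R) qE intrM; ring.
  by rewrite normrM (ger0_norm (le_trans ler01 gR)) ler_peMr.
exists q', p'; split.
- rewrite ltnNge; apply/negP => q'Q.
  have := dH q' p'; rewrite q'0 q'Q => /(_ isT); apply/negP; rewrite -ltNge.
  by rewrite (lt_trans H')// invf_plt.
- exists u, v; apply: (@mulIf _ g); first by rewrite gt_eqF.
  by rewrite mul1r -[RHS]uv pE qE; ring.
- have qR : 0 < q'%:R :> R by rewrite ltr0n.
  have -> : theta - p'%:~R / q'%:R = (q'%:R * theta - p'%:~R) / q'%:R.
    by field; rewrite gt_eqF.
  rewrite normrM normfV (gtr0_norm qR) ltr_pdivrMr//.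
  rewrite expr2 invfM -mulrA mulVf ?gt_eqF// mulr1 (lt_le_trans H')//.
  by rewrite lef_pV2 ?posrE// ler_nat (leq_trans q'q).
Qed.

End PrimitiveVectors.

Lemma continuous_pair (R : realType) (f g : R * R -> R) (v : R * R) :
  {for v, continuous f} -> {for v, continuous g} ->
  {for v, continuous (fun u => (f u, g u))}.
Proof. by move=> cf cg; exact: cvg_pair cf cg. Qed.

Section Transvections.
Variable R : realType.
Variable Sg : R -> R -> Prop.
Hypothesis SgN : forall s t, Sg s t <-> Sg (- s) (- t).
Hypothesis SgA : forall s t, Sg s t <-> Sg (s + 2 * t) t.
Hypothesis SgB : forall s t, Sg s t <-> Sg s (t + 2 * s).

Definition transvection_invariant (p q : int) := forall s t,
  Sg s t <-> Sg (s + 2 * (s * q%:~R - t * p%:~R) * p%:~R)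
                (t + 2 * (s * q%:~R - t * p%:~R) * q%:~R).

Let Sg_eq s t s' t' : s = s' -> t = t' -> Sg s t <-> Sg s' t'.
Proof. by move=> -> ->. Qed.

(** Conjugating a transvection by a shear gives the transvection along the sheared axis, so
    [primitive_ind] leaves four axes. Along [(1, 1)] and [(1, -1)] a product of the two shears is
    minus the transvection, which is where [SgN] enters. *)
Lemma transvectionP (p q : int) : primitive p q -> transvection_invariant p q.
Proof.
have SgA' s t : Sg s t <-> Sg (s - 2 * t) t by rewrite (SgA (s - _)) subrK.
have SgB' s t : Sg s t <-> Sg s (t - 2 * s) by rewrite (SgB _ (t - _)) subrK.
apply: primitive_ind => {p q}; rewrite /transvection_invariant.
- by move=> s t; rewrite SgA'; apply: Sg_eq; ring.
- by move=> s t; rewrite SgB; apply: Sg_eq; ring.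
- by move=> s t; rewrite SgB' SgA SgN; apply: Sg_eq; ring.
- by move=> s t; rewrite SgA SgB' SgN; apply: Sg_eq; ring.
- move=> p q H s t; rewrite H; apply: Sg_eq; rewrite !intrN; ring.
- move=> p q H s t; rewrite SgA' H SgA; apply: Sg_eq; rewrite intrD intrM; ring.
- move=> p q H s t; rewrite SgA H SgA'; apply: Sg_eq; rewrite intrB intrM; ring.
- move=> p q H s t; rewrite SgB' H SgB; apply: Sg_eq; rewrite intrD intrM; ring.
- move=> p q H s t; rewrite SgB H SgB'; apply: Sg_eq; rewrite intrB intrM; ring.
Qed.

End Transvections.

(** * Zero-one laws on half-lines and on directions *)

Section LinearAction.
Variable R : realType.
Notation mu := (@lebesgue_measure R).
Notation plane := (measurableTypeR R * measurableTypeR R)%type.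
Notation mu2 := (@lebesgue_measure R \x @lebesgue_measure R)%E.
Variable Sg : R -> R -> Prop.
Hypothesis SgN : forall s t, Sg s t <-> Sg (- s) (- t).
Hypothesis SgA : forall s t, Sg s t <-> Sg (s + 2 * t) t.
Hypothesis SgB : forall s t, Sg s t <-> Sg s (t + 2 * s).

Let Sg_eq s t s' t' : s = s' -> t = t' -> Sg s t <-> Sg s' t'.
Proof. by move=> -> ->. Qed.

(** The coordinates are the slope [s / t] and the height [t], so that vertical fibres are half-lines
    from the origin. *)
Notation S := ([set v | 0 < v.2 /\ Sg (v.1 * v.2) v.2] : set plane).
Hypothesis mS : measurable S.

Section Strip.
Variables (p : int) (q : nat) (D : R).
Hypothesis pq : primitive p q%:Z.
Hypothesis q0 : (0 < q)%N.
Hypothesis D0 : 0 < D.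

Let qR : 0 < q%:R :> R. Proof. by rewrite ltr0n. Qed.

(* In the coordinate d = s q - t p transverse to the direction (p, q) the
   transvection along (p, q) becomes the translation by 2 d q of t. *)
Definition line (d : R) : set R := [set t | Sg ((d + t * p%:~R) / q%:R) t].

Lemma line_periodic d t : line d t <-> line d (t + 2 * d * q%:R).
Proof.
rewrite /line/= (transvectionP SgN SgA SgB pq); apply: Sg_eq.
  by rewrite -[q%:R]/(q%:Z%:~R); field; rewrite gt_eqF.
by rewrite -[q%:R]/(q%:Z%:~R); field; rewrite gt_eqF.
Qed.

Definition strip (a l : R) : set plane :=
  [set v | 0 < v.1 < D /\ a <= v.2 < a + l /\ line v.1 v.2].

Lemma strip_measurable a l : 0 < a -> measurable (strip a l).
Proof.
move=> a0; pose U : set plane := [set v | 0 < v.2].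
pose f (v : R * R) := ((v.1 + v.2 * p%:~R) / (q%:R * v.2), v.2).
have oU : open (U : set (R * R)).
  rewrite (_ : U = snd @^-1` `]0, +oo[%classic); last first.
    by apply/seteqP; split => v; rewrite /U /= in_itv/= andbT.
  by apply: open_comp => [v _|]; [exact: cvg_snd|exact: interval_open].
have mf := @measurable_preimage_open R U f oU _ S mS.
rewrite (_ : strip a l = (`]0, D[ `*` `[a, a + l[)%classic `&` (U `&` f @^-1` S)).
  apply: measurableI; last first.
    apply: mf => v Uv; rewrite /f; apply: continuous_pair; last exact: cvg_snd.
    apply: cvgM.
      by apply: cvgD; [exact: cvg_fst|apply: cvgM; [exact: cvg_snd|exact: cvg_cst]].
    apply: cvgV; first by rewrite mulf_neq0 ?gt_eqF.
    by apply: cvgM; [exact: cvg_cst|exact: cvg_snd].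
  by apply: measurableX; exact: measurable_itv.
apply/seteqP; split => -[d t]; rewrite /strip /line /U /f /=.
  move=> [dD [tI Sl]]; rewrite !in_itv/= dD tI; split=> //.
  have t0 : 0 < t by move: tI; lra.
  do 2 split => //; move: Sl; apply: iffLR; apply: Sg_eq => //.
  by field; rewrite !gt_eqF.
rewrite !in_itv/= => -[[dD tI] [t0 [_ Sl]]]; do 2 split => //.
move: Sl; apply: iffLR; apply: Sg_eq => //.
by field; rewrite !gt_eqF.
Qed.

(** Slopes just to the right of [p / q]. At height [t] the transverse coordinate is
    [d = q t (th - p / q)]; hence [c = a + l] puts the sector inside the strip, and [c = a] makes it
    cover the strip. *)
Let sector (a l c : R) : set plane :=
  S `&` (`]p%:~R / q%:R, p%:~R / q%:R + D / (q%:R * c)[ `*` `[a, a + l[)%classic.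

Lemma sector_measurable a l c : measurable (sector a l c).
Proof.
by apply: measurableI => //; apply: measurableX; exact: measurable_itv.
Qed.

Lemma sector_le_strip a l : 0 < a -> 0 < l ->
  (mu2 (sector a l (a + l)) <= ((q%:R * a)^-1)%:E * mu2 (strip a l))%E.
Proof.
move=> a0 l0; apply: mu2_le_ysection.
- exact: sector_measurable.
- exact: strip_measurable.
- by rewrite invr_ge0 mulr_ge0// ltW.
move=> t; have [tI|tI] := boolP (a <= t < a + l); last first.
  rewrite (_ : ysection _ _ = set0) ?measure0 ?mule_ge0 ?lee_fin ?invr_ge0 ?mulr_ge0// ?ltW//.
  by rewrite -subset0 => th /ysectionP[_ [_]]; rewrite /= in_itv/= (negPf tI).
have t0 : 0 < t by move: tI; lra.
have qt : 0 < q%:R * t by rewrite mulr_gt0.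
rewrite lee_pdivlMl ?mulr_gt0//.
have [B0 B1] : 0 < q%:R * a /\ q%:R * a <= q%:R * t.
  by rewrite mulr_gt0 ?ler_pM2l//; case/andP: tI.
apply: (@le_trans _ _ ((q%:R * t)%:E * mu (ysection (sector a l (a + l)) t))%E).
  by rewrite lee_wpmul2r// lee_fin.
rewrite -[X in X%:E](gtr0_norm qt) -(mu_image_affine (- (t * p%:~R))) ?gt_eqF//.
apply: le_outer_measure => _ [th /ysectionP[[_ Sl] [/=]] + _ <-].
rewrite in_itv/= => /andP[h1 h2]; apply/ysectionP.
have E : q%:R * t * th - t * p%:~R = (th - p%:~R / q%:R) * (q%:R * t).
  by field; rewrite gt_eqF.
split => /=; [|split => //].
  rewrite E mulr_gt0 ?subr_gt0//=.
  have : th - p%:~R / q%:R < D / (q%:R * (a + l)) by lra.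
  have al : 0 < a + l by lra.
  rewrite ltr_pdivlMr ?mulr_gt0// => h; apply: le_lt_trans h.
  by rewrite ler_pM2l ?subr_gt0// ler_pM2l// ltW//; case/andP: tI.
move: Sl; rewrite /line/=; apply: iffLR; apply: Sg_eq => //.
by rewrite E; field; rewrite gt_eqF.
Qed.

Lemma strip_le_sector a l : 0 < a -> 0 < l ->
  (mu2 (strip a l) <= (q%:R * (a + l))%:E * mu2 (sector a l a))%E.
Proof.
move=> a0 l0; have al : 0 < a + l by lra.
apply: mu2_le_ysection.
- exact: strip_measurable.
- exact: sector_measurable.
- by rewrite mulr_ge0// ltW.
move=> t; have [tI|tI] := boolP (a <= t < a + l); last first.
  rewrite (_ : ysection _ _ = set0) ?measure0 ?mule_ge0 ?lee_fin ?mulr_ge0// ?ltW//.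
  by rewrite -subset0 => th /ysectionP[_ [/=]]; rewrite (negPf tI).
have t0 : 0 < t by move: tI; lra.
have qt : 0 < q%:R * t by rewrite mulr_gt0.
apply: (@le_trans _ _ ((q%:R * t)%:E * mu (ysection (sector a l a) t))%E); last first.
  by rewrite lee_wpmul2r// lee_fin ler_pM2l// ltW//; case/andP: tI.
rewrite -[X in (X%:E * _)%E](gtr0_norm qt) -(mu_image_affine (- (t * p%:~R))) ?gt_eqF//.
apply: le_outer_measure => d /ysectionP[/= /andP[d0 dD] [_ Sl]].
exists ((d + t * p%:~R) / (q%:R * t)); last by field; rewrite !gt_eqF.
have E : (d + t * p%:~R) / (q%:R * t) = p%:~R / q%:R + d / (q%:R * t).
  by field; rewrite !gt_eqF.
apply/ysectionP; split => /=.
  split => //; move: Sl; rewrite /line/=; apply: iffLR; apply: Sg_eq => //.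
  by field; rewrite !gt_eqF.
split; rewrite /= in_itv//= E ltrDl divr_gt0//= ltrD2l.
rewrite ltr_pdivrMr// mulrAC ltr_pdivlMr ?mulr_gt0//.
case/andP: tI => at1 _; have := ler_pM2l qR a t; rewrite at1 => h.
apply: (@lt_le_trans _ _ (D * (q%:R * a))); first by rewrite ltr_pM2r// mulr_gt0.
by rewrite ler_pM2l.
Qed.

(** For fixed [d] the fibre has period [2 d q], so moving the window from [a] to [b] by whole
    periods loses at most one period, of length below [2 D q]. Integrating over [0 < d < D] gives
    the error term. *)
Lemma strip_shift a b l : 0 < a -> 0 < b -> 0 < l ->
  (mu2 (strip a l) <= mu2 (strip b l) + (D * (2 * D * q%:R))%:E)%E.
Proof.
move=> a0 b0 l0.
have [D1 D2] : measurable (`]0, D[%classic : set (measurableTypeR R)) /\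
  measurable (`[0, 2 * D * q%:R[%classic : set (measurableTypeR R)).
  by split; exact: measurable_itv.
have -> : (D * (2 * D * q%:R))%:E = mu2 (`]0, D[ `*` `[0%R, 2 * D * q%:R[)%classic.
  rewrite product_measure1E//= !lebesgue_measure_itv/= !lte_fin D0 !mulr_gt0//.
  by rewrite -!EFinB !subr0 EFinM.
apply: mu2_le_xsection; [exact: strip_measurable|exact: strip_measurable|exact: measurableX|].
move=> d; have [dI|dI] := boolP (0 < d < D); last first.
  rewrite (_ : xsection _ _ = set0) ?measure0 ?adde_ge0//.
  by rewrite -subset0 => t /xsectionP[/=]; rewrite (negPf dI).
rewrite in_xsectionX; last by rewrite inE/= in_itv.
have /andP[d0 dD] := dI; pose P := 2 * d * q%:R; have P0 : 0 < P by rewrite !mulr_gt0.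
pose n := Num.ceil ((b - a) / P).
have nP : b <= a + n%:~R * P < b + P.
  have := ceil_itv ((b - a) / P); rewrite -/n intrD ltr_pdivlMr// ler_pdivrMr//.
  by rewrite rmorphN rmorph1; lra.
have Ln := period_int (line_periodic d) n.
apply: (@le_trans _ _ (mu (xsection (strip b l) d `|` `[b + l, b + l + P[%classic))).
  rewrite -[leLHS]mul1e -[1%E]/((1:R)%:E) -(normr1 R) -(mu_image_affine (n%:~R * P)) ?oner_eq0//.
  apply: le_outer_measure => _ [t /xsectionP[/= _ [tI Lt]] <-]; rewrite mul1r.
  have [tb|bt] := ltP (t + n%:~R * P) (b + l); last first.
    by right; rewrite /= in_itv/=; lra.
  left; apply/xsectionP; split => //=; split; first by lra.
  exact: (Ln t).1 Lt.
apply: le_trans (outer_measureU2 _ _ _) _; rewrite leeD2l//.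
apply: (@le_trans _ _ (mu `[b + l, b + l + P[%classic)) => //.
rewrite !lebesgue_measure_itv/= !lte_fin ltrDl P0 !mulr_gt0// -!EFinB lee_fin subr0.
by rewrite addrAC subrr add0r /P ler_pM2r// ler_pM2l// ltW.
Qed.

End Strip.

Lemma mu2_rect (A B : set (measurableTypeR R)) : measurable A -> measurable B ->
  mu2 (A `*` B) = (mu A * mu B)%E.
Proof. exact: product_measure1E. Qed.

Lemma S_measurable_rect (I : set R) : measurable (I : set (measurableTypeR R)) ->
  measurable (S `&` [set v | I v.2]).
Proof.
move=> mI; apply: measurableI => //.
by rewrite -[X in measurable X]setTI; exact: measurable_snd.
Qed.

Notation fiber th a l := (xsection S th `&` `[a, (a + l)%R[%classic).

Lemma fiberE th (a l : R) : fiber th a l = xsection (S `&` [set v | `[a, a + l[%classic v.2]) th.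
Proof. rewrite xsectionI; congr (_ `&` _); apply/seteqP.
by split=> [t tI|t /xsectionP//]; apply/xsectionP. Qed.

(** The obstruction, at scale [l], to a zero-one law on the half-line of slope [th]. *)
Definition skew (a b l : R) : set R := [set th |
  (((99 / 100) * l)%:E <= mu (fiber th a l))%E /\
  (mu (fiber th b l) <= ((1 / 100) * l)%:E)%E].

Lemma skew_measurable a b l : measurable (skew a b l : set (measurableTypeR R)).
Proof.
have mI (c : R) : measurable (`[c, c + l[%classic : set (measurableTypeR R)).
  exact: measurable_itv.
have mf c := measurable_fun_xsection mu (S_measurable_rect (mI c)).
rewrite (_ : skew a b l = [set th | (((99 / 100) * l)%:E <= mu (fiber th a l))%E] `&`
  [set th | (mu (fiber th b l) <= ((1 / 100) * l)%:E)%E]) //.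
apply: measurableI.
  have := mf a measurableT `[((99 / 100) * l)%:E, +oo%E]%classic (emeasurable_itv _).
  rewrite setTI; congr (measurable _); apply/seteqP; split => th /=;
  by rewrite in_itv/= fiberE leey andbT.
have := mf b measurableT `[-oo%E, ((1 / 100) * l)%:E]%classic (emeasurable_itv _).
rewrite setTI; congr (measurable _); apply/seteqP; split => th /=;
by rewrite in_itv/= fiberE ?leNye.
Qed.

(** [X0] and [X1] stand for [q] times the measures of the strips at [a] and [b]. The first is at
    least about [0.022 l^2], the second at most [0.0035 l^2], and the shift accounts for only
    [0.005 l^2]. *)
Let skew_arith (a b l e X0 X1 : R) : 0 < l -> l <= a -> l <= b -> 0 < e ->
  e * (a + b + l) = l / 20 / 40 ->
  a * (l / (20 * (a + l)) - 2 * e) * (99 / 100 * l) <= X0 ->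
  X1 <= (b + l) * (l / (20 * b) * (1 / 100 * l) + 2 * e * l) ->
  X0 <= X1 + l ^+ 2 / 10 / 20 -> False.
Proof.
move=> l0 la lb e0 eE L1 L2 L3; have [a0 b0] : 0 < a /\ 0 < b by lra.
have A1 : l / 40 <= a * (l / (20 * (a + l))).
  rewrite mulrA ler_pdivlMr ?mulr_gt0//; [nra|lra].
have B1 : (b + l) * (l / (20 * b)) <= l / 10.
  rewrite mulrA ler_pdivrMr ?mulr_gt0//; nra.
have ea : 0 <= e * a by rewrite mulr_ge0 ?ltW.
have eb : 0 <= e * (b + l) by rewrite mulr_ge0 ?ltW//; lra.
have eE2 : e * a + e * (b + l) = l / 20 / 40 by rewrite -eE; ring.
have M1 : (l / 40 - 2 * (l / 20 / 40)) * (99 / 100 * l) <=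
    a * (l / (20 * (a + l)) - 2 * e) * (99 / 100 * l).
  rewrite ler_pM2r ?mulr_gt0// mulrBr (_ : a * (2 * e) = 2 * (e * a)); [lra|ring].
have M2 : (b + l) * (l / (20 * b) * (1 / 100 * l) + 2 * e * l) <=
    (l / 10 * (1 / 100) + 2 * (l / 20 / 40)) * l.
  have -> : (b + l) * (l / (20 * b) * (1 / 100 * l) + 2 * e * l) =
    ((b + l) * (l / (20 * b)) * (1 / 100) + 2 * (e * (b + l))) * l by ring.
  by rewrite ler_pM2r//; lra.
have l2 : 0 < l * l by rewrite mulr_gt0.
have : l ^+ 2 = l * l by [].
lra.
Qed.

(** At a density point with irrational slope, take a primitive [p / q] within [1 / q^2]. The sectors
    at both heights fit into the density ball, so nearly all their slopes are skew: one sector is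
    nearly full, the other nearly empty. The corresponding strips, however, have nearly equal
    measures by [strip_shift]. *)
Lemma skew_negligible a b l : 0 < l -> l <= a -> l <= b ->
  mu.-negligible (skew a b l).
Proof.
move=> l0 la lb; have [a0 b0] : 0 < a /\ 0 < b by lra.
apply: contrapT => nN.
have mT := skew_measurable a b l.
have [th0 [sth0 irr] dens] : exists2 th, skew a b l th /\ irrational_real (th / 1) &
   forall e : R, 0 < e -> exists2 d : R, 0 < d &
     forall r : R, 0 < r < d -> (mu (ball th r `\` skew a b l) <= (e * r)%:E)%E.
  have H := ae_and (density_ae mT) (irrational_ae (oner_neq0 R)).
  apply: contrapT => H'; apply: nN; apply: negligibleS H => th sth /= [h1 h2].
  by apply: H'; exists th => //; exact: h1.
rewrite divr1 in irr.
(* Slopes that are not skew have measure at most [2 e k] in the ball; this [e] lets them remove at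
   most a tenth of the sector over [a]. *)
pose e := l / (20 * (40 * (a + b + l))).
have abl : 0 < a + b + l by lra.
have e0 : 0 < e by rewrite divr_gt0 ?mulr_gt0.
have eE : e * (a + b + l) = l / 20 / 40 by rewrite /e; field; rewrite gt_eqF.
have [d d0 dH] := dens e e0.
have [q [p [Qq pq thpq]]] := dirichlet_primitive (Num.truncn (2 / d)) irr.
have q0 : (0 < q)%N by exact: leq_ltn_trans Qq.
have qR : 0 < q%:R :> R by rewrite ltr0n.
have q1 : 1 <= q%:R :> R by rewrite ler1n.
have dq : 2 / d < q%:R.
  have /andP[_ h] := truncn_itv (ltW (divr_gt0 (ltr0n R 2) d0)).
  by apply: lt_le_trans h _; rewrite ler_nat.
pose k := (q%:R ^+ 2)^-1 : R; have k0 : 0 < k by rewrite invr_gt0 exprn_gt0.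
have kq : k * q%:R = q%:R^-1 by rewrite /k; field; rewrite gt_eqF.
have kd : 0 < 2 * k < d.
  rewrite mulr_gt0//=; move: dq; rewrite ltr_pdivrMr// => h.
  have : k <= q%:R^-1 by rewrite -kq ler_peMr// ltW.
  have : 2 * q%:R^-1 < d by rewrite ltr_pdivrMr// mulrC.
  lra.
have {dH}badk := dH _ kd.
(* Of order [1 / q], so that sectors have angular width of order [1 / q^2]. The factor 20 makes the
   shift error [2 D^2 q] a tenth of [D l], the area of the window of the strip. *)
pose D := l / (20 * q%:R); have D0 : 0 < D by rewrite divr_gt0 ?mulr_gt0.
pose J (c : R) := `]p%:~R / q%:R, p%:~R / q%:R + D / (q%:R * c)[%classic : set R.
have DJ c : 0 < c -> D / (q%:R * c) = k * l / (20 * c).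
  by move=> c0; rewrite /D /k; field; rewrite !gt_eqF.
have JD c : l <= c -> J c `<=` ball th0 (2 * k).
  move=> lc x; rewrite /J /ball/= in_itv/= DJ; last lra.
  have : k * l / (20 * c) <= k.
    rewrite ler_pdivrMr; [nra|lra].
  move: thpq; rewrite -/k !ltr_norml; lra.
have muJ c : 0 < c -> mu (J c) = (k * l / (20 * c))%:E.
  move=> c0; rewrite lebesgue_measure_itv/= lte_fin ltrDl DJ//.
  by rewrite divr_gt0 ?mulr_gt0// -EFinB addrAC subrr add0r.
have Jbad c : l <= c -> (mu (J c `\` skew a b l) <= (e * (2 * k))%:E)%E.
  move=> lc; apply: le_trans badk; apply: le_outer_measure.
  by apply: setSD; exact: JD.
have mJ c : measurable (J c : set (measurableTypeR R)) by exact: measurable_itv.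
have mR (u : R) : measurable (`[0, u[%classic : set (measurableTypeR R)).
  exact: measurable_itv.
have muR (u : R) : 0 < u -> mu `[0, u[%classic = u%:E.
  by move=> u0; rewrite lebesgue_measure_itv/= lte_fin u0 -EFinB subr0.
pose T := skew a b l.
pose x0 := mu2 (strip p q D a l); pose x1 := mu2 (strip p q D b l).
have sectE c u : S `&` (J c `*` `[u, u + l[) = [set v | J c v.1 /\ fiber v.1 u l v.2].
  apply/seteqP; split => -[x y] /=; rewrite -/(xsection S x).
    by move=> [Sv [Jx yI]]; split => //; split => //; exact/xsectionP.
  by move=> [Jx [/xsectionP Sv yI]].
have L1 : (((k * l / (20 * (a + l)) - e * (2 * k)) * ((99 / 100) * l))%:E <=
    ((q%:R * a)^-1)%:E * x0)%E.
  apply: le_trans (sector_le_strip p D q0 a0 l0); rewrite sectE.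
  have al : 0 < a + l by lra.
  have mJT := measurableI _ _ (mJ (a + l)) mT.
  have mB : measurable ([set v : plane | J (a + l) v.1 /\ fiber v.1 a l v.2]).
    by rewrite -sectE; exact: sector_measurable.
  have := @mu2_le_xsection R ((J (a + l) `&` T) `*` `[0, (99 / 100) * l[)%classic
    _ set0 (measurableX mJT (mR _)) mB measurable0.
  rewrite measure0 adde0 mu2_rect// => H.
  apply: le_trans (H _); last first.
    move=> th; have [thJ|thJ] := pselect ((J (a + l) `&` T) th); last first.
      by rewrite notin_xsectionX ?measure0 ?adde_ge0// notin_setE.
    rewrite in_xsectionX ?inE// muR ?mulr_gt0//.
    have [Jth [h _]] := thJ.
    rewrite (_ : xsection [set v | _ /\ _] th = fiber th a l) ?xsection0 ?measure0 ?adde0//.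
    by apply/seteqP; split => t; [move=> /xsectionP[]|move=> h'; apply/xsectionP].
  rewrite muR ?mulr_gt0// EFinM lee_pmul2r// ?lte_fin ?mulr_gt0//.
  rewrite EFinB leeBlDr// -muJ//.
  apply: (@le_trans _ _ (mu (J (a + l)%R `&` T) + mu (J (a + l)%R `\` T))%E).
    apply: le_trans (outer_measureU2 _ _ _); apply: le_outer_measure => x Jx.
    by have [Tx|nTx] := pselect (T x); [left|right].
  by rewrite leeD2l//; apply: Jbad; lra.
have L2 : (x1 <= (q%:R * (b + l) * (k * l / (20 * b) * (1 / 100 * l) + e * (2 * k) * l))%:E)%E.
  apply: le_trans (strip_le_sector p q0 D0 b0 l0) _; rewrite sectE.
  rewrite [leRHS]EFinM; apply: lee_wpmul2l; first by rewrite lee_fin mulr_ge0 ?ltW//; lra.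
  have mJT := measurableD (mJ b) mT.
  have mB : measurable ([set v : plane | J b v.1 /\ fiber v.1 b l v.2]).
    by rewrite -sectE; exact: sector_measurable.
  have := @mu2_le_xsection R _ (J b `*` `[0, (1 / 100) * l[)%classic
    ((J b `\` T) `*` `[0, l[)%classic mB (measurableX (mJ b) (mR _)) (measurableX mJT (mR _)).
  rewrite !mu2_rect// => H; apply: le_trans (H _) _.
    move=> th; have [thJ|thJ] := pselect (J b th); last first.
      rewrite (_ : xsection [set v | _ /\ _] th = set0) ?measure0 ?adde_ge0//.
      by rewrite -subset0 => t /xsectionP[].
    rewrite in_xsectionX ?inE//.
    rewrite (_ : xsection [set v | _ /\ _] th = fiber th b l); last first.
      by apply/seteqP; split => t; [move=> /xsectionP[]|move=> h'; apply/xsectionP].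
    have fl : (mu (fiber th b l) <= l%:E)%E.
      apply: (@le_trans _ _ (mu `[b, b + l[%classic)); first by apply: le_outer_measure => t [].
      by rewrite lebesgue_measure_itv/= lte_fin ltrDl l0 -EFinB addrAC subrr add0r.
    have [Tth|nTth] := pselect (T th).
      by rewrite muR ?mulr_gt0//; apply: le_trans (leeDl _ _) => //; case: Tth.
    rewrite [xsection (_ `*` _) _]in_xsectionX ?inE// !muR ?mulr_gt0//.
    by apply: le_trans (leeDr _ _) => //; rewrite lee_fin mulr_ge0// ltW.
  rewrite !muR ?mulr_gt0// muJ// EFinD !EFinM leeD2l// lee_pmul2r//.
  by rewrite -EFinM; exact: Jbad.
have L3 : (x0 <= x1 + (D * (2 * D * q%:R))%:E)%E by exact: strip_shift.
have [r1 r1E] : exists r1 : R, x1 = r1%:E.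
  exists (fine x1); rewrite fineK// ge0_fin_numE ?measure_ge0//.
  exact: le_lt_trans L2 (ltry _).
rewrite r1E -EFinD in L3; rewrite r1E lee_fin in L2.
have [r0 r0E] : exists r0 : R, x0 = r0%:E.
  exists (fine x0); rewrite fineK// ge0_fin_numE ?measure_ge0//.
  exact: le_lt_trans L3 (ltry _).
rewrite r0E lee_fin in L3; rewrite r0E -EFinM lee_fin in L1.
have {}L1 : a * (l / (20 * (a + l)) - 2 * e) * (99 / 100 * l) <= q%:R * r0.
  have -> : a * (l / (20 * (a + l)) - 2 * e) * (99 / 100 * l) =
    q%:R * (q%:R * a) * ((k * l / (20 * (a + l)) - e * (2 * k)) * (99 / 100 * l)).
    by rewrite /k; field; rewrite !gt_eqF//; lra.
  by rewrite -mulrA ler_pM2l// -ler_pdivlMl ?mulr_gt0.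
have {}L2 : q%:R * r1 <= (b + l) * (l / (20 * b) * (1 / 100 * l) + 2 * e * l).
  rewrite -ler_pdivlMl//; apply: le_trans L2 _; rewrite le_eqVlt; apply/orP; left.
  by apply/eqP; rewrite /k; field; rewrite !gt_eqF//; lra.
have {}L3 : q%:R * r0 <= q%:R * r1 + l ^+ 2 / 10 / 20.
  have -> : l ^+ 2 / 10 / 20 = q%:R * (D * (2 * D * q%:R)).
    by rewrite /D; field; rewrite gt_eqF.
  by rewrite -mulrDr ler_pM2l.
exact: skew_arith l0 la lb e0 eE L1 L2 L3.
Qed.

Notation upper := ([set v | 0 < v.2] : set plane).

Lemma upper_measurable : measurable upper.
Proof.
rewrite (_ : upper = setT `*` `]0, +oo[%classic).
  by apply: measurableX => //; exact: measurable_itv.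
by apply/seteqP; split => v /=; rewrite in_itv/= andbT => // -[].
Qed.

(** If both parts of a half-line have positive measure, the grid windows of length [1 / (n + 1)]
    containing a density point of each part make the slope skew for large [n], and there are only
    countably many such windows. *)
Lemma fiber_dichotomy : {ae mu, forall th,
  mu.-negligible (xsection S th) \/ mu.-negligible (xsection (upper `\` S) th)}.
Proof.
have l0 n : 0 < n.+1%:R^-1 :> R by rewrite invr_gt0.
have H : mu.-negligible (\bigcup_n \bigcup_k \bigcup_j
    skew (k.+1%:R * n.+1%:R^-1) (j.+1%:R * n.+1%:R^-1) n.+1%:R^-1).
  do 3 (apply: negligible_bigcup => ?); apply: skew_negligible => //;
  by rewrite -[leLHS]mul1r ler_pM2r// ler1n.
apply: negligibleS H => th /= /not_orP[nA nB].
have mA : measurable (xsection S th) by exact: measurable_xsection.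
have mB : measurable (xsection (upper `\` S) th).
  by apply: measurable_xsection; apply: measurableD => //; exact: upper_measurable.
(* The ball of radius [2 l] contains the grid window, and its defect [2 l / 200] is one hundredth of
   [l]. *)
have e0 : 0 < 1 / 20 / 10 :> R by rewrite !divr_gt0.
have [x /xsectionP[/= x0 _] /(_ _ e0)[d1 d10 H1]] := density_point mA nA.
have [y /xsectionP[/= y0 _] /(_ _ e0)[d2 d20 H2]] := density_point mB nB.
pose z := Num.min (Num.min d1 d2) (Num.min x y).
have z0 : 0 < z by rewrite !lt_min d10 d20 x0 y0.
have [zd1 zd2 zx zy] : [/\ z <= d1, z <= d2, z <= x & z <= y].
  by rewrite !ge_min !lexx !orbT.
pose n := Num.truncn (2 / z); exists n => //; pose l : R := n.+1%:R^-1.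
have l2 : 2 * l < z.
  have /andP[_ h] := truncn_itv (ltW (divr_gt0 (ltr0n R 2) z0)).
  by rewrite ltr_pdivrMr// -ltr_pdivrMl// mulrC.
have win (w : R) : l < w -> exists k : nat, k.+1%:R * l <= w < k.+1%:R * l + l.
  move=> lw; have w0 : 0 < w by apply: lt_trans lw; exact: l0.
  have /andP[h1 h2] := truncn_itv (ltW (divr_gt0 w0 (l0 n))).
  have k0 : (0 < Num.truncn (w / n.+1%:R^-1))%N.
    rewrite truncn_gt0 ler_pdivlMr// mul1r; exact: ltW.
  exists (Num.truncn (w / n.+1%:R^-1)).-1; rewrite prednK//.
  move: h1 h2; rewrite -/l ler_pdivlMr ?ltr_pdivrMr; try exact: (l0 n).
  by move=> -> /=; rewrite -natr1 mulrDl mul1r.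
have [k kx] : exists k : nat, k.+1%:R * l <= x < k.+1%:R * l + l.
  by apply: win; have := l0 n; rewrite -/l; lra.
have [j jy] : exists k : nat, k.+1%:R * l <= y < k.+1%:R * l + l.
  by apply: win; have := l0 n; rewrite -/l; lra.
exists k => //; exists j => //; rewrite -/l.
have ll0 : 0 < l := l0 n.
have sub (w c t : R) : c <= w < c + l -> `[c, c + l[%classic t -> ball w (2 * l) t.
  by rewrite /ball/= in_itv/= ltr_norml; lra.
have {}H1 := H1 (2 * l); rewrite mulr_gt0//= (lt_le_trans l2 zd1) in H1; have {}H1 := H1 isT.
have {}H2 := H2 (2 * l); rewrite mulr_gt0//= (lt_le_trans l2 zd2) in H2; have {}H2 := H2 isT.
have eE : 1 / 20 / 10 * (2 * l) = 1 / 100 * l by field.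
split.
  have mul : mu `[k.+1%:R * l, k.+1%:R * l + l[%classic = l%:E.
    by rewrite lebesgue_measure_itv/= lte_fin ltrDl ll0 -EFinB addrAC subrr add0r.
  have -> : 99 / 100 * l = l - 1 / 100 * l by field.
  rewrite EFinB leeBlDr// -mul.
  apply: (@le_trans _ _ (mu (fiber th (k.+1%:R * l)%R l) +
      mu (ball x (2 * l)%R `\` xsection S th))%E); last first.
    by rewrite leeD2l// -eE.
  apply: le_trans (outer_measureU2 _ _ _); apply: le_outer_measure => t tI.
  have [St|nSt] := pselect (xsection S th t); [by left|right; split=> //].
  exact: sub kx tI.
apply: (le_trans _ (le_trans H2 _)); last by rewrite eE.
apply: le_outer_measure => t [St tI]; split; first exact: sub jy tI.
by move=> /xsectionP[_]; apply; exact/xsectionP.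
Qed.

(** Phrased for vectors instead of slopes, so that the linear symmetries act on it directly. *)
Definition cone (s t : R) : Prop :=
  mu.-negligible [set u | 0 < u /\ ~ Sg (u * s) (u * t)].

Lemma coneN s t : cone s t <-> cone (- s) (- t).
Proof.
rewrite /cone; suff -> : [set u | 0 < u /\ ~ Sg (u * s) (u * t)] =
  [set u | 0 < u /\ ~ Sg (u * - s) (u * - t)] by [].
by apply/seteqP; split=> u [u0 h]; split=> //; move: h; rewrite !mulrN -SgN.
Qed.

Lemma coneA s t : cone s t <-> cone (s + 2 * t) t.
Proof.
rewrite /cone; suff -> : [set u | 0 < u /\ ~ Sg (u * s) (u * t)] =
  [set u | 0 < u /\ ~ Sg (u * (s + 2 * t)) (u * t)] by [].
by apply/seteqP; split=> u [u0 h]; split=> //; move: h;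
  rewrite mulrDr (mulrCA u 2) -SgA.
Qed.

Lemma coneB s t : cone s t <-> cone s (t + 2 * s).
Proof.
rewrite /cone; suff -> : [set u | 0 < u /\ ~ Sg (u * s) (u * t)] =
  [set u | 0 < u /\ ~ Sg (u * s) (u * (t + 2 * s))] by [].
by apply/seteqP; split=> u [u0 h]; split=> //; move: h;
  rewrite mulrDr (mulrCA u 2) -SgB.
Qed.

Lemma cone_scale (c : R) s t : c != 0 -> cone (c * s) (c * t) -> cone s t.
Proof.
suff H (c' : R) s' t' : 0 < c' -> cone (c' * s') (c' * t') -> cone s' t'.
  move=> c0; have [cp|cn] := ltrP 0 c; first exact: H.
  rewrite coneN -!mulNr; apply: H; rewrite oppr_gt0 lt_neqAle c0; exact: cn.
move=> c0 Kc; have KI : mu.-negligible ((fun u => c' * u) @`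
    [set u | 0 < u /\ ~ Sg (u * (c' * s')) (u * (c' * t'))]).
  apply: (negligible_lipschitz_image c0) Kc => x y _ _.
  by rewrite -mulrBr normrM gtr0_norm.
apply: negligibleS KI => u [u0 nS]; exists (u / c'); last by rewrite mulrC divfK ?gt_eqF.
by split; [rewrite divr_gt0|move: nS; rewrite !mulrA divfK ?gt_eqF].
Qed.

(** The vectors are [x (p, q) + (b, d)] with [(p, q)] one of [(1, 0)], [(0, 1)], [(1, 1)],
    [(1, -1)], completed by [(b, d)] to a basis of determinant 1. *)
Definition cusp (i : 'I_4) (x : R) : Prop :=
  if i == 0 :> nat then cone x 1 else if i == 1 :> nat then cone (-1) x
  else if i == 2 :> nat then cone x (x + 1) else cone x (1 - x).

(** The shears carry a unimodular basis starting with [(p, q)] to one of the four model bases, and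
    this transports the whole coordinate [x], not only the direction [(p, q)]. *)
Lemma cusp_coordinates (p q : int) : primitive p q -> exists b d : int,
  p * d - q * b = 1 /\ exists i : 'I_4, forall x,
  cone (x * p%:~R + b%:~R) (x * q%:~R + d%:~R) <-> cusp i x.
Proof.
have cone_eq s t s' t' : s = s' -> t = t' -> cone s t <-> cone s' t' by move=> -> ->.
have coneA' s t : cone s t <-> cone (s - 2 * t) t by rewrite (coneA (s - _)) subrK.
have coneB' s t : cone s t <-> cone s (t - 2 * s) by rewrite (coneB _ (t - _)) subrK.
apply: (@primitive_ind (fun p q => exists b d : int, p * d - q * b = 1 /\
  exists i : 'I_4, forall x,
  cone (x * p%:~R + b%:~R) (x * q%:~R + d%:~R) <-> cusp i x)) => {p q}.
- exists 0, 1; split => //; exists (@Ordinal 4 0 isT) => x; apply: cone_eq; ring.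
- exists (-1), 0; split => //; exists (@Ordinal 4 1 isT) => x; apply: cone_eq; ring.
- exists 0, 1; split => //; exists (@Ordinal 4 2 isT) => x; apply: cone_eq; ring.
- exists 0, 1; split => //; exists (@Ordinal 4 3 isT) => x; apply: cone_eq; ring.
- move=> p q [b [d [bd [i H]]]]; exists (- b), (- d); split; first by rewrite -bd; ring.
  by exists i => x; rewrite -H coneN; apply: cone_eq; rewrite !intrN; ring.
- move=> p q [b [d [bd [i H]]]]; exists (b + 2 * d), d; split; first by rewrite -bd; ring.
  by exists i => x; rewrite -H coneA'; apply: cone_eq; rewrite ?intrD ?intrM; ring.
- move=> p q [b [d [bd [i H]]]]; exists (b - 2 * d), d; split; first by rewrite -bd; ring.
  by exists i => x; rewrite -H coneA; apply: cone_eq; rewrite ?intrB ?intrM; ring.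
- move=> p q [b [d [bd [i H]]]]; exists b, (d + 2 * b); split; first by rewrite -bd; ring.
  by exists i => x; rewrite -H coneB'; apply: cone_eq; rewrite ?intrD ?intrM; ring.
- move=> p q [b [d [bd [i H]]]]; exists b, (d - 2 * b); split; first by rewrite -bd; ring.
  by exists i => x; rewrite -H coneB; apply: cone_eq; rewrite ?intrB ?intrM; ring.
Qed.

(** The window [[0, 2)] splits into two pieces, each of which translates into [[c, c + 2)]. Only
    subadditivity of outer measure is at hand, whence the factor 2. *)
Lemma periodic_window (A : set R) (c : R) : (forall x, A x <-> A (x + 2)) ->
  (mu (A `&` `[0%R, 2%R[) <= mu (A `&` `[c, (c + 2)%R[) + mu (A `&` `[c, (c + 2)%R[))%E.
Proof.
move=> A2; pose m := Num.ceil (c / 2).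
have mc : c <= m%:~R * 2 < c + 2.
  have := ceil_itv (c / 2); rewrite -/m ltr_pdivlMr// ler_pdivrMr//.
  by rewrite intrD rmorphN rmorph1; lra.
have Am := period_int A2.
pose f (n : int) (x : R) := 1 * x + n%:~R * 2.
have mf (n : int) B : mu (f n @` B) = mu B.
  by rewrite mu_image_affine ?oner_eq0// normr1 mul1e.
pose r := c + 2 - m%:~R * 2.
apply: (@le_trans _ _ (mu (A `&` `[0%R, r[) + mu (A `&` `[r, 2%R[))%E).
  apply: le_trans (outer_measureU2 _ _ _); apply: le_outer_measure => x.
  rewrite /= !in_itv/= => -[Ax /andP[x0 x2]].
  by have [xr|rx] := ltP x r; [left|right]; split=> //; rewrite ?x0 ?x2 ?xr ?rx.
apply: leeD.
  rewrite -(mf m); apply: le_outer_measure => _ [x + <-].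
  rewrite /f/= !in_itv/= mul1r => -[Ax xr].
  by split; [exact: (Am m x).1|rewrite /r in xr; lra].
rewrite -(mf (m - 1)); apply: le_outer_measure => _ [x + <-].
rewrite /f/= !in_itv/= mul1r => -[Ax xr].
by split; [exact: (Am (m - 1) x).1|rewrite /r in xr; rewrite intrB; lra].
Qed.

Lemma periodic_negligible (A : set R) : (forall x, A x <-> A (x + 2)) ->
  mu.-negligible (A `&` `[0%R, 2%R[) -> mu.-negligible A.
Proof.
move=> A2 A0; apply: (@negligibleS _ _ _ mu (\bigcup_n \bigcup_(b in [set: bool])
    (fun x => 1 * x + (-1) ^+ b * n%:R * 2) @` (A `&` `[0%R, 2%R[))).
  move=> x Ax; pose m := Num.floor (x / 2).
  have xm : m%:~R * 2 <= x < m%:~R * 2 + 2.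
    have := floor_itv (x / 2); rewrite -/m ler_pdivlMr// ltr_pdivrMr//.
    by rewrite intrD; lra.
  exists (absz m) => //; exists (m < 0) => //; exists (x - m%:~R * 2).
    split; last by rewrite /= in_itv/=; lra.
    by apply/(period_int A2 m); rewrite subrK.
  have -> : (-1) ^+ (m < 0)%R * `|m|%:R = m%:~R :> R.
    by rewrite [in RHS](intEsign m) rmorphM/= rmorph_sign.
  by rewrite mul1r subrK.
apply: negligible_bigcup => n; apply: (@negligibleS _ _ _ mu
  ((fun x => 1 * x + (-1) ^+ true * n%:R * 2) @` (A `&` `[0%R, 2%R[) `|`
   (fun x => 1 * x + (-1) ^+ false * n%:R * 2) @` (A `&` `[0%R, 2%R[))).
  by move=> y [[] _ h]; [left|right].
have N (c : R) : mu.-negligible ((fun x => 1 * x + c) @` (A `&` `[0%R, 2%R[)).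
  apply: (@negligible_lipschitz_image _ _ _ 1) => // x y _ _.
  by rewrite !mul1r opprD addrACA subrr addr0.
by apply: negligibleU; exact: N.
Qed.

Lemma cusp_periodic i x : cusp i x <-> cusp i (x + 2).
Proof.
have cone_eq s t s' t' : s = s' -> t = t' -> cone s t <-> cone s' t' by move=> -> ->.
rewrite /cusp; case: ifP => _; last case: ifP => _; last case: ifP => _.
- by rewrite coneA; apply: cone_eq; ring.
- by rewrite (coneB _ (x + 2)); apply: cone_eq; ring.
- have T := transvectionP coneN coneA coneB (_ : primitive 1 1).
  rewrite (T _ (x + 2)); last by exists 1, 0.
  by apply: cone_eq; ring.
- have T := transvectionP coneN coneA coneB (_ : primitive 1 (-1)).
  rewrite (T _ (x + 2)); last by exists 1, 0.
  by apply: cone_eq; ring.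
Qed.

(** The slope is a fractional linear function of each cusp coordinate, derivable off its pole, so
    null sets are carried to null sets. *)
Lemma cusp_conull i : mu.-negligible (~` cusp i) ->
  mu.-negligible [set th | ~ cone th 1].
Proof.
have img (f : R -> R) (c : R) (B : set R) : (forall x, x != c -> derivable f x 1) ->
    mu.-negligible B -> mu.-negligible (f @` (B `&` [set x | x != c])).
  move=> df B0; apply: negligible_derivable_image => [x [_ /df]//|].
  by apply: negligibleS B0 => x [].
have n1 (c : R) : mu.-negligible [set c].
  by apply/negligible_mu; exact: lebesgue_measure_set1.
have red (f : R -> R) (c : R) (B : set R) (c' : R) :
    (forall x, x != c -> derivable f x 1) -> mu.-negligible B ->
    (forall th, th != c' -> ~ cone th 1 -> exists2 x, B x /\ x != c & f x = th) ->
    mu.-negligible [set th | ~ cone th 1].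
  move=> df B0 H; apply: negligibleS (negligibleU (img f c B df B0) (n1 c')) => th nth.
  have [->|thc] := eqVneq th c'; [by right|left].
  by have [x [Bx xc] <-] := H th thc nth; exists x.
case: i => [[|[|[|[|//]]]] i4]; rewrite /cusp/= => H.
- exact: negligibleS H.
- apply: (red (fun x => - x^-1) 0 _ 0 _ H) => [x x0|th th0 nth].
    by apply: derivableN; apply: derivableV.
  exists (- th^-1); last by rewrite invrN invrK opprK.
  rewrite oppr_eq0 invr_eq0 th0; split => // h; apply: nth.
  apply: (@cone_scale (- th^-1)); first by rewrite oppr_eq0 invr_eq0.
  by rewrite mulr1 mulNr mulVf.
- apply: (red (fun x => x * (x + 1)^-1) (-1) _ 1 _ H) => [x x0|th th0 nth].
    apply: derivableM; first exact: derivable_id.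
    apply: derivableV; first by rewrite addr_eq0.
    by apply: derivableD.
  have th1 : 1 - th != 0 by rewrite subr_eq0 eq_sym.
  have E : th / (1 - th) + 1 = (1 - th)^-1 by field.
  exists (th / (1 - th)); last by rewrite E invrK divfK.
  rewrite -subr_eq0 opprK E invr_eq0; split => // h; apply: nth.
  apply: (@cone_scale (1 - th)^-1); first by rewrite invr_eq0.
  by move: h; rewrite /= E mulr1 [_^-1 * th]mulrC.
- apply: (red (fun x => x * (1 - x)^-1) 1 _ (-1) _ H) => [x x0|th th0 nth].
    apply: derivableM; first exact: derivable_id.
    apply: derivableV; first by rewrite subr_eq0 eq_sym.
    by apply: derivableB.
  have th1 : 1 + th != 0 by rewrite addrC addr_eq0.
  have E : 1 - th / (1 + th) = (1 + th)^-1 by field.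
  exists (th / (1 + th)); last by rewrite E invrK divfK.
  rewrite eq_sym -subr_eq0 E invr_eq0; split => // h; apply: nth.
  apply: (@cone_scale (1 + th)^-1); first by rewrite invr_eq0.
  by move: h; rewrite /= E mulr1 [_^-1 * th]mulrC.
Qed.

(* Near a density point, a Dirichlet approximation p / q blows a neighbourhood
   of size 1 / q^2 up to a full period of one of the four cusp coordinates. *)
Lemma directions_zero_one (P : set R) : measurable (P : set (measurableTypeR R)) ->
  (forall th, P th <-> cone th 1) -> mu.-negligible P \/ mu.-negligible (~` P).
Proof.
move=> mP PE; apply: contrapT => /not_orP[nP nC].
have nN i : ~ mu.-negligible (~` cusp i).
  move=> /cusp_conull H; apply: nC; apply: negligibleS H => th /= nPth Kth.
  by apply: nPth; apply/PE.
have [th0 [Pth0 irr] dens] : exists2 th, P th /\ irrational_real (th / 1) &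
   forall e : R, 0 < e -> exists2 d : R, 0 < d &
     forall r : R, 0 < r < d -> (mu (ball th r `\` P) <= (e * r)%:E)%E.
  have H := ae_and (density_ae mP) (irrational_ae (oner_neq0 R)).
  apply: contrapT => H'; apply: nP; apply: negligibleS H => th sth /= [h1 h2].
  by apply: H'; exists th => //; exact: h1.
rewrite divr1 in irr.
(* The 18 is the Lipschitz constant [9 / k] of [g] below times the bound [2 e k] on the missing
   slopes; the sum of two copies comes from [periodic_window]. *)
have [e e0 He] : exists2 e : R, 0 < e & forall i : 'I_4,
    ((18 * e + 18 * e)%:E < mu (~` cusp i `&` `[0%R, 2%R[))%E.
  have pos i : exists2 e : R, 0 < e & ((18 * e + 18 * e)%:E < mu (~` cusp i `&` `[0%R, 2%R[))%E.
    have : (0 < mu (~` cusp i `&` `[0%R, 2%R[))%E.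
      rewrite lt0e outer_measure_ge0 andbT; apply/eqP => /negligible_mu h.
      apply: (nN i); apply: periodic_negligible h => x /=.
      by split=> h; [rewrite -cusp_periodic|rewrite cusp_periodic].
    case: (mu _) => [r||]//; last by exists 1 => //; rewrite ltry.
    rewrite lte_fin => r0; exists (r / 40); first by rewrite divr_gt0.
    by rewrite lte_fin; lra.
  have [e1 e10 H1] := pos (@Ordinal 4 0 isT); have [e2 e20 H2] := pos (@Ordinal 4 1 isT).
  have [e3 e30 H3] := pos (@Ordinal 4 2 isT); have [e4 e40 H4] := pos (@Ordinal 4 3 isT).
  exists (Num.min (Num.min e1 e2) (Num.min e3 e4)); first by rewrite !lt_min e10 e20 e30.
  have aux (e e' : R) (x : \bar R) : e <= e' -> ((18 * e' + 18 * e')%:E < x)%E -> ((18 * e + 18 * e)%:E < x)%E.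
    by move=> ee; apply: le_lt_trans; rewrite lee_fin; lra.
  case=> [[|[|[|[|//]]]] i4]; rewrite (bool_irrelevance i4 isT).
  - by apply: aux H1; rewrite !ge_min lexx.
  - by apply: aux H2; rewrite !ge_min lexx !orbT.
  - by apply: aux H3; rewrite !ge_min lexx !orbT.
  - by apply: aux H4; rewrite !ge_min lexx !orbT.
have [d d0 dH] := dens e e0.
have [q [p [Qq pq thpq]]] := dirichlet_primitive (Num.truncn (2 / d)) irr.
have q0 : (0 < q)%N by exact: leq_ltn_trans Qq.
have qR : 0 < q%:R :> R by rewrite ltr0n.
have q1 : 1 <= q%:R :> R by rewrite ler1n.
have dq : 2 / d < q%:R.
  have /andP[_ h] := truncn_itv (ltW (divr_gt0 (ltr0n R 2) d0)).
  by apply: lt_le_trans h _; rewrite ler_nat.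
pose k := (q%:R ^+ 2)^-1 : R; have k0 : 0 < k by rewrite invr_gt0 exprn_gt0.
have kq : k * q%:R = q%:R^-1 by rewrite /k; field; rewrite gt_eqF.
have kd : 0 < 2 * k < d.
  rewrite mulr_gt0//=; move: dq; rewrite ltr_pdivrMr// => h.
  have : k <= q%:R^-1 by rewrite -kq ler_peMr// ltW.
  have : 2 * q%:R^-1 < d by rewrite ltr_pdivrMr// mulrC.
  lra.
have {dH}badk := dH _ kd.
have [b [f [pfqb [i iE]]]] := cusp_coordinates pq.
have {}pfqb : f%:~R * p%:~R - q%:R * b%:~R = 1 :> R.
  by move/(congr1 (fun z : int => z%:~R : R)): pfqb; rewrite intrB !intrM mulrC.
(* The cusp coordinate [x] has slope [p / q + k / u] with [u = - x - f / q], and [g] is the inverse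
   map. The window starting at [a] is [1 < u <= 3], where the slopes stay within [2 k] of [th0]. *)
pose c : R := p%:~R / q%:R; pose a : R := - 3 - f%:~R / q%:R.
pose g (th : R) := - (k / (th - c)) - f%:~R / q%:R.
pose B := (ball th0 (2 * k) `\` P) `&` [set th | k / 3 <= th - c <= k].
have gB : (mu (g @` B) <= (9 / k)%:E * mu B)%E.
  apply: lipschitz_outer_measure; first by rewrite divr_gt0.
  move=> x y [_ /=/andP[x1 x2]] [_ /=/andP[y1 y2]].
  have [X0 Y0] : 0 < x - c /\ 0 < y - c by lra.
  have -> : g x - g y = k / ((x - c) * (y - c)) * (x - y).
    by rewrite /g; field; rewrite !gt_eqF.
  rewrite normrM ler_wpM2r// gtr0_norm ?divr_gt0 ?mulr_gt0//.
  rewrite ler_pdivrMr ?mulr_gt0// mulrAC ler_pdivlMr//.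
  have : k / 3 * (k / 3) <= (x - c) * (y - c) by apply: ler_pM => //; lra.
  nra.
have winB : ~` cusp i `&` `[a, a + 2[ `<=` g @` B.
  move=> x [/= nx]; rewrite in_itv/= /a => /andP[x1 x2].
  pose u := - x - f%:~R / q%:R; have u13 : 1 < u <= 3 by rewrite /u; lra.
  have u0 : 0 < u by lra.
  have [h1 h2] : k / 3 <= k / u /\ k / u <= k.
    rewrite ler_pM2l// lef_pV2 ?posrE//; split; first lra.
    by rewrite ler_pdivrMr// ler_peMr ?ltW//; lra.
  exists (c + k / u).
    split; last by rewrite /= addrAC subrr add0r h1 h2.
    split.
      rewrite /ball/=; move: thpq; rewrite -/c -/k !ltr_norml; lra.
    move=> /PE h; apply: nx; rewrite -iE.
    apply: (@cone_scale (- (q%:R * u))^-1).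
      by rewrite invr_eq0 oppr_eq0 mulf_neq0 ?gt_eqF.
    have xE : x = - u - f%:~R / q%:R by rewrite /u; ring.
    have -> : (- (q%:R * u))^-1 * (x * q%:~R + f%:~R) = 1.
      by rewrite xE -[q%:~R]/(q%:R : R); field; rewrite !gt_eqF.
    have -> // : (- (q%:R * u))^-1 * (x * p%:~R + b%:~R) = c + k / u.
    have -> : b%:~R = (f%:~R * p%:~R - 1) / q%:R :> R.
      have e1 : f%:~R * p%:~R - 1 = q%:R * b%:~R :> R.
        by rewrite -[X in _ - X]pfqb; ring.
      by rewrite e1 mulrAC divff ?gt_eqF// mul1r.
    by rewrite xE /c /k; field; rewrite !gt_eqF.
  rewrite /g addrAC subrr add0r invf_div mulrCA divff ?gt_eqF// mulr1 /u; ring.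
have bound : (mu (~` cusp i `&` `[a, (a + 2)%R[) <= (18 * e)%:E)%E.
  apply: (@le_trans _ _ (mu (g @` B))); first exact: le_outer_measure.
  apply: le_trans gB _.
  rewrite muleC -lee_pdivlMr ?divr_gt0//.
  apply: (@le_trans _ _ (mu (ball th0 (2 * k)%R `\` P))).
    by apply: le_outer_measure => x [].
  apply: le_trans badk _; rewrite -EFinM lee_fin le_eqVlt; apply/orP; left.
  by apply/eqP; field; rewrite gt_eqF.
have := He i; apply/negP; rewrite -leNgt.
apply: (le_trans (@periodic_window _ a _)); last first.
  by rewrite EFinD; exact: leeD.
by move=> x /=; split=> h; [rewrite -cusp_periodic|rewrite cusp_periodic].
Qed.

Theorem linear_action_zero_one :
  mu2.-negligible S \/ mu2.-negligible (upper `\` S).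
Proof.
have Sup : S `<=` upper by move=> v [].
have [P [mP N1 N2 PE]] := fiber_zero_one mS upper_measurable Sup fiber_dichotomy.
have PK th : P th <-> cone th 1.
  rewrite PE /cone; suff -> : [set u | 0 < u /\ ~ Sg (u * th) (u * 1)] =
    xsection (upper `\` S) th by [].
  apply/seteqP; split=> u /=; rewrite mulr1 [u * th]mulrC.
    by move=> [u0 nS]; apply/xsectionP; split=> // -[].
  by move=> /xsectionP[/= u0 nS]; split => // h; apply: nS.
have [P0|P0] := directions_zero_one mP PK; [left|right].
  apply: negligibleS (negligibleU N1 (negligible_fst P0)) => v Sv.
  by have [Pu|nPu] := pselect (P v.1); [right|left].
apply: negligibleS (negligibleU N2 (negligible_fst P0)) => v Sv.
by have [Pu|nPu] := pselect (P v.1); [left|right].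
Qed.

End LinearAction.

(** * The cubic surface *)

Section CubicDescent.
Variable R : realType.

Definition cubic (x y z : R) := 0 < x /\ x ^+ 2 + x * y * z = y ^+ 2 + z ^+ 2.

(** [H] is the goal of a descent, so every move is stated backwards: the property at the image point
    gives it at the original point. *)
Variable H : R -> R -> R -> Prop.
Hypothesis Hsmall : forall x y z, cubic x y z -> x < 2 -> H x y z.
Hypothesis H0 : forall x y z, cubic x y z -> y * z = 0 -> H x y z.
Hypothesis HN : forall x y z, H x (- y) (- z) -> H x y z.
Hypothesis Hy : forall x y z, H (x - y * (z - x * y)) y (z - x * y) -> H x y z.
Hypothesis Hy' : forall x y z, H (x + y * z) y (z + (x + y * z) * y) -> H x y z.
Hypothesis Hz : forall x y z, H (x - z * (y - x * z)) (y - x * z) z -> H x y z.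
Hypothesis Hz' : forall x y z, H (x + y * z) (y + (x + y * z) * z) z -> H x y z.

(* A pair with u^2 + v^2 + x u v = x^2 codes the state (x, u, -v) for [false]
   and the state (x, u, v + x u) for [true]; the twist fixing u moves both to
   (x - u v, v - (x - u v) u). *)
Let coded (b : bool) (x u v : R) := if b then H x u (v + x * u) else H x u (- v).
Let coded' (b : bool) (x u v : R) := if b then H x (v + x * u) u else H x (- v) u.

Let H_eq x y z x' y' z' : H x y z -> x = x' -> y = y' -> z = z' -> H x' y' z'.
Proof. by move=> + <- <- <-. Qed.

Let descend b x u v : coded b (x - u * v) u (v - (x - u * v) * u) -> coded b x u v.
Proof.
case: b => /= h; [apply: Hy|apply: Hy']; apply: H_eq h _ _ _ => //; ring.
Qed.

Let descend' b x u v : coded' b (x - u * v) u (v - (x - u * v) * u) -> coded' b x u v.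
Proof.
case: b => /= h; [apply: Hz|apply: Hz']; apply: H_eq h _ _ _ => //; ring.
Qed.

(** Otherwise the terms on the left are at most [1], [x^2 / 16] and [x^2 / 16], too little for
    [x^2 >= 4]. *)
Let pair_small (x u v : R) : 0 < x -> 0 < u -> 0 <= v -> u <= 1 / 4 -> v <= x * u ->
  u ^+ 2 + v ^+ 2 + x * u * v = x ^+ 2 -> x < 2.
Proof.
move=> x0 u0 v0 u4 vx E; rewrite ltNge; apply/negP => x2.
have h1 : v ^+ 2 <= (x * u) ^+ 2 by rewrite lerXn2r ?nnegrE// mulr_ge0 ?ltW.
have h2 : x * u * v <= (x * u) ^+ 2 by rewrite expr2 ler_wpM2l// mulr_ge0 ?ltW.
have h3 : (x * u) ^+ 2 <= x ^+ 2 / 16.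
  rewrite exprMn ler_pM2l ?exprn_gt0//.
  have : u ^+ 2 <= (1 / 4) ^+ 2 by rewrite lerXn2r ?nnegrE// ltW.
  by rewrite expr_div_n expr1n; lra.
have h4 : u ^+ 2 <= 1 by rewrite expr_le1// ltW//; lra.
have : 2 ^+ 2 <= x ^+ 2 by rewrite lerXn2r ?nnegrE// ltW.
rewrite expr2; lra.
Qed.

(** The equation reads [x (x - u v) = u^2 + v^2], which keeps the new first coordinate positive. *)
Let pair_step (x u v : R) : 0 < x -> 0 < u -> u ^+ 2 + v ^+ 2 + x * u * v = x ^+ 2 ->
  [/\ 0 < x - u * v &
      u ^+ 2 + (v - (x - u * v) * u) ^+ 2 + (x - u * v) * u * (v - (x - u * v) * u)
        = (x - u * v) ^+ 2].
Proof.
move=> x0 u0 E; split.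
  have : 0 < x * (x - u * v).
    have -> : x * (x - u * v) = u ^+ 2 + v ^+ 2 by lra.
    by rewrite ltr_pwDl ?exprn_gt0// sqr_ge0.
  by rewrite pmulr_rgt0.
have e : (x - u * v) * x = u ^+ 2 + v ^+ 2 by lra.
have -> : u ^+ 2 + (v - (x - u * v) * u) ^+ 2 + (x - u * v) * u * (v - (x - u * v) * u) =
  u ^+ 2 + v ^+ 2 - (x - u * v) * u * v by ring.
by rewrite -e; ring.
Qed.

(** With [u] fixed, each twist lowers [v / u] by [x1], which is at least 2 unless the base case is
    reached, so the integer part decreases. If a twist would make [v] nonpositive, then [v <= x u]
    and [pair_small] gives [x < 2]. *)
Let small_side (code : R -> R -> R -> Prop) :
  (forall x u v, code (x - u * v) u (v - (x - u * v) * u) -> code x u v) ->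
  (forall x u v, 0 < u -> 0 < x -> u ^+ 2 + v ^+ 2 + x * u * v = x ^+ 2 ->
    x < 2 \/ v = 0 -> code x u v) ->
  forall x u v : R, 0 < u -> 0 <= v -> 0 < x -> u <= 1 / 4 ->
    u ^+ 2 + v ^+ 2 + x * u * v = x ^+ 2 -> code x u v.
Proof.
move=> dsc base x u v u0 v0 x0 u4.
have [n] := ubnP (Num.truncn (v / u)); elim: n x v v0 x0 => // n IH x v v0 x0 vn E.
have [x2|x2] := ltP x 2; first by apply: base => //; left.
have [x10 E1] := pair_step x0 u0 E.
set x1 := x - u * v in x10 E1 *.
have x1x : x1 <= x by rewrite /x1 lerBlDr lerDl mulr_ge0// ltW.
apply: dsc; rewrite -/x1.
have [v1|v1] := lerP v (x1 * u).
  have := @pair_small x u v x0 u0 v0 u4 (le_trans v1 _) E.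
  by rewrite ler_pM2r// => /(_ x1x); rewrite ltNge x2.
have [x12|x12] := ltP x1 2; first by apply: base => //; left.
apply: IH => //; first by rewrite subr_ge0 ltW.
apply: (@leq_trans (Num.truncn (v / u))); last exact: vn.
have vu0 : 0 <= v / u by rewrite divr_ge0// ltW.
have := truncn_itv vu0 => /andP[_ h].
rewrite -(ltr_nat R); apply: (@le_lt_trans _ _ ((v - x1 * u) / u)).
  by rewrite truncn_le divr_ge0 ?subr_ge0 ?ltW.
have -> : (v - x1 * u) / u = v / u - x1 by field; rewrite gt_eqF.
by move: h; rewrite -natr1; lra.
Qed.

Let cubic_true x u v : 0 < x -> u ^+ 2 + v ^+ 2 + x * u * v = x ^+ 2 ->
  cubic x u (v + x * u) /\ cubic x (v + x * u) u.
Proof.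
move=> x0 E; split; split => //; rewrite -E; ring.
Qed.

Let cubic_false x u v : 0 < x -> u ^+ 2 + v ^+ 2 + x * u * v = x ^+ 2 ->
  cubic x u (- v) /\ cubic x (- v) u.
Proof.
move=> x0 E; split; split => //; rewrite -E; ring.
Qed.

Let coded_small b x u v : 0 < u -> 0 <= v -> 0 < x -> u <= 1 / 4 ->
  u ^+ 2 + v ^+ 2 + x * u * v = x ^+ 2 -> coded b x u v.
Proof.
apply: small_side => {x u v} [x u v|x u v u0 x0 E]; first exact: descend.
have [c1 _] := cubic_true x0 E; have [c2 _] := cubic_false x0 E.
case: b => /= -[x2|v0]; try exact: Hsmall.
  apply: Hy; apply: H0; last by rewrite v0; ring.
  by split; [rewrite v0; move: x0; congr (_ < _); ring|rewrite v0 in E *; move: E => E; nra].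
by apply: H0 => //; rewrite v0 oppr0 mulr0.
Qed.

Let coded'_small b x u v : 0 < u -> 0 <= v -> 0 < x -> u <= 1 / 4 ->
  u ^+ 2 + v ^+ 2 + x * u * v = x ^+ 2 -> coded' b x u v.
Proof.
apply: small_side => {x u v} [x u v|x u v u0 x0 E]; first exact: descend'.
have [_ c1] := cubic_true x0 E; have [_ c2] := cubic_false x0 E.
case: b => /= -[x2|v0]; try exact: Hsmall.
  apply: Hz; apply: H0; last by rewrite v0; ring.
  by split; [rewrite v0; move: x0; congr (_ < _); ring|rewrite v0 in E *; move: E => E; nra].
by apply: H0 => //; rewrite v0 oppr0 mul0r.
Qed.

(** The step [1 / 16] is [(1 / 4)^2]: when [u] and [v] both exceed [1 / 4], one twist lowers [x] by
    more than that. When one of them is at most [1 / 4], the lemmas on small pairs apply, after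
    exchanging the roles of [u] and [v] if necessary. *)
Lemma coded_all b (n : nat) : (forall x y z, cubic x y z -> x <= n%:R / 16 -> H x y z) ->
  forall x u v, x <= n.+1%:R / 16 -> 0 < u -> 0 < v -> 0 < x ->
    u ^+ 2 + v ^+ 2 + x * u * v = x ^+ 2 -> coded b x u v /\ coded' b x u v.
Proof.
move=> IH x u v xn u0 v0 x0 E.
have [u4|u4] := lerP u (1 / 4).
  by split; [apply: coded_small|apply: coded'_small] => //; rewrite ltW.
have [x10 E1] := pair_step x0 u0 E; set x1 := x - u * v in x10 E1.
have c0 : cubic x1 u v /\ cubic x1 v u.
  by have := cubic_true x10 E1; rewrite subrK.
have [v4|v4] := lerP v (1 / 4); last first.
  have x1n : x1 <= n%:R / 16.
    have : 1 / 4 * (1 / 4) <= u * v by apply: ler_pM => //; exact: ltW.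
    by move: xn; rewrite /x1 -natr1 mulrDl; lra.
  have [c1 c1'] := cubic_false x10 E1; case: c0 => c2 c2'.
  split; [apply: descend|apply: descend']; case: b => /=; rewrite -/x1 ?subrK; exact: IH.
have E' : v ^+ 2 + u ^+ 2 + x * v * u = x ^+ 2 by rewrite -E; ring.
case: b => /=; last first.
  split; [apply: HN|apply: HN]; rewrite opprK.
    exact: (@coded'_small false x v u v0 (ltW u0) x0 v4 E').
  exact: (@coded_small false x v u v0 (ltW u0) x0 v4 E').
(* The twisted point is read as a pair with the small [v] in front and second entry [u - x1 v]. If
   this entry is negative, then [x1^2 < v^2], so [x1 < 2]. *)
have [x1E [_ E1']] : x - v * u = x1 /\ [/\ True & v ^+ 2 + (u - x1 * v) ^+ 2 + x1 * v * (u - x1 * v) = x1 ^+ 2].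
  have e : x - v * u = x1 by rewrite mulrC.
  by have [_] := pair_step x0 v0 E'; rewrite e.
have [w0|w0] := lerP 0 (u - x1 * v).
  split; [apply: Hy|apply: Hz]; rewrite addrK -/x1.
    by have := @coded'_small true x1 v _ v0 w0 x10 v4 E1'; rewrite /= subrK.
  by have := @coded_small true x1 v _ v0 w0 x10 v4 E1'; rewrite /= subrK.
have x12 : x1 < 2.
  have : x1 ^+ 2 < 2 ^+ 2.
    case: c0 => -[_ c] _; apply: (@lt_le_trans _ _ (v ^+ 2)).
      have -> : x1 ^+ 2 = v ^+ 2 + u * (u - x1 * v) by lra.
      by rewrite gtrDl pmulr_rlt0.
    by rewrite lerXn2r ?nnegrE ?ltW//; lra.
  by rewrite ltr_pXn2r ?nnegrE ?ltW.
by split; [apply: Hy|apply: Hz]; rewrite addrK -/x1; apply: Hsmall => //; case: c0.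
Qed.

End CubicDescent.

(* Going backwards along a branch of the conic, the coordinates decrease by
   at least 2 until their signs differ. *)
Lemma conic_reduction (R : realType) (x : R) (K : R -> R -> Prop) : 2 <= x ->
  (forall y z, cubic x y z -> y * z = 0 -> K y z) ->
  (forall y z, K (- y) (- z) -> K y z) ->
  (forall y z, K (x * (x * y - z) - y) (x * y - z) -> K y z) ->
  (forall u v, 0 < u -> 0 < v -> u ^+ 2 + v ^+ 2 + x * u * v = x ^+ 2 ->
    K u (- v) /\ K u (v + x * u)) ->
  forall y z, cubic x y z -> 0 < y -> y < z -> K y z.
Proof.
move=> x2 K0 KN Kx Kc y z.
have [n] := ubnP (Num.truncn z); elim: n y z => // n IH y z zn [x0 E] y0 yz.
have z0 : 0 < z by exact: lt_trans yz.
set w1 := x * y - z.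
have c1 : cubic x (x * w1 - y) w1.
  by split => //; rewrite /w1; apply/eqP; rewrite -subr_eq0; apply/eqP; transitivity
   (x ^+ 2 + x * y * z - (y ^+ 2 + z ^+ 2)); [ring|rewrite E subrr].
have zw : z * w1 = y ^+ 2 - x ^+ 2 by rewrite /w1; lra.
have [w1n|w1p|w10] := ltgtP w1 0; last first.
- by apply: Kx; rewrite -/w1; apply: K0 => //; rewrite w10 mulr0.
- apply: Kx; rewrite -/w1; set w2 := x * w1 - y in c1 *.
  have [w2n|w2p|w20] := ltgtP w2 0; last first.
  + by apply: K0 => //; rewrite w20 mul0r.
  + have yw : y * w2 = w1 ^+ 2 - x ^+ 2.
      by have [_ ] := c1; rewrite /w2 => e; lra.
    have w1y : w1 < y.
      rewrite -(ltr_pM2l z0) zw.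
      have h : y * y < z * y by rewrite ltr_pM2r.
      by move: (exprn_gt0 2 x0); rewrite [y ^+ 2]expr2; lra.
    have w21 : w2 < w1.
      rewrite -(ltr_pM2l y0) yw.
      have h : w1 * w1 < y * w1 by rewrite ltr_pM2r.
      by move: (exprn_gt0 2 x0); rewrite [w1 ^+ 2]expr2; lra.
    apply: IH => //.
    have yz2 : y + 2 <= z.
      have : 2 ^+ 2 <= (z - y) ^+ 2.
        have -> : (z - y) ^+ 2 = x ^+ 2 + (x - 2) * (y * z) by lra.
        have h1 : 2 ^+ 2 <= x ^+ 2 by rewrite lerXn2r ?nnegrE// ltW.
        have h2 : 0 <= (x - 2) * (y * z) by rewrite !mulr_ge0 ?subr_ge0// ltW.
        by rewrite -[leLHS]addr0 lerD.
      by rewrite ler_pXn2r ?nnegrE ?subr_ge0 ?(ltW yz)//; lra.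
    apply: (@leq_trans (Num.truncn z)); last exact: zn.
    rewrite -(ltr_nat R).
    apply: (@le_lt_trans _ _ w1); first by rewrite truncn_le ltW.
    have /andP[_ h] := truncn_itv (ltW z0); move: h; rewrite -natr1; lra.
  + apply: KN; have [] := Kc (- w2) w1; rewrite ?oppr_gt0// => //.
    by have [_ e] := c1; rewrite sqrrN mulrN mulNr -e; ring.
- have nw : 0 < - w1 by rewrite oppr_gt0.
  have e : y ^+ 2 + (- w1) ^+ 2 + x * y * (- w1) = x ^+ 2 by rewrite /w1; lra.
  have [_] := Kc y _ y0 nw e.
  by have -> : - w1 + x * y = z by rewrite /w1; ring.
Qed.

Section CubicReduction.
Variable R : realType.
Variable H : R -> R -> R -> Prop.
Hypothesis Hsmall : forall x y z, cubic x y z -> x < 2 -> H x y z.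
Hypothesis H0 : forall x y z, cubic x y z -> y * z = 0 -> H x y z.
Hypothesis HN : forall x y z, H x (- y) (- z) -> H x y z.
Hypothesis Hx : forall x y z, H x (x * z - y) (x * (x * z - y) - z) -> H x y z.
Hypothesis Hx' : forall x y z, H x (x * (x * y - z) - y) (x * y - z) -> H x y z.
Hypothesis Hy : forall x y z, H (x - y * (z - x * y)) y (z - x * y) -> H x y z.
Hypothesis Hy' : forall x y z, H (x + y * z) y (z + (x + y * z) * y) -> H x y z.
Hypothesis Hz : forall x y z, H (x - z * (y - x * z)) (y - x * z) z -> H x y z.
Hypothesis Hz' : forall x y z, H (x + y * z) (y + (x + y * z) * z) z -> H x y z.

(** Induction on [x] in steps of [1 / 16]. For [x >= 2], points with [y] and [z] of opposite signs
    are coded pairs; those with equal signs are moved along their branch to such a pair, [y = z]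
    being impossible there. *)
Theorem cubic_reduction x y z : cubic x y z -> H x y z.
Proof.
move=> c; have [n] : exists n : nat, x <= n%:R / 16.
  exists (Num.truncn (x * 16)).+1; have [x0 _] := c.
  by rewrite ler_pdivlMr// ltW//; have /andP[] := truncn_itv (ltW (mulr_gt0 x0 (ltr0n R 16))).
elim: n x y z c => [|n IH] x y z c xn.
  by have [x0 _] := c; move: x0; rewrite ltNge; move: xn; rewrite mul0r => ->.
have [x2|x2] := ltP x 2; first exact: Hsmall.
have [x0 E] := c.
have all b u v := @coded_all R H Hsmall H0 HN Hy Hy' Hz Hz' b n IH x u v xn.
have pos y' z' : cubic x y' z' -> 0 < y' -> 0 < z' -> H x y' z'.
  move=> c' y0 z0; have [yz|zy|yz] := ltgtP y' z'.
  - apply: (@conic_reduction _ x (H x)) => //.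
    + by move=> *; exact: H0.
    + by move=> *; exact: HN.
    + by move=> *; exact: Hx'.
    + move=> u v u0 v0 e; have [/= h1 _] := all true u v u0 v0 x0 e.
      by have [/= h2 _] := all false u v u0 v0 x0 e.
  - apply: (@conic_reduction _ x (fun y z => H x z y)) => //.
    + by move=> u v [_ e] uv; apply: H0; [split; [|rewrite -mulrA [v * u]mulrC mulrA addrC [RHS]addrC] => //; rewrite addrC|rewrite mulrC].
    + by move=> *; exact: HN.
    + by move=> *; exact: Hx.
    + move=> u v u0 v0 e; have [_ /= h1] := all true u v u0 v0 x0 e.
      by have [_ /= h2] := all false u v u0 v0 x0 e.
    + by have [_ e] := c'; split => //; rewrite -mulrA [z' * y']mulrC mulrA e addrC.
  - have [_] := c'; rewrite yz => e; have : 0 < x ^+ 2 by rewrite exprn_gt0.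
    have : 0 <= (x - 2) * z' ^+ 2 by rewrite mulr_ge0 ?sqr_ge0 ?subr_ge0.
    by rewrite !expr2 in e *; lra.
have mixed y' z' : cubic x y' z' -> 0 < y' -> z' < 0 -> H x y' z'.
  move=> [_ e] y0 z0; have [] := all false y' (- z') y0; rewrite ?oppr_gt0// ?opprK//.
  by rewrite sqrrN mulrN; lra.
have cN : cubic x (- y) (- z) by split => //; rewrite mulrNN mulrN mulNr mulrNN opprK !sqrrN || (rewrite !sqrrN -E; ring).
have [y0|y0|y0] := ltgtP y 0; have [z0|z0|z0] := ltgtP z 0;
  try (by apply: H0 => //; rewrite ?y0 ?z0 ?mul0r ?mulr0).
- by apply: HN; apply: pos => //; rewrite oppr_gt0.
- by apply: HN; apply: mixed => //; rewrite ?oppr_gt0 ?oppr_lt0.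
- exact: mixed.
- exact: pos.
Qed.

End CubicReduction.

(** * The zero-one law on the part [x < 2] of the cubic surface *)

Lemma derivable1_comp (R : realType) (f g : R -> R) x :
  derivable f (g x) 1 -> derivable g x 1 -> derivable (f \o g) x 1.
Proof.
move=> df dg.
have h1 := derivableP df; have h2 := derivableP dg.
by have [] := is_derive1_comp h1 h2.
Qed.

Lemma derivable_quadratic (R : realType) (a b c x : R) :
  derivable (fun t : R => a * (t * t) + b * t + c) x 1.
Proof.
have d1 : derivable (id : R -> R) x 1 by exact: derivable_id.
have d2 : derivable (fun t : R => t * t) x 1 by exact: (derivableM d1 d1).
have da : derivable (fun t : R => a * (t * t)) x 1 by exact: (derivableM (derivable_cst _ _ _) d2).
have db : derivable (fun t : R => b * t) x 1 by exact: (derivableM (derivable_cst _ _ _) d1).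
exact: (derivableD (derivableD da db) (derivable_cst _ _ _)).
Qed.

Section CubicErgodic.
Variable R : realType.
Notation mu := (@lebesgue_measure R).
Notation plane := (measurableTypeR R * measurableTypeR R)%type.
Notation mu2 := (@lebesgue_measure R \x @lebesgue_measure R)%E.

(* The larger root z of x^2 + x y z = y^2 + z^2; the points with z at most x y / 2
   are reached by (y, z) -> (-y, -z) and by exchanging y and z. *)
Definition cubic_disc (x y : R) := x ^+ 2 * y ^+ 2 + 4 * x ^+ 2 - 4 * y ^+ 2.
Definition cubic_root (x y : R) := (x * y + Num.sqrt (cubic_disc x y)) / 2.

Lemma cubic_rootP x y : 0 < x -> 0 <= cubic_disc x y -> cubic x y (cubic_root x y).
Proof.
move=> x0 d0; split => //; rewrite /cubic_root.
have := sqr_sqrtr d0; rewrite {1}/cubic_disc; move: (Num.sqrt _) => s e.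
have -> : ((x * y + s) / 2) ^+ 2 = ((x * y) ^+ 2 + 2 * (x * y) * s + s ^+ 2) / 4.
  by field.
by rewrite e /cubic_disc; field.
Qed.

Lemma cubic_root_unique x y z : cubic x y z -> x * y < 2 * z ->
  0 < cubic_disc x y /\ z = cubic_root x y.
Proof.
move=> [x0 E] xyz.
have dE : cubic_disc x y = (2 * z - x * y) ^+ 2.
  have -> : (2 * z - x * y) ^+ 2 = 4 * (z ^+ 2 - x * y * z) + x ^+ 2 * y ^+ 2 by ring.
  have -> : z ^+ 2 - x * y * z = x ^+ 2 - y ^+ 2 by lra.
  by rewrite /cubic_disc; ring.
have d0 : 0 < 2 * z - x * y by lra.
rewrite /cubic_root dE sqrtr_sqr gtr0_norm//; split; first by rewrite exprn_gt0.
by field.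
Qed.

Variable Q : R -> R -> R -> Prop.
Hypothesis QN : forall x y z, Q x y z <-> Q x (- y) (- z).
Hypothesis Qx : forall x y z, Q x y z <-> Q x (x * z - y) (x * (x * z - y) - z).
Hypothesis Qy : forall x y z, Q x y z <-> Q (x + y * z) y (z + (x + y * z) * y).

Definition cubic_dom : set plane := [set v | 0 < v.1 /\ 0 < cubic_disc v.1 v.2].
Notation D := cubic_dom.
Notation S := ([set v | D v /\ Q v.1 v.2 (cubic_root v.1 v.2)] : set plane).
Notation E := ([set v | D v /\ v.1 < 2] : set plane).
Hypothesis mS : measurable S.

Let disc_cont : continuous (fun v : R * R => cubic_disc v.1 v.2).
Proof.
move=> v; rewrite /cubic_disc.
have c1 : {for v, continuous (fun v : R * R => v.1)} by exact: cvg_fst.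
have c2 : {for v, continuous (fun v : R * R => v.2)} by exact: cvg_snd.
apply: cvgB; first apply: cvgD.
- by apply: cvgM; rewrite !expr2; apply: cvgM.
- by apply: cvgM; [exact: cvg_cst|rewrite !expr2; apply: cvgM].
- by apply: cvgM; [exact: cvg_cst|rewrite !expr2; apply: cvgM].
Qed.

Let root_cont : continuous (fun v : R * R => cubic_root v.1 v.2).
Proof.
move=> v; rewrite /cubic_root.
have c1 : {for v, continuous (fun v : R * R => v.1)} by exact: cvg_fst.
have c2 : {for v, continuous (fun v : R * R => v.2)} by exact: cvg_snd.
apply: cvgM; last exact: cvg_cst.
apply: cvgD; first exact: cvgM.
apply: (@continuous_comp _ _ _ (fun v : R * R => cubic_disc v.1 v.2) Num.sqrt).
  exact: disc_cont.
exact: sqrt_continuous.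
Qed.

Lemma cubic_dom_open : open (D : set (R * R)).
Proof.
rewrite (_ : D = (fst @^-1` `]0, +oo[%classic) `&`
  ((fun v : R * R => cubic_disc v.1 v.2) @^-1` `]0, +oo[%classic)).
  apply: openI; apply: open_comp.
  - by move=> v _; exact: cvg_fst.
  - exact: interval_open.
  - by move=> v _; exact: disc_cont.
  - exact: interval_open.
by apply/seteqP; split => v; rewrite /cubic_dom /= !in_itv/= !andbT.
Qed.

Let E_open : open (E : set (R * R)).
Proof.
rewrite (_ : E = D `&` (fst @^-1` `]-oo, 2[%classic)).
  apply: openI; first exact: cubic_dom_open.
  by apply: open_comp => [v _|]; [exact: cvg_fst|exact: interval_open].
by apply/seteqP; split => v; rewrite /= in_itv/=.
Qed.

(** The exceptions are among the countably many values [2 cos (pi q / 2)] with [q] rational. *)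
Let angle_countable : {ae mu, forall x, 0 < x < 2 ->
  irrational_real (2 * acos (x / 2) / pi)}.
Proof.
apply: (@negligibleS _ _ _ mu (range (fun q : rat => 2 * cos (pi * ratr q / 2)))).
  move=> x /= /not_implyP[/andP[x0 x2]].
  move=> /existsNP[q /existsNP[p /not_implyP[q0 /negP]]].
  rewrite negbK => /eqP e; exists (p%:~R / q%:R) => //.
  have qR : q%:R != 0 :> R by rewrite pnatr_eq0 -lt0n.
  have p0 : pi != 0 :> R by rewrite gt_eqF ?pi_gt0.
  rewrite fmorph_div/= ratr_int ratr_nat -e.
  rewrite (_ : pi * _ / 2 = acos (x / 2)); last first.
    have fe (P c a : R) : P != 0 -> c != 0 -> P * (c * (2 * a / P) / c) / 2 = a.
      by move=> *; field; apply/andP.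
    exact: fe.
  by rewrite acosK ?in_itv/=; lra.
have := sub_countable (card_image_le (fun q : rat => 2 * cos (pi * ratr q / 2) : R) setT) (countableP _).
by move=> /countable_lebesgue_measure0/negligible_mu.
Qed.

Let cos_zeros_countable : countable [set f : R | cos f = 0].
Proof.
apply: (@sub_countable _ _ _ (range (fun k : int => pi / 2 + k%:~R * pi : R))).
  apply: subset_card_le => f /= cf; pose k := Num.floor (f / pi).
  have pi0 : 0 < pi :> R := pi_gt0 R.
  have /andP[h1 h2] := floor_itv (f / pi); exists k => //.
  have := @period_int R [set g | cos g = 0] pi _ k (f - k%:~R * pi).
  rewrite /= subrK => /(_ _)[|_ /(_ cf) cg].
    by move=> g; rewrite cosDpi; split=> [->|/eqP]; rewrite ?oppr0// oppr_eq0 => /eqP.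
  move: h1 h2; rewrite -/k ler_pdivlMr// ltr_pdivrMr// intrD mulrDl mul1r => h1 h2.
  have /cosK : f - k%:~R * pi \in `[0, pi] by rewrite in_itv/=; lra.
  by rewrite cg acos0 => ->; rewrite subrK.
exact: sub_countable (card_image_le _ _) (countableP _).
Qed.

(** With [x = 2 cos th] the ellipse is [y = m sin f], [z = m sin (f + th)]. The twist becomes the
    rotation by [2 th] and the central symmetry the rotation by [pi]; null sets of angles give null
    sets of [y]. *)
Lemma ellipse_fiber x : 0 < x < 2 -> irrational_real (2 * acos (x / 2) / pi) ->
  mu.-negligible (xsection S x) \/ mu.-negligible (xsection (E `\` S) x).
Proof.
move=> /andP[x0 x2] irr; pose th := acos (x / 2).
have xI : x / 2 \in `[(-1), 1] by rewrite in_itv/=; lra.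
have xc : x / 2 = cos th by rewrite /th acosK.
have cth : x = 2 * cos th by rewrite /th acosK//; field.
have th0 : 0 < th by rewrite acos_gt0//; lra.
have sth : 0 < sin th.
  rewrite /th sin_acos; last by lra.
  rewrite sqrtr_gt0 subr_gt0 expr_lt1//; lra.
pose m := x / sin th; have m0 : 0 < m by rewrite divr_gt0.
pose y f := m * sin f; pose z f := m * sin (f + th).
(* Hence the larger root corresponds to [cos f > 0]. *)
have zE f : 2 * z f - x * y f = 2 * x * cos f.
  by rewrite /z /y sinD /m {2}cth; field; rewrite gt_eqF.
have yzE f : cubic x (y f) (z f).
  split => //; have := cos2Dsin2 f; have := cos2Dsin2 th.
  have -> : z f = (x * y f + 2 * x * cos f) / 2 by rewrite -zE; field.
  rewrite /y /m => e1 e2.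
  have h : sin th ^+ 2 = 1 - (x / 2) ^+ 2.
    by rewrite xc; lra.
  have h' : cos f ^+ 2 = 1 - sin f ^+ 2 by rewrite -e2; ring.
  apply/eqP; rewrite -subr_eq0; apply/eqP.
  transitivity (x ^+ 2 / sin th ^+ 2 * (sin th ^+ 2 - sin th ^+ 2 * cos f ^+ 2 - sin f ^+ 2 * (1 - (x / 2) ^+ 2))).
    by field; rewrite gt_eqF.
  by rewrite h' h; ring.
pose G := [set f | Q x (y f) (z f)].
have rootE f : 0 < cos f -> 0 < cubic_disc x (y f) /\ z f = cubic_root x (y f).
  move=> cf; apply: cubic_root_unique => //.
  by rewrite -subr_gt0 zE !mulr_gt0.
have Gpi f : G f <-> G (f + pi).
  rewrite /G/= /y /z addrAC !sinDpi QN !mulrN; exact.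
have Gth f : G f <-> G (f + 2 * th).
  have e g : x * (m * sin (g + th)) - m * sin g = m * sin (g + 2 * th).
    have -> : g + 2 * th = g + th + th by ring.
    rewrite (sinD (g + th)) (sinD g) (cosD g) {1}cth.
    apply/eqP; rewrite -subr_eq0; apply/eqP.
    transitivity (m * sin g * (cos th ^+ 2 + sin th ^+ 2 - 1)); first by ring.
    by rewrite cos2Dsin2 subrr mulr0.
  rewrite /G/= Qx /y /z e -addrA.
  have -> : x * (m * sin (f + 2 * th)) - m * sin (f + th) = m * sin (f + 2 * th + th).
    have -> : f + 2 * th + th = f + th + 2 * th by ring.
    by rewrite -(e (f + th)) (_ : f + th + th = f + 2 * th)//; ring.
  by rewrite addrA.
have mG : measurable (G : set (measurableTypeR R)).
  pose A : set (measurableTypeR R) := xsection S x.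
  have mA : measurable A by exact: measurable_xsection.
  have mc (g : R -> R) (B : set (measurableTypeR R)) : continuous g -> measurable B ->
      measurable (g @^-1` B : set (measurableTypeR R)).
    move=> cg mB; have := continuous_measurable_fun cg measurableT mB.
    by rewrite setTI.
  have cy : continuous y by move=> f; apply: cvgM; [exact: cvg_cst|exact: continuous_sin].
  have cy' : continuous (fun f => - y f) by move=> f; apply: cvgN; exact: cy.
  have mpos : measurable (`]0, +oo[%classic : set (measurableTypeR R)) by exact: measurable_itv.
  have mneg : measurable (`]-oo, 0[%classic : set (measurableTypeR R)) by exact: measurable_itv.
  (* Where [cos f < 0] the point lies on the smaller root and is replaced by its opposite; the
     angles with [cos f = 0] are countable. *)
  have -> : G = (cos @^-1` `]0, +oo[ `&` y @^-1` A) `|`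
     (cos @^-1` `]-oo, 0[ `&` (fun f => - y f) @^-1` A) `|` (G `&` [set f | cos f = 0]).
    apply/seteqP; split=> f.
      move=> Gf; have [cf|cf|cf] := ltgtP 0 (cos f).
      - have [d0 e] := rootE f cf; left; left; split; first by rewrite /= in_itv/= andbT.
        by apply/xsectionP; split => //=; rewrite -e.
      - left; right; split; first by rewrite /= in_itv/=.
        have [] := rootE (f + pi); first by rewrite cosDpi oppr_gt0.
        rewrite /y /z addrAC !sinDpi !mulrN => d0 e.
        by apply/xsectionP; split => //=; rewrite -e -QN.
      - by right.
    move=> [[[]|[]]|[]//]; rewrite /= in_itv/= ?andbT => cf /xsectionP[[_ /= d0]].
      by have [_ <-] := rootE f cf.
    have [] := rootE (f + pi); first by rewrite cosDpi oppr_gt0.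
    by rewrite /y /z addrAC !sinDpi !mulrN => _ <-; rewrite -QN.
  apply: measurableU; first (apply: measurableU; apply: measurableI).
  - exact: mc _ _ (@continuous_cos R) mpos.
  - exact: mc.
  - exact: mc _ _ (@continuous_cos R) mneg.
  - exact: mc.
  apply: countable_measurable; first exact: measurable_set1.
  apply: sub_countable cos_zeros_countable.
  by apply: subset_card_le => f [].
have yimg (w : R) : 0 < cubic_disc x w -> exists2 f, 0 < cos f & y f = w.
  move=> d0; have wm : `|w / m| < 1.
    have : w ^+ 2 < m ^+ 2.
      rewrite /m expr_div_n ltr_pdivlMr ?exprn_gt0//.
      have e := cos2Dsin2 th.
      have -> : sin th ^+ 2 = 1 - (x / 2) ^+ 2 by rewrite xc; lra.
      by move: d0; rewrite /cubic_disc; lra.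
    move=> h.
    rewrite -(@expr_lt1 _ 2)// real_normK ?num_real// expr_div_n.
    by rewrite ltr_pdivrMr ?mul1r// exprn_gt0.
  move: wm; rewrite ltr_norml => /andP[w1 w2].
  exists (asin (w / m)).
    by rewrite cos_gt0_pihalf// asin_gtNpi2 ?asin_ltpi2// ?w1 ?w2 ?ltW.
  rewrite /y asinK; first by rewrite mulrC divfK// gt_eqF.
  by rewrite in_itv/= !ltW.
have dy f : derivable y f 1.
  by apply: derivableM; [exact: derivable_cst|exact: derivable_sin].
have yneg (B : set R) : mu.-negligible B -> mu.-negligible (y @` B).
  by apply: negligible_derivable_image => f _; exact: dy.
have [h|h] := two_periods_zero_one mG (pi_gt0 R) irr Gth Gpi; [left|right].
  apply: negligibleS (yneg _ h) => w /xsectionP[[_ /= d0] Qw].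
  have [f cf yf] := yimg w d0; exists f => //.
  by have [_ e] := rootE f cf; rewrite /G/= e yf.
apply: negligibleS (yneg _ h) => w /xsectionP[[[_ /= d0] _] nS].
have [f cf yf] := yimg w d0; exists f => //= Gf; apply: nS.
by split=> //=; have [_ e] := rootE f cf; move: Gf; rewrite /G/= e yf.
Qed.

Let disc_derivable2 x y : derivable (cubic_disc x) y 1.
Proof.
rewrite (_ : cubic_disc x = fun t => (x ^+ 2 - 4) * (t * t) + 0 * t + 4 * x ^+ 2).
  exact: derivable_quadratic.
by apply/funext => t; rewrite /cubic_disc; ring.
Qed.

Let disc_derivable1 x y : derivable (cubic_disc ^~ y) x 1.
Proof.
rewrite (_ : cubic_disc ^~ y = fun t => (y ^+ 2 + 4) * (t * t) + 0 * t + - 4 * y ^+ 2).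
  exact: derivable_quadratic.
by apply/funext => t; rewrite /cubic_disc; ring.
Qed.

Let half_derivable (f g : R -> R) (y : R) : derivable f y 1 -> derivable g y 1 ->
  derivable (fun t => (f t + g t) / 2) y 1.
Proof.
move=> df dg; have h := derivableD df dg.
exact: (derivableM h (derivable_cst _ _ _)).
Qed.

Let mul_derivable (a y : R) : derivable (fun t => a * t) y 1.
Proof.
have d1 : derivable (id : R -> R) y 1 by exact: derivable_id.
exact: (derivableM (derivable_cst _ _ _) d1).
Qed.

Let root_derivable2 x y : 0 < cubic_disc x y -> derivable (cubic_root x) y 1.
Proof.
move=> d0; apply: half_derivable; first exact: mul_derivable.
apply: (@derivable1_comp R Num.sqrt (cubic_disc x)); last exact: disc_derivable2.
by have [] := is_derive1_sqrt d0.
Qed.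

Let root_derivable1 x y : 0 < cubic_disc x y -> derivable (cubic_root ^~ y) x 1.
Proof.
move=> d0; apply: (half_derivable (f := fun t => t * y)).
  by rewrite (_ : (fun t => t * y) = (fun t => y * t));
    [exact: mul_derivable|apply/funext => t; rewrite mulrC].
apply: (@derivable1_comp R Num.sqrt (cubic_disc ^~ y)); last exact: disc_derivable1.
by have [] := is_derive1_sqrt d0.
Qed.

(** The first coordinate after the twist that fixes [y]; it measures the passage from one ellipse to
    another. *)
Let shift (x y : R) := x + y * cubic_root x y.

Let shiftP x y : 0 < y -> D (x, y) ->
  [/\ x < shift x y, D (shift x y, y), (S (x, y) <-> S (shift x y, y)) &
    x = shift x y - y * (cubic_root (shift x y) y - shift x y * y)].
Proof.
move=> y0 [/= x0 d0]; have [_ e] := cubic_rootP x0 (ltW d0).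
have z0 : 0 < cubic_root x y.
  by rewrite divr_gt0// ltr_pwDl ?sqrtr_ge0// mulr_gt0.
have xs : x < shift x y by rewrite /shift ltrDl mulr_gt0.
have X0 : 0 < shift x y by exact: lt_trans xs.
have [||d1 rE] := @cubic_root_unique (shift x y) y (cubic_root x y + shift x y * y).
- split => //; move: e; rewrite /shift; move: (cubic_root x y) => z e.
  apply/eqP; rewrite -subr_eq0; apply/eqP.
  transitivity (x ^+ 2 + x * y * z - (y ^+ 2 + z ^+ 2)); first by ring.
  by rewrite e subrr.
- have := mulr_gt0 X0 y0; lra.
split => //; last by rewrite -rE addrK addrK.
rewrite -/(shift x y) /=; split=> -[_ /= q]; split=> //=.
  by move: q; rewrite -rE Qy.
by rewrite Qy; move: q; rewrite -rE.
Qed.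

Let shift_cont x : continuous (shift x).
Proof.
move=> y; apply: cvgD; first exact: cvg_cst.
apply: cvgM; first exact: cvg_id.
apply: cvgM; last exact: cvg_cst.
apply: cvgD; first by apply: cvgM; [exact: cvg_cst|exact: cvg_id].
apply: (@continuous_comp _ _ _ (cubic_disc x) Num.sqrt); last exact: sqrt_continuous.
by apply/differentiable_continuous/derivable1_diffP; exact: disc_derivable2.
Qed.

(** Intermediate values between [shift x 0 = x] and [shift x x = x + x^3], the latter explicit
    because [cubic_disc x x = x^4]. *)
Let shift_onto x t : 0 < x -> x < t -> t < x + x ^+ 3 ->
  exists y, [/\ 0 < y, D (x, y) & shift x y = t].
Proof.
move=> x0 xt tx.
have [||y] := @IVT R (shift x) 0 x t (ltW x0).
- by apply: continuous_subspaceT; exact: shift_cont.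
- have -> : shift x 0 = x by rewrite /shift mul0r addr0.
  have -> : shift x x = x + x ^+ 3.
    rewrite /shift /cubic_root /cubic_disc.
    have -> : x ^+ 2 * x ^+ 2 + 4 * x ^+ 2 - 4 * x ^+ 2 = (x ^+ 2) ^+ 2 by ring.
    by rewrite sqrtr_sqr ger0_norm ?sqr_ge0//; field.
  by rewrite ge_min le_max (ltW xt) (ltW tx) orbT.
rewrite in_itv/= => /andP[y0 yx] e; exists y.
have yp : 0 < y.
  rewrite lt_neqAle y0 andbT; apply/eqP => y0'.
  by move: xt; rewrite -e -y0' /shift mul0r addr0 ltxx.
split => //; split => //=; rewrite /cubic_disc.
have h1 : y ^+ 2 <= x ^+ 2 by rewrite lerXn2r ?nnegrE// ltW.
have h2 : 0 < x ^+ 2 * y ^+ 2 by rewrite mulr_gt0 ?exprn_gt0.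
lra.
Qed.

Let ae_exists_itv (a b : R) (P : R -> Prop) : a < b -> {ae mu, forall x, P x} ->
  exists2 x, a < x < b & P x.
Proof.
move=> ab H; apply: contrapT => nP.
have /negligible_mu : mu.-negligible (`]a, b[%classic : set R).
  apply: negligibleS H => x; rewrite /= in_itv/= => xab Px.
  by apply: nP; exists x.
by rewrite lebesgue_measure_itv/= lte_fin ab -EFinD => /eqP; rewrite eqe subr_eq0 gt_eqF.
Qed.

(** A good [x] spreads [P] to almost all of the interval from [x] to [x + x^3]. Choosing it within
    [x0^3 / 2] of the frontier [J n] advances the frontier by at least that amount, so finitely many
    steps reach 2. *)
Let interval_step (P : set R) x0 : 0 < x0 < 2 ->
  {ae mu, forall x, 0 < x < 2 -> P x ->
     mu.-negligible [set t | [/\ ~ P t, x < t, t < 2 & t < x + x ^+ 3]]} ->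
  mu.-negligible [set t | [/\ ~ P t, x0 < t, t < 2 & t < x0 + x0 ^+ 3]] ->
  mu.-negligible [set t | [/\ ~ P t, x0 < t & t < 2]].
Proof.
move=> /andP[x00 x02] H H0.
have e0 : 0 < x0 ^+ 3 by rewrite exprn_gt0.
pose J (n : nat) : R := x0 + x0 ^+ 3 + n%:R * (x0 ^+ 3 / 2).
have step n : mu.-negligible [set t | [/\ ~ P t, x0 < t, t < 2 & t < J n]].
  elim: n => [|n IH].
    by apply: negligibleS H0 => t [nP xt t2]; rewrite /J mul0r addr0.
  have Jn : x0 + x0 ^+ 3 <= J n by rewrite /J lerDl mulr_ge0// divr_ge0// ltW.
  have [Jn2|Jn2] := lerP 2 (J n).
    by apply: negligibleS IH => t [nP xt t2 _]; split => //; exact: lt_le_trans Jn2.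
  have nIH : {ae mu, forall x, ~ [/\ ~ P x, x0 < x, x < 2 & x < J n]}.
    by apply: negligibleS IH => t /= /contrapT.
  have lo : J n - x0 ^+ 3 / 2 < J n by rewrite ltrBlDr ltrDl divr_gt0.
  have [x /andP[xlo xJ] [Hx nx]] := ae_exists_itv lo (ae_and H nIH).
  have x0x : x0 < x by apply: lt_trans xlo; lra.
  have x2 : x < 2 by exact: lt_trans Jn2.
  have xp : 0 < x by exact: lt_trans x0x.
  have Px : P x by apply: contrapT => nP; exact: nx.
  have J1 : J n.+1 <= x + x ^+ 3.
    have : x0 ^+ 3 <= x ^+ 3 by rewrite lerXn2r ?nnegrE// ltW.
    have -> : J n.+1 = J n + x0 ^+ 3 / 2 by rewrite /J -natr1; ring.
    lra.
  have Hx' : mu.-negligible [set t | [/\ ~ P t, x < t, t < 2 & t < x + x ^+ 3]].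
    by apply: Hx => //; rewrite xp.
  apply: negligibleS (negligibleU IH Hx') => t [nP xt t2 tJ].
  have [tx|tx] := lerP t x; [left|right]; split => //.
    exact: le_lt_trans xJ.
  exact: lt_le_trans J1.
pose n := (Num.truncn (2 / (x0 ^+ 3 / 2))).+1.
apply: negligibleS (step n) => t [nP xt t2]; split => //.
have h : 0 <= 2 / (x0 ^+ 3 / 2) by rewrite !divr_ge0// ltW.
have /andP[_] := truncn_itv h; rewrite -/n ltr_pdivrMr ?divr_gt0// /J; lra.
Qed.

(** Up to a null set [N], the invariant set is a union of ellipses over [P]. For almost every [x],
    the twist fixing [y] carries almost all of the ellipse over [x] off [N] again, so [P] spreads
    from [x] to almost all larger values up to [x + x^3], and so does its complement. If neither
    were null, both would be conull near 2. *)
Theorem cubic_zero_one : mu2.-negligible [set v | S v /\ v.1 < 2] \/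
  mu2.-negligible (E `\` S).
Proof.
have mE : measurable E by exact: open_prod_measurable.
have mSE : measurable (S `&` E) by exact: measurableI.
have xE x : xsection (S `&` E) x `<=` xsection S x.
  by apply: le_xsection => v [].
have ES : E `\` (S `&` E) = E `\` S.
  by apply/seteqP; split => v [Ev nS]; split => //; [move=> Sv; apply: nS|case].
have SE2 : [set v | S v /\ v.1 < 2] = S `&` E.
  by apply/seteqP; split => [v [Sv v2]|v [Sv [_ v2]]]; split => //; case: Sv.
have SEE : S `&` E `<=` E by move=> v [].
have fib : {ae mu, forall x, mu.-negligible (xsection (S `&` E) x) \/
    mu.-negligible (xsection (E `\` (S `&` E)) x)}.
  apply: ae_imply angle_countable => x irr.
  have [x02|x02] := pselect (0 < x < 2).
    have [h|h] := ellipse_fiber x02 (irr x02); [left|right].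
      exact: negligibleS (xE x) h.
    by rewrite ES.
  left; apply: (@negligibleS _ _ _ _ set0); last exact: negligible_set0.
  by move=> y /xsectionP[_ [[/= x0 _] x2]]; apply: x02; rewrite x0.
have [P [mP N1 N2 PE]] := fiber_zero_one mSE mE SEE fib.
rewrite ES in N2; have [N [mN N0 NN]] := negligibleU N1 N2.
have {N0} nN : mu2.-negligible N by apply/negligibleP.
pose f (v : R * R) := (shift v.1 v.2, v.2).
pose M0 : set plane := [set v | [/\ 0 < v.2, E v & shift v.1 v.2 < 2]].
have cf : continuous f.
  move=> v; apply: continuous_pair; last exact: cvg_snd.
  apply: cvgD; first exact: cvg_fst.
  by apply: cvgM; [exact: cvg_snd|exact: root_cont].
have M0_open : open (M0 : set (R * R)).
  have -> : M0 = (snd @^-1` `]0, +oo[%classic) `&` E `&`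
     ((fst \o f) @^-1` `]-oo, 2[%classic).
    by apply/seteqP; split => v; rewrite /M0/= !in_itv/= andbT; [move=> []|move=> [[]]].
  apply: openI; first apply: openI.
  - by apply: open_comp => [v _|]; [exact: cvg_snd|exact: interval_open].
  - exact: E_open.
  - apply: open_comp => [v _|]; last exact: interval_open.
    by apply: continuous_comp; [exact: cf|exact: cvg_fst].
have mN' : measurable (M0 `&` (f @^-1` N : set plane)).
  by apply: measurable_preimage_open => // v _; exact: cf.
(* For fixed [y] the old first coordinate is a derivable function of the new one, so horizontal
   sections of the preimage are null. *)
have nN' : mu2.-negligible (M0 `&` (f @^-1` N : set plane)).
  apply/measurable_negligible_ysection => //.
  apply: ae_imply (negligible_ysection nN) => y nNy.
  have sub : ysection (M0 `&` (f @^-1` N : set plane)) y `<=`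
      (fun X : R => X - y * (cubic_root X y - X * y)) @`
      (ysection N y `&` [set X | 0 < cubic_disc X y]).
    move=> x /ysectionP[[/= y0 [Dv _] _] Nf].
    have [_ [_ d1] _ e] := shiftP y0 Dv.
    by exists (shift x y) => //; split => //; exact/ysectionP.
  apply: negligibleS sub _.
  apply: negligible_derivable_image; last by apply: negligibleS nNy => X [].
  move=> X [_ d0].
  have dr := root_derivable1 d0.
  have did : derivable (id : R -> R) X 1 by exact: derivable_id.
  have dxy : derivable (fun t : R => t * y) X 1 := derivableM did (derivable_cst _ _ _).
  have db : derivable (fun t : R => cubic_root t y - t * y) X 1 := derivableB dr dxy.
  have dm : derivable (fun t : R => y * (cubic_root t y - t * y)) X 1 :=
    derivableM (derivable_cst _ _ _) db.
  exact: (derivableB did dm).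
have img x (B : set R) : mu.-negligible B ->
    mu.-negligible (shift x @` (B `&` [set y | 0 < cubic_disc x y])).
  move=> nB; apply: negligible_derivable_image; last by apply: negligibleS nB => y [].
  move=> y [_ d0].
  have dr := root_derivable2 d0.
  have did : derivable (id : R -> R) y 1 by exact: derivable_id.
  have dm : derivable (fun t : R => t * cubic_root x t) y 1 := derivableM did dr.
  exact: (derivableD (derivable_cst _ _ _) dm).
have tr : {ae mu, forall x, 0 < x < 2 ->
   (P x -> mu.-negligible [set t | [/\ ~ P t, x < t, t < 2 & t < x + x ^+ 3]]) /\
   (~ P x -> mu.-negligible [set t | [/\ ~ ~ P t, x < t, t < 2 & t < x + x ^+ 3]])}.
  apply: ae_imply (ae_and (negligible_xsection nN) (negligible_xsection nN')).
  move=> x [h1 h2] /andP[x0 x2].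
  have nB := img x _ (negligibleU h1 h2).
  split=> Px; apply: negligibleS nB => t [nPt xt t2 tx];
    have [y [y0 Dxy yt]] := shift_onto x0 xt tx; exists y => //;
    have [_ Dt SS _] := shiftP y0 Dxy; (split; last by case: Dxy);
    apply: contrapT => /not_orP[/xsectionP nNx /xsectionP nN'x];
    rewrite yt in Dt SS.
  - have Sxy : S (x, y) by apply: contrapT => nS; apply: nNx; apply: NN; right.
    apply: nN'x; split; first by split => //=; rewrite yt.
    by rewrite /f/= yt; apply: NN; left; split => //; split; [exact/SS|].
  - have nSxy : ~ S (x, y) by move=> Sxy; apply: nNx; apply: NN; left.
    apply: nN'x; split; first by split => //=; rewrite yt.
    rewrite /f/= yt; apply: NN; right; split; last exact: contrapT.
    by split => // /SS.
have concl (P' : set R) : {ae mu, forall x, 0 < x < 2 -> P' x ->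
     mu.-negligible [set t | [/\ ~ P' t, x < t, t < 2 & t < x + x ^+ 3]]} ->
   mu.-negligible [set x | P' x /\ 0 < x < 2] \/
   exists2 x0, 0 < x0 < 2 & mu.-negligible [set t | [/\ ~ P' t, x0 < t & t < 2]].
  move=> H; have [|H'] := pselect (mu.-negligible [set x | P' x /\ 0 < x < 2]); first by left.
  right; apply: contrapT => nx; have K := H; apply: H'; apply: negligibleS H => x [Px x02] Hx.
  by apply: nx; exists x => //; exact: interval_step x02 K (Hx x02 Px).
have H1 : {ae mu, forall x, 0 < x < 2 -> P x ->
     mu.-negligible [set t | [/\ ~ P t, x < t, t < 2 & t < x + x ^+ 3]]}.
  by apply: ae_imply tr => x h x02; case: (h x02).
have H2 : {ae mu, forall x, 0 < x < 2 -> (~` P) x ->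
     mu.-negligible [set t | [/\ ~ (~` P) t, x < t, t < 2 & t < x + x ^+ 3]]}.
  by apply: ae_imply tr => x h x02; case: (h x02).
have [P0|[x1 /andP[x10 x12] n1]] := concl P H1.
  left; rewrite SE2; apply: negligibleS (negligibleU N1 (negligible_fst P0)) => v Sv.
  have [Pv|nPv] := pselect (P v.1); last by left.
  by right; split => //; case: Sv => _ [[v0 _] v2]; rewrite v0.
have [P0|[x2 /andP[x20 x22] n2]] := concl _ H2.
  right; apply: negligibleS (negligibleU N2 (negligible_fst P0)) => v Sv.
  have [Pv|nPv] := pselect (P v.1); first by left.
  by right; split => //; case: Sv => -[[v0 _] v2] _; rewrite v0.
have m2 : Num.max x1 x2 < 2 by rewrite gt_max x12.
have nae (B : set R) : mu.-negligible B -> {ae mu, forall x, ~ B x}.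
  by apply: negligibleS => x /= /contrapT.
have [x /andP[]] := ae_exists_itv m2 (ae_and (nae _ n1) (nae _ n2)).
rewrite gt_max => /andP[x1x x2x] xlt2 [h1 h2].
by exfalso; apply: h2; split => // nPx; exact: h1.
Qed.

End CubicErgodic.

(** * The fundamental group and the two twists *)

Section FundamentalGroup.

Lemma ord4_ind (P : 'I_4 -> Prop) :
  P (inord 0) -> P (inord 1) -> P (inord 2) -> P (inord 3) -> forall i, P i.
Proof.
move=> P0 P1 P2 P3 [[|[|[|[|]]]] i4] //.
- by have -> : Ordinal i4 = inord 0 by apply: val_inj; rewrite /= inordK.
- by have -> : Ordinal i4 = inord 1 by apply: val_inj; rewrite /= inordK.
- by have -> : Ordinal i4 = inord 2 by apply: val_inj; rewrite /= inordK.
- by have -> : Ordinal i4 = inord 3 by apply: val_inj; rewrite /= inordK.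
Qed.

Lemma relatorE : relator =
  [:: (inord 0, true); (inord 1, true); (inord 2, true); (inord 3, true)].
Proof.
rewrite /relator (_ : enum 'I_4 = [:: inord 0; inord 1; inord 2; inord 3])//.
by apply: (inj_map val_inj); rewrite val_enum_ord /= !inordK.
Qed.

Section Words.
Variable G : groupType.

Definition letter_val (g : 'I_4 -> G) (l : 'I_4 * bool) : G :=
  if l.2 then g l.1 else ((g l.1)^-1)%g.
Definition word_val (g : 'I_4 -> G) (u : word) : G :=
  foldr (fun l x => letter_val g l * x)%g 1%g u.

Lemma word_val_cat g u v : word_val g (u ++ v) = (word_val g u * word_val g v)%g.
Proof. by elim: u => [|l u IH] /=; rewrite ?mul1g// IH mulgA. Qed.

Lemma word_val_eq g u v :
  (g (inord 0) * g (inord 1) * g (inord 2) * g (inord 3) = 1)%g ->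
  word_eq u v -> word_val g u = word_val g v.
Proof.
move=> g1; elim=> {u v} [u|u v _ -> //|u v w _ -> _ -> //|u u' v v' _ e1 _ e2|i b|] //.
- by rewrite !word_val_cat e1 e2.
- by case: b; rewrite /word_val /letter_val /= mulg1 ?mulgV ?mulVg.
- by rewrite relatorE /word_val /letter_val /= mulg1 -g1 !mulgA.
Qed.

Lemma pi1_lift (g : 'I_4 -> G) :
  (g (inord 0) * g (inord 1) * g (inord 2) * g (inord 3) = 1)%g ->
  exists f : {multiplicative pi1 -> G}, forall i, f (loop i) = g i.
Proof.
move=> g1; pose f (x : pi1) := word_val g (repr x).
have fM : {morph f : x y / (x * y)%g}.
  move=> x y; rewrite /f -word_val_cat; apply: word_val_eq => //.
  exact: word_eq_repr.
pose F : {multiplicative pi1 -> G} := HB.pack f (isMultiplicative.Build pi1 G f fM).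
exists F => i; rewrite /= /f (@word_val_eq g _ [:: (i, true)])//.
  by rewrite /word_val /= mulg1.
exact: word_eq_repr.
Qed.

Lemma hom_word_val (f : {multiplicative pi1 -> G}) u :
  f (\pi_pi1 u) = word_val (fun i => f (loop i)) u.
Proof.
elim: u => [|[i b] u IH]; first exact: (gmorph1 f).
have -> : \pi_pi1 ((i, b) :: u) = (\pi_pi1 [:: (i, b)] * \pi_pi1 u)%g.
  exact/esym/pi1_mulE.
rewrite gmulfM IH /=; congr (_ * _)%g; rewrite /letter_val /=; case: b => //.
by rewrite -gmorphV; congr (f _); exact/esym/(pi1_invE [:: (i, true)]).
Qed.

Lemma pi1_ext (f f' : {multiplicative pi1 -> G}) :
  (forall i, f (loop i) = f' (loop i)) -> f =1 f'.
Proof.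
move=> ff' x; rewrite -[x]reprK !hom_word_val.
by congr word_val; apply/funext.
Qed.

End Words.

Lemma loop_prod :
  (loop (inord 0) * loop (inord 1) * loop (inord 2) * loop (inord 3) = 1)%g.
Proof.
rewrite [LHS](_ : _ = \pi_pi1 relator); first by apply/pi1P/asboolP/word_eq_relator.
rewrite relatorE.
by rewrite [(loop (inord 0) * _)%g](pi1_mulE _ _) [(_ * loop (inord 2))%g](pi1_mulE _ _)
  [LHS](pi1_mulE _ _).
Qed.

Definition conj_loops (P : pred 'I_4) (k : pi1) (i : 'I_4) : pi1 :=
  if P i then (k * loop i * k^-1)%g else loop i.

(** Conjugating the loops on one side of a curve by the class [h] of the curve is a Dehn twist. The
    first hypothesis preserves the relation; the second makes [h] fixed, so that conjugation by the
    inverse of [h] undoes the twist. *)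
Lemma conj_loops_hom (P : pred 'I_4) (h : pi1) :
  (forall k, commute k h -> (conj_loops P k (inord 0) * conj_loops P k (inord 1) *
     conj_loops P k (inord 2) * conj_loops P k (inord 3) = 1)%g) ->
  (forall (f : {multiplicative pi1 -> pi1}) k,
     (forall i, P i -> f (loop i) = k * loop i * k^-1)%g -> f h = (k * h * k^-1)%g) ->
  exists phi psi : mcg, [/\ cancel phi psi, cancel psi phi,
    forall i, phi (loop i) = conj_loops P h i &
    forall i, psi (loop i) = conj_loops P (h^-1)%g i].
Proof.
move=> P1 Ph.
have cV : commute (h^-1)%g h by rewrite /commute mulVg mulgV.
have [f fE] := pi1_lift (P1 h erefl); have [g gE] := pi1_lift (P1 _ cV).
have fh : f h = h.
  rewrite (Ph f h) ?mulgK// => i Pi; first by rewrite fE /conj_loops Pi.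
have gh : g h = h.
  rewrite (Ph g h^-1)%g ?invgK ?mulVg ?mul1g// => i Pi.
  by rewrite gE /conj_loops Pi invgK.
have K1 : cancel f g.
  move=> x; rewrite -[RHS]/(idfun x) -[LHS]/((g \o f) x); apply: pi1_ext => i /=.
  rewrite fE /conj_loops; case: ifP => Pi; last by rewrite gE /conj_loops Pi.
  by rewrite !gmulfM gmorphV gh gE /conj_loops Pi !mulgA mulgV mul1g invgK mulgK.
have K2 : cancel g f.
  move=> x; rewrite -[RHS]/(idfun x) -[LHS]/((f \o g) x); apply: pi1_ext => i /=.
  rewrite gE /conj_loops; case: ifP => Pi; last by rewrite fE /conj_loops Pi.
  by rewrite !gmulfM !gmorphV fh fE /conj_loops Pi !mulgA mulVg mul1g invgK mulgVK.
have cP k i : exists h, conj_loops P k i = (h * loop i * h^-1)%g.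
  rewrite /conj_loops; case: ifP => _; [by exists k|exists 1%g].
  by rewrite invg1 mul1g mulg1.
have bf : bijective f by exists g.
have bg : bijective g by exists f.
have pf i : exists h, f (loop i) = (h * loop i * h^-1)%g by rewrite fE.
have pg i : exists h, g (loop i) = (h * loop i * h^-1)%g by rewrite gE.
by exists (Mcg bf pf), (Mcg bg pg); split.
Qed.

Definition first_two : pred 'I_4 := fun i => (i < 2)%N.
Definition middle_two : pred 'I_4 := fun i => (0 < i < 3)%N.
Definition curve12 : pi1 := (loop (inord 0) * loop (inord 1))%g.
Definition curve23 : pi1 := (loop (inord 1) * loop (inord 2))%g.

Let conj_pair (G : groupType) (k x y : G) : commute k (x * y)%g ->
  (k * x * k^-1 * (k * y * k^-1) = x * y)%g.
Proof. by rewrite /commute => c; rewrite !mulgA mulgVK -(mulgA k) c mulgK. Qed.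

Let conj_mul (G : groupType) (k x y : G) :
  (k * x * k^-1 * (k * y * k^-1) = k * (x * y) * k^-1)%g.
Proof. by rewrite !mulgA mulgVK. Qed.

Lemma twist12 : exists phi psi : mcg, [/\ cancel phi psi, cancel psi phi,
  forall i, phi (loop i) = conj_loops first_two curve12 i &
  forall i, psi (loop i) = conj_loops first_two (curve12^-1)%g i].
Proof.
apply: conj_loops_hom => [k ck|f k fk].
  rewrite /conj_loops /first_two !inordK//= conj_pair//; exact: loop_prod.
by rewrite /curve12 gmulfM !fk /first_two ?inordK// conj_mul.
Qed.

Lemma twist23 : exists phi psi : mcg, [/\ cancel phi psi, cancel psi phi,
  forall i, phi (loop i) = conj_loops middle_two curve23 i &
  forall i, psi (loop i) = conj_loops middle_two (curve23^-1)%g i].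
Proof.
apply: conj_loops_hom => [k ck|f k fk].
  rewrite /conj_loops /middle_two !inordK//= -(mulgA (loop (inord 0))) conj_pair//.
  by rewrite !mulgA; exact: loop_prod.
by rewrite /curve23 gmulfM !fk /middle_two ?inordK// conj_mul.
Qed.

End FundamentalGroup.

(** * Parabolic matrices and coordinates *)

Section Matrices.
Variable R : realType.
Implicit Types (A B : 'M[R]_2) (u v : R * R) (g : PSL2 R).

Definition mx2 (p q r s : R) : 'M[R]_2 := \matrix_(i, j)
  (if i == 0 then (if j == 0 then p else q) else (if j == 0 then r else s)).

Lemma mx2E p q r s : (mx2 p q r s 0 0 = p) * (mx2 p q r s 0 1 = q) *
  (mx2 p q r s 1 0 = r) * (mx2 p q r s 1 1 = s).
Proof. by rewrite !mxE. Qed.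

Lemma ord2_ind (P : 'I_2 -> Prop) : P 0 -> P 1 -> forall i, P i.
Proof.
move=> P0 P1 [[|[|]] i2] //.
- by have -> : Ordinal i2 = 0 by exact: val_inj.
- by have -> : Ordinal i2 = 1 by exact: val_inj.
Qed.

Lemma mx2P A B : A 0 0 = B 0 0 -> A 0 1 = B 0 1 -> A 1 0 = B 1 0 -> A 1 1 = B 1 1 ->
  A = B.
Proof. by move=> *; apply/matrixP; do 2!apply: ord2_ind. Qed.

Lemma mx2_eta A : A = mx2 (A 0 0) (A 0 1) (A 1 0) (A 1 1).
Proof. by apply: mx2P; rewrite mx2E. Qed.

Lemma mulmx2E A B : (A *m B = mx2
  (A 0 0 * B 0 0 + A 0 1 * B 1 0) (A 0 0 * B 0 1 + A 0 1 * B 1 1)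
  (A 1 0 * B 0 0 + A 1 1 * B 1 0) (A 1 0 * B 0 1 + A 1 1 * B 1 1)).
Proof.
apply: mx2P; rewrite mx2E !mxE !big_ord_recl big_ord0 addr0 /=;
  by rewrite (_ : lift ord0 ord0 = 1)//; exact: val_inj.
Qed.

Lemma det_mx2 A : \det A = A 0 0 * A 1 1 - A 0 1 * A 1 0.
Proof.
rewrite (expand_det_row _ 0) !big_ord_recl big_ord0 addr0 /cofactor !det_mx11 !mxE /=.
rewrite (_ : lift ord0 ord0 = 1); last exact: val_inj.
rewrite (_ : lift 1 0 = 0); last exact: val_inj.
by rewrite expr0 expr1; ring.
Qed.

Lemma tr_mx2 A : \tr A = A 0 0 + A 1 1.
Proof.
rewrite /mxtrace !big_ord_recl big_ord0 addr0 (_ : lift ord0 ord0 = 1)//.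
exact: val_inj.
Qed.

Lemma scalar_mx2 (x : R) : x%:M = mx2 x 0 0 x.
Proof. by apply: mx2P; rewrite mx2E !mxE. Qed.

Lemma opp_mx2 A : - A = mx2 (- A 0 0) (- A 0 1) (- A 1 0) (- A 1 1).
Proof. by apply: mx2P; rewrite mx2E !mxE. Qed.

Definition adj2 A := mx2 (A 1 1) (- A 0 1) (- A 1 0) (A 0 0).

Lemma invmx2 A : \det A = 1 -> invmx A = adj2 A.
Proof.
move=> d; have uA : A \in unitmx by rewrite unitmxE d unitr1.
apply: (can_inj (mulKmx uA)); rewrite mulmxV// scalar_mx2 mulmx2E /adj2 !mx2E.
move: d; rewrite det_mx2 => d; apply: mx2P; rewrite !mx2E; rewrite -?d; ring.
Qed.

Definition w2 u v := u.1 * v.2 - u.2 * v.1.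

Definition act A v := (A 0 0 * v.1 + A 0 1 * v.2, A 1 0 * v.1 + A 1 1 * v.2).

Definition oppv v : R * R := (- v.1, - v.2).

Lemma w2_act A u v : w2 (act A u) (act A v) = \det A * w2 u v.
Proof. rewrite /w2 /act det_mx2 /=; ring. Qed.

(* 1 + e v v^T J, where w2 u v = u^T J v *)
Definition par (e : R) v : 'M[R]_2 :=
  mx2 (1 - e * v.1 * v.2) (e * v.1 ^+ 2) (- e * v.2 ^+ 2) (1 + e * v.1 * v.2).

Lemma par_det e v : \det (par e v) = 1.
Proof. rewrite det_mx2 !mx2E; ring. Qed.

Lemma par_tr e v : \tr (par e v) = 2.
Proof. rewrite tr_mx2 !mx2E; ring. Qed.

Lemma parD e e' v : par e v *m par e' v = par (e + e') v.
Proof. rewrite mulmx2E !mx2E /par; congr mx2; ring. Qed.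

Lemma par0 v : par 0 v = 1%:M.
Proof. by rewrite scalar_mx2 /par; congr mx2; ring. Qed.

Lemma invmx_par e v : invmx (par e v) = par (- e) v.
Proof. by rewrite invmx2 ?par_det// /adj2 !mx2E /par; congr mx2; ring. Qed.

Lemma act_par e u v : act (par e v) u = (u.1 + e * w2 v u * v.1, u.2 + e * w2 v u * v.2).
Proof. rewrite /act !mx2E /w2; congr (_, _); ring. Qed.

Lemma par_oppv e v : par e (oppv v) = par e v.
Proof. rewrite /par /=; congr mx2; ring. Qed.

Lemma par_conj A e v : \det A = 1 -> A *m par e v = par e (act A v) *m A.
Proof.
rewrite det_mx2 => d; rewrite !mulmx2E !mx2E /act /=.
move: d; move: (A 0 0) (A 0 1) (A 1 0) (A 1 1) (v.1) (v.2) => p q r s x y d.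
congr mx2.
- transitivity (p - e * (p * x + q * y) * y * (p * s - q * r)); [rewrite d|]; ring.
- transitivity (q + e * (p * x + q * y) * x * (p * s - q * r)); [rewrite d|]; ring.
- transitivity (r - e * (r * x + s * y) * y * (p * s - q * r)); [rewrite d|]; ring.
- transitivity (s + e * (r * x + s * y) * x * (p * s - q * r)); [rewrite d|]; ring.
Qed.

Lemma par_eq1 e v : e != 0 -> v != 0 -> par e v != 1%:M.
Proof.
move=> e0 v0; apply/eqP; rewrite scalar_mx2 => /matrixP h.
have := h 0 1; have := h 1 0; rewrite !mx2E.
move=> /eqP; rewrite mulNr oppr_eq0 mulf_eq0 (negbTE e0) expf_eq0/= => /eqP v2.
move=> /eqP; rewrite mulf_eq0 (negbTE e0) expf_eq0/= => /eqP v1.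
by move: v0; rewrite (surjective_pairing v) v1 v2 eqxx.
Qed.

Lemma par_eqN1 e v : par e v != - 1%:M.
Proof.
apply/eqP => h; have := par_tr e v; rewrite h linearN/= mxtrace1 => h2.
by have : 0 < 2 :> R by []; lra.
Qed.

Lemma act_neq0 A v : \det A = 1 -> v != 0 -> act A v != 0.
Proof.
rewrite det_mx2 => d; apply: contraNneq => /eqP; rewrite /act xpair_eqE => /andP[/eqP h1 /eqP h2].
apply/eqP; rewrite (surjective_pairing v); congr (_, _).
- transitivity ((A 0 0 * A 1 1 - A 0 1 * A 1 0) * v.1); first by rewrite d mul1r.
  transitivity (A 1 1 * (A 0 0 * v.1 + A 0 1 * v.2) - A 0 1 * (A 1 0 * v.1 + A 1 1 * v.2)).
    ring.
  by rewrite h1 h2; ring.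
- transitivity ((A 0 0 * A 1 1 - A 0 1 * A 1 0) * v.2); first by rewrite d mul1r.
  transitivity (A 0 0 * (A 1 0 * v.1 + A 1 1 * v.2) - A 1 0 * (A 0 0 * v.1 + A 0 1 * v.2)).
    ring.
  by rewrite h1 h2; ring.
Qed.

Lemma sign_cases (e : R) : e ^+ 2 = 1 -> e = 1 \/ e = -1.
Proof. by move/eqP; rewrite sqrf_eq1 => /orP[]/eqP; [left|right]. Qed.

Lemma par_inj (e : R) u v : e != 0 -> par e u = par e v -> u = v \/ u = oppv v.
Proof.
move=> e0 /matrixP h; have := h 0 0; have := h 0 1; have := h 1 0; rewrite !mx2E.
rewrite !mulNr => /oppr_inj/(mulfI e0) h2 /(mulfI e0) h1 /addrI/oppr_inj.
rewrite -!mulrA => /(mulfI e0) h3.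
have /eqP := h1; have /eqP := h2; rewrite -subr_eq0 => h2' h1'; rewrite !eqf_sqr in h1' *.
move: h1' h2'; rewrite subr_eq0 eqf_sqr (surjective_pairing u) (surjective_pairing v) /oppv /=.
move: h3; case: u v {h h1 h2} => [a b] [c d] /= h3.
move=> /orP[]/eqP ac /orP[]/eqP bd; rewrite ac bd in h3 *; try by [left|right].
- have /eqP : c * d *+ 2 = 0 by rewrite mulr2n -{1}h3; ring.
  rewrite mulrn_eq0/= mulf_eq0 => /orP[]/eqP ->; rewrite ?oppr0; by [right|left].
- have /eqP : c * d *+ 2 = 0 by rewrite mulr2n -{1}h3; ring.
  rewrite mulrn_eq0/= mulf_eq0 => /orP[]/eqP ->; rewrite ?oppr0; by [left|right].
Qed.

(** The upper right entry must be [e v1^2], which gives [e] and [v1]. If it vanishes, the diagonal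
    is 1 and the other entry is used. *)
Lemma par_exists A : \det A = 1 -> \tr A = 2 -> A != 1%:M ->
  exists e v, [/\ e ^+ 2 = 1, v != 0 & A = par e v].
Proof.
rewrite (mx2_eta A) det_mx2 tr_mx2 !mx2E.
move: (A 0 0) (A 0 1) (A 1 0) (A 1 1) => p q r s d t A1.
have qr : q * r = - (1 - p) ^+ 2.
  have -> : q * r = p * s - 1 by rewrite -d; ring.
  by rewrite (_ : s = 2 - p); [ring|rewrite -t; ring].
have sE : s = 2 - p by rewrite -t; ring.
have [q0|q0] := eqVneq q 0.
  have p1 : p = 1.
    by move: qr; rewrite q0 mul0r => /esym/eqP; rewrite oppr_eq0 expf_eq0/= subr_eq0 => /eqP.
  have r0 : r != 0.
    apply: contraNneq A1 => r0; rewrite scalar_mx2 sE p1 q0 r0.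
    by apply/eqP; congr mx2; ring.
  exists (- Num.sg r), (0, Num.sqrt `|r|); split.
  - by rewrite sqrrN sqr_sg r0.
  - by rewrite xpair_eqE negb_and sqrtr_eq0 -ltNge normr_gt0 r0 orbT.
  - rewrite /par /= sqr_sqrtr// opprK -numEsg sE p1 q0; congr mx2; ring.
exists (Num.sg q), (Num.sqrt `|q|, (1 - p) / (Num.sg q * Num.sqrt `|q|)).
have sq : Num.sqrt `|q| != 0 by rewrite sqrtr_eq0 -ltNge normr_gt0.
have sg0 : Num.sg q != 0 by rewrite sgr_eq0.
have e2 : Num.sqrt `|q| ^+ 2 = `|q| by rewrite sqr_sqrtr.
split.
- by rewrite sqr_sg q0.
- by rewrite xpair_eqE negb_and sq.
- rewrite /par /=; congr mx2.
  + by field; rewrite sg0 sq.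
  + by rewrite e2 -numEsg.
  + have -> : - Num.sg q * ((1 - p) / (Num.sg q * Num.sqrt `|q|)) ^+ 2 =
      - (1 - p) ^+ 2 / (Num.sg q * Num.sqrt `|q| ^+ 2) by field; rewrite sg0 sq.
    by rewrite e2 -numEsg -qr mulrC mulKf.
  + by rewrite sE; field; rewrite sg0 sq.
Qed.

Definition lifts (B : 'M[R]_2) (g : PSL2 R) := exists2 A : SL2 R, val A = B & \pi_(PSL2 R) A = g.

Lemma lifts_det B g : lifts B g -> \det B = 1.
Proof. by move=> [A <- _]; exact/eqP/(valP A). Qed.

Lemma lifts_ex g : lifts (psl2_mx g) g.
Proof. by exists (repr g) => //; rewrite reprK. Qed.

Lemma det1_lifts B : \det B = 1 -> exists g, lifts B g.
Proof.
by move/eqP => d; exists (\pi_(PSL2 R) (mkSL2 d)); exists (mkSL2 d).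
Qed.

Lemma lifts_mul B B' g g' : lifts B g -> lifts B' g' -> lifts (B *m B') (g * g')%g.
Proof.
move=> [A <- <-] [A' <- <-]; exists (sl2_mul A A') => //.
exact/esym/psl2_mulE.
Qed.

Lemma lifts_inv B g : lifts B g -> lifts (invmx B) (g^-1)%g.
Proof.
move=> [A <- <-]; exists (sl2_inv A) => //; exact/esym/psl2_invE.
Qed.

Lemma lifts_one : lifts 1%:M 1%g.
Proof. by exists (@sl2_one R). Qed.

Lemma lifts_opp B g : lifts B g -> lifts (- B) g.
Proof.
move=> [A <- <-]; have d : \det (- val A) == 1.
  by rewrite -scaleN1r detZ sqrrN expr1n mul1r; exact: (valP A).
by exists (mkSL2 d) => //; apply/psl2P; rewrite /sl2_eq /= eqxx orbT.
Qed.

Lemma lifts_uniq B B' g : lifts B g -> lifts B' g -> B = B' \/ B = - B'.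
Proof.
move=> [A <- <-] [A' <- /psl2P]; rewrite /sl2_eq => /orP[]/eqP->; first by left.
by right; rewrite opprK.
Qed.

Lemma lifts_inj B g g' : lifts B g -> lifts B g' -> g = g'.
Proof. by move=> [A <- <-] [A' /val_inj -> <-]. Qed.

Lemma lifts1 B g : lifts B g -> g = 1%g <-> B = 1%:M \/ B = - 1%:M.
Proof.
move=> Bg; split=> [g1|[]B1].
- by apply: (lifts_uniq Bg); rewrite g1; exact: lifts_one.
- by rewrite B1 in Bg; exact: lifts_inj Bg lifts_one.
- by rewrite B1 in Bg; exact: lifts_inj Bg (lifts_opp lifts_one).
Qed.

Lemma parabolicE B g : lifts B g ->
  parabolic g <-> [/\ B <> 1%:M, B <> - 1%:M & \tr B ^+ 2 = 4].
Proof.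
move=> Bg; rewrite /parabolic.
have -> : \tr (psl2_mx g) ^+ 2 = \tr B ^+ 2.
  by have [->//|->] := lifts_uniq (lifts_ex g) Bg; rewrite linearN sqrrN.
have -> : (g <> 1%g) = ~ (B = 1%:M \/ B = - 1%:M).
  by apply/propext; split=> h1 h2; apply: h1; apply/(lifts1 Bg).
by split=> [[/not_orP[h1 h2] t]|[h1 h2 t]]; split => //; apply/not_orP.
Qed.

Lemma parabolic_par g : parabolic g ->
  exists e v, [/\ e ^+ 2 = 1, v != 0 & lifts (par e v) g].
Proof.
have Bg := lifts_ex g; move: (psl2_mx g) Bg => B Bg /(parabolicE Bg)[B1 B1' t].
have [B' [B'g tB' B'1]] : exists B', [/\ lifts B' g, \tr B' = 2 & B' != 1%:M].
  have : (\tr B == 2) || (\tr B == - 2) by rewrite -eqf_sqr t; apply/eqP; ring.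
  move=> /orP[]/eqP tB; first by exists B; split => //; apply/eqP.
  exists (- B); split; [exact: lifts_opp|by rewrite linearN/= tB opprK|].
  by apply/eqP => h; apply: B1'; rewrite -h opprK.
have [e [v [e1 v0 E]]] := par_exists (lifts_det B'g) tB' B'1.
by exists e, v; split => //; rewrite -E.
Qed.

Lemma par_parabolic e v g : e != 0 -> v != 0 -> lifts (par e v) g -> parabolic g.
Proof.
move=> e0 v0 /parabolicE ->; split; [exact/eqP/par_eq1|exact/eqP/par_eqN1|].
by rewrite par_tr; ring.
Qed.

Lemma par_expg e v g n : lifts (par e v) g -> lifts (par (e *+ n) v) (g ^+ n)%g.
Proof.
move=> h; elim: n => [|n IH]; first by rewrite expg0 mulr0n par0; exact: lifts_one.
by rewrite expgS mulrS -parD; exact: lifts_mul.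
Qed.

Lemma par_conjg B h e v g : lifts B h -> lifts (par e v) g ->
  lifts (par e (act B v)) (h * g * h^-1)%g.
Proof.
move=> Bh vg; have d := lifts_det Bh.
have -> : par e (act B v) = B *m par e v *m invmx B.
  by rewrite par_conj// mulmxK// unitmxE d unitr1.
exact: lifts_mul (lifts_mul Bh vg) (lifts_inv Bh).
Qed.

Lemma par3_tr (e1 e2 e3 : R) u v w :
  \tr (par e1 u *m par e2 v *m par e3 w) =
  2 - e1 * e2 * w2 u v ^+ 2 - e2 * e3 * w2 v w ^+ 2 - e1 * e3 * w2 u w ^+ 2
  - e1 * e2 * e3 * (w2 u v * w2 v w * w2 u w).
Proof. rewrite tr_mx2 !mulmx2E !mx2E /w2; ring. Qed.

Lemma par2_tr (e1 e2 : R) u v :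
  \tr (par e1 u *m par e2 v) = 2 - e1 * e2 * w2 u v ^+ 2.
Proof. rewrite tr_mx2 !mulmx2E !mx2E /w2; ring. Qed.

(** The matrix sends [u, v] to [u', v'] and is written by Cramer's rule; the [w2] values of a vector
    against a frame are its coordinates up to the common factor. *)
Lemma frame_transport u v u' v' : w2 u v != 0 -> w2 u' v' = w2 u v ->
  exists2 B, \det B = 1 & forall x x', w2 u' x' = w2 u x -> w2 x' v' = w2 x v ->
    act B x = x'.
Proof.
move=> d0 d; pose k := (w2 u v)^-1.
exists (mx2 (k * (v.2 * u'.1 - u.2 * v'.1)) (k * (u.1 * v'.1 - v.1 * u'.1))
            (k * (v.2 * u'.2 - u.2 * v'.2)) (k * (u.1 * v'.2 - v.1 * u'.2))).
  rewrite det_mx2 !mx2E; transitivity (k ^+ 2 * (w2 u v * w2 u' v')).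
    by rewrite /w2; ring.
  by rewrite d /k; field.
move=> x x' ux xv; rewrite /act !mx2E (surjective_pairing x'); congr (_, _).
- transitivity (k * (w2 x v * u'.1 + w2 u x * v'.1)); first by rewrite /w2; ring.
  transitivity (k * (w2 u' v' * x'.1)); last by rewrite d mulrA mulVf// mul1r.
  by rewrite -ux -xv /w2; ring.
- transitivity (k * (w2 x v * u'.2 + w2 u x * v'.2)); first by rewrite /w2; ring.
  transitivity (k * (w2 u' v' * x'.2)); last by rewrite d mulrA mulVf// mul1r.
  by rewrite -ux -xv /w2; ring.
Qed.

End Matrices.

(** * Zariski density from two unipotents *)

Section Density.
Variable R : realType.
Local Notation polyn := (mpoly.mpoly (2 * 2) R).
Definition mx_eval (p : polyn) (M : 'M[R]_2) := mpoly.meval (fun k => mxvec M 0 k) p.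

Lemma mx_eval_line (p : polyn) (X Y : 'M[R]_2) :
  exists q : {poly R}, forall s, q.[s] = mx_eval p (X + s *: Y).
Proof.
exists (\sum_(m <- mpoly.msupp p) (mpoly.mcoeff m p)%:P *
   \prod_i ((mxvec X 0 i)%:P + (mxvec Y 0 i)%:P * 'X) ^+ (mpoly.fun_of_multinom m i)) => s.
rewrite /mx_eval mpoly.mevalE horner_sum; apply: eq_bigr => m _.
rewrite hornerM hornerC; congr (_ * _); rewrite horner_prod; apply: eq_bigr => i _.
by rewrite horner_exp hornerD hornerM !hornerC hornerX linearD linearZ !mxE /= [s * _]mulrC.
Qed.

(** [par s v] is affine in [s], so the value is a polynomial in [s], with the infinitely many roots
    [n e]. *)
Lemma mx_eval_unipotent (p : polyn) (e : R) (v : R * R) (M N : 'M[R]_2) : e != 0 ->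
  (forall n : nat, mx_eval p (M *m par (e *+ n) v *m N) = 0) ->
  forall s, mx_eval p (M *m par s v *m N) = 0.
Proof.
move=> e0 H s; pose T := par 1 v - 1%:M.
have lin t : M *m par t v *m N = M *m N + t *: (M *m T *m N).
  have -> : par t v = 1%:M + t *: T.
    by apply: mx2P; rewrite /T /par !mxE /=; ring.
  by rewrite mulmxDr mulmxDl mulmx1 scalemxAl scalemxAr.
have [q qE] := mx_eval_line p (M *m N) (M *m T *m N).
rewrite lin -qE; suff -> : q = 0 by rewrite horner0.
apply: (@roots_geq_poly_eq0 _ q [seq e *+ n | n <- iota 0 (size q)]).
- apply/allP => _ /mapP[n _ ->]; rewrite /root qE -lin H//.
- rewrite map_inj_uniq ?iota_uniq// => m n; rewrite -(mulr_natr e m) -(mulr_natr e n).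
  by move=> /(mulfI e0)/eqP; rewrite eqr_nat => /eqP.
- by rewrite size_map size_iota.
Qed.

(** Three factors do when the lower left entry is nonzero; the first one makes it so otherwise. *)
Lemma sl2_factor (A : 'M[R]_2) : \det A = 1 -> exists s1 s2 s3 s4,
  A = par s1 (0, 1) *m par s2 (1, 0) *m par s3 (0, 1) *m par s4 (1, 0).
Proof.
rewrite (mx2_eta A) det_mx2 !mx2E.
move: (A 0 0) (A 0 1) (A 1 0) (A 1 1) => p q r s d.
have [r0|r0] := eqVneq r 0.
  have ps : p * s = 1 by rewrite -d r0; ring.
  have p0 : p != 0 by apply: contra_eq_neq ps => ->; rewrite mul0r eq_sym oner_eq0.
  have sE : s = p^-1 by apply: (mulfI p0); rewrite ps mulfV.
  exists 1, ((p - 1) / p), (- p), ((q + s - 1) / p).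
  rewrite !mulmx2E !mx2E /=; congr mx2; rewrite ?r0 ?sE; by field.
exists 0, ((p - 1) / r), (- r), ((s - 1) / r).
rewrite !mulmx2E !mx2E /=; congr mx2; try by field.
apply: (mulfI r0); rewrite (_ : r * q = p * s - 1); last by rewrite -d; ring.
by field.
Qed.

(** A polynomial vanishing on products of powers of the two unipotents vanishes on products of their
    one-parameter groups, the exponents being made real one at a time, and four such factors give
    all of [SL2]. *)
Lemma unipotents_dense (rho : {multiplicative pi1 -> PSL2 R}) x y (e e' k : R) :
  e != 0 -> e' != 0 -> k != 0 ->
  lifts (par e (1, 0)) (rho x) -> lifts (par e' (0, k)) (rho y) ->
  zariski_dense (range rho).
Proof.
move=> e0 e'0 k0 ux ly p Hp A; rewrite -[LHS]/(mx_eval p (val A)).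
have H M z : lifts M (rho z) -> mx_eval p M = 0.
  by move=> [B <- BE]; apply: Hp; exists z.
have [s1 [s2 [s3 [s4 ->]]]] := sl2_factor (eqP (valP A)).
have k20 : e' * k ^+ 2 != 0 by rewrite mulf_neq0// expf_neq0.
have lk : par e' (0, k) = par (e' * k ^+ 2) (0, 1).
  by rewrite /par /=; congr mx2; ring.
rewrite lk in ly.
have Un n : lifts (par (e *+ n) (1, 0)) (rho (x ^+ n)%g).
  by rewrite gmorphX; exact: par_expg.
have Ln n : lifts (par (e' * k ^+ 2 *+ n) (0, 1)) (rho (y ^+ n)%g).
  by rewrite gmorphX; exact: par_expg.
have H1 n1 n2 n3 s : mx_eval p (par (e' * k ^+ 2 *+ n1) (0, 1) *m par (e *+ n2) (1, 0)
   *m par (e' * k ^+ 2 *+ n3) (0, 1) *m par s (1, 0)) = 0.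
  rewrite -[X in mx_eval p X]mulmx1; apply: (mx_eval_unipotent e0) => n4.
  rewrite mulmx1; apply: (H _ (y ^+ n1 * x ^+ n2 * y ^+ n3 * x ^+ n4)%g).
  by rewrite !gmulfM; do 3![apply: lifts_mul => //].
have H2 n1 n2 s s' : mx_eval p (par (e' * k ^+ 2 *+ n1) (0, 1) *m par (e *+ n2) (1, 0)
   *m par s (0, 1) *m par s' (1, 0)) = 0.
  by apply: (mx_eval_unipotent k20) => n3.
have H3 n1 s s' s'' : mx_eval p (par (e' * k ^+ 2 *+ n1) (0, 1) *m par s (1, 0)
   *m par s' (0, 1) *m par s'' (1, 0)) = 0.
  rewrite -mulmxA; apply: (mx_eval_unipotent e0) => n2.
  by rewrite mulmxA.
rewrite -!mulmxA -[X in mx_eval p X]mul1mx mulmxA.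
apply: (mx_eval_unipotent k20) => n1; rewrite mul1mx !mulmxA; exact: H3.
Qed.

End Density.

Section Loops.

Lemma pi1_ext3 (G : groupType) (f f' : {multiplicative pi1 -> G}) :
  f (loop (inord 0)) = f' (loop (inord 0)) -> f (loop (inord 1)) = f' (loop (inord 1)) ->
  f (loop (inord 2)) = f' (loop (inord 2)) -> f =1 f'.
Proof.
move=> h0 h1 h2; apply: pi1_ext; apply: ord4_ind => //.
have e (k : {multiplicative pi1 -> G}) : k (loop (inord 3)) =
    ((k (loop (inord 0)) * k (loop (inord 1)) * k (loop (inord 2)))^-1)%g.
  apply: (mulgI (k (loop (inord 0)) * k (loop (inord 1)) * k (loop (inord 2)))%g).
  by rewrite mulgV -!gmulfM loop_prod gmorph1.
by rewrite !e h0 h1 h2.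
Qed.

End Loops.

(** * Coordinates of a representation: uniqueness, range, action of the twists *)

Section Relative.
Import (canonicals) mpoly.
Variable R : realType.
Implicit Types (rho : pi1 -> PSL2 R) (u v w : R * R).

(** Sending every loop to the same involution [J] of the hyperbolic plane respects the relation. *)
Lemma loop_neq1 i : loop i <> 1%g.
Proof.
pose J : 'M[R]_2 := mx2 0 1 (-1) 0.
have [|g Jg] := @det1_lifts _ J; first by rewrite det_mx2 !mx2E; ring.
have gg : (g * g = 1)%g.
  apply/(lifts1 (lifts_mul Jg Jg)); right.
  by rewrite scalar_mx2 mulmx2E opp_mx2 !mx2E; congr mx2; ring.
have g4 : (g * g * g * g = 1)%g by rewrite gg mul1g gg.
have [f fE] := @pi1_lift _ (fun=> g) g4.
move=> /(congr1 f); rewrite fE gmorph1 => /(lifts1 Jg)[]/matrixP/(_ 0 1);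
  rewrite !mxE/= ?oppr0; apply/eqP; exact: oner_neq0.
Qed.

Lemma rep_parabolic (rho : rep R) i : parabolic (rho (loop i)).
Proof.
apply: (rep_type_preserving rho); last exact: loop_neq1.
by exists i, 1%g, 1%N; left; rewrite expg1 invg1 mul1g mulg1.
Qed.

Variables e1 e2 e3 sg : R.
Hypotheses (e11 : e1 ^+ 2 = 1) (e22 : e2 ^+ 2 = 1) (e33 : e3 ^+ 2 = 1).

(* [trace_eqn] says that the first three trace 2 lifts have a product of trace
   [2 sg], i.e. that the four of them have product [sg]. *)
Definition trace_eqn (a b c : R) := e1 * e2 * a ^+ 2 + e2 * e3 * b ^+ 2
  + e1 * e3 * c ^+ 2 + e1 * e2 * e3 * (a * b * c) = 2 - 2 * sg.

Definition framed rho v1 v2 v3 := [/\ lifts (par e1 v1) (rho (loop (inord 0))),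
  lifts (par e2 v2) (rho (loop (inord 1))) & lifts (par e3 v3) (rho (loop (inord 2)))].

Definition coords rho (a b c : R) := exists v1 v2 v3,
  framed rho v1 v2 v3 /\ [/\ w2 v1 v2 = a, w2 v2 v3 = b, w2 v1 v3 = c & trace_eqn a b c].

(** The effect of changing signs of the [v_i], which are determined only up to sign; only the
    products of neighbouring signs matter. *)
Definition flips (a b c a' b' c' : R) := exists s t : R,
  [/\ s ^+ 2 = 1, t ^+ 2 = 1 & [/\ a' = s * a, b' = t * b & c' = s * t * c]].

Let e10 : e1 != 0. Proof. by rewrite -sqrf_eq0 e11 oner_eq0. Qed.
Let e20 : e2 != 0. Proof. by rewrite -sqrf_eq0 e22 oner_eq0. Qed.
Let e30 : e3 != 0. Proof. by rewrite -sqrf_eq0 e33 oner_eq0. Qed.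

Lemma w2_opp u v : (w2 (oppv u) v = - w2 u v) * (w2 u (oppv v) = - w2 u v).
Proof. by rewrite /w2 /oppv /=; split; ring. Qed.

Lemma coords_flips rho a b c a' b' c' : flips a b c a' b' c' ->
  coords rho a b c -> coords rho a' b' c'.
Proof.
move=> [s [t [/sign_cases s1 /sign_cases t1 [-> -> ->]]]].
move=> [v1 [v2 [v3 [[f1 f2 f3] [wa wb wc E]]]]].
exists (if s == 1 then v1 else oppv v1), v2, (if t == 1 then v3 else oppv v3).
have N1 : (-1 == 1 :> R) = false by apply/negbTE; rewrite eqr_oppLR; apply/eqP; lra.
move: s1 t1 => [->|->] [->|->]; rewrite ?eqxx ?N1; split;
  rewrite ?/framed ?par_oppv //; rewrite ?w2_opp wa wb wc; split; try ring;
  move: E; rewrite /trace_eqn => <-; ring.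
Qed.

Lemma coords_uniq rho a b c a' b' c' : coords rho a b c -> coords rho a' b' c' ->
  flips a b c a' b' c'.
Proof.
have sgn (e : R) u v g : e != 0 -> lifts (par e u) g -> lifts (par e v) g ->
    exists s : R, s ^+ 2 = 1 /\ u = (s * v.1, s * v.2).
  move=> e0 h1 h2; have [/par_inj|h] := lifts_uniq h1 h2.
    move=> /(_ e0)[]->; [exists 1|exists (-1)]; split; rewrite ?sqrrN ?expr1n// ?mul1r ?mulN1r//.
    exact: surjective_pairing.
  have := par_tr e u; rewrite h linearN/= par_tr; lra.
move=> [v1 [v2 [v3 [[f1 f2 f3] [<- <- <- _]]]]] [u1 [u2 [u3 [[g1 g2 g3] [<- <- <- _]]]]].
have [s1 [s11 ->]] := sgn _ _ _ _ e10 g1 f1.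
have [s2 [s21 ->]] := sgn _ _ _ _ e20 g2 f2.
have [s3 [s31 ->]] := sgn _ _ _ _ e30 g3 f3.
exists (s1 * s2), (s2 * s3); split; rewrite ?exprMn ?s11 ?s21 ?s31 ?mulr1//.
rewrite /w2 /=; split; try ring.
transitivity (s2 ^+ 2 * (s1 * s3 * (v1.1 * v3.2 - v1.2 * v3.1))); last by ring.
by rewrite s21; ring.
Qed.

Lemma coords_conj (rho rho' : pi1 -> PSL2 R) g a b c :
  (forall x, rho' x = g * rho x * g^-1)%g -> coords rho a b c -> coords rho' a b c.
Proof.
move=> gE [v1 [v2 [v3 [[f1 f2 f3] [wa wb wc E]]]]].
have Bg := lifts_ex g; move: (psl2_mx g) Bg => B Bg.
exists (act B v1), (act B v2), (act B v3).
rewrite !w2_act (lifts_det Bg) !mul1r; split => //.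
by rewrite /framed !gE; split; apply: par_conjg.
Qed.

Lemma coords_inj (rho rho' : rep R) a b c : [|| a != 0, b != 0 | c != 0] ->
  coords rho a b c -> coords rho' a b c -> \pi_(moduli R) rho = \pi_(moduli R) rho'.
Proof.
move=> abc [v1 [v2 [v3 [[f1 f2 f3] [wa wb wc E]]]]] [u1 [u2 [u3 [[g1 g2 g3] [wa' wb' wc' _]]]]].
have w20 u : w2 u u = 0 by rewrite /w2; ring.
have w2C u v : w2 u v = - w2 v u by rewrite /w2; ring.
have [B dB [B1 B2 B3]] : exists2 B, \det B = 1 & [/\ act B v1 = u1, act B v2 = u2 & act B v3 = u3].
  case/or3P: abc => n0.
  - have [||B dB H] := @frame_transport _ v1 v2 u1 u2; rewrite ?wa ?wa'//.
    exists B => //; split; apply: H; rewrite ?w20 ?wa ?wa' ?wb ?wb' ?wc ?wc'//.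
    by rewrite w2C wb' w2C wb.
  - have [||B dB H] := @frame_transport _ v2 v3 u2 u3; rewrite ?wb ?wb'//.
    exists B => //; split; apply: H; rewrite ?w20 ?wa ?wa' ?wb ?wb' ?wc ?wc'//.
    by rewrite w2C wa' w2C wa.
  - have [||B dB H] := @frame_transport _ v1 v3 u1 u3; rewrite ?wc ?wc'//.
    exists B => //; split; apply: H; rewrite ?w20 ?wa ?wa' ?wb ?wb' ?wc ?wc'//.
have [g Bg] := det1_lifts dB.
apply/moduliP/asboolP; exists g => x.
have cM : {morph (fun x => (g * rho x * g^-1)%g) : x y / (x * y)%g}.
  by move=> y z; rewrite gmulfM !mulgA mulgVK.
pose F : {multiplicative pi1 -> PSL2 R} :=
  HB.pack (fun x => (g * rho x * g^-1)%g) (isMultiplicative.Build pi1 (PSL2 R) _ cM).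
apply: (@pi1_ext3 _ rho' F); rewrite /=.
- by apply: lifts_inj g1 _; rewrite -B1; exact: par_conjg.
- by apply: lifts_inj g2 _; rewrite -B2; exact: par_conjg.
- by apply: lifts_inj g3 _; rewrite -B3; exact: par_conjg.
Qed.

Hypothesis sg2 : sg ^+ 2 = 1.

(** Characterises the triples that occur: two nonzero entries say that the three vectors are nonzero
    and not all parallel, and the last clause keeps the image of the fourth loop nontrivial in the
    odd case. *)
Definition valid (a b c : R) := [/\ trace_eqn a b c,
  [|| (a != 0) && (b != 0), (a != 0) && (c != 0) | (b != 0) && (c != 0)] &
  sg = -1 -> a ^+ 2 <> 4 * (e1 * e2) \/ b ^+ 2 <> 4 * (e2 * e3)].

Let w2_span u v x : w2 u v != 0 -> w2 u x = 0 -> w2 v x = 0 -> x = 0.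
Proof.
move=> d h1 h2; rewrite (surjective_pairing x); congr (_, _); apply: (mulfI d); rewrite mulr0.
- transitivity (w2 u x * v.1 - w2 v x * u.1); first by rewrite /w2; ring.
  by rewrite h1 h2; ring.
- transitivity (w2 u x * v.2 - w2 v x * u.2); first by rewrite /w2; ring.
  by rewrite h1 h2; ring.
Qed.

Let framed_neq0 (rho : rep R) v1 v2 v3 : framed rho v1 v2 v3 ->
  [/\ v1 != 0, v2 != 0 & v3 != 0].
Proof.
have H e v i : lifts (par e v) (rho (loop i)) -> v != 0.
  move=> h; apply/eqP => v0; have [] := rep_parabolic rho i.
  move=> /(lifts1 h) h' _; apply: h'; left.
  by rewrite v0 /par scalar_mx2 /=; congr mx2; ring.
by move=> [f1 f2 f3]; split; [exact: H f1|exact: H f2|exact: H f3].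
Qed.

(** If the vectors were all parallel, every element of the image would fix [v1] up to sign. Then
    [w2 (A v1) v1], linear in the entries of [A], would vanish on the image, hence on a rotation by
    a right angle, where it equals the squared length of [v1]. *)
Lemma coords_neq0 (rho : rep R) a b c : coords rho a b c ->
  [|| a != 0, b != 0 | c != 0].
Proof.
move=> [v1 [v2 [v3 [F [wa wb wc _]]]]].
have [v10 v20 v30] := framed_neq0 F; case: F => f1 f2 f3.
apply: contraT; rewrite !negb_or !negbK => /and3P[/eqP a0 /eqP b0 /eqP c0].
pose K g := exists2 M, lifts M g & act M v1 = v1.
have fix_par e v : w2 v v1 = 0 -> act (par e v) v1 = v1.
  by move=> h; rewrite act_par h !(mulr0, mul0r) !addr0 -surjective_pairing.
have w20 u : w2 u u = 0 by rewrite /w2; ring.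
have w2C u v : w2 u v = - w2 v u by rewrite /w2; ring.
have KM g g' : K g -> K g' -> K (g * g')%g.
  move=> [M Mg M1] [M' Mg' M1']; exists (M *m M'); first exact: lifts_mul.
  rewrite -[RHS]M1 -{2}M1' /act mulmx2E !mx2E /=; congr (_, _); ring.
have KV g : K g -> K (g^-1)%g.
  move=> [M Mg M1]; exists (invmx M); first exact: lifts_inv.
  have d := lifts_det Mg; rewrite invmx2// -{1}M1 /act /adj2 !mx2E /=.
  rewrite det_mx2 in d; rewrite [RHS]surjective_pairing; congr (_, _).
    by rewrite -[RHS]mul1r -d; ring.
  by rewrite -[RHS]mul1r -d; ring.
have K0 : K (rho (loop (inord 0))) by exists (par e1 v1) => //; exact: fix_par.
have K1 : K (rho (loop (inord 1))).
  by exists (par e2 v2) => //; apply: fix_par; rewrite w2C wa a0 oppr0.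
have K2 : K (rho (loop (inord 2))).
  by exists (par e3 v3) => //; apply: fix_par; rewrite w2C wc c0 oppr0.
have Kl : forall i, K (rho (loop i)).
  apply: ord4_ind => //.
  have -> : rho (loop (inord 3)) =
    ((rho (loop (inord 0)) * rho (loop (inord 1)) * rho (loop (inord 2)))^-1)%g.
    apply: (mulgI (rho (loop (inord 0)) * rho (loop (inord 1)) * rho (loop (inord 2)))%g).
    by rewrite mulgV -!gmulfM loop_prod gmorph1.
  by apply: KV; apply: (KM) => //; exact: KM.
have Kx x : K (rho x).
  rewrite -[x]reprK hom_word_val; elim: (repr x) => [|[i d] u IH] /=.
    exists 1%:M; first exact: lifts_one.
    by rewrite /act scalar_mx2 !mx2E !mul1r !mul0r addr0 add0r -surjective_pairing.
  by apply: KM => //; rewrite /letter_val; case: d => //=; exact: KV.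
pose X i j := mpoly.mpolyX R (mpoly.mnm1 (mxvec_index (m := 2) (n := 2) i j)).
pose p := (v1.1 * v1.2) *: X 0 0 + v1.2 ^+ 2 *: X 0 1
  + (- v1.1 ^+ 2) *: X 1 0 + (- (v1.1 * v1.2)) *: X 1 1.
have pE M : mpoly.meval (fun k => mxvec M 0 k) p = w2 (act M v1) v1.
  rewrite /p !mpoly.mevalD !mpoly.mevalZ !mpoly.mevalXU !mxvecE /w2 /act /=; ring.
have H0 M g : K g -> lifts M g -> mpoly.meval (fun k => mxvec M 0 k) p = 0.
  move=> [M' M'g M'1] Mg; rewrite pE; have [->|->] := lifts_uniq Mg M'g.
    by rewrite M'1 w20.
  have -> : act (- M') v1 = oppv (act M' v1).
    by rewrite /act /oppv opp_mx2 !mx2E /=; congr (_, _); ring.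
  by rewrite M'1 w2_opp w20 oppr0.
have dJ : \det (mx2 0 1 (-1) 0 : 'M[R]_2) == 1.
  by rewrite det_mx2 !mx2E; apply/eqP; ring.
have Hall A : range rho (\pi_(PSL2 R) A) -> mpoly.meval (fun k => mxvec (val A) 0 k) p = 0.
  by move=> [z _ zA]; apply: (H0 _ (rho z)); [exact: Kx|exists A].
have := @rep_non_elementary R rho p Hall (mkSL2 dJ); rewrite pE /w2 /act /= !mx2E => H.
exfalso; move/eqP: v10; apply.
have : v1.1 ^+ 2 + v1.2 ^+ 2 = 0 by rewrite -[RHS]H; ring.
move/eqP; rewrite paddr_eq0 ?sqr_ge0// !expf_eq0/= => /andP[/eqP h1 /eqP h2].
by rewrite (surjective_pairing v1) h1 h2.
Qed.

(* If c_1 c_2 and c_2 c_3 both had trace -2 in the odd case, then c_4 would be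
   sent to the identity. *)
Let odd_trace e v1 v2 v3 : e ^+ 2 = 1 ->
  w2 v1 v2 ^+ 2 = 4 -> w2 v2 v3 ^+ 2 = 4 ->
  w2 v1 v2 ^+ 2 + w2 v2 v3 ^+ 2 + w2 v1 v3 ^+ 2
    + e * (w2 v1 v2 * w2 v2 v3 * w2 v1 v3) = 4 ->
  par e v1 *m par e v2 *m par e v3 = - 1%:M.
Proof.
move=> es; set a := w2 v1 v2; set b := w2 v2 v3; set c := w2 v1 v3 => a4 b4 E.
have a0 : a != 0 by rewrite -sqrf_eq0 a4; apply/eqP; lra.
have cE : c = - (e * a * b / 2).
  have : (c + e * a * b / 2) ^+ 2 = 0.
    transitivity (c ^+ 2 + e * (a * b * c) + e ^+ 2 * a ^+ 2 * b ^+ 2 / 4); first by field.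
    by rewrite es a4 b4; lra.
  by move/eqP; rewrite sqrf_eq0 addr_eq0 => /eqP.
have [||B dB H] := @frame_transport R v1 v2 (1, 0) (0, a) => //.
  by rewrite -/a /w2 /=; ring.
have B1 : act B v1 = (1, 0) by apply: H; rewrite -/a /w2 /=; ring.
have B2 : act B v2 = (0, a) by apply: H; rewrite -/a /w2 /=; ring.
have B3 : act B v3 = (- (b / a), c).
  apply: H; first by rewrite -/c /w2 /=; ring.
  rewrite (_ : w2 v3 v2 = - b); last by rewrite /b /w2; ring.
  by rewrite /w2 /=; field.
have uB : B \in unitmx by rewrite unitmxE dB unitr1.
apply: (can_inj (mulKmx uB)); rewrite mulmxN mulmx1.
have C1 : B *m par e v1 = par e (1, 0) *m B by rewrite par_conj// B1.
have C2 : B *m par e v2 = par e (0, a) *m B by rewrite par_conj// B2.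
have C3 : B *m par e v3 = par e (- (b / a), c) *m B by rewrite par_conj// B3.
rewrite 2!mulmxA C1 -(mulmxA _ B (par e v2)) C2 mulmxA -(mulmxA _ B (par e v3)) C3 mulmxA.
suff -> : par e (1, 0) *m par e (0, a) *m par e (- (b / a), c) = - 1%:M by rewrite mulNmx mul1mx.
have es' : e * e = 1 by rewrite -expr2.
have ba2 : (b / a) ^+ 2 = 1 by rewrite expr_div_n a4 b4 mulfV//; apply/eqP; lra.
have cba : e * (b / a) * c = - 2.
  rewrite cE; transitivity (- (e ^+ 2 * b ^+ 2) / 2); first by field.
  by rewrite es b4; lra.
have c2 : c ^+ 2 = 4.
  rewrite cE sqrrN; transitivity (e ^+ 2 * a ^+ 2 * b ^+ 2 / 4); first by field.
  by rewrite es a4 b4; lra.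
have -> : par e (- (b / a), c) = mx2 (- 1) e (- 4 * e) 3.
  rewrite /par /=; congr mx2.
  - transitivity (1 + e * (b / a) * c); [ring|by rewrite cba; ring].
  - by rewrite sqrrN ba2 mulr1.
  - by rewrite c2; ring.
  - transitivity (1 - e * (b / a) * c); [ring|by rewrite cba; ring].
rewrite scalar_mx2 opp_mx2 !mulmx2E !mx2E /= a4; congr mx2; rewrite ?oppr0.
- by transitivity (-1 + 4 * (e * e) - 4 * (e * e)); ring.
- by transitivity (4 * e * (1 - e * e)); [ring|rewrite es'; ring].
- by ring.
- by transitivity (3 - 4 * (e * e)); [ring|rewrite es'; ring].
Qed.

Lemma coords_valid (rho : rep R) a b c : coords rho a b c -> valid a b c.
Proof.
move=> C; have n0 := coords_neq0 C.
case: C => [v1 [v2 [v3 [F [wa wb wc E]]]]].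
have [v10 v20 v30] := framed_neq0 F; case: F => f1 f2 f3; split => //.
  have w2C u v : w2 u v = - w2 v u by rewrite /w2; ring.
  have z (x y t : R * R) : w2 x y != 0 -> t != 0 -> (w2 x t != 0) || (w2 y t != 0).
    move=> d; apply: contraNT; rewrite negb_or !negbK => /andP[/eqP h1 /eqP h2].
    by apply/eqP; apply: w2_span d h1 h2.
  case/or3P: n0 => h0; rewrite h0 ?andbT/= ?orbT//.
  - by have := z v1 v2 v3; rewrite wa wb wc => /(_ h0 v30)/orP[]->; rewrite ?orbT.
  - by have := z v2 v3 v1; rewrite wb w2C wa w2C wc !oppr_eq0 => /(_ h0 v10)/orP[]->; rewrite ?orbT.
  - have := z v1 v3 v2; rewrite wc wa w2C wb oppr_eq0 => /(_ h0 v20)/orP[]->; rewrite ?orbT//.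
move=> sgN; apply: contrapT => /not_orP[/contrapT a4 /contrapT b4].
have M1 : par e1 v1 *m par e2 v2 *m par e3 v3 = - 1%:M.
  move: a4 b4 E; rewrite /trace_eqn sgN -wa -wb -wc.
  have [->|->] := sign_cases e11; have [->|->] := sign_cases e22; have [->|->] := sign_cases e33 => a4 b4 E;
    try (by exfalso; have := sqr_ge0 (w2 v1 v2); have := sqr_ge0 (w2 v2 v3); lra);
    apply: odd_trace; rewrite ?sqrrN ?expr1n//; try (by rewrite ?a4 ?b4; lra); move: E; lra.
have l3 : rho (loop (inord 3)) = 1%g.
  have h : (rho (loop (inord 0)) * rho (loop (inord 1)) * rho (loop (inord 2)) = 1)%g.
    by apply/(lifts1 (lifts_mul (lifts_mul f1 f2) f3)); right.
  by have := congr1 rho loop_prod; rewrite !gmulfM h mul1g gmorph1.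
by have [] := rep_parabolic rho (inord 3); rewrite l3.
Qed.

Lemma rep_of_frame v1 v2 v3 : v1 != 0 -> v2 != 0 -> v3 != 0 ->
  \tr (par e1 v1 *m par e2 v2 *m par e3 v3) ^+ 2 = 4 ->
  par e1 v1 *m par e2 v2 *m par e3 v3 <> 1%:M ->
  par e1 v1 *m par e2 v2 *m par e3 v3 <> - 1%:M ->
  (forall f : {multiplicative pi1 -> PSL2 R}, framed f v1 v2 v3 -> zariski_dense (range f)) ->
  exists rho : rep R, framed rho v1 v2 v3.
Proof.
move=> v10 v20 v30 t4 M1 MN1 dense; set M := _ *m par e3 v3 in t4 M1 MN1.
have [g1 h1] := det1_lifts (par_det e1 v1).
have [g2 h2] := det1_lifts (par_det e2 v2).
have [g3 h3] := det1_lifts (par_det e3 v3).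
have h4 := lifts_mul (lifts_mul h1 h2) h3; rewrite -/M in h4.
pose g (i : 'I_4) := nth 1%g [:: g1; g2; g3; ((g1 * g2 * g3)^-1)%g] i.
have gE : ((g (inord 0) = g1) * (g (inord 1) = g2) * (g (inord 2) = g3)
    * (g (inord 3) = ((g1 * g2 * g3)^-1)%g))%type.
  by rewrite /g !inordK.
have [|f fE] := @pi1_lift _ g; first by rewrite !gE mulgV.
have F : framed f v1 v2 v3 by rewrite /framed !fE !gE.
have parl i : exists e v, [/\ e != 0, v != 0 & lifts (par e v) (f (loop i))].
  rewrite fE; move: i; apply: ord4_ind; rewrite !gE.
  - by exists e1, v1.
  - by exists e2, v2.
  - by exists e3, v3.
  have p4 : parabolic ((g1 * g2 * g3)^-1)%g.
    have hV := lifts_inv h4.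
    have n1 : ((g1 * g2 * g3)^-1 <> 1)%g.
      move=> h; have : (g1 * g2 * g3 = 1)%g by rewrite -[LHS]invgK h invg1.
      by move=> /(lifts1 h4)[].
    apply/(parabolicE hV); split.
    + by move=> h; apply/n1/(lifts1 hV); left.
    + by move=> h; apply/n1/(lifts1 hV); right.
    + by rewrite invmx2 ?(lifts_det h4)// tr_mx2 !mx2E addrC -tr_mx2.
  have [e [v [e_1 v_0 h]]] := parabolic_par p4; exists e, v; split => //.
  by rewrite -sqrf_eq0 e_1 oner_eq0.
have tp : type_preserving f.
  move=> x [i [h [n E]]] x1; have [e [v [ee0 vv0 Le]]] := parl i.
  have n0 : n != 0%N.
    apply/eqP => n0; apply: x1; case: E => ->; rewrite n0 expg0 ?invg1 mulg1 mulgV//.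
  have Bh := lifts_ex (f h).
  have en0 : e *+ n != 0 by rewrite mulrn_eq0 negb_or n0.
  have av0 := act_neq0 (lifts_det Bh) vv0.
  case: E => ->; rewrite !gmulfM !gmorphV gmorphX.
    exact: par_parabolic en0 av0 (par_conjg Bh (par_expg n Le)).
  have := lifts_inv (par_expg n Le); rewrite invmx_par => L'.
  by apply: (par_parabolic _ av0 (par_conjg Bh L')); rewrite oppr_eq0.
by exists (Rep tp (dense f F)).
Qed.

(** If the product were scalar, it would be [sg], and the images of [c_1 c_2] and [c_2 c_3] would be
    [sg] times unipotents, of trace [2 sg]. For [sg = 1] this gives [a = b = 0]; for [sg = -1] it is
    the excluded case. *)
Lemma valid_prod v1 v2 v3 : valid (w2 v1 v2) (w2 v2 v3) (w2 v1 v3) ->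
  [/\ \tr (par e1 v1 *m par e2 v2 *m par e3 v3) ^+ 2 = 4,
    par e1 v1 *m par e2 v2 *m par e3 v3 <> 1%:M &
    par e1 v1 *m par e2 v2 *m par e3 v3 <> - 1%:M].
Proof.
move=> [E two odd].
have tM : \tr (par e1 v1 *m par e2 v2 *m par e3 v3) = 2 * sg.
  by rewrite par3_tr; move: E; rewrite /trace_eqn; lra.
have H s : par e1 v1 *m par e2 v2 *m par e3 v3 = s%:M -> False.
  move=> Ms; have := tM; rewrite Ms tr_mx2 scalar_mx2 !mx2E => ssg.
  have {}ssg : s = sg by lra.
  have u1 : par e1 v1 \in unitmx by rewrite unitmxE par_det unitr1.
  have u3 : par e3 v3 \in unitmx by rewrite unitmxE par_det unitr1.
  have t12 : \tr (par e1 v1 *m par e2 v2) = 2 * sg.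
    rewrite -[X in \tr X](mulmxK u3) Ms invmx_par mul_scalar_mx linearZ/= par_tr ssg.
    by rewrite mulrC.
  have t23 : \tr (par e2 v2 *m par e3 v3) = 2 * sg.
    rewrite -[X in \tr X](mulKmx u1) (mulmxA (par e1 v1)) Ms invmx_par mul_mx_scalar linearZ/= par_tr ssg.
    by rewrite mulrC.
  move: t12 t23; rewrite !par2_tr; have [sg1|sg1] := sign_cases sg2; rewrite sg1 => h1 h2.
    have a0 : w2 v1 v2 = 0.
      apply/eqP; rewrite -sqrf_eq0; apply/eqP; apply: (mulfI (mulf_neq0 e10 e20)).
      by rewrite mulr0; lra.
    have b0 : w2 v2 v3 = 0.
      apply/eqP; rewrite -sqrf_eq0; apply/eqP; apply: (mulfI (mulf_neq0 e20 e30)).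
      by rewrite mulr0; lra.
    by move: two; rewrite a0 b0 eqxx /= .
  case: (odd sg1) => h; apply: h.
    transitivity (e1 ^+ 2 * e2 ^+ 2 * w2 v1 v2 ^+ 2); first by rewrite e11 e22 !mul1r.
    transitivity (e1 * e2 * (e1 * e2 * w2 v1 v2 ^+ 2)); first by ring.
    by rewrite (_ : e1 * e2 * w2 v1 v2 ^+ 2 = 4); [rewrite mulrC|lra].
  transitivity (e2 ^+ 2 * e3 ^+ 2 * w2 v2 v3 ^+ 2); first by rewrite e22 e33 !mul1r.
  transitivity (e2 * e3 * (e2 * e3 * w2 v2 v3 ^+ 2)); first by ring.
  by rewrite (_ : e2 * e3 * w2 v2 v3 ^+ 2 = 4); [rewrite mulrC|lra].
split; first by rewrite tM exprMn sg2; ring.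
  exact: H.
by rewrite -scaleN1r scalemx1; exact: H.
Qed.

(** Conjugation brings [v1, v2] to the axes, and the third vector is then forced by [b] and [c]. *)
Lemma rep_exists_left a b c : valid a b c -> a != 0 ->
  exists rho : rep R, framed rho (1, 0) (0, a) (- (b / a), c).
Proof.
move=> V a0; case: (V) => E two odd.
have wa : w2 (1, 0) (0, a) = a by rewrite /w2 /=; ring.
have wb : w2 (0, a) (- (b / a), c) = b by rewrite /w2 /=; field.
have wc : w2 (1, 0) (- (b / a), c) = c by rewrite /w2 /=; ring.
have [|t4 M1 MN1] := @valid_prod (1, 0) (0, a) (- (b / a), c); first by rewrite wa wb wc.
apply: rep_of_frame => //.
- by rewrite xpair_eqE negb_and oner_eq0.
- by rewrite xpair_eqE negb_and a0 orbT.
- rewrite xpair_eqE negb_and oppr_eq0 mulf_eq0 invr_eq0 (negbTE a0) orbF.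
  by case/or3P: two => /andP[h1 h2]; rewrite ?h1 ?h2 ?orbT.
- by move=> f [f1 f2 _]; apply: unipotents_dense f1 f2.
Qed.

Lemma rep_exists_right a b c : valid a b c -> b != 0 ->
  exists rho : rep R, framed rho (c / b, - a) (1, 0) (0, b).
Proof.
move=> V b0; case: (V) => E two odd.
have wa : w2 (c / b, - a) (1, 0) = a by rewrite /w2 /=; ring.
have wb : w2 (1, 0) (0, b) = b by rewrite /w2 /=; ring.
have wc : w2 (c / b, - a) (0, b) = c by rewrite /w2 /=; field.
have [|t4 M1 MN1] := @valid_prod (c / b, - a) (1, 0) (0, b); first by rewrite wa wb wc.
apply: rep_of_frame => //.
- rewrite xpair_eqE negb_and oppr_eq0 mulf_eq0 invr_eq0 (negbTE b0) orbF.
  by case/or3P: two => /andP[h1 h2]; rewrite ?h1 ?h2 ?orbT.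
- by rewrite xpair_eqE negb_and oner_eq0.
- by rewrite xpair_eqE negb_and b0 orbT.
- by move=> f [_ f2 f3]; apply: unipotents_dense f2 f3.
Qed.

Let conj_framed (rho : rep R) (phi : mcg) (P : pred 'I_4) h B v1 v2 v3 :
  (forall i, phi (loop i) = conj_loops P h i) -> lifts B (rho h) ->
  framed rho v1 v2 v3 ->
  framed (precomp phi rho) (if P (inord 0) then act B v1 else v1)
    (if P (inord 1) then act B v2 else v2) (if P (inord 2) then act B v3 else v3).
Proof.
move=> phiE Bh [f1 f2 f3]; rewrite /framed /= !phiE /conj_loops; split; case: ifP => _ //;
  rewrite !gmulfM gmorphV; exact: par_conjg.
Qed.

Lemma coords_twist12 (phi psi : mcg) (rho : rep R) a b c :
  (forall i, phi (loop i) = conj_loops first_two curve12 i) ->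
  (forall i, psi (loop i) = conj_loops first_two (curve12^-1)%g i) ->
  coords rho a b c ->
  coords (precomp phi rho) a (b + e1 * a * c) (c - e2 * a * (b + e1 * a * c)) /\
  coords (precomp psi rho) a (b - e1 * a * (c + e2 * a * b)) (c + e2 * a * b).
Proof.
move=> phiE psiE [v1 [v2 [v3 [F [wa wb wc E]]]]]; have [f1 f2 f3] := F.
have B12 : lifts (par e1 v1 *m par e2 v2) (rho curve12).
  by rewrite gmulfM; exact: lifts_mul.
have F1 := conj_framed phiE B12 F.
have Bi : lifts (par (- e2) v2 *m par (- e1) v1) (rho (curve12^-1)%g).
  rewrite gmorphV gmulfM invgM -!invmx_par.
  by apply: lifts_mul; exact: lifts_inv.
have F2 := conj_framed psiE Bi F.
rewrite /first_two !inordK//= in F1 F2.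
split.
  eexists _, _, _; split; first exact: F1.
  split.
  - by rewrite w2_act det_mulmx !par_det !mul1r.
  - by rewrite -wa -wb -wc /act !mulmx2E !mx2E /w2 /=; ring.
  - by rewrite -wa -wb -wc /act !mulmx2E !mx2E /w2 /=; ring.
  - move: E; rewrite /trace_eqn => <-; have [->|->] := sign_cases e11;
      have [->|->] := sign_cases e22; ring.
eexists _, _, _; split; first exact: F2.
split.
- by rewrite w2_act det_mulmx !par_det !mul1r.
- by rewrite -wa -wb -wc /act !mulmx2E !mx2E /w2 /=; ring.
- by rewrite -wa -wb -wc /act !mulmx2E !mx2E /w2 /=; ring.
- move: E; rewrite /trace_eqn => <-; have [->|->] := sign_cases e11;
    have [->|->] := sign_cases e22; ring.
Qed.

Lemma coords_twist23 (phi psi : mcg) (rho : rep R) a b c :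
  (forall i, phi (loop i) = conj_loops middle_two curve23 i) ->
  (forall i, psi (loop i) = conj_loops middle_two (curve23^-1)%g i) ->
  coords rho a b c ->
  coords (precomp phi rho) (a - e3 * b * (c + e2 * b * a)) b (c + e2 * b * a) /\
  coords (precomp psi rho) (a + e3 * b * c) b (c - e2 * b * (a + e3 * b * c)).
Proof.
move=> phiE psiE [v1 [v2 [v3 [F [wa wb wc E]]]]]; have [f1 f2 f3] := F.
have B23 : lifts (par e2 v2 *m par e3 v3) (rho curve23).
  by rewrite gmulfM; exact: lifts_mul.
have F1 := conj_framed phiE B23 F.
have Bi : lifts (par (- e3) v3 *m par (- e2) v2) (rho (curve23^-1)%g).
  rewrite gmorphV gmulfM invgM -!invmx_par.
  by apply: lifts_mul; exact: lifts_inv.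
have F2 := conj_framed psiE Bi F.
rewrite /middle_two !inordK//= in F1 F2.
split.
  eexists _, _, _; split; first exact: F1.
  split.
  - by rewrite -wa -wb -wc /act !mulmx2E !mx2E /w2 /=; ring.
  - by rewrite w2_act det_mulmx !par_det !mul1r.
  - by rewrite -wa -wb -wc /act !mulmx2E !mx2E /w2 /=; ring.
  - move: E; rewrite /trace_eqn => <-; have [->|->] := sign_cases e33;
      have [->|->] := sign_cases e22; ring.
eexists _, _, _; split; first exact: F2.
split.
- by rewrite -wa -wb -wc /act !mulmx2E !mx2E /w2 /=; ring.
- by rewrite w2_act det_mulmx !par_det !mul1r.
- by rewrite -wa -wb -wc /act !mulmx2E !mx2E /w2 /=; ring.
- move: E; rewrite /trace_eqn => <-; have [->|->] := sign_cases e33;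
    have [->|->] := sign_cases e22; ring.
Qed.
End Relative.

(** * Signs on a component and the Euler class *)

Section ContinuousEntries.
Variables (R : realType) (T : topologicalType).
Implicit Types f g : T -> R.

Lemma continuous_add f g : continuous f -> continuous g -> continuous (fun x => f x + g x).
Proof. by move=> cf cg x; apply: cvgD; [exact: cf|exact: cg]. Qed.

Lemma continuous_sub f g : continuous f -> continuous g -> continuous (fun x => f x - g x).
Proof. by move=> cf cg x; apply: cvgB; [exact: cf|exact: cg]. Qed.

Lemma continuous_mul f g : continuous f -> continuous g -> continuous (fun x => f x * g x).
Proof. by move=> cf cg x; apply: cvgM; [exact: cf|exact: cg]. Qed.

Lemma continuous_const (c : R) : continuous (fun _ : T => c).
Proof. by move=> x; exact: cvg_cst. Qed.

Lemma continuous_mulmx (F G : T -> 'M[R]_2) :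
  (forall i j, continuous (fun x => F x i j)) -> (forall i j, continuous (fun x => G x i j)) ->
  forall i j, continuous (fun x => (F x *m G x) i j).
Proof.
move=> cF cG; under eq_forall do under eq_forall do under eq_fun do rewrite mulmx2E.
apply: ord2_ind; apply: ord2_ind; under eq_fun do rewrite mx2E;
  by apply: continuous_add; apply: continuous_mul.
Qed.

Lemma continuous_tr2 (F : T -> 'M[R]_2) :
  (forall i j, continuous (fun x => F x i j)) -> continuous (fun x => \tr (F x)).
Proof. by move=> cF; under eq_fun do rewrite tr_mx2; exact: continuous_add. Qed.

End ContinuousEntries.

Section Types.
Variable R : realType.
Implicit Types (A B : 'M[R]_2) (g : PSL2 R).

(* Multiplying a lift by half its trace makes it independent of the choice of
   its sign; for parabolic elements it is the lift of trace 2. *)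
Definition normal_lift g : 'M[R]_2 := (\tr (psl2_mx g) / 2) *: psl2_mx g.

Lemma normal_liftE B g : lifts B g -> normal_lift g = (\tr B / 2) *: B.
Proof.
move=> Bg; rewrite /normal_lift; have [->//|->] := lifts_uniq (lifts_ex g) Bg.
by apply/matrixP => i j; rewrite !mxE raddfN/=; ring.
Qed.

Lemma normal_lift_par (e : R) v g : lifts (par e v) g -> normal_lift g = par e v.
Proof. by move=> /normal_liftE ->; rewrite par_tr divff// scale1r. Qed.

Lemma normal_lift_continuous i j : continuous (fun g => normal_lift g i j).
Proof.
pose h (A : SL2 R) := (val A 0 0 + val A 1 1) / 2 * val A i j.
have hc : continuous h.
  have cv k l : continuous (fun A : SL2 R => val A k l).
    move=> A; apply: (@continuous_comp _ _ _ (val : SL2 R -> 'M[R]_2) (fun M : 'M[R]_2 => M k l)).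
      exact: initial_continuous.
    exact: coord_continuous.
  apply: continuous_mul; last exact: cv.
  by apply: continuous_mul; [exact: continuous_add|exact: continuous_const].
rewrite [X in continuous X](_ : _ = h \o repr); last first.
  by apply/funext => g; rewrite /normal_lift /h /= mxE tr_mx2.
apply: repr_comp_continuous => // A B /eqP/psl2P; rewrite /sl2_eq /h => /orP[]/eqP ->//.
by rewrite !mxE; apply/eqP; ring.
Qed.

Lemma loop_continuous i : continuous (fun rho : rep R => rho (loop i)).
Proof.
pose f (rho : rep R) : {ptws 'I_4 -> PSL2 R} := fun i => rho (loop i).
move=> rho; apply: (@continuous_comp _ _ _ f (fun h : {ptws 'I_4 -> PSL2 R} => h i)).
  exact: initial_continuous.
exact: (@proj_continuous _ (fun=> PSL2 R) i).
Qed.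

Lemma rep_entry_continuous k i j :
  continuous (fun rho : rep R => normal_lift (rho (loop k)) i j).
Proof.
move=> rho; apply: (@continuous_comp _ _ _ (fun rho : rep R => rho (loop k))
  (fun g => normal_lift g i j)); first exact: loop_continuous.
exact: normal_lift_continuous.
Qed.

(** For [par e v] this is [e] times the squared length of [v]: the sign of the parabolic in a form
    continuous in the representation. *)
Definition twist_sign (rho : rep R) k : R :=
  normal_lift (rho (loop k)) 0 1 - normal_lift (rho (loop k)) 1 0.

(** It is 2 or -2 according to whether the trace 2 lifts have product 1 or -1. *)
Definition total_trace (rho : rep R) : R :=
  \tr (normal_lift (rho (loop (inord 0))) *m normal_lift (rho (loop (inord 1)))
    *m (normal_lift (rho (loop (inord 2))) *m normal_lift (rho (loop (inord 3))))).

Lemma twist_sign_continuous k : continuous (twist_sign ^~ k).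
Proof. by apply: continuous_sub; exact: rep_entry_continuous. Qed.

Lemma total_trace_continuous : continuous total_trace.
Proof.
apply: continuous_tr2 => i j; apply: continuous_mulmx => {i j} i j;
  by apply: continuous_mulmx => {i j} i j; exact: rep_entry_continuous.
Qed.

Definition typed (e1 e2 e3 e4 sg : R) (rho : rep R) :=
  (exists a b c, coords e1 e2 e3 sg rho a b c) /\
  exists v, lifts (par e4 v) (rho (loop (inord 3))).

Let sgn_val (x : R) : x != 0 -> Num.sg x ^+ 2 = 1 /\ 0 < Num.sg x * x.
Proof. by move=> x0; rewrite sqr_sg x0 -normrEsg normr_gt0. Qed.

Lemma par_twist (e : R) v : (par e v) 0 1 - (par e v) 1 0 = e * (v.1 ^+ 2 + v.2 ^+ 2).
Proof. rewrite !mx2E; ring. Qed.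

Let norm_gt0 (v : R * R) : v != 0 -> 0 < v.1 ^+ 2 + v.2 ^+ 2.
Proof.
move=> v0; rewrite lt_neqAle addr_ge0 ?sqr_ge0// andbT eq_sym paddr_eq0 ?sqr_ge0//.
apply: contra v0; rewrite !expf_eq0/= => /andP[/eqP h1 /eqP h2].
by rewrite (surjective_pairing v) h1 h2.
Qed.

Lemma twist_sign_typed (rho : rep R) k (e : R) : e ^+ 2 = 1 ->
  0 < e * twist_sign rho k <-> exists v, lifts (par e v) (rho (loop k)).
Proof.
move=> e2; have [e' [v [e2' v0 L]]] := parabolic_par (rep_parabolic rho k).
have -> : twist_sign rho k = e' * (v.1 ^+ 2 + v.2 ^+ 2).
  by rewrite /twist_sign (normal_lift_par L) par_twist.
have nv := norm_gt0 v0; split.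
  rewrite mulrA pmulr_lgt0// => ee; exists v; suff -> : e = e' by [].
  move: ee; have [->|->] := sign_cases e2; have [->|->] := sign_cases e2' => //;
    rewrite ?mulN1r ?mul1r ?mulr1; lra.
move=> [u L']; have [E|E] := lifts_uniq L' L; last first.
  by have := par_tr e u; rewrite E linearN/= par_tr; lra.
have := congr1 (fun M : 'M[R]_2 => M 0 1 - M 1 0) E; rewrite !par_twist => <-.
rewrite mulrA -expr2 e2 mul1r; apply: norm_gt0; apply/eqP => u0.
have [+ _] := rep_parabolic rho k; apply; apply/(lifts1 L'); left.
by rewrite u0 /par scalar_mx2 /=; congr mx2; ring.
Qed.

Lemma total_trace_typed (rho : rep R) (e1 e2 e3 e4 : R) v1 v2 v3 v4 sg : sg ^+ 2 = 1 ->
  framed e1 e2 e3 rho v1 v2 v3 -> lifts (par e4 v4) (rho (loop (inord 3))) ->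
  [/\ 0 < sg * total_trace rho <-> trace_eqn e1 e2 e3 sg (w2 v1 v2) (w2 v2 v3) (w2 v1 v3),
      total_trace rho != 0 &
      0 < sg * total_trace rho ->
        par e1 v1 *m par e2 v2 *m (par e3 v3 *m par e4 v4) = sg%:M].
Proof.
move=> sg2 [f1 f2 f3] f4.
rewrite /total_trace (normal_lift_par f1) (normal_lift_par f2) (normal_lift_par f3) (normal_lift_par f4).
have L : lifts (par e1 v1 *m par e2 v2 *m (par e3 v3 *m par e4 v4)) 1%g.
  have -> : 1%g = (rho (loop (inord 0)) * rho (loop (inord 1)) *
      (rho (loop (inord 2)) * rho (loop (inord 3))))%g.
    by rewrite -!gmulfM mulgA loop_prod gmorph1.
  by apply: lifts_mul; exact: lifts_mul.
have [s [s2 E]] : exists s : R, s ^+ 2 = 1 /\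
    par e1 v1 *m par e2 v2 *m (par e3 v3 *m par e4 v4) = s%:M.
  have [|E] := (lifts1 L).1 erefl; first by exists 1; rewrite expr1n.
  by exists (-1); rewrite sqrrN expr1n; split=> //; rewrite E -scaleN1r scalemx1.
have t3 : \tr (par e1 v1 *m par e2 v2 *m par e3 v3) = 2 * s.
  have u4 : par e4 v4 \in unitmx by rewrite unitmxE par_det unitr1.
  rewrite -[X in \tr X](mulmxK u4) -(mulmxA _ (par e3 v3)) E invmx_par mul_scalar_mx linearZ/=.
  by rewrite par_tr mulrC.
have tE : trace_eqn e1 e2 e3 s (w2 v1 v2) (w2 v2 v3) (w2 v1 v3).
  by move: t3; rewrite par3_tr /trace_eqn; lra.
rewrite E tr_mx2 scalar_mx2 !mx2E.
have sgs : 0 < sg * (s + s) -> s = sg.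
  by have [->|->] := sign_cases s2; have [->|->] := sign_cases sg2 => //; lra.
have s0 : s != 0 by rewrite -sqrf_eq0 s2 oner_eq0.
split.
- split=> [/sgs <-//|]; move: tE; rewrite /trace_eqn => -> h.
  have -> : s = sg by lra.
  have -> : sg * (sg + sg) = sg ^+ 2 + sg ^+ 2 by ring.
  by rewrite sg2.
- by rewrite -mulr2n mulrn_eq0/=.
- by rewrite -scalar_mx2 => /sgs ->.
Qed.

Definition type_set (e1 e2 e3 e4 sg : R) : set (rep R) := [set rho |
  [/\ 0 < e1 * twist_sign rho (inord 0), 0 < e2 * twist_sign rho (inord 1),
      0 < e3 * twist_sign rho (inord 2), 0 < e4 * twist_sign rho (inord 3) &
      0 < sg * total_trace rho]].

Lemma typedE (e1 e2 e3 e4 sg : R) rho :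
  e1 ^+ 2 = 1 -> e2 ^+ 2 = 1 -> e3 ^+ 2 = 1 -> e4 ^+ 2 = 1 -> sg ^+ 2 = 1 ->
  type_set e1 e2 e3 e4 sg rho <-> typed e1 e2 e3 e4 sg rho.
Proof.
move=> e11 e22 e33 e44 sg2; split.
  move=> [] /(twist_sign_typed _ _ e11)[v1 f1] /(twist_sign_typed _ _ e22)[v2 f2].
  move=> /(twist_sign_typed _ _ e33)[v3 f3] /(twist_sign_typed _ _ e44)[v4 f4] t; split; last by exists v4.
  exists (w2 v1 v2), (w2 v2 v3), (w2 v1 v3), v1, v2, v3; split => //; split => //.
  by have [<-] := total_trace_typed sg2 (And3 f1 f2 f3) f4.
move=> [[a [b [c [v1 [v2 [v3 [[f1 f2 f3] [wa wb wc E]]]]]]]] [v4 f4]].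
split; [by apply/twist_sign_typed => //; exists v1|by apply/twist_sign_typed => //; exists v2
  |by apply/twist_sign_typed => //; exists v3|by apply/twist_sign_typed => //; exists v4|].
have [-> _ _] := total_trace_typed sg2 (And3 f1 f2 f3) f4.
by rewrite wa wb wc.
Qed.

Lemma twist_sign_neq0 (rho : rep R) k : twist_sign rho k != 0.
Proof.
have [e [v [e2 v0 L]]] := parabolic_par (rep_parabolic rho k).
rewrite /twist_sign (normal_lift_par L) par_twist mulf_neq0//; last by rewrite gt_eqF ?norm_gt0.
by rewrite -sqrf_eq0 e2 oner_eq0.
Qed.

Lemma total_trace_neq0 (rho : rep R) : total_trace rho != 0.
Proof.
have P k := parabolic_par (rep_parabolic rho k).
have [e1 [v1 [_ _ f1]]] := P (inord 0); have [e2 [v2 [_ _ f2]]] := P (inord 1).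
have [e3 [v3 [_ _ f3]]] := P (inord 2); have [e4 [v4 [_ _ f4]]] := P (inord 3).
by have [] := total_trace_typed (expr1n R 2) (And3 f1 f2 f3) f4.
Qed.

Lemma type_set_open e1 e2 e3 e4 sg : open (type_set e1 e2 e3 e4 sg).
Proof.
have oP (f : rep R -> R) (e : R) : continuous f -> open [set rho | 0 < e * f rho].
  move=> cf; rewrite (_ : mkset _ = (fun rho => e * f rho) @^-1` `]0, +oo[%classic).
    apply: open_comp; last exact: interval_open.
    by move=> rho _; apply: continuous_mul => //; exact: continuous_const.
  by apply/seteqP; split => rho; rewrite /= in_itv/= andbT.
rewrite (_ : type_set _ _ _ _ _ = [set rho | 0 < e1 * twist_sign rho (inord 0)] `&`
  [set rho | 0 < e2 * twist_sign rho (inord 1)] `&`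
  [set rho | 0 < e3 * twist_sign rho (inord 2)] `&`
  [set rho | 0 < e4 * twist_sign rho (inord 3)] `&` [set rho | 0 < sg * total_trace rho]).
  by do !apply: openI; apply: oP; (exact: twist_sign_continuous || exact: total_trace_continuous).
by apply/seteqP; split=> rho; [move=> []|move=> [[[[]]]]].
Qed.

(** The type is read from continuous functions that never vanish and is invariant under conjugation,
    so the classes of one type form a set that is open and closed. *)
Lemma component_typed (C : set (moduli R)) : is_component C ->
  exists e1 e2 e3 e4 sg : R, [/\ e1 ^+ 2 = 1, e2 ^+ 2 = 1, e3 ^+ 2 = 1,
    e4 ^+ 2 = 1 & sg ^+ 2 = 1] /\
    forall rho, C (\pi_(moduli R) rho) -> typed e1 e2 e3 e4 sg rho.
Proof.
move=> [x0 ->]; pose rho0 := repr x0.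
pose s k := Num.sg (twist_sign rho0 (inord k)); pose t := Num.sg (total_trace rho0).
have [s0 p0] := sgn_val (twist_sign_neq0 rho0 (inord 0)).
have [s1 p1] := sgn_val (twist_sign_neq0 rho0 (inord 1)).
have [s2 p2] := sgn_val (twist_sign_neq0 rho0 (inord 2)).
have [s3 p3] := sgn_val (twist_sign_neq0 rho0 (inord 3)).
have [t2 pt] := sgn_val (total_trace_neq0 rho0).
exists (s 0%N), (s 1%N), (s 2%N), (s 3%N), t; split => //.
pose T := type_set (s 0%N) (s 1%N) (s 2%N) (s 3%N) t.
have TE rho : T rho <-> typed (s 0%N) (s 1%N) (s 2%N) (s 3%N) t rho by exact: typedE.
have T0 : T rho0 by [].
have Tconj rho sigma : conjugate rho sigma -> T rho -> T sigma.
  move=> /asboolP[g gE] /TE[[a [b [c h]]] [v Lv]]; apply/TE; split.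
    by exists a, b, c; exact: (coords_conj gE).
  exists (act (psl2_mx g) v); rewrite gE; exact: par_conjg (lifts_ex g) Lv.
pose U : set (moduli R) := [set x | T (repr x)].
have UE rho : U (\pi_(moduli R) rho) <-> T rho.
  have c : conjugate (repr (\pi_(moduli R) rho)) rho by apply/moduliP; rewrite reprK.
  by split; apply: Tconj => //; rewrite conjugate_sym.
have oU : open U.
  rewrite /open/= /quotient_open (_ : _ @^-1` U = T); first exact: type_set_open.
  by apply/seteqP; split => rho /=; rewrite UE.
have oUC : open (~` U).
  rewrite /open/= /quotient_open (_ : _ @^-1` _ = ~` T); last first.
    by apply/seteqP; split => rho /=; rewrite UE.
  have oP (f : rep R -> R) (e : R) : continuous f -> (forall rho, f rho != 0) ->
      e ^+ 2 = 1 -> open [set rho | ~ (0 < e * f rho)].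
    move=> cf f0 e2; rewrite (_ : mkset _ = (fun rho => e * f rho) @^-1` `]-oo, 0[%classic).
      apply: open_comp; last exact: interval_open.
      by move=> rho _; apply: continuous_mul => //; exact: continuous_const.
    have e0 : e != 0 by rewrite -sqrf_eq0 e2 oner_eq0.
    apply/seteqP; split => rho; rewrite /= in_itv/=.
      by move=> /negP; rewrite -leNgt le_eqVlt mulf_eq0 (negbTE e0) (negbTE (f0 rho)).
    by move=> h; rewrite lt_gtF.
  rewrite (_ : ~` T = [set rho | ~ (0 < s 0%N * twist_sign rho (inord 0))] `|`
    [set rho | ~ (0 < s 1%N * twist_sign rho (inord 1))] `|`
    [set rho | ~ (0 < s 2%N * twist_sign rho (inord 2))] `|`
    [set rho | ~ (0 < s 3%N * twist_sign rho (inord 3))] `|`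
    [set rho | ~ (0 < t * total_trace rho)]).
    by do !apply: openU; apply: oP => //; (exact: twist_sign_continuous ||
      exact: total_trace_continuous || (move=> *; exact: twist_sign_neq0) ||
      (move=> *; exact: total_trace_neq0)).
  apply/seteqP; split=> rho.
    move=> nT; apply: contrapT => /not_orP[/not_orP[/not_orP[/not_orP[h0 h1] h2] h3] h4].
    by apply: nT; split; exact: contrapT.
  by move=> [[[[]|]|]|] h [] *; exact: h.
have x0C : connected_component setT x0 x0 by exact: connected_component_refl.
have CU : connected_component setT x0 `&` U = connected_component setT x0.
  apply: (@component_connected _ setT x0).
  - by exists x0; split.
  - by exists U.
  - by exists U => //; rewrite -[U]setCK; exact: open_closedC.
by move=> rho; rewrite -CU => -[_ /UE/TE].
Qed.

(** * Lifts of parabolics to the universal cover of the circle *)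

Lemma cos_sin_eq0 (t : R) : ~ (sin t = 0 /\ cos t = 0).
Proof. by move=> [s0 c0]; have := cos2Dsin2 t; rewrite s0 c0 expr0n addr0 => /eqP; rewrite eq_sym oner_eq0. Qed.

Definition dirp (t : R) : R * R := (sin t, cos t).

Lemma mul_dir B t x k : B *m dir t = k *: dir x <->
  act B (dirp t) = (k * (dirp x).1, k * (dirp x).2).
Proof.
have E i : (B *m dir t) i 0 = B i 0 * sin t + B i 1 * cos t.
  rewrite !mxE !big_ord_recl big_ord0 addr0 !mxE/=.
  by rewrite (_ : lift ord0 ord0 = 1)//; exact: val_inj.
split.
  move=> /colP h; have := h 0; have := h 1; rewrite !E !mxE/= => h1 h0.
  by rewrite /act /= h0 h1.
by rewrite /act /= => -[h0 h1]; apply/colP; apply: ord2_ind; rewrite E ?h0 ?h1 !mxE.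
Qed.

Section Lift.
Variables (e : R) (v : R * R) (g : PSL2 R) (f : R -> R).
Hypotheses (e2 : e ^+ 2 = 1) (L : lifts (par e v) g) (gf : is_lift g f).
Hypothesis fix_f : exists t, f t = t.

(** The factor by which the matrix stretches [dir t] onto [dir (f t)]. *)
Let r (t : R) := (act (par e v) (dirp t)).1 * sin (f t) + (act (par e v) (dirp t)).2 * cos (f t).

Let e0 : e != 0. Proof. by rewrite -sqrf_eq0 e2 oner_eq0. Qed.

Let act_r t : act (par e v) (dirp t) = (r t * sin (f t), r t * cos (f t)).
Proof.
have [_ /(_ t)[k]] := gf; have [->|->] := lifts_uniq (lifts_ex g) L.
  move=> /mul_dir E; rewrite /r E /=; have h := cos2Dsin2 (f t); congr (_, _).
    by rewrite -[LHS]mulr1 -h; ring.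
  by rewrite -[LHS]mulr1 -h; ring.
rewrite mulNmx => /eqP; rewrite eqr_oppLR -scaleNr => /eqP/mul_dir E.
rewrite /r E /=; have h := cos2Dsin2 (f t); congr (_, _).
  by rewrite -[LHS]mulr1 -h; ring.
by rewrite -[LHS]mulr1 -h; ring.
Qed.

Let cross t : r t * sin (t - f t) = - e * w2 v (dirp t) ^+ 2.
Proof.
transitivity (w2 (dirp t) (act (par e v) (dirp t))).
  by rewrite act_r /w2 /= sinB; ring.
by rewrite act_par /w2 /=; ring.
Qed.

Lemma lift_fixed t : f t = t -> w2 v (dirp t) = 0.
Proof.
move=> ft; have := cross t; rewrite ft subrr sin0 mulr0 => /esym/eqP.
by rewrite mulNr oppr_eq0 mulf_eq0 (negbTE e0) expf_eq0/= => /eqP.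
Qed.

Let r_neq0 t : r t != 0.
Proof.
apply/eqP => r0; have := act_r t; rewrite r0 !mul0r => h.
have d0 : dirp t != 0 by apply/eqP => -[s0 c0]; exact: (@cos_sin_eq0 t).
by have := act_neq0 (par_det e v) d0; rewrite h eqxx.
Qed.

Let r_cont : continuous r.
Proof.
have [cf _] := gf.
have cs : continuous (fun t : R => sin t) by exact: continuous_sin.
have cc : continuous (fun t : R => cos t) by exact: continuous_cos.
have csf : continuous (fun t : R => sin (f t)).
  by move=> t; apply: continuous_comp; [exact: cf|exact: continuous_sin].
have ccf : continuous (fun t : R => cos (f t)).
  by move=> t; apply: continuous_comp; [exact: cf|exact: continuous_cos].
rewrite /r /act /=.
by apply: continuous_add; apply: continuous_mul => //; apply: continuous_add;
  apply: continuous_mul => //; exact: continuous_const.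
Qed.

(** The factor is continuous and never zero, and it equals 1 at the fixed point of the lift. *)
Lemma lift_pos t : exists2 k, 0 < k &
  act (par e v) (dirp t) = (k * sin (f t), k * cos (f t)).
Proof.
exists (r t); last exact: act_r.
have [t0 ft0] := fix_f; have r0 : r t0 = 1.
  have w0 := lift_fixed ft0; rewrite /r act_par w0 ft0 !mulr0 !mul0r !addr0 /=.
  by rewrite -!expr2 addrC cos2Dsin2.
rewrite ltNge le_eqVlt (negbTE (r_neq0 t)) /=; apply/negP => rt.
have ivt a b : a <= b -> Num.min (r a) (r b) <= 0 <= Num.max (r a) (r b) -> False.
  move=> ab h; have [||c _ rc] := @IVT R r a b 0 ab => //; first exact: continuous_subspaceT.
  by have := r_neq0 c; rewrite rc eqxx.
have [tt|tt] := leP t t0.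
  by apply: (ivt _ _ tt); rewrite r0 ge_min le_max (ltW rt) ler01 orbT.
by apply: (ivt _ _ (ltW tt)); rewrite r0 ge_min le_max (ltW rt) ler01 orbT.
Qed.

(** The cross product of a vector with its image has a sign given by [e], so the sine of the
    displacement times [e] is never negative. As the displacement vanishes at the fixed point, a
    negative value elsewhere would make it pass through the interval from [- pi / 2] to 0. *)
Lemma lift_ge t : 0 <= e * (f t - t).
Proof.
have [t0 ft0] := fix_f; pose h s := e * (f s - s); have h0 : h t0 = 0.
  by rewrite /h ft0 subrr mulr0.
have sin_ge s : 0 <= sin (h s).
  have [k k0 E] := lift_pos s; have c : k * sin (s - f s) = - e * w2 v (dirp s) ^+ 2.
    transitivity (w2 (dirp s) (act (par e v) (dirp s))).
      by rewrite E /w2 /= sinB; ring.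
    by rewrite act_par /w2 /=; ring.
  rewrite -(pmulr_rge0 _ k0) /h; have -> : k * sin (e * (f s - s)) = w2 v (dirp s) ^+ 2.
    have := c; have [->|->] := sign_cases e2; rewrite -(opprB (f s)) ?mul1r ?mulN1r ?opprK sinN; lra.
  exact: sqr_ge0.
rewrite leNgt; apply/negP => ht; rewrite -/(h t) in ht.
have hc : continuous h.
  have [cf _] := gf; apply: continuous_mul; first exact: continuous_const.
  by apply: continuous_sub => // x; exact: cvg_id.
have pi0 : 0 < pi :> R := pi_gt0 R.
pose y := Num.max (h t) (- (pi / 2)).
have y0 : y < 0 by rewrite gt_max ht oppr_lt0 divr_gt0.
have yp : - (pi / 2) <= y by rewrite le_max lexx orbT.
have hy : h t <= y by rewrite le_max lexx.
clearbody y; have [s hs] : exists s, h s = y.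
  have [tt|tt] := leP t t0.
    have [||s _ hs] := @IVT _ h t t0 y tt; last by exists s.
      exact: continuous_subspaceT.
    by rewrite h0 ge_min le_max hy (ltW y0) orbT.
  have [||s _ hs] := @IVT _ h t0 t y (ltW tt); last by exists s.
    exact: continuous_subspaceT.
  by rewrite h0 ge_min le_max hy (ltW y0) orbT.
have := sin_ge s; rewrite hs leNgt -oppr_gt0 -sinN sin_gt0_pi//.
by rewrite oppr_gt0 y0/=; lra.
Qed.

End Lift.

(* If the three parabolics rotate in the same direction and the product of the
   lifts is the identity, then the fixed points of the fourth are common to all. *)
Lemma euler_same_sign (rho : rep R) (e a b c : R) k : e ^+ 2 = 1 ->
  coords e e e 1 rho a b c -> euler_class rho k -> k \in [:: -1; 0; 1] -> False.
Proof.
move=> e2 C [f [fP fE]] kI.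
have e0 : e != 0 by rewrite -sqrf_eq0 e2 oner_eq0.
have n0 := coords_neq0 C.
have [v1 [v2 [v3 [[f1 f2 f3] [wa wb wc E]]]]] := C.
have [e4 [v4 [e42 _ f4]]] := parabolic_par (rep_parabolic rho (inord 3)).
have [tE _ tP] := total_trace_typed (expr1n R 2) (And3 f1 f2 f3) f4.
rewrite wa wb wc in tE; have {tE tP} P1 := tP (tE.2 E).
pose P (B : 'M[R]_2) (h : R -> R) := forall t, exists2 K, 0 < K &
  act B (dirp t) = (K * sin (h t), K * cos (h t)).
have Pc B B' h h' : P B h -> P B' h' -> P (B *m B') (h \o h').
  move=> PB PB' t; have [K' K'0 E'] := PB' t; have [K K0 EB] := PB (h' t).
  exists (K' * K); first exact: mulr_gt0.
  transitivity (act B (act B' (dirp t))).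
    by rewrite /act mulmx2E !mx2E /=; congr (_, _); ring.
  rewrite E'; transitivity (K' * (act B (dirp (h' t))).1, K' * (act B (dirp (h' t))).2).
    by rewrite /act /=; congr (_, _); ring.
  by rewrite EB /= !mulrA.
have [L1 x1] := fP (inord 0); have [L2 x2] := fP (inord 1).
have [L3 x3] := fP (inord 2); have [L4 x4] := fP (inord 3).
(* The matrices have product 1 and positive factors, so the total shift by [k pi] must satisfy
   [cos (k pi) > 0], which excludes [k = 1] and [k = -1]. *)
have := Pc _ _ _ _ (Pc _ _ _ _ (lift_pos e2 f1 L1 x1) (lift_pos e2 f2 L2 x2))
  (Pc _ _ _ _ (lift_pos e2 f3 L3 x3) (lift_pos e42 f4 L4 x4)).
move=> /(_ 0)[K K0]; rewrite P1 /= fE add0r /act scalar_mx2 !mx2E /= cos0 sin0 => -[_ hc].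
have k0 : k = 0.
  move: kI hc; rewrite !inE => /or3P[]/eqP-> //.
    have -> : (-1)%:~R = -1 :> R by [].
    by rewrite mulN1r cosN cospi => h; exfalso; lra.
  have -> : 1%:~R = 1 :> R by [].
  by rewrite !mul1r cospi => h; exfalso; lra.
have [t4 ft4] := x4; have := fE t4; rewrite k0 mul0r addr0 ft4 => F.
have g3 := lift_ge e2 f3 L3 x3 t4; have g2 := lift_ge e2 f2 L2 x2 (f (inord 2) t4).
have g1 := lift_ge e2 f1 L1 x1 (f (inord 1) (f (inord 2) t4)); rewrite F in g1.
move: g1 g2 g3; set y := f (inord 2) t4; set z := f (inord 1) y => g1 g2 g3.
(* Three nonnegative displacements along a closed path: all vanish. *)
have s0 : e * (t4 - z) + e * (z - y) + e * (y - t4) = 0 by ring.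
have eq0 (p q : R) : e * (p - q) = 0 -> p = q.
  by move/eqP; rewrite mulf_eq0 (negbTE e0) subr_eq0 => /eqP.
have yt : y = t4 by apply: eq0; lra.
have zt : z = t4 by rewrite -yt; apply: eq0; lra.
have w3 := lift_fixed e2 f3 L3 yt.
have w2' : w2 v2 (dirp t4) = 0 by apply: (lift_fixed e2 f2 L2); rewrite -{1}yt.
have w1 : w2 v1 (dirp t4) = 0 by apply: (lift_fixed e2 f1 L1); rewrite -{1}zt.
have par0 (u w : R * R) : w2 u (dirp t4) = 0 -> w2 w (dirp t4) = 0 -> w2 u w = 0.
  move=> hu hw; have := cos2Dsin2 t4 => cs.
  have h1 : w2 u w * sin t4 = 0.
    transitivity (w2 u (dirp t4) * w.1 - w2 w (dirp t4) * u.1); first by rewrite /w2 /=; ring.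
    by rewrite hu hw !mul0r subrr.
  have h2 : w2 u w * cos t4 = 0.
    transitivity (w2 u (dirp t4) * w.2 - w2 w (dirp t4) * u.2); first by rewrite /w2 /=; ring.
    by rewrite hu hw !mul0r subrr.
  by rewrite -[LHS]mulr1 -cs mulrDr !expr2 !mulrA h1 h2 !mul0r addr0.
by move: n0; rewrite -wa -wb -wc (par0 _ _ w1 w2') (par0 _ _ w2' w3) (par0 _ _ w1 w3) eqxx.
Qed.

End Types.

(** * Charts and null sets of classes *)

Section Calculus.
Variable R : realType.
Local Notation pt := (R * R)%type.

Lemma is_derive_line (f : pt -> R) (t v : pt) (d : R) :
  is_derive (0 : R) 1 (fun h : R => f (h *: v + t)) d <-> is_derive t v f d.
Proof.
have E : 'D_1 (fun h : R => f (h *: v + t)) 0 = 'D_v f t.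
  rewrite /derive; set g1 := fun h => h^-1 *: _; set g2 := fun h => h^-1 *: _.
  suff -> : g1 = g2 by []; apply/funext => h; rewrite /g1 /g2 /=.
  by rewrite addr0 scale0r add0r [_%:A]mulr1.
split=> -[h1 h2].
  by apply: (DeriveDef ((derivable1P f t v).2 h1)); rewrite -E.
by apply: (DeriveDef ((derivable1P f t v).1 h1)); rewrite E.
Qed.

Lemma is_derive_comp2 (g : R -> R) (f : pt -> R) (t v : pt) (a b : R) :
  is_derive (f t) 1 g a -> is_derive t v f b -> is_derive t v (fun x => g (f x)) (a * b).
Proof.
move=> dg /is_derive_line df; apply/is_derive_line.
have dg0 : is_derive (f (0 *: v + t)) 1 g a by rewrite scale0r add0r.
exact: (is_derive1_comp dg0 df).
Qed.

(** The directional derivatives are carried as arbitrary functions agreeing with them on [D], so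
    that the closure rules follow from formulas. *)
Definition C1 (D : set pt) (f : pt -> R) :=
  (forall t, D t -> {for t, continuous f}) /\
  forall v, exists f' : pt -> R, forall t, D t ->
    is_derive t v f (f' t) /\ {for t, continuous f'}.

Section Closure.
Variable D : set pt.

Lemma C1_cst (c : R) : C1 D (fun=> c).
Proof.
split=> [t _|v]; first exact: cvg_cst.
by exists (fun=> 0) => t _; split; [exact: is_derive_cst|exact: cvg_cst].
Qed.

Lemma C1_add f g : C1 D f -> C1 D g -> C1 D (fun t => f t + g t).
Proof.
move=> [cf df] [cg dg]; split=> [t Dt|v]; first by apply: cvgD; [exact: cf|exact: cg].
have [f' f'P] := df v; have [g' g'P] := dg v; exists (fun t => f' t + g' t) => t Dt.
have [h1 h2] := f'P t Dt; have [h3 h4] := g'P t Dt.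
by split; [exact: (is_deriveD h1 h3)|exact: cvgD].
Qed.

Lemma C1_mul f g : C1 D f -> C1 D g -> C1 D (fun t => f t * g t).
Proof.
move=> [cf df] [cg dg]; split=> [t Dt|v]; first by apply: cvgM; [exact: cf|exact: cg].
have [f' f'P] := df v; have [g' g'P] := dg v; exists (fun t => f t * g' t + g t * f' t) => t Dt.
have [h1 h2] := f'P t Dt; have [h3 h4] := g'P t Dt; have := cf t Dt; have := cg t Dt => h5 h6.
split; first exact: (is_deriveM h1 h3).
by apply: cvgD; apply: cvgM.
Qed.

Lemma C1_comp g g' f : C1 D f -> (forall t, D t -> is_derive (f t) 1 g (g' (f t))) ->
  (forall t, D t -> {for f t, continuous g'}) -> C1 D (fun t => g (f t)).
Proof.
move=> [cf df] dg cg'; split=> [t Dt|v].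
  apply: (@continuous_comp _ _ _ f g); first exact: cf.
  by apply/differentiable_continuous/derivable1_diffP; have [] := dg t Dt.
have [f' f'P] := df v; exists (fun t => g' (f t) * f' t) => t Dt.
have [h1 h2] := f'P t Dt; split; first exact: is_derive_comp2 (dg t Dt) h1.
apply: cvgM => //; apply: (@continuous_comp _ _ _ f g'); first exact: cf.
exact: cg'.
Qed.

Lemma C1_opp f : C1 D f -> C1 D (fun t => - f t).
Proof.
move=> h; have := C1_mul (C1_cst (-1)) h; congr C1.
by apply/funext => t; rewrite mulN1r.
Qed.

Lemma C1_sub f g : C1 D f -> C1 D g -> C1 D (fun t => f t - g t).
Proof. by move=> hf hg; exact: C1_add hf (C1_opp hg). Qed.

Lemma C1_inv f : C1 D f -> (forall t, D t -> f t != 0) -> C1 D (fun t => (f t)^-1).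
Proof.
move=> hf f0; apply: (C1_comp (g := GRing.inv) (g' := fun x => - x ^- 2 *: 1) hf) => t Dt.
  exact: (@is_deriveV R id (f t) 1 1 (f0 t Dt) (is_derive_id _ _)).
have c : {for f t, continuous (fun x : R => x ^+ 2)} by exact: exprn_continuous.
rewrite /= ; apply: cvgZr_tmp; apply: cvgN; apply: cvgV => //.
by rewrite expf_neq0// f0.
Qed.

Lemma C1_div f g : C1 D f -> C1 D g -> (forall t, D t -> g t != 0) ->
  C1 D (fun t => f t / g t).
Proof. by move=> hf hg g0; exact: C1_mul hf (C1_inv hg g0). Qed.

Lemma C1_fst : C1 D fst.
Proof.
split=> [t _|v]; first exact: cvg_fst.
exists (fun=> v.1) => t _; split; last exact: cvg_cst.
apply/is_derive_line => /=.
have h := is_deriveD (is_deriveM (is_derive_id (0 : R) 1) (is_derive_cst v.1 (0 : R) 1))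
  (is_derive_cst t.1 (0 : R) 1).
by apply: (is_derive_eq h); rewrite scaler0 add0r addr0 /cst [LHS]mulr1.
Qed.

Lemma C1_snd : C1 D snd.
Proof.
split=> [t _|v]; first exact: cvg_snd.
exists (fun=> v.2) => t _; split; last exact: cvg_cst.
apply/is_derive_line => /=.
have h := is_deriveD (is_deriveM (is_derive_id (0 : R) 1) (is_derive_cst v.2 (0 : R) 1))
  (is_derive_cst t.2 (0 : R) 1).
by apply: (is_derive_eq h); rewrite scaler0 add0r addr0 /cst [LHS]mulr1.
Qed.

Lemma C1_exp f : C1 D f -> C1 D (fun t => expR (f t)).
Proof.
move=> hf; apply: (@C1_comp expR expR) => // t Dt.
exact: continuous_expR.
Qed.

Lemma C1_cos f : C1 D f -> C1 D (fun t => cos (f t)).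
Proof.
move=> hf; apply: (@C1_comp cos (fun x => - sin x)) => // t Dt.
by apply: cvgN; exact: continuous_sin.
Qed.

Lemma C1_sqrt f : C1 D f -> (forall t, D t -> 0 < f t) -> C1 D (fun t => Num.sqrt (f t)).
Proof.
move=> hf f0; apply: (@C1_comp Num.sqrt (fun x => (2 * Num.sqrt x)^-1)) => // t Dt.
  by apply: is_derive1_sqrt; exact: f0.
apply: cvgV; first by rewrite mulf_neq0// sqrtr_eq0 -ltNge f0.
by apply: cvgM; [exact: cvg_cst|exact: sqrt_continuous].
Qed.

End Closure.

Lemma C1_sub_dom (D D' : set pt) f : D' `<=` D -> C1 D f -> C1 D' f.
Proof.
move=> DD [cf df]; split=> [t /DD|v]; first exact: cf.
by have [f' f'P] := df v; exists f' => t /DD; exact: f'P.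
Qed.

Lemma C1_derivable (D : set pt) f : open D -> C1 D f -> forall t v, D t ->
  derivable f t v /\ {for t, continuous ('D_v f)}.
Proof.
move=> oD [cf df] t v Dt; have [f' f'P] := df v.
have [[h1 h2] h3] := f'P t Dt; split => //.
have e : {near t, f' =1 'D_v f}.
  have : nbhs t D by exact: open_nbhs_nbhs.
  by apply: filterS => s Ds; have [[_ ->]] := f'P s Ds.
have h4 : f' @ t --> 'D_v f t by rewrite h2; exact: h3.
suff : 'D_v f @ t --> 'D_v f t by [].
apply: cvg_trans h4.
exact: near_eq_cvg.
Qed.

Lemma C1_constant_derive (D : set pt) f (c : R) : open D -> (forall t, D t -> f t = c) ->
  forall t v, D t -> 'D_v f t = 0.
Proof.
move=> oD fc t v Dt; rewrite (@near_eq_derive _ _ _ f (cst c)) ?derive_cst//.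
have : nbhs t D by exact: open_nbhs_nbhs.
by apply: filterS => s /fc.
Qed.

Definition mxC1 (D : set pt) (A : pt -> 'M[R]_2) := forall i j, C1 D (fun t => A t i j).

Lemma mxC1_mul D A B : mxC1 D A -> mxC1 D B -> mxC1 D (fun t => A t *m B t).
Proof.
move=> hA hB; rewrite /mxC1; under eq_forall do under eq_forall do under eq_fun do rewrite mulmx2E.
 apply: ord2_ind; apply: ord2_ind; under eq_fun do rewrite mx2E;
  by apply: C1_add; apply: C1_mul.
Qed.

Lemma mxC1_mx2 D p q r s : C1 D p -> C1 D q -> C1 D r -> C1 D s ->
  mxC1 D (fun t => mx2 (p t) (q t) (r t) (s t)).
Proof. by move=> hp hq hr hs; apply: ord2_ind; apply: ord2_ind; under eq_fun do rewrite mx2E. Qed.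

Lemma mxC1_adj D A : mxC1 D A -> mxC1 D (fun t => adj2 (A t)).
Proof. by move=> hA; apply: mxC1_mx2; [exact: hA|apply: C1_opp; exact: hA|apply: C1_opp; exact: hA|exact: hA]. Qed.

Lemma mxC1_par D (e : R) (v : pt -> pt) : C1 D (fun t => (v t).1) -> C1 D (fun t => (v t).2) ->
  mxC1 D (fun t => par e (v t)).
Proof.
move=> h1 h2; apply: mxC1_mx2.
- by apply: C1_sub; [exact: C1_cst|apply: C1_mul => //; apply: C1_mul => //; exact: C1_cst].
- under eq_fun do rewrite expr2; apply: C1_mul; first exact: C1_cst.
  exact: C1_mul.
- under eq_fun do rewrite expr2; apply: C1_mul; first exact: C1_cst.
  exact: C1_mul.
- by apply: C1_add; [exact: C1_cst|apply: C1_mul => //; apply: C1_mul => //; exact: C1_cst].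
Qed.

Lemma mxC1_derivable (D : set pt) A : open D -> mxC1 D A -> forall t v, D t ->
  [/\ derivable A t v, {for t, continuous ('D_v A)} &
      forall i j, 'D_v A t i j = 'D_v (fun s => A s i j) t].
Proof.
move=> oD hA t v Dt.
have dA s : D s -> derivable A s v.
  by move=> Ds; apply/derivable_mxP => i j; have [] := C1_derivable oD (hA i j) v Ds.
have E s : D s -> 'D_v A s = \matrix_(i, j) 'D_v (fun s => A s i j) s.
  by move=> Ds; rewrite derive_mx//; exact: dA.
split; [exact: dA| |by move=> i j; rewrite E// mxE].
have cE i j : {for t, continuous ('D_v (fun s => A s i j))}.
  by have [] := C1_derivable oD (hA i j) v Dt.
rewrite /continuous_at; move=> P [Q Qn QP].
have nD : nbhs t D by exact: open_nbhs_nbhs.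
have : nbhs t [set s | forall i j, Q i j ('D_v (fun s => A s i j) s)].
  have H i j : nbhs t [set s | Q i j ('D_v (fun s => A s i j) s)].
    have := Qn i j; rewrite E// mxE => h; exact: cE h.
  apply: filterS (filterI (filterI (H 0 0) (H 0 1)) (filterI (H 1 0) (H 1 1))).
  by move=> s [[h1 h2] [h3 h4]]; do 2!apply: ord2_ind.
by apply: filterS2 nD => s Ds Qs; apply: QP => i j; rewrite E// mxE; exact: Qs.
Qed.

End Calculus.

Section NullIntegral.
Import HBNNSimple.
Local Open Scope ereal_scope.
Context d (T : measurableType d) (R : realType).
Variable m : {measure set T -> \bar R}.

(** [f] is arbitrary because the density of a chart is obtained by choice at each point. A
    nonnegative simple function below [f] on [N] and below 0 elsewhere is supported in [N]. *)
Lemma ge0_integral_null (N : set T) (f : T -> \bar R) : measurable N -> m N = 0 ->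
  (forall x, 0 <= f x) -> \int[m]_(x in N) f x = 0.
Proof.
move=> mN N0 f0; apply/eqP; rewrite eq_le integral_ge0// andbT.
rewrite ge0_integralE//; apply: ub_ereal_sup => _ [h /= hf <-].
rewrite le_eqVlt; apply/orP; left; apply/eqP; rewrite sintegralE.
apply: fsbig1 => x _; have [->|x0] := eqVneq x 0%R; first by rewrite mul0e.
have mh : measurable (h @^-1` [set x]) by exact: measurable_sfunP.
have sub : h @^-1` [set x] `<=` N.
  move=> t ht; apply: contrapT => Nt; have := hf t; rewrite /patch memNset// ht lee_fin => h1.
  have h2 : (0 <= h t)%R by exact: fun_ge0.
  rewrite (ht : h t = x) in h2.
  by move/eqP: x0; apply; apply/eqP; rewrite eq_le h1 h2.
by rewrite (subset_measure0 mh mN sub N0) mule0.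
Qed.

End NullIntegral.

Section Primitive.
Variable R : realType.

(* With Ad (A) X - X = u and u = B A^-1, the primitive solves A X - X A = B. *)
Lemma cocycle_primitive (A B : 'M[R]_2) : \det A = 1 -> \tr A ^+ 2 = 4 ->
  A <> 1%:M -> A <> - 1%:M -> \tr B = 0 -> \tr (B *m adj2 A) = 0 ->
  exists X, \tr X = 0 /\ B *m invmx A = Ad A X - X.
Proof.
move=> dA tA A1 AN1 tB tBA; have uA : A \in unitmx by rewrite unitmxE dA unitr1.
suff [X tX E] : exists2 X, \tr X = 0 & A *m X - X *m A = B.
  by exists X; split => //; rewrite -E mulmxBl mulmxK.
move: dA tA tB tBA; rewrite det_mx2 !tr_mx2 mulmx2E /adj2 !mx2E => dA tA tB tBA.
have hB : B 1 1 = - B 0 0 by apply/eqP; rewrite -addr_eq0 addrC tB.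
rewrite hB in tBA.
have sol x y z : A 0 1 * z - A 1 0 * y = B 0 0 ->
    (A 0 0 - A 1 1) * y - 2 * A 0 1 * x = B 0 1 ->
    2 * A 1 0 * x - (A 0 0 - A 1 1) * z = B 1 0 ->
    exists2 X, \tr X = 0 & A *m X - X *m A = B.
  move=> h1 h2 h3; exists (mx2 x y z (- x)); first by rewrite tr_mx2 !mx2E subrr.
  by apply: mx2P; rewrite !mulmx2E !mxE/= ?hB -?h1 -?h2 -?h3; ring.
have [q0|q0] := eqVneq (A 0 1) 0; last first.
  apply: (sol (- B 0 1 / (2 * A 0 1)) 0 (B 0 0 / A 0 1)); [by field|by field|].
  apply: (mulfI q0).
  transitivity (- (A 1 0 * B 0 1) - (A 0 0 - A 1 1) * B 0 0); first by field.
  lra.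
have [r0|r0] := eqVneq (A 1 0) 0; last first.
  apply: (sol (B 1 0 / (2 * A 1 0)) (- B 0 0 / A 1 0) 0); [by field| |by field].
  apply: (mulfI r0).
  transitivity (- (A 0 0 - A 1 1) * B 0 0 - A 0 1 * B 1 0); first by field.
  lra.
exfalso; rewrite q0 r0 mul0r subr0 in dA.
have pt : A 0 0 = A 1 1.
  have : (A 0 0 - A 1 1) ^+ 2 = 0.
    transitivity ((A 0 0 + A 1 1) ^+ 2 - 4 * (A 0 0 * A 1 1)); first by ring.
    by rewrite tA dA; ring.
  by move/eqP; rewrite sqrf_eq0 subr_eq0 => /eqP.
have : A 0 0 ^+ 2 = 1 by rewrite -dA -pt expr2.
move=> /sign_cases[h|h].
  by apply: A1; apply: mx2P; rewrite ?scalar_mx2 ?mx2E -?pt ?h ?q0 ?r0.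
by apply: AN1; apply: mx2P; rewrite scalar_mx2 opp_mx2 !mx2E ?oppr0 -?pt ?h ?q0 ?r0.
Qed.

End Primitive.

(** * Smooth families of representations *)

Section Charts.
Variable R : realType.
Local Notation pt := (R * R)%type.
Local Notation mu2 := (@lebesgue_measure R \x @lebesgue_measure R)%E.
Local Notation plane := (measurableTypeR R * measurableTypeR R)%type.

(* Unlike a [parametrization], a [chart] can be precomposed with a mapping class;
   the density of the Goldman form always exists since the lifts are parabolic. *)
Record chart : Type := Chart {
  cdom : set pt;
  cfam : pt -> rep R;
  clft : 'I_4 -> pt -> 'M[R]_2;
  cdom_open : open cdom;
  clft_fam : forall i t, cdom t -> lifts (clft i t) (cfam t (loop i));
  clft_C1 : forall i, mxC1 cdom (clft i);
  cfam_inj : forall t t', cdom t -> cdom t' ->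
    \pi_(moduli R) (cfam t) = \pi_(moduli R) (cfam t') -> t = t' }.

Let derive_entry (D : set pt) (A : pt -> 'M[R]_2) t v i j : open D -> mxC1 D A -> D t ->
  is_derive t v (fun s => A s i j) ('D_v A t i j).
Proof.
move=> oD cA Dt; have [_ _ E] := mxC1_derivable oD cA v Dt.
by rewrite E; apply/derivableP; have [] := C1_derivable oD (cA i j) v Dt.
Qed.

(** These are the derivatives of the constants [tr^2 = 4] and [det = 1]. *)
Lemma chart_tangent (c : chart) i t v : cdom c t ->
  \tr ('D_v (clft c i) t) = 0 /\ \tr ('D_v (clft c i) t *m adj2 (clft c i t)) = 0.
Proof.
move=> Dt; have oD := @cdom_open c; have dE k l := derive_entry v k l oD (@clft_C1 c i) Dt.
have Lf s (Ds : cdom c s) := @clft_fam c i s Ds.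
have par s (Ds : cdom c s) := (parabolicE (Lf s Ds)).1 (rep_parabolic (cfam c s) i).
set A := clft c i in dE Lf par *.
split.
- have [_ E] : is_derive t v (fun s => (A s 0 0 + A s 1 1) * (A s 0 0 + A s 1 1)) _ :=
    is_deriveM (is_deriveD (dE 0 0) (dE 1 1)) (is_deriveD (dE 0 0) (dE 1 1)).
  have E0 : 'D_v (fun s => (A s 0 0 + A s 1 1) * (A s 0 0 + A s 1 1)) t = 0.
    apply: (C1_constant_derive (c := 4)) oD _ _ _ Dt => s Ds.
    by have [_ _] := par s Ds; rewrite tr_mx2 expr2.
  have t0 : A t 0 0 + A t 1 1 != 0.
    rewrite -sqrf_eq0 -tr_mx2; have [_ _ ->] := par t Dt.
    by rewrite pnatr_eq0.
  move: E; rewrite E0 tr_mx2 => /esym/eqP.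
  rewrite -[X in X == _]/((A t 0 0 + A t 1 1) * ('D_v A t 0 0 + 'D_v A t 1 1)
    + (A t 0 0 + A t 1 1) * ('D_v A t 0 0 + 'D_v A t 1 1)).
  by rewrite -mulr2n mulrn_eq0/= mulf_eq0 (negbTE t0) => /eqP.
- have [_ E] : is_derive t v (fun s => A s 0 0 * A s 1 1 - A s 0 1 * A s 1 0) _ :=
    is_deriveB (is_deriveM (dE 0 0) (dE 1 1)) (is_deriveM (dE 0 1) (dE 1 0)).
  have E0 : 'D_v (fun s => A s 0 0 * A s 1 1 - A s 0 1 * A s 1 0) t = 0.
    apply: (C1_constant_derive (c := 1)) oD _ _ _ Dt => s Ds.
    by rewrite -det_mx2 (lifts_det (Lf s Ds)).
  rewrite tr_mx2 mulmx2E /adj2 !mx2E -[RHS]E0 E.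
  rewrite -[RHS]/(A t 0 0 * 'D_v A t 1 1 + A t 1 1 * 'D_v A t 0 0
    - (A t 0 1 * 'D_v A t 1 0 + A t 1 0 * 'D_v A t 0 1)).
  by ring.
Qed.

Lemma chart_parametrization (c : chart) :
  exists p : parametrization R, dom p = cdom c /\ fam p = cfam c.
Proof.
have /choice[jac jacP] t : exists w, cdom c t ->
    goldman_form (clft c ^~ t) (velocity (clft c) (1, 0) t) (velocity (clft c) (0, 1) t) w.
  have [Dt|nD] := pselect (cdom c t); last by exists 0.
  have /choice[X XP] i : exists X, \tr X = 0 /\
      velocity (clft c) (0, 1) t i = Ad (clft c i t) X - X.
    have [t1 t2] := chart_tangent i (0, 1) Dt.
    have L := @clft_fam c i t Dt.
    have [p1 p2 p3] := (parabolicE L).1 (rep_parabolic (cfam c t) i).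
    exact: cocycle_primitive (lifts_det L) p3 p1 p2 t1 t2.
  by eexists => _; exists X; split; [exact: XP|reflexivity].
have lf i t : cdom c t -> exists2 B : SL2 R, val B = clft c i t & \pi_(PSL2 R) B = cfam c t (loop i).
  exact: clft_fam.
have lC i t e : cdom c t -> e = (1, 0) \/ e = (0, 1) ->
    derivable (clft c i) t e /\ {for t, continuous ('D_e (clft c i))}.
  by move=> Dt _; have [] := mxC1_derivable (@cdom_open c) (@clft_C1 c i) e Dt.
have inj : {in cdom c &, injective (fun t => \pi_(moduli R) (cfam c t))}.
  by move=> t t'; rewrite !inE; exact: cfam_inj.
by exists (Parametrization (@cdom_open c) lf lC inj jacP).
Qed.

(** Used in place of a vanishing [goldman_measure] because it is visibly stable under countable
    unions and mapping classes. *)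
Definition null_class (S : set (moduli R)) := exists (c : nat -> chart) (B : nat -> set pt),
  (forall n, mu2.-negligible (B n : set plane) /\ B n `<=` cdom (c n)) /\
  S `<=` \bigcup_n [set \pi_(moduli R) (cfam (c n) t) | t in B n].

Lemma null_class_measure S : null_class S -> goldman_measure S = 0%E.
Proof.
move=> [c [B [BP SB]]].
have /choice[p pP] n := chart_parametrization (c n).
have /choice[N NP] n : exists N : set plane, [/\ measurable N, mu2 N = 0%E & B n `<=` N].
  by have [[N [mN N0 BN]] _] := BP n; exists N.
apply/eqP; rewrite eq_le; apply/andP; split; last first.
  apply: le_ereal_inf_tmp => _ [q [B' [_ _ ->]]].
  by apply: nneseries_ge0 => n _ _; apply: integral_ge0.
apply: ereal_inf_lbound; exists p, (fun n => N n `&` cdom (c n)); split.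
- move=> n; have [mN _ _] := NP n; have [-> _] := pP n; split; last by move=> t [].
  apply: measurableI => //; apply: open_prod_measurable; exact: cdom_open.
- move=> x /SB[n _ [t Bt <-]]; exists n => //; exists t.
    by have [_ BD] := BP n; have [_ _ BN] := NP n; split; [exact: BN|exact: BD].
  by have [_ ->] := pP n.
- rewrite eseries0// => n _ _; have [mN N0 _] := NP n.
  have mD : measurable (N n `&` cdom (c n) : set plane).
    by apply: measurableI => //; apply: open_prod_measurable; exact: cdom_open.
  apply: ge0_integral_null => //.
  by apply: (subset_measure0 mD mN _ N0); exact: subIsetl.
Qed.

Lemma null_class_sub S S' : S `<=` S' -> null_class S' -> null_class S.
Proof. by move=> SS' [c [B [BP SB]]]; exists c, B; split => // x /SS'; exact: SB. Qed.

Lemma null_class_bigcup (S : nat -> set (moduli R)) : (forall n, null_class (S n)) ->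
  null_class (\bigcup_n S n).
Proof.
move=> /choice[c /choice[B H]].
pose dec (n : nat) : nat * nat := odflt (0, 0)%N (unpickle n).
exists (fun n => c (dec n).1 (dec n).2), (fun n => B (dec n).1 (dec n).2); split.
  by move=> n; have [+ _] := H (dec n).1; exact.
move=> x [n _ Sx]; have [_ /(_ x Sx)[k _ Bx]] := H n.
by exists (pickle (n, k)) => //; rewrite /dec pickleK.
Qed.

Lemma null_class_setU S S' : null_class S -> null_class S' -> null_class (S `|` S').
Proof.
move=> h h'; apply: (@null_class_sub _ (\bigcup_n (if n == 0%N then S else S'))).
  by move=> x [Sx|Sx]; [exists 0%N|exists 1%N].
by apply: null_class_bigcup => n; case: ifP.
Qed.

(** Precomposition with a mapping class replaces each loop by a word, and the corresponding product
    of lifts is still C1. *)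
Lemma chart_element (c : chart) x : exists2 L : pt -> 'M[R]_2, mxC1 (cdom c) L &
  forall t, cdom c t -> lifts (L t) (cfam c t x).
Proof.
rewrite -[x]reprK; elim: (repr x) => [|[i b] u [L LC LP]].
  exists (fun=> 1%:M) => [k l|t Dt]; first exact: C1_cst.
  by rewrite hom_word_val; exact: lifts_one.
exists (fun t => (if b then clft c i t else adj2 (clft c i t)) *m L t) => [|t Dt].
  apply: mxC1_mul => //; case: b; first exact: clft_C1.
  by apply: mxC1_adj; exact: clft_C1.
move: (LP t Dt); rewrite !hom_word_val /= => h; apply: lifts_mul => //.
have Li := @clft_fam c i t Dt; rewrite /letter_val; case: b => //=.
by rewrite -invmx2 ?(lifts_det Li)//; exact: lifts_inv.
Qed.

Lemma mcg_act_inj (phi : mcg) : injective (@mcg_act R phi).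
Proof.
move=> x y; rewrite -[x]reprK -[y]reprK !mcg_actE => /moduliP/asboolP[g gE].
apply/moduliP/asboolP; exists g => z; have [psi _ K] := mcg_bij phi.
by have := gE (psi z); rewrite /= K.
Qed.

Lemma null_class_preimage S (phi psi : mcg) : cancel psi phi -> null_class S ->
  null_class (mcg_act phi @^-1` S).
Proof.
move=> K [c [B [BP SB]]].
have /choice[L LP] n : exists L : pi1 -> pt -> 'M[R]_2, forall x,
    mxC1 (cdom (c n)) (L x) /\ forall t, cdom (c n) t -> lifts (L x t) (cfam (c n) t x).
  have H x : exists L : pt -> 'M[R]_2, mxC1 (cdom (c n)) L /\
      forall t, cdom (c n) t -> lifts (L t) (cfam (c n) t x).
    by have [l h1 h2] := chart_element (c n) x; exists l.
  by have [L LP] := choice H; exists L.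
have lf n i t : cdom (c n) t -> lifts (L n (psi (loop i)) t) (precomp psi (cfam (c n) t) (loop i)).
  by move=> Dt; have [_] := LP n (psi (loop i)); exact.
have lC n i : mxC1 (cdom (c n)) (L n (psi (loop i))) by have [] := LP n (psi (loop i)).
have inj n t t' : cdom (c n) t -> cdom (c n) t' ->
    \pi_(moduli R) (precomp psi (cfam (c n) t)) = \pi_(moduli R) (precomp psi (cfam (c n) t')) -> t = t'.
  move=> Dt Dt'; rewrite -!mcg_actE => /mcg_act_inj; exact: cfam_inj.
exists (fun n => Chart (@cdom_open (c n)) (lf n) (lC n) (inj n)), B; split => //.
move=> x /=; rewrite -[x]reprK; move: (repr x) => r /SB[n _ [t Bt e]]; exists n => //; exists t => //=.
rewrite -mcg_actE e [mcg_act phi _](mcg_actE phi r) mcg_actE; apply/moduliP/asboolP; exists 1%g => z /=.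
by rewrite K mul1g invg1 mulg1.
Qed.

Section Coordinates.
Variables e1 e2 e3 sg : R.
Hypotheses (e11 : e1 ^+ 2 = 1) (e22 : e2 ^+ 2 = 1) (e33 : e3 ^+ 2 = 1) (sg2 : sg ^+ 2 = 1).
Variable rho0 : rep R.
Notation coords := (coords e1 e2 e3 sg).
Notation valid := (valid e1 e2 e3 sg).

Definition coord_set (S : set (moduli R)) (a b c : R) :=
  exists rho : rep R, S (\pi_(moduli R) rho) /\ coords rho a b c.

Lemma valid_neq0 a b c : valid a b c -> a != 0 \/ b != 0.
Proof. by move=> [_ /or3P[] /andP[h1 h2] _]; [left|left|right]. Qed.

Lemma coord_setE (S : set (moduli R)) (rho : rep R) a b c : coords rho a b c ->
  coord_set S a b c <-> S (\pi_(moduli R) rho).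
Proof.
move=> C; split=> [[rho' [S' C']]|Sr]; last by exists rho.
by rewrite (coords_inj (coords_neq0 C) C C').
Qed.

Section Family.
Variables (D : set pt) (a b c : pt -> R) (v1 v2 v3 : pt -> pt).
Hypothesis oD : open D.
Hypothesis ex : forall t, D t -> exists rho : rep R, framed e1 e2 e3 rho (v1 t) (v2 t) (v3 t).
Hypothesis wv : forall t, D t -> [/\ w2 (v1 t) (v2 t) = a t, w2 (v2 t) (v3 t) = b t,
   w2 (v1 t) (v3 t) = c t & valid (a t) (b t) (c t)].

(** [adj2] is the inverse in determinant 1 and is linear in the entries, so the fourth lift is as
    smooth as the others. *)
Definition family_lift (i : 'I_4) (t : pt) : 'M[R]_2 :=
  nth 1%:M [:: par e1 (v1 t); par e2 (v2 t); par e3 (v3 t);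
    adj2 (par e1 (v1 t) *m par e2 (v2 t) *m par e3 (v3 t))] i.

Lemma family_liftE t : ((family_lift (inord 0) t = par e1 (v1 t)) *
  (family_lift (inord 1) t = par e2 (v2 t)) * (family_lift (inord 2) t = par e3 (v3 t)) *
  (family_lift (inord 3) t = adj2 (par e1 (v1 t) *m par e2 (v2 t) *m par e3 (v3 t))))%type.
Proof. by rewrite /family_lift !inordK. Qed.

Lemma family_ex : exists F : pt -> rep R, forall t, D t ->
  coords (F t) (a t) (b t) (c t) /\ forall i, lifts (family_lift i t) (F t (loop i)).
Proof.
have /choice[F FP] : forall t, exists rho : rep R, D t -> framed e1 e2 e3 rho (v1 t) (v2 t) (v3 t).
  move=> t; have [Dt|nD] := pselect (D t); last by exists rho0.
  by have [rho h] := ex Dt; exists rho.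
exists F => t Dt; have [f1 f2 f3] := FP t Dt; have [wa wb wc V] := wv Dt.
split; first by exists (v1 t), (v2 t), (v3 t); split => //; split => //; case: V.
apply: ord4_ind; rewrite !family_liftE//.
have L := lifts_mul (lifts_mul f1 f2) f3.
rewrite -invmx2 ?(lifts_det L)//.
have -> : F t (loop (inord 3)) = ((F t (loop (inord 0)) * F t (loop (inord 1)) *
    F t (loop (inord 2)))^-1)%g.
  apply: (mulgI (F t (loop (inord 0)) * F t (loop (inord 1)) * F t (loop (inord 2)))%g).
  by rewrite mulgV -!gmulfM loop_prod gmorph1.
exact: lifts_inv.
Qed.

Lemma family_C1 : C1 D (fun t => (v1 t).1) -> C1 D (fun t => (v1 t).2) ->
  C1 D (fun t => (v2 t).1) -> C1 D (fun t => (v2 t).2) ->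
  C1 D (fun t => (v3 t).1) -> C1 D (fun t => (v3 t).2) -> forall i, mxC1 D (family_lift i).
Proof.
move=> p1 q1 p2 q2 p3 q3; have h1 : mxC1 D (fun t => par e1 (v1 t)) by exact: mxC1_par.
have h2 : mxC1 D (fun t => par e2 (v2 t)) by exact: mxC1_par.
have h3 : mxC1 D (fun t => par e3 (v3 t)) by exact: mxC1_par.
apply: ord4_ind => k l; under eq_fun do rewrite family_liftE; [exact: h1|exact: h2|exact: h3|].
exact: (mxC1_adj (mxC1_mul (mxC1_mul h1 h2) h3)).
Qed.

Lemma family_null (B : set pt) : (forall i, mxC1 D (family_lift i)) ->
  (forall t t', D t -> D t' -> flips (a t) (b t) (c t) (a t') (b t') (c t') -> t = t') ->
  mu2.-negligible (B : set plane) -> B `<=` D ->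
  null_class [set x | exists2 t, B t & exists2 rho : rep R, \pi_(moduli R) rho = x &
    coords rho (a t) (b t) (c t)].
Proof.
move=> cF inj B0 BD; have [F FP] := family_ex.
have lF i t : D t -> lifts (family_lift i t) (F t (loop i)) by move=> /FP[_].
have iF t t' : D t -> D t' -> \pi_(moduli R) (F t) = \pi_(moduli R) (F t') -> t = t'.
  move=> Dt Dt' /moduliP/asboolP[g gE]; apply: inj => //.
  have [C _] := FP t Dt; have [C' _] := FP t' Dt'.
  exact: (coords_uniq e11 e22 e33 (coords_conj gE C) C').
exists (fun=> Chart oD lF cF iF), (fun=> B); split=> // x [t Bt [rho <- C]].
exists 0%N => //; exists t => //=.
have [C' _] := FP t (BD t Bt).
exact: coords_inj (coords_neq0 C') C' C.
Qed.

(** The representations are picked by choice, but their values at the loops have continuous lifts,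
    so the map to the moduli space is continuous on [D]. The sets with measurable preimage then form
    a sigma-algebra containing the open sets. *)
Lemma family_measurable (S : set (moduli R)) : borel S ->
  (forall i k l t, D t -> {for t, continuous (fun t => family_lift i t k l)}) ->
  measurable ([set t | D t /\ coord_set S (a t) (b t) (c t)] : set plane).
Proof.
move=> bS cL; have [F FP] := family_ex.
pose q t : moduli R := \pi_(moduli R) (F t).
have -> : [set t | D t /\ coord_set S (a t) (b t) (c t)] = D `&` q @^-1` S.
  apply/seteqP; split => t [Dt h]; split => //; have [C _] := FP t Dt.
    exact/(coord_setE S C).
  exact/(coord_setE S C).
have det1 i t : \det (family_lift i t) == 1.
  move: i; apply: ord4_ind; rewrite family_liftE ?par_det//.
  have d : \det (par e1 (v1 t) *m par e2 (v2 t) *m par e3 (v3 t)) = 1.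
    by rewrite !det_mulmx !par_det !mulr1.
  by rewrite -invmx2// det_inv d invr1.
pose G i (t : subspace D) : SL2 R := mkSL2 (det1 i t).
have cG i : continuous (G i).
  apply: continuous_comp_initial.
  apply/subspace_continuousP => t Dt P [P' nP' PP'].
  have H k l : (within D (nbhs t)) [set s | P' k l (family_lift i s k l)].
    have h : nbhs t [set s | P' k l (family_lift i s k l)] := cL i k l t Dt _ (nP' k l).
    by apply: filterS h => s hs _.
  apply: filterS (filterI (filterI (H 0 0) (H 0 1)) (filterI (H 1 0) (H 1 1))).
  by move=> s [[h1 h2] [h3 h4]]; apply: PP' => k l; move: k l; do 2!apply: ord2_ind.
have cP i : continuous ((fun t => F t (loop i)) : subspace D -> PSL2 R).
  apply: (@subspace_eq_continuous _ D _ (fun t => \pi_(PSL2 R) (G i t))).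
    move=> t /set_mem Dt; have [_ L] := FP t Dt.
    by apply: lifts_inj (L i); exists (G i t).
  by move=> t; apply: continuous_comp; [exact: cG|exact: pi_continuous].
have cF : continuous (F : subspace D -> rep R).
  apply: continuous_comp_initial => t; apply/cvg_sup => i U [?/= [[W oW <-]]] /= WF /filterS; apply.
  have nW : nbhs (F t (loop i)) W by exact: open_nbhs_nbhs.
  exact: (cP i t W nW).
have cq : continuous (q : subspace D -> moduli R).
  by move=> t; apply: continuous_comp; [exact: cF|exact: pi_continuous].
pose M := [set T : set (moduli R) | measurable (D `&` q @^-1` T : set plane)].
have mD : measurable (D : set plane) by exact: open_prod_measurable.
have sM : sigma_algebra setT M.
  split=> [|T mT|T mT]; rewrite /M/=.
  - by rewrite preimage_set0 setI0.
  - rewrite (_ : D `&` _ = D `\` (D `&` q @^-1` T)); first exact: measurableD.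
    by apply/seteqP; split=> t [Dt]; [move=> [_ nT]; split => // -[_]|move=> nT; split => //; split => // qT; apply: nT].
  - rewrite preimage_bigcup setI_bigcupr; exact: bigcupT_measurable.
apply: (bS M); split => //.
move=> U oU; rewrite /M/=; apply: open_prod_measurable.
have /continuousP/(_ U oU) oqU := cq.
by rewrite setIC open_setIS.
Qed.

End Family.

Let open_neq0 (D : set pt) (f : pt -> R) : open D -> (forall t, D t -> {for t, continuous f}) ->
  open (D `&` [set t | f t != 0]).
Proof.
move=> oD cf; rewrite openE => t [Dt ft]; apply: filterI; first exact: open_nbhs_nbhs.
have o0 : open (~` [set 0 : R]) by apply: closed_openC; exact: closed_eq.
have : nbhs (f t) (~` [set 0 : R]) by apply: open_nbhs_nbhs; split => //; exact/eqP.
move=> /(cf t Dt) h; have h' : nbhs t (f @^-1` (~` [set 0])) := h.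
by apply: filterS h' => s /eqP.
Qed.

Section Frames.
Variables (D : set pt) (a b c : pt -> R).
Hypotheses (oD : open D) (Ca : C1 D a) (Cb : C1 D b) (Cc : C1 D c).
Hypothesis V : forall t, D t -> valid (a t) (b t) (c t).

Let Da := D `&` [set t | a t != 0].
Let Db := D `&` [set t | b t != 0].

Let oDa : open Da. Proof. by apply: open_neq0 => //; case: Ca. Qed.
Let oDb : open Db. Proof. by apply: open_neq0 => //; case: Cb. Qed.

Let Ca_ D' f : D' `<=` D -> C1 D f -> C1 D' f. Proof. exact: C1_sub_dom. Qed.

Let u1 (t : pt) : pt := (1, 0).
Let u2 (t : pt) : pt := (0, a t).
Let u3 (t : pt) : pt := (- (b t / a t), c t).

Let exa t : Da t -> exists rho : rep R, framed e1 e2 e3 rho (u1 t) (u2 t) (u3 t).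
Proof. by move=> [Dt a0]; exact: rep_exists_left (V Dt) a0. Qed.

Let wa t : Da t -> [/\ w2 (u1 t) (u2 t) = a t, w2 (u2 t) (u3 t) = b t,
   w2 (u1 t) (u3 t) = c t & valid (a t) (b t) (c t)].
Proof.
move=> [Dt a0]; rewrite /w2 /u1 /u2 /u3 /=; split; last exact: V.
- by ring.
- by field.
- by ring.
Qed.

Let La i : mxC1 Da (family_lift u1 u2 u3 i).
Proof.
move: i; apply: family_C1; rewrite /u1 /u2 /u3 /=; try exact: C1_cst.
- by apply: Ca_ => // t [].
- apply: C1_opp; apply: C1_div; [by apply: Ca_ => // t []|by apply: Ca_ => // t []|].
  by move=> t [].
- by apply: Ca_ => // t [].
Qed.

Let u1' (t : pt) : pt := (c t / b t, - a t).
Let u2' (t : pt) : pt := (1, 0).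
Let u3' (t : pt) : pt := (0, b t).

Let exb t : Db t -> exists rho : rep R, framed e1 e2 e3 rho (u1' t) (u2' t) (u3' t).
Proof. by move=> [Dt b0]; exact: rep_exists_right (V Dt) b0. Qed.

Let wb t : Db t -> [/\ w2 (u1' t) (u2' t) = a t, w2 (u2' t) (u3' t) = b t,
   w2 (u1' t) (u3' t) = c t & valid (a t) (b t) (c t)].
Proof.
move=> [Dt b0]; rewrite /w2 /u1' /u2' /u3' /=; split; last exact: V.
- by ring.
- by ring.
- by field.
Qed.

Let Lb i : mxC1 Db (family_lift u1' u2' u3' i).
Proof.
move: i; apply: family_C1; rewrite /u1' /u2' /u3' /=; try exact: C1_cst.
- apply: C1_div; [by apply: Ca_ => // t []|by apply: Ca_ => // t []|].
  by move=> t [].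
- by apply: C1_opp; apply: Ca_ => // t [].
- by apply: Ca_ => // t [].
Qed.

(** The two explicit frames require [a != 0] and [b != 0] respectively; a valid triple satisfies one
    of these, so the domain is covered by two open parts. *)
Lemma coord_null (B : set pt) :
  (forall t t', D t -> D t' -> flips (a t) (b t) (c t) (a t') (b t') (c t') -> t = t') ->
  mu2.-negligible (B : set plane) -> B `<=` D ->
  null_class [set x | exists2 t, B t & exists2 rho : rep R, \pi_(moduli R) rho = x &
    coords rho (a t) (b t) (c t)].
Proof.
move=> inj B0 BD.
have na : null_class [set x | exists2 t, (B `&` Da) t & exists2 rho : rep R,
    \pi_(moduli R) rho = x & coords rho (a t) (b t) (c t)].
  apply: family_null oDa exa wa _ La _ _ _.
  - by move=> t t' [Dt _] [Dt' _]; exact: inj.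
  - by apply: negligibleS B0 => t [].
  - by move=> t [].
have nb : null_class [set x | exists2 t, (B `&` Db) t & exists2 rho : rep R,
    \pi_(moduli R) rho = x & coords rho (a t) (b t) (c t)].
  apply: family_null oDb exb wb _ Lb _ _ _.
  - by move=> t t' [Dt _] [Dt' _]; exact: inj.
  - by apply: negligibleS B0 => t [].
  - by move=> t [].
apply: null_class_sub (null_class_setU na nb) => x [t Bt C].
have Dt := BD t Bt; have [n0|n0] := valid_neq0 (V Dt); [left|right];
  by exists t => //; do !split.
Qed.

Lemma coord_measurable (S : set (moduli R)) : borel S ->
  measurable ([set t | D t /\ coord_set S (a t) (b t) (c t)] : set plane).
Proof.
move=> bS.
rewrite (_ : mkset _ = [set t | Da t /\ coord_set S (a t) (b t) (c t)] `|`
   [set t | Db t /\ coord_set S (a t) (b t) (c t)]); last first.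
  apply/seteqP; split => t; last by move=> [[[Dt _] h]|[[Dt _] h]].
  by move=> [Dt h]; have [n0|n0] := valid_neq0 (V Dt); [left|right].
apply: measurableU.
  by apply: family_measurable oDa exa wa _ bS _ => i k l t Dt; have [cL _] := La i k l; exact: cL.
by apply: family_measurable oDb exb wb _ bS _ => i k l t Dt; have [cL _] := Lb i k l; exact: cL.
Qed.

End Frames.

Definition twist_invariant (T : set (moduli R)) := forall phi : mcg,
  (forall i, phi (loop i) = conj_loops first_two curve12 i) \/
  (forall i, phi (loop i) = conj_loops middle_two curve23 i) ->
  forall x, T (mcg_act phi x) <-> T x.

Lemma coord_set_flips T a b c a' b' c' : flips a b c a' b' c' ->
  coord_set T a b c <-> coord_set T a' b' c'.
Proof.
move=> F; have F' : flips a' b' c' a b c.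
  case: F => s [t [s2 t2 [-> -> ->]]]; exists s, t; split => //.
  rewrite !mulrA -!expr2 s2 t2 !mul1r; split => //.
  by transitivity (s ^+ 2 * t ^+ 2 * c); [rewrite s2 t2 !mul1r|ring].
by split=> -[rho [h C]]; exists rho; split => //; apply: coords_flips C.
Qed.

Let act_precomp (phi psi : mcg) (rho : rep R) : cancel phi psi ->
  mcg_act phi (\pi_(moduli R) (precomp psi rho)) = \pi_(moduli R) rho.
Proof.
move=> K; rewrite mcg_actE; apply/moduliP/asboolP; exists 1%g => z /=.
by rewrite K mul1g invg1 mulg1.
Qed.

Lemma coord_set_twist12 T a b c : twist_invariant T ->
  coord_set T a b c <->
  coord_set T a (b + e1 * a * c) (c - e2 * a * (b + e1 * a * c)).
Proof.
have [phi [psi [K1 K2 phiE psiE]]] := twist12.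
move=> invT; have iT := invT phi (or_introl phiE).
split=> -[rho [h C]].
  exists (precomp phi rho); split; last by have [] := coords_twist12 e11 e22 phiE psiE C.
  by rewrite -mcg_actE; exact/iT.
exists (precomp psi rho); split; first by apply/iT; rewrite act_precomp.
have [_] := coords_twist12 e11 e22 phiE psiE C.
have -> : c - e2 * a * (b + e1 * a * c) + e2 * a * (b + e1 * a * c) = c by ring.
by have -> : b + e1 * a * c - e1 * a * c = b by ring.
Qed.

Lemma coord_set_twist23 T a b c : twist_invariant T ->
  coord_set T a b c <->
  coord_set T (a - e3 * b * (c + e2 * b * a)) b (c + e2 * b * a).
Proof.
have [phi [psi [K1 K2 phiE psiE]]] := twist23.
move=> invT; have iT := invT phi (or_intror phiE).
split=> -[rho [h C]].
  exists (precomp phi rho); split; last by have [] := coords_twist23 e22 e33 phiE psiE C.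
  by rewrite -mcg_actE; exact/iT.
exists (precomp psi rho); split; first by apply/iT; rewrite act_precomp.
have [_] := coords_twist23 e22 e33 phiE psiE C.
have -> : a - e3 * b * (c + e2 * b * a) + e3 * b * (c + e2 * b * a) = a by ring.
by have -> : c + e2 * b * a - e2 * b * a = c by ring.
Qed.

Lemma twist_invariant_setD S T : twist_invariant S -> twist_invariant T ->
  twist_invariant (S `\` T).
Proof.
move=> iS iT phi h x; have [s1 s2] := iS phi h x; have [t1 t2] := iT phi h x.
by split=> -[Sx nT]; split; [exact: s1|move=> /t2|exact: s2|move=> /t1].
Qed.

Fixpoint twist_orbit (T : set (moduli R)) (fs : seq mcg) (n : nat) : set (moduli R) :=
  if n is m.+1 then twist_orbit T fs m `|`
    [set x | exists2 phi, List.In phi fs & twist_orbit T fs m (mcg_act phi x)] else T.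

(** Take preimages repeatedly under the two twists and their inverses. A mapping class is determined
    by its values on the loops, so the chosen twists represent all those of [twist_invariant]. *)
Lemma null_class_saturation T : null_class T -> exists2 T', null_class T' &
  T `<=` T' /\ twist_invariant T'.
Proof.
move=> nT; have [f1 [g1 [K1 K1' f1E g1E]]] := twist12.
have [f2 [g2 [K2 K2' f2E g2E]]] := twist23.
pose fs := [:: f1; g1; f2; g2].
exists (\bigcup_n twist_orbit T fs n).
  apply: null_class_bigcup; elim=> [|n IH] //=; apply: null_class_setU => //.
  have h : null_class ((mcg_act f1 @^-1` twist_orbit T fs n `|` mcg_act g1 @^-1` twist_orbit T fs n)
    `|` (mcg_act f2 @^-1` twist_orbit T fs n `|` mcg_act g2 @^-1` twist_orbit T fs n)).
    by apply: null_class_setU; apply: null_class_setU; apply: null_class_preimage IH; eassumption.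
  by apply: null_class_sub h => x [phi /= [<-|[<-|[<-|[<-|[]]]]]]; [left; left|left; right|right; left|right; right].
split=> [x Tx|phi phiP x]; first by exists 0%N.
have ext (phi' : mcg) : (forall i, phi (loop i) = phi' (loop i)) -> forall y : moduli R, mcg_act phi y = mcg_act phi' y.
  move=> E y; apply/moduliP/asboolP; exists 1%g => z /=.
  by rewrite (pi1_ext E) mul1g invg1 mulg1.
have main (f g : mcg) : List.In f fs -> List.In g fs -> cancel g f ->
    (forall i, phi (loop i) = f (loop i)) ->
    (\bigcup_n twist_orbit T fs n) (mcg_act phi x) <-> (\bigcup_n twist_orbit T fs n) x.
  move=> ff gg K E; rewrite (ext f E); split=> -[n _ h]; exists n.+1 => //=; right.
    by exists f.
  exists g => //; rewrite (_ : mcg_act g (mcg_act f x) = x)//.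
  rewrite -[x]reprK; move: (repr x) => r.
  by rewrite [mcg_act f _](mcg_actE f r); exact: act_precomp.
case: phiP => E.
  by apply: (main f1 g1) => //=; [left|right; left|move=> i; rewrite E f1E].
by apply: (main f2 g2) => //=; [right; right; left|right; right; right; left|move=> i; rewrite E f2E].
Qed.

End Coordinates.

End Charts.

(** * Ergodicity in the even case *)

Section CubicTwists.
Variable R : realType.
Variable Q : R -> R -> R -> Prop.
Hypothesis QN : forall x y z, Q x y z <-> Q x (- y) (- z).
Hypothesis Qx : forall x y z, Q x y z <-> Q x (x * z - y) (x * (x * z - y) - z).
Hypothesis Qy : forall x y z, Q x y z <-> Q (x + y * z) y (z + (x + y * z) * y).

Let Q_eq x y z x' y' z' : Q x y z -> x = x' -> y = y' -> z = z' -> Q x' y' z'.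
Proof. by move=> + <- <- <-. Qed.

Let Qy' x y z : Q x y z -> Q (x - y * (z - x * y)) y (z - x * y).
Proof. by move=> h; apply/Qy; apply: Q_eq h _ _ _ => //; ring. Qed.

(** The twist fixing [z] is composed of the twist fixing [x], the central symmetry and the inverse
    of the twist fixing [y]. *)
Let Qz x y z : Q x y z -> Q (x - z * (y - x * z)) (y - x * z) z.
Proof. by move=> /Qx/QN/Qy' h; apply: Q_eq h _ _ _; ring. Qed.

Let Qz' x y z : Q x y z -> Q (x + y * z) (y + (x + y * z) * z) z.
Proof. by move=> /Qy h; apply/Qx/QN; apply: Q_eq h _ _ _; ring. Qed.

Lemma cubic_reduction_twists :
  (forall x y z, cubic x y z -> x < 2 -> ~ Q x y z) ->
  (forall x y z, cubic x y z -> y * z = 0 -> ~ Q x y z) ->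
  forall x y z, cubic x y z -> ~ Q x y z.
Proof.
move=> h1 h2; apply: cubic_reduction => // x y z h q; apply: h.
- exact/(QN x y z).
- exact/(Qx x y z).
- by apply/Qx; apply: Q_eq q _ _ _ => //; ring.
- exact: Qy'.
- exact/(Qy x y z).
- exact: Qz.
- exact: Qz'.
Qed.

End CubicTwists.

Section Even.
Variable R : realType.
Local Notation pt := (R * R)%type.
Local Notation mu := (@lebesgue_measure R).
Local Notation plane := (measurableTypeR R * measurableTypeR R)%type.
Local Notation mu2 := (@lebesgue_measure R \x @lebesgue_measure R)%E.

Lemma C1_exprn (D : set pt) f n : C1 D f -> C1 D (fun t => f t ^+ n).
Proof.
move=> cf; elim: n => [|n IH]; first by under eq_fun do rewrite expr0; exact: C1_cst.
by under eq_fun do rewrite exprS; exact: C1_mul.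
Qed.

Lemma C1_zero_measurable (f : pt -> R) : C1 setT f ->
  measurable ([set v | f v = 0] : set plane).
Proof.
move=> [cf _]; rewrite (_ : mkset _ = ~` (f @^-1` [set x | x != 0])).
  apply: measurableC; apply: open_prod_measurable; apply: open_comp; last exact: open_neq.
  by move=> v _; exact: cf.
apply/seteqP; split => v /=; first by move=> ->; rewrite eqxx.
by move=> /negP; rewrite negbK => /eqP.
Qed.

Lemma axis_negligible : mu2.-negligible ([set v | v.2 = 0] : set plane).
Proof.
have mN : measurable ([set v | v.2 = 0] : set plane).
  by apply: C1_zero_measurable; exact: C1_snd.
apply/(measurable_negligible_xsection mN); apply/aeW => x.
apply: (@negligibleS _ _ _ mu ([set 0] : set (measurableTypeR R))).
  by move=> y; rewrite /xsection /= inE.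
by exists [set 0]; split => //; exact: lebesgue_measure_set1.
Qed.

(** This curve is the fold [2 z = x y], where the two roots in [z] coincide, seen in the chart with
    coordinates [x] and [z]. A vertical line meets it in at most two points. *)
Lemma cubic_fold_negligible (P : set pt) :
  (forall v, P v -> v.1 ^+ 4 + v.1 ^+ 2 * v.2 ^+ 2 = 4 * v.2 ^+ 2) ->
  mu2.-negligible (P : set plane).
Proof.
move=> PE; have fold0 (x y : R) : x ^+ 2 = 4 -> x ^+ 4 + x ^+ 2 * y ^+ 2 = 4 * y ^+ 2 -> False.
  by rewrite (exprM x 2 2) => ->; lra.
pose N : set plane := [set v | v.1 ^+ 4 + v.1 ^+ 2 * v.2 ^+ 2 = 4 * v.2 ^+ 2].
apply: (@negligibleS _ _ _ _ N) => [v /PE //|].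
have mN : measurable N.
  rewrite (_ : N = [set v | v.1 ^+ 4 + v.1 ^+ 2 * v.2 ^+ 2 - 4 * v.2 ^+ 2 = 0]).
    apply: C1_zero_measurable.
    have [p q] : C1 (setT : set pt) fst /\ C1 (setT : set pt) snd by split; [exact: C1_fst|exact: C1_snd].
    by apply: C1_sub; [apply: C1_add; [|apply: C1_mul]|apply: C1_mul; [exact: C1_cst|]]; exact: C1_exprn.
  apply/seteqP; split => v; rewrite /N /=; first by move=> ->; rewrite subrr.
  by move/eqP; rewrite subr_eq0 => /eqP.
apply/(measurable_negligible_xsection mN); apply/aeW => x.
have [x4|x4] := eqVneq (x ^+ 2) 4.
  rewrite (_ : xsection N x = set0); first exact: negligible_set0.
  apply/seteqP; split=> // y; rewrite /xsection /= inE /N/= => E.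
  by exfalso; exact: fold0 x4 E.
pose r := Num.sqrt (x ^+ 4 / (4 - x ^+ 2)).
apply: (@negligibleS _ _ _ mu ([set r; - r] : set (measurableTypeR R))); last first.
  exists [set r; - r]; split => //; last by apply: countable_lebesgue_measure0; exact: finite_set_countable.
  by apply: measurableU; exact: measurable_set1.
move=> y; rewrite /xsection /= inE /N/= => E.
have E' : y ^+ 2 = x ^+ 4 / (4 - x ^+ 2).
  have n0 : 4 - x ^+ 2 != 0 by rewrite subr_eq0 eq_sym.
  by apply: (mulIf n0); rewrite divfK//; lra.
have : `|y| = r by rewrite /r -E' sqrtr_sqr.
by case: (ger0P y) => _ <-; [left|right; rewrite opprK].
Qed.

Variables e1 e2 e3 : R.
Hypotheses (e11 : e1 ^+ 2 = 1) (e22 : e2 ^+ 2 = 1) (e33 : e3 ^+ 2 = 1).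
Variable rho0 : rep R.
Local Notation coords := (coords e1 e2 e3 1).
Local Notation valid := (valid e1 e2 e3 1).
Local Notation coord_set := (coord_set e1 e2 e3 1).
(** They place the cubic coordinates among [a], [b], [c], up to sign, so that the three positions of
    the deviating sign share one proof. *)
Variables fa fb fc : R -> R -> R -> R.
Local Notation tri P x y z := (P (fa x y z) (fb x y z) (fc x y z)).
Hypothesis valid_cubic : forall x y z, cubic x y z -> tri valid x y z.
Hypothesis cubic_valid : forall a b c, valid a b c ->
  exists x y z, cubic x y z /\ tri (flips a b c) x y z.
Hypothesis cubic_flips : forall x y z x' y' z', cubic x y z -> cubic x' y' z' ->
  tri (tri (@flips R) x y z) x' y' z' -> x' = x /\ (y' = y /\ z' = z \/ y' = - y /\ z' = - z).
Hypothesis flipsN : forall x y z, tri (tri (@flips R) x y z) x (- y) (- z).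
Hypothesis twistX : forall T, twist_invariant T -> forall x y z,
  tri (coord_set T) x y z <-> tri (coord_set T) x (x * z - y) (x * (x * z - y) - z).
Hypothesis twistY : forall T, twist_invariant T -> forall x y z,
  tri (coord_set T) x y z <-> tri (coord_set T) (x + y * z) y (z + (x + y * z) * y).
Hypothesis coordC1 : forall D (p q r : pt -> R), C1 D p -> C1 D q -> C1 D r ->
  [/\ C1 D (fun t => fa (p t) (q t) (r t)), C1 D (fun t => fb (p t) (q t) (r t)) &
      C1 D (fun t => fc (p t) (q t) (r t))].

Local Notation dom := (@cubic_dom R : set pt).
Let dom_open : open dom. Proof. exact: cubic_dom_open. Qed.

Let sg2 : (1 : R) ^+ 2 = 1. Proof. by rewrite expr1n. Qed.

Let root_C1 : C1 dom (fun t => cubic_root t.1 t.2).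
Proof.
rewrite /cubic_root; apply: C1_mul; last exact: C1_cst.
apply: C1_add; first by apply: C1_mul; [exact: C1_fst|exact: C1_snd].
apply: C1_sqrt => [|t []//]; rewrite /cubic_disc.
have q1 : C1 dom (fun t => t.1 ^+ 2) by apply: C1_mul; exact: C1_fst.
have q2 : C1 dom (fun t => t.2 ^+ 2) by apply: C1_mul; exact: C1_snd.
apply: C1_sub; last by apply: C1_mul => //; exact: C1_cst.
by apply: C1_add; apply: C1_mul => //; exact: C1_cst.
Qed.

Let dom_cubic (t : pt) : dom t -> cubic t.1 t.2 (cubic_root t.1 t.2).
Proof. by move=> [x0 d0]; exact: cubic_rootP x0 (ltW d0). Qed.

Let dom_cubic' (t : pt) : dom t -> cubic t.1 (cubic_root t.1 t.2) t.2.
Proof. by move=> /dom_cubic[x0 E]; split => //; lra. Qed.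

Let root_gt (t : pt) : dom t -> t.1 * t.2 < 2 * cubic_root t.1 t.2.
Proof.
move=> [_ d0]; have : 0 < Num.sqrt (cubic_disc t.1 t.2) by rewrite sqrtr_gt0.
by rewrite /cubic_root; lra.
Qed.

Definition chart_class (B : set pt) (f : pt -> R * R * R) : set (moduli R) :=
  [set x | exists2 t, B t & exists2 rho : rep R, \pi_(moduli R) rho = x &
    tri (coords rho) (f t).1.1 (f t).1.2 (f t).2].

(** Taking the larger root selects one of the opposite points [(y, z)] and [(-y, -z)], which makes
    the chart injective. *)
Let chart_z_null (B : set pt) : mu2.-negligible (B : set plane) -> B `<=` dom ->
  null_class (chart_class B (fun t => (t.1, t.2, cubic_root t.1 t.2))).
Proof.
move=> B0 BD; have [ca cb cc] := coordC1 (@C1_fst R dom) (@C1_snd R dom) root_C1.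
apply: (coord_null e11 e22 e33 sg2 rho0 dom_open ca cb cc _ _ B0 BD) => [t /dom_cubic/valid_cubic//|].
move=> [x y] [x' y'] d d' /(cubic_flips (dom_cubic d) (dom_cubic d'))/= [xE].
move=> -[[yE _]|[yE zE]]; first by rewrite xE yE.
by exfalso; have := root_gt d; have := root_gt d'; rewrite /= xE yE in zE *; rewrite zE; lra.
Qed.

Let chart_y_null (B : set pt) : mu2.-negligible (B : set plane) -> B `<=` dom ->
  null_class (chart_class B (fun t => (t.1, cubic_root t.1 t.2, t.2))).
Proof.
move=> B0 BD; have [ca cb cc] := coordC1 (@C1_fst R dom) root_C1 (@C1_snd R dom).
apply: (coord_null e11 e22 e33 sg2 rho0 dom_open ca cb cc _ _ B0 BD) => [t /dom_cubic'/valid_cubic//|].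
move=> [x y] [x' y'] d d' /(cubic_flips (dom_cubic' d) (dom_cubic' d'))/= [xE].
move=> -[[_ yE]|[zE yE]]; first by rewrite xE yE.
by exfalso; have := root_gt d; have := root_gt d'; rewrite /= xE yE in zE *; rewrite zE; lra.
Qed.

Let half_plane z y x rho : cubic x y z -> tri (coords rho) x y z -> x * y != 2 * z ->
  exists t, [/\ dom t, t.1 = x, t.2 = y \/ t.2 = - y &
    tri (coords rho) t.1 t.2 (cubic_root t.1 t.2)].
Proof.
move=> c C; rewrite neq_lt => /orP[lt|lt].
  have [d0 zE] := cubic_root_unique c lt; exists (x, y) => /=; rewrite -zE; split=> //; last by left.
  by split => //; case: c.
have c' : cubic x (- y) (- z) by case: c => x0 E; split=> //; lra.
have [|d0 zE] := cubic_root_unique c'; first by lra.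
exists (x, - y) => /=; rewrite -zE; split=> //; [|by right|].
  by split => //; case: c.
exact: coords_flips C.
Qed.

Let half_plane' y z x rho : cubic x y z -> tri (coords rho) x y z -> x * z != 2 * y ->
  exists t, [/\ dom t, t.1 = x, t.2 = z /\ cubic_root t.1 t.2 = y \/
    t.2 = - z /\ cubic_root t.1 t.2 = - y & tri (coords rho) t.1 (cubic_root t.1 t.2) t.2].
Proof.
move=> [x0 E] C; have c : cubic x z y by split => //; lra.
rewrite neq_lt => /orP[lt|lt].
  have [d0 yE] := cubic_root_unique c lt; exists (x, z) => /=; rewrite -yE; split=> //.
  by left.
have c' : cubic x (- z) (- y) by split=> //; lra.
have [|d0 zE] := cubic_root_unique c'; first by lra.
exists (x, - z) => /=; rewrite -zE; split=> //; first by right.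
exact: coords_flips C.
Qed.

(** The points of [T] with [x < 2] and all points with [y z = 0] lie in an invariant null class.
    What is left of [T] is invariant and avoids both, so the descent shows that it is empty. *)
Lemma even_null T : twist_invariant T ->
  mu2.-negligible ([set v | (dom v /\ tri (coord_set T) v.1 v.2 (cubic_root v.1 v.2)) /\
    v.1 < 2] : set plane) ->
  null_class (T `&` [set x | exists rho a b c, \pi_(moduli R) rho = x /\ coords rho a b c]).
Proof.
move=> iT T0.
pose N1 := chart_class [set v | (dom v /\ tri (coord_set T) v.1 v.2 (cubic_root v.1 v.2)) /\
    v.1 < 2] (fun t => (t.1, t.2, cubic_root t.1 t.2)).
pose N2 := chart_class [set v | dom v /\ v.2 = 0] (fun t => (t.1, t.2, cubic_root t.1 t.2)).
pose N3 := chart_class [set v | dom v /\ v.2 = 0] (fun t => (t.1, cubic_root t.1 t.2, t.2)).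
pose N4 := chart_class [set v | dom v /\ 2 * v.2 = v.1 * cubic_root v.1 v.2]
  (fun t => (t.1, cubic_root t.1 t.2, t.2)).
have line0 : mu2.-negligible ([set v | dom v /\ v.2 = 0] : set plane).
  by apply: negligibleS axis_negligible => v [].
have nN : null_class ((N1 `|` N2) `|` (N3 `|` N4)).
  apply: null_class_setU; apply: null_class_setU.
  - by apply: chart_z_null => // v [[]].
  - by apply: chart_z_null => // v [].
  - by apply: chart_y_null => // v [].
  - apply: chart_y_null => [|v []//]; apply: cubic_fold_negligible => v [/dom_cubic' [v0 E] zE].
    move: E zE; move: (cubic_root _ _) => y E zE.
    have E2 : v.1 ^+ 2 * y ^+ 2 = 4 * v.2 ^+ 2 by rewrite -exprMn -zE; ring.
    have E3 : y ^+ 2 = v.1 ^+ 2 + v.2 ^+ 2.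
      have : v.1 * y * v.2 = 2 * v.2 ^+ 2 by rewrite -zE; ring.
      by lra.
    by rewrite -E2 E3; ring.
have [N nullN [subN iN]] := null_class_saturation nN.
have iU := twist_invariant_setD iT iN.
have main : forall x y z, cubic x y z -> ~ tri (coord_set (T `\` N)) x y z.
  apply: cubic_reduction_twists => x y z.
  - exact: coord_set_flips.
  - exact: twistX.
  - exact: twistY.
  - move=> c x2 [rho [[Tr Nr] C]]; apply: Nr; apply: subN.
    have [zE|zN] := eqVneq (x * y) (2 * z).
      right; right; have c' : cubic x z y by case: c => x0 E; split => //; lra.
      have y0 : y != 0.
        apply/eqP => y0; move: zE; rewrite y0 mulr0 => z0.
        by case: c => x0; rewrite y0 (_ : z = 0); [nra|lra].
      have [|t [dt tx tz C']] := half_plane' c C.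
        apply/eqP => E; have : (4 - x ^+ 2) * y = 0.
          by transitivity (4 * y - x * (x * y)); [ring|rewrite zE; lra].
        by move/eqP; rewrite mulf_eq0 (negPf y0) orbF; case: c => x0 _; nra.
      exists t; last by exists rho.
      split=> //=; case: tz => -[tz ->]; rewrite tz tx; first by rewrite zE.
      by rewrite !mulrN zE.
    have [t [dt tx ty C']] := half_plane c C zN.
    by left; left; exists t; [split; [split => //; exists rho|rewrite tx]|exists rho].
  - move=> c /eqP; rewrite mulf_eq0 => yz0 [rho [[Tr Nr] C]]; apply: Nr; apply: subN.
    have [x0 E] := c.
    case/orP: yz0 => /eqP y0.
      have [|t [dt tx ty C']] := half_plane c C.
        by rewrite y0 mulr0; apply/eqP => z0; move: E; rewrite y0 (_ : z = 0); [nra|lra].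
      left; right; exists t; last by exists rho.
      by split => //; case: ty => ->; rewrite y0 ?oppr0.
    have [|t [dt tx tz C']] := half_plane' c C.
      by rewrite y0 mulr0; apply/eqP => z0; move: E; rewrite y0 (_ : y = 0); [nra|lra].
    right; left; exists t; last by exists rho.
    by split => //; case: tz => -[-> _]; rewrite y0 ?oppr0.
apply: null_class_sub nullN => x [Tx [rho [a [b [c [rE C]]]]]].
apply: contrapT => nN'.
have [x' [y' [z' [cc F]]]] := cubic_valid (coords_valid e11 e22 e33 C).
by apply: (main _ _ _ cc); exists rho; split; [split; rewrite rE|exact: coords_flips F C].
Qed.

Theorem even_zero_one (S : set (moduli R))
    (V := [set x | exists rho a b c, \pi_(moduli R) rho = x /\ coords rho a b c]) :
  borel S -> twist_invariant S -> null_class (V `&` S) \/ null_class (V `\` S).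
Proof.
move=> bS iS.
have [ca cb cc] := coordC1 (@C1_fst R dom) (@C1_snd R dom) root_C1.
have mS := coord_measurable e11 e22 e33 sg2 rho0 dom_open ca cb cc
  (fun t h => valid_cubic (dom_cubic h)) bS.
have := cubic_zero_one (fun x y z => coord_set_flips e1 e2 e3 1 S (flipsN x y z))
  (twistX iS) (twistY iS) mS.
case=> N0; [left|right].
  by rewrite setIC; exact: even_null.
rewrite setDE setIC; apply: even_null.
  by move=> phi h x; have [s1 s2] := iS phi h x; split=> n; [move=> /s2|move=> /s1].
apply: negligibleS N0 => v [[d [rho [nS C]]] v2] /=; split => // -[_].
by move=> /(coord_setE S C).
Qed.

End Even.

Section EvenTypes.
Variable R : realType.
Variable rho0 : rep R.
Variable d : R.
Hypothesis d2 : d ^+ 2 = 1.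

Let dN2 : (- d) ^+ 2 = 1. Proof. by rewrite sqrrN. Qed.

Let even_valid e1 e2 e3 (a b c : R) : trace_eqn e1 e2 e3 1 a b c ->
  [|| (a != 0) && (b != 0), (a != 0) && (c != 0) | (b != 0) && (c != 0)] ->
  valid e1 e2 e3 1 a b c.
Proof. by move=> E n0; split=> //; lra. Qed.

Let coord_eq e1 e2 e3 (T : set (moduli R)) a b c a' b' c' : a = a' -> b = b' -> c = c' ->
  coord_set e1 e2 e3 1 T a b c <-> coord_set e1 e2 e3 1 T a' b' c'.
Proof. by move=> -> -> ->. Qed.

Let cubic_neq0 (x y z : R) : cubic x y z -> x != 0 /\ (y != 0 \/ z != 0).
Proof.
move=> [x0 E]; split; first by rewrite gt_eqF.
have [y0|] := eqVneq y 0; [right|by left].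
by apply/eqP => z0; move: E; rewrite y0 z0; nra.
Qed.

Let neq0M (z : R) : z != 0 -> - d * z != 0.
Proof. by move: d2 => /sign_cases[]-> h; rewrite ?opprK ?mulN1r ?mul1r ?oppr_eq0. Qed.

Let flips_gt (x x' s : R) : 0 < x -> 0 < x' -> s ^+ 2 = 1 -> x' = s * x -> s = 1.
Proof. by move=> x0 x0' /sign_cases[]// -> E; exfalso; lra. Qed.

Let squares0 (y z : R) : y ^+ 2 + z ^+ 2 = 0 -> y = 0 /\ z = 0.
Proof.
move=> E; have := sqr_ge0 y; have := sqr_ge0 z => h1 h2.
by split; apply/eqP; rewrite -sqrf_eq0; apply/eqP; lra.
Qed.

Let mulKd (z z' : R) (t : R) : - d * z' = t * (- d * z) -> z' = t * z.
Proof. by move: d2 => /sign_cases[]-> h; lra. Qed.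

(** In this lemma and the next two, [x] is, up to sign, the determinant of the two vectors with
    equal signs. *)
Lemma even_zero_one3 (S : set (moduli R)) (coords := coords d d (- d) 1)
    (V := [set x | exists rho a b c, \pi_(moduli R) rho = x /\ coords rho a b c]) :
  borel S -> twist_invariant S -> null_class (V `&` S) \/ null_class (V `\` S).
Proof.
apply: (@even_zero_one R d d (- d) d2 d2 dN2 rho0 (fun x y z => x) (fun x y z => y)
  (fun x y z => - d * z)).
- move=> x y z c; have [x0 yz0] := cubic_neq0 c; have [xp E] := c; apply: even_valid.
    by rewrite /trace_eqn; move: d2 => /sign_cases[]->; lra.
  by rewrite x0 /=; case: yz0 => [->//|/neq0M ->]; rewrite orbT.
- move=> a b c [E n0 _]; rewrite /trace_eqn in E.
  have a0 : a != 0.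
    apply/eqP => a0; have [|b0 c0] := @squares0 b c.
      by move: E; rewrite a0; move: d2 => /sign_cases[]->; lra.
    by move: n0; rewrite a0 b0 c0 eqxx.
  have : cubic a b (- d * c) \/ cubic (- a) b (d * c).
    move: a0; rewrite neq_lt => /orP[an|ap]; [right|left]; split; rewrite ?oppr_gt0//;
      by move: E; move: d2 => /sign_cases[]->; lra.
  case=> h; eexists; eexists; eexists; (split; first exact: h).
    by exists 1, 1; split; rewrite ?expr1n//; split; move: d2 => /sign_cases[] dE; rewrite ?dE; ring.
  by exists (-1), 1; split; rewrite ?sqrrN ?expr1n//; split; move: d2 => /sign_cases[] dE; rewrite ?dE; ring.
- move=> x y z x' y' z' [x0 _] [x0' _] [s [t [s2 t2 [xE yE zE]]]].
  have s1 := flips_gt x0 x0' s2 xE; rewrite s1 !mul1r in xE zE.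
  by split => //; move: t2 yE (mulKd zE) => /sign_cases[]->; rewrite ?mul1r ?mulN1r; [left|right].
- move=> x y z; exists 1, (-1); split; rewrite ?sqrrN ?expr1n//; split; ring.
- move=> T iT x y z; apply: iff_trans (coord_set_twist12 (- d) 1 d2 d2 _ _ _ iT) _.
  apply: coord_set_flips; exists 1, (-1); split; rewrite ?sqrrN ?expr1n//.
  by split; move: d2 => /sign_cases[] dE; rewrite ?dE; ring.
- move=> T iT x y z; apply: iff_sym.
  apply: iff_trans (coord_set_twist23 d 1 d2 dN2 _ _ _ iT) _.
  by apply: coord_eq; move: d2 => /sign_cases[] dE; rewrite ?dE; ring.
- by move=> D p q r cp cq cr; split; try exact: cp; try exact: cq; exact: C1_mul (C1_cst _ _) cr.
Qed.

Lemma even_zero_one1 (S : set (moduli R)) (coords := coords (- d) d d 1)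
    (V := [set x | exists rho a b c, \pi_(moduli R) rho = x /\ coords rho a b c]) :
  borel S -> twist_invariant S -> null_class (V `&` S) \/ null_class (V `\` S).
Proof.
apply: (@even_zero_one R (- d) d d dN2 d2 d2 rho0 (fun x y z => y) (fun x y z => x)
  (fun x y z => - d * z)).
- move=> x y z c; have [x0 yz0] := cubic_neq0 c; have [xp E] := c; apply: even_valid.
    by rewrite /trace_eqn; move: d2 => /sign_cases[]->; lra.
  by rewrite x0 /=; case: yz0 => [->//|/neq0M ->]; rewrite !orbT.
- move=> a b c [E n0 _]; rewrite /trace_eqn in E.
  have a0 : b != 0.
    apply/eqP => a0; have [|b0 c0] := @squares0 a c.
      by move: E; rewrite a0; move: d2 => /sign_cases[]->; lra.
    by move: n0; rewrite a0 b0 c0 eqxx.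
  have : cubic b a (- d * c) \/ cubic (- b) a (d * c).
    move: a0; rewrite neq_lt => /orP[an|ap]; [right|left]; split; rewrite ?oppr_gt0//;
      by move: E; move: d2 => /sign_cases[]->; lra.
  case=> h; eexists; eexists; eexists; (split; first exact: h).
    by exists 1, 1; split; rewrite ?expr1n//; split; move: d2 => /sign_cases[] dE; rewrite ?dE; ring.
  by exists 1, (-1); split; rewrite ?sqrrN ?expr1n//; split; move: d2 => /sign_cases[] dE; rewrite ?dE; ring.
- move=> x y z x' y' z' [x0 _] [x0' _] [t [s [t2 s2 [yE xE zE]]]].
  have s1 := flips_gt x0 x0' s2 xE; rewrite s1 ?mulr1 ?mul1r in xE zE.
  by split => //; move: t2 yE (mulKd zE) => /sign_cases[]->; rewrite ?mul1r ?mulN1r; [left|right].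
- move=> x y z; exists (-1), 1; split; rewrite ?sqrrN ?expr1n//; split; ring.
- move=> T iT x y z; apply: iff_sym.
  apply: iff_trans (coord_set_twist23 (- d) 1 d2 d2 _ _ _ iT) _.
  apply: coord_set_flips; exists (-1), 1; split; rewrite ?sqrrN ?expr1n//.
  by split; move: d2 => /sign_cases[] dE; rewrite ?dE; ring.
- move=> T iT x y z; apply: iff_trans (coord_set_twist12 d 1 dN2 d2 _ _ _ iT) _.
  by apply: coord_eq; move: d2 => /sign_cases[] dE; rewrite ?dE; ring.
- by move=> D p q r cp cq cr; split; try exact: cp; try exact: cq; exact: C1_mul (C1_cst _ _) cr.
Qed.

Lemma even_zero_one2 (S : set (moduli R)) (coords := coords d (- d) d 1)
    (V := [set x | exists rho a b c, \pi_(moduli R) rho = x /\ coords rho a b c]) :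
  borel S -> twist_invariant S -> null_class (V `&` S) \/ null_class (V `\` S).
Proof.
have QN T x y z : coord_set d (- d) d 1 T y (- d * z) x <->
    coord_set d (- d) d 1 T (- y) (- d * - z) x.
  by apply: coord_set_flips; exists (-1), (-1); split; rewrite ?sqrrN ?expr1n//; split; ring.
have QY T : twist_invariant T -> forall x y z, coord_set d (- d) d 1 T y (- d * z) x <->
    coord_set d (- d) d 1 T y (- d * (z + (x + y * z) * y)) (x + y * z).
  move=> iT x y z; apply: iff_sym.
  apply: iff_trans (coord_set_twist12 d 1 d2 dN2 _ _ _ iT) _.
  by apply: coord_eq => //; move: d2 => /sign_cases[] dE; rewrite ?dE; ring.
apply: (@even_zero_one R d (- d) d d2 dN2 d2 rho0 (fun x y z => y) (fun x y z => - d * z)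
  (fun x y z => x)) => //.
- move=> x y z c; have [x0 yz0] := cubic_neq0 c; have [xp E] := c; apply: even_valid.
    by rewrite /trace_eqn; move: d2 => /sign_cases[]->; lra.
  by rewrite x0 !andbT; case: yz0 => [->|/neq0M ->]; rewrite !orbT.
- move=> a b c [E n0 _]; rewrite /trace_eqn in E.
  have a0 : c != 0.
    apply/eqP => a0; have [|b0 c0] := @squares0 a b.
      by move: E; rewrite a0; move: d2 => /sign_cases[]->; lra.
    by move: n0; rewrite a0 b0 c0 eqxx.
  have : cubic c a (- d * b) \/ cubic (- c) a (d * b).
    move: a0; rewrite neq_lt => /orP[an|ap]; [right|left]; split; rewrite ?oppr_gt0//;
      by move: E; move: d2 => /sign_cases[]->; lra.
  case=> h; eexists; eexists; eexists; (split; first exact: h).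
    by exists 1, 1; split; rewrite ?expr1n//; split; move: d2 => /sign_cases[] dE; rewrite ?dE; ring.
  by exists 1, (-1); split; rewrite ?sqrrN ?expr1n//; split; move: d2 => /sign_cases[] dE; rewrite ?dE; ring.
- move=> x y z x' y' z' [x0 _] [x0' _] [s [t [s2 t2 [yE zE xE]]]].
  have st2 : (s * t) ^+ 2 = 1 by rewrite exprMn s2 t2 mulr1.
  have st := flips_gt x0 x0' st2 xE; rewrite st mul1r in xE; split=> //.
  move: s2 t2 st yE (mulKd zE) => /sign_cases[]-> /sign_cases[]-> st; try by (exfalso; lra).
    by rewrite !mul1r; left.
  by rewrite !mulN1r; right.
- by move=> x y z; exists (-1), (-1); split; rewrite ?sqrrN ?expr1n//; split; ring.
- move=> T iT x y z.
  (* Here [x] belongs to the first and third vectors, and neither available twist preserves it; the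
     two twists are combined with a sign change. *)
  apply: iff_trans (_ : _ <-> coord_set d (- d) d 1 T (y - x * z) (- d * z) (x - z * (y - x * z))) _.
    apply: iff_sym; apply: iff_trans (coord_set_twist23 d 1 dN2 d2 _ _ _ iT) _.
    by apply: coord_eq; move: d2 => /sign_cases[] dE; rewrite ?dE; ring.
  apply: iff_trans (QY _ iT _ _ _) _; apply: iff_trans (QN _ _ _ _) _.
  by apply: coord_eq; ring.
- by move=> D p q r cp cq cr; split; try exact: cp; try exact: cq; exact: C1_mul (C1_cst _ _) cr.
Qed.

End EvenTypes.

(** * Ergodicity in the odd case *)

Section OddHyperbolic.
Variable R : realType.
Local Notation pt := (R * R)%type.
Local Notation plane := (measurableTypeR R * measurableTypeR R)%type.
Local Notation mu2 := (@lebesgue_measure R \x @lebesgue_measure R)%E.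

(** Both [2 cosh] for [h = 1] and [2 sinh] for [h = -1], so that all sign patterns are treated at
    once. *)
Definition cosinh (h u : R) := expR u + h * expR (- u).

Lemma cosinhN h u : h ^+ 2 = 1 -> cosinh h (- u) = h * cosinh h u.
Proof. by rewrite /cosinh opprK mulrDr mulrA -expr2 => ->; rewrite mul1r addrC. Qed.

Lemma cosinh_sqr_inj h u v : h ^+ 2 = 1 -> cosinh h u ^+ 2 = cosinh h v ^+ 2 -> u = v \/ u = - v.
Proof.
move=> h2; rewrite /cosinh !expRN => E.
have p0 := expR_gt0 u; have q0 := expR_gt0 v.
have : (expR u - expR v) * (expR u * expR v - 1) = 0.
  have : (expR u ^+ 2 - expR v ^+ 2) * ((expR u * expR v) ^+ 2 - 1) = 0.
    have : (expR u * expR v) ^+ 2 * ((expR u + h * (expR u)^-1) ^+ 2 -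
      (expR v + h * (expR v)^-1) ^+ 2) = 0 by rewrite E subrr mulr0.
    move: p0 q0; move: (expR u) (expR v) => p q p0 q0.
    move: h2 => /sign_cases[]-> <-; field; by rewrite ?gt_eqF.
  move: p0 q0; move: (expR u) (expR v) => p q p0 q0 E'.
  have n0 : (p + q) * (p * q + 1) != 0 by rewrite gt_eqF// mulr_gt0// ?addr_gt0// mulr_gt0.
  by apply: (mulIf n0); rewrite mul0r -E'; ring.
move/eqP; rewrite mulf_eq0 !subr_eq0 => /orP[/eqP/expR_inj|/eqP]; first by left.
by rewrite -expRD -[1]expR0 => /expR_inj E1; right; lra.
Qed.

Lemma cosinh_surj h a : h ^+ 2 = 1 -> (h = 1 -> 2 <= a) -> exists u, cosinh h u = a.
Proof.
move=> h2 a2; pose p := (a + Num.sqrt (a ^+ 2 - 4 * h)) / 2.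
have d0 : 0 <= a ^+ 2 - 4 * h.
  move: h2 a2 => /sign_cases[]-> a2; last by have := sqr_ge0 a; lra.
  by have := a2 erefl; nra.
have := sqr_sqrtr d0; have := sqrtr_ge0 (a ^+ 2 - 4 * h).
rewrite -/p; set r := Num.sqrt _ in p * => r0 rE.
have p0 : 0 < p.
  rewrite divr_gt0// ; move: h2 a2 rE => /sign_cases[]-> a2 rE; first by have := a2 erefl; lra.
  by rewrite ltNge; apply/negP => ar; nra.
have pE : p ^+ 2 - a * p + h = 0.
  have -> : p ^+ 2 - a * p + h = (r ^+ 2 - a ^+ 2 + 4 * h) / 4 by rewrite /p; field.
  by rewrite rE; field.
exists (ln p); rewrite /cosinh expRN lnK ?posrE//.
by apply: (mulIf (lt0r_neq0 p0)); rewrite mulrDl divfK ?gt_eqF//; lra.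
Qed.

Lemma C1_cosinh D h f : C1 D f -> C1 D (fun t : pt => cosinh h (f t)).
Proof.
move=> cf; apply: C1_add; first exact: C1_exp.
by apply: C1_mul; [exact: C1_cst|apply: C1_exp; exact: C1_opp].
Qed.

Variables e1 e2 e3 : R.
Hypotheses (e11 : e1 ^+ 2 = 1) (e22 : e2 ^+ 2 = 1) (e33 : e3 ^+ 2 = 1).
Variable rho0 : rep R.
Local Notation coords := (coords e1 e2 e3 (- 1)).
Local Notation valid := (valid e1 e2 e3 (- 1)).
Local Notation coord_set := (coord_set e1 e2 e3 (- 1)).
Let ca (s t : R) := cosinh (e1 * e2) s.
Let cb (s t : R) := cosinh (e2 * e3) t.
Let cc (s t : R) := - e2 * cosinh (e1 * e3) (s + t).
Local Notation tri P s t := (P (ca s t) (cb s t) (cc s t)).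

Let sg2 : (- 1 : R) ^+ 2 = 1. Proof. by rewrite sqrrN expr1n. Qed.
Let h12 : (e1 * e2) ^+ 2 = 1. Proof. by rewrite exprMn e11 e22 mulr1. Qed.
Let h22 : (e2 * e3) ^+ 2 = 1. Proof. by rewrite exprMn e22 e33 mulr1. Qed.
Let h32 : (e1 * e3) ^+ 2 = 1. Proof. by rewrite exprMn e11 e33 mulr1. Qed.

(** For given [a] and [b] the trace equation is quadratic in [c]; the addition formulas show that
    its roots are the values at [(s, t)] and, up to sign, at [(s, - t)]. *)
Let factor s t c : e1 * e2 * ca s t ^+ 2 + e2 * e3 * cb s t ^+ 2 + e1 * e3 * c ^+ 2 +
    e1 * e2 * e3 * (ca s t * cb s t * c) =
  4 + e1 * e3 * (c - cc s t) * (c - e2 * e3 * cc s (- t)).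
Proof.
rewrite /ca /cb /cc /cosinh !opprD !opprK !expRD !expRN.
have p0 := expR_gt0 s; have q0 := expR_gt0 t; have E1 := sign_cases e11.
have E2 := sign_cases e22; have E3 := sign_cases e33.
by case: E1 => ->; case: E2 => ->; case: E3 => ->; field; rewrite !gt_eqF.
Qed.

Let cosinh_neq0 h u : h ^+ 2 = 1 -> cosinh h u = 0 -> h = -1 /\ u = 0.
Proof.
move=> /sign_cases[]-> E.
  by have := expR_gt0 u; have := expR_gt0 (- u); move: E; rewrite /cosinh; lra.
split=> //; move: E; rewrite /cosinh mulN1r => /eqP; rewrite subr_eq0 => /eqP/expR_inj.
lra.
Qed.

Let cosinh_edge h u : h ^+ 2 = 1 -> cosinh h u ^+ 2 = 4 * h -> h = 1 /\ u = 0.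
Proof.
move=> h2 E; have h1 : h = 1.
  by case: (sign_cases h2) E => // -> E; have := sqr_ge0 (cosinh (-1) u); lra.
split=> //; have [||] := @cosinh_sqr_inj h u 0 h2; last 1 first; try lra.
by rewrite E h1 /cosinh oppr0 expR0; ring.
Qed.

Let cc_neq0 s t : cc s t = 0 -> e1 * e3 = -1 /\ s + t = 0.
Proof.
move=> /eqP; rewrite mulf_eq0 oppr_eq0 -(sqrf_eq0 e2) e22 oner_eq0 /= => /eqP.
exact: cosinh_neq0.
Qed.

Let param_valid s t : s != 0 \/ t != 0 -> tri valid s t.
Proof.
move=> st0; split.
- have := factor s t (cc s t); rewrite subrr mulr0 mul0r /trace_eqn.
  by move=> ->; lra.
- have st00 : ~ (s = 0 /\ t = 0) by move=> [s0 t0]; case: st0; rewrite ?s0 ?t0 eqxx.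
  have ab0 : ca s t = 0 -> cb s t = 0 -> False.
    by move=> /(cosinh_neq0 h12)[_ s0] /(cosinh_neq0 h22)[_ t0]; exact: st00.
  have ac0 : ca s t = 0 -> cc s t = 0 -> False.
    by move=> /(cosinh_neq0 h12)[_ s0] /cc_neq0[_]; rewrite s0 add0r => t0; exact: st00.
  have bc0 : cb s t = 0 -> cc s t = 0 -> False.
    by move=> /(cosinh_neq0 h22)[_ t0] /cc_neq0[_]; rewrite t0 addr0 => s0; exact: st00.
  have [a0|a0] := eqVneq (ca s t) 0; have [b0|b0] := eqVneq (cb s t) 0;
    have [c0|c0] := eqVneq (cc s t) 0 => //=; exfalso; by [exact: ab0|exact: ac0|exact: bc0].
- move=> _; case: st0 => [s0|t0]; [left|right] => E.
    by have [_ /eqP] := cosinh_edge h12 E; rewrite (negPf s0).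
  by have [_ /eqP] := cosinh_edge h22 E; rewrite (negPf t0).
Qed.

Let param_flipsN s t : tri (tri (@flips R) s t) (- s) (- t).
Proof.
exists (e1 * e2), (e2 * e3); split=> //; split; rewrite /ca /cb /cc ?cosinhN//.
rewrite -opprD cosinhN//; transitivity (e2 ^+ 2 * (- e2 * (e1 * e3 * cosinh (e1 * e3) (s + t)))).
  by rewrite e22 mul1r.
by ring.
Qed.

(** After sign changes [a] and [b] are values of [cosinh], and the second root for [c] is reached by
    [t -> - t]. A valid triple cannot have [s = t = 0]. *)
Let param_surj a b c : valid a b c -> (e1 * e2 = 1 -> 4 <= a ^+ 2) -> (e2 * e3 = 1 -> 4 <= b ^+ 2) ->
  exists s t, (s != 0 \/ t != 0) /\ tri (flips a b c) s t.
Proof.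
have solve (h x : R) : h ^+ 2 = 1 -> (h = 1 -> 4 <= x ^+ 2) -> exists sg u, sg ^+ 2 = 1 /\ cosinh h u = sg * x.
  move=> h2 x4; have [x0|x0] := leP 0 x.
    have [|u uE] := @cosinh_surj h x h2; first by move=> /x4; nra.
    by exists 1, u; rewrite expr1n mul1r.
  have [|u uE] := @cosinh_surj h (- x) h2; first by move=> /x4; nra.
  by exists (-1), u; rewrite sqrrN expr1n mulN1r.
move=> [E n0 edge] ha hb.
have [x [s [x2 sE]]] := solve _ _ h12 ha; have [y [t [y2 tE]]] := solve _ _ h22 hb.
have [st0|st0] := pselect (s = 0 /\ t = 0).
  exfalso; case: st0 => s0 t0; move: sE tE; rewrite s0 t0 /cosinh oppr0 expR0 !mulr1 => aE bE.
  have a2 : a ^+ 2 = (1 + e1 * e2) ^+ 2 by rewrite aE exprMn x2 mul1r.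
  have b2 : b ^+ 2 = (1 + e2 * e3) ^+ 2 by rewrite bE exprMn y2 mul1r.
  have sq0 (z : R) : z ^+ 2 = 0 -> z = 0 by move=> /eqP; rewrite sqrf_eq0 => /eqP.
  have ez : e1 * e3 = (e1 * e2) * (e2 * e3) by rewrite -mulrA (mulrA e2) -expr2 e22 mul1r.
  move: E; rewrite /trace_eqn a2 b2 ez; move: (edge erefl); rewrite a2 b2.
  case: (sign_cases h12) => h1; case: (sign_cases h22) => h2; rewrite h1 h2 in a2 b2 *.
  - by case; lra.
  - have b0 : b = 0 by apply: sq0; rewrite b2; ring.
    move=> _; rewrite b0 mulr0 mul0r mulr0 => E.
    have c0 : c = 0 by apply: sq0; lra.
    by move: n0; rewrite b0 c0 eqxx /= !andbF.
  - have a0 : a = 0 by apply: sq0; rewrite a2; ring.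
    move=> _; rewrite a0 !mul0r mulr0 => E.
    have c0 : c = 0 by apply: sq0; lra.
    by move: n0; rewrite a0 c0 eqxx /= !andbF.
  - have a0 : a = 0 by apply: sq0; rewrite a2; ring.
    have b0 : b = 0 by apply: sq0; rewrite b2; ring.
    by move: n0; rewrite a0 b0 eqxx.
have st : s != 0 \/ t != 0.
  have [s0|] := eqVneq s 0; [right|by left].
  by apply/eqP => t0; apply: st0.
have := factor s t (x * y * c); rewrite /ca /cb sE tE.
rewrite (_ : e1 * e2 * _ + _ + _ + _ = x ^+ 2 * (e1 * e2 * a ^+ 2) + y ^+ 2 * (e2 * e3 * b ^+ 2) +
  x ^+ 2 * y ^+ 2 * (e1 * e3 * c ^+ 2 + e1 * e2 * e3 * (a * b * c))); last by ring.
rewrite x2 y2 !mul1r; move: E; rewrite /trace_eqn => E F.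
have {F} : e1 * e3 * (x * y * c - cc s t) * (x * y * c - e2 * e3 * cc s (- t)) = 0.
  by move: F; rewrite addrA E; lra.
move/eqP; rewrite 2!mulf_eq0 -(sqrf_eq0 (e1 * e3)) h32 oner_eq0 /= !subr_eq0 => /orP[/eqP cE|/eqP cE].
  by exists s, t; split=> //; exists x, y; split=> //; split; rewrite /ca /cb ?sE ?tE.
exists s, (- t); split; first by rewrite oppr_eq0.
exists x, (e2 * e3 * y); split; rewrite ?exprMn ?y2 ?e22 ?e33 ?mulr1//.
split; rewrite /ca /cb ?sE// ?cosinhN// ?tE ?mulrA//.
transitivity ((e2 * e3) ^+ 2 * cc s (- t)); first by rewrite h22 mul1r.
by transitivity (e2 * e3 * (x * y * c)); [rewrite cE; ring|ring].
Qed.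

Let twist12_param T : twist_invariant T -> forall s t,
  tri (coord_set T) s t <-> tri (coord_set T) s (t + 2 * s).
Proof.
move=> iT s t; apply: iff_trans (coord_set_twist12 e3 (-1) e11 e22 _ _ _ iT) _.
apply: coord_set_flips; exists 1, (- (e1 * e2)); split; rewrite ?expr1n ?sqrrN//.
rewrite /ca /cb /cc /cosinh mulr_natl mulr2n !opprD !expRD !expRN.
have p0 := expR_gt0 s; have q0 := expR_gt0 t; have E1 := sign_cases e11.
have E2 := sign_cases e22; have E3 := sign_cases e33.
by split; case: E1 => E1; case: E2 => E2; case: E3 => E3; rewrite ?E1 ?E2 ?E3; field; rewrite ?gt_eqF.
Qed.

Let twist23_param T : twist_invariant T -> forall s t,
  tri (coord_set T) s t <-> tri (coord_set T) (s + 2 * t) t.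
Proof.
move=> iT s t; apply: iff_sym; apply: iff_trans (coord_set_twist23 e1 (-1) e22 e33 _ _ _ iT) _.
apply: coord_set_flips; exists (- (e2 * e3)), 1; split; rewrite ?expr1n ?sqrrN//.
rewrite /ca /cb /cc /cosinh mulr_natl mulr2n !opprD !expRD !expRN.
have p0 := expR_gt0 s; have q0 := expR_gt0 t; have E1 := sign_cases e11.
have E2 := sign_cases e22; have E3 := sign_cases e33.
by split; case: E1 => E1; case: E2 => E2; case: E3 => E3; rewrite ?E1 ?E2 ?E3; field; rewrite ?gt_eqF.
Qed.

Let param_inj s t s' t' : tri (tri (@flips R) s t) s' t' ->
  [/\ s' = s \/ s' = - s, t' = t \/ t' = - t & s' + t' = s + t \/ s' + t' = - (s + t)].
Proof.
move=> [x [y [x2 y2 [aE bE cE]]]]; split; apply: cosinh_sqr_inj.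
- exact: h12.
- by rewrite [LHS](congr1 (fun z => z ^+ 2) aE) exprMn x2 mul1r.
- exact: h22.
- by rewrite [LHS](congr1 (fun z => z ^+ 2) bE) exprMn y2 mul1r.
- exact: h32.
- have := congr1 (fun z => z ^+ 2) cE; rewrite /cc !exprMn sqrrN e22 !mul1r.
  by rewrite x2 y2 !mul1r.
Qed.

(** The half-plane [t > 0] contains one of each pair of opposite parameters off the axis. The points
    with [t = 0] form a half-line, null in a second chart. *)
Lemma odd_null T :
  mu2.-negligible ([set v | 0 < v.2 /\ tri (coord_set T) (v.1 * v.2) v.2] : set plane) ->
  null_class ([set x | exists rho a b c, [/\ \pi_(moduli R) rho = x, coords rho a b c,
    e1 * e2 = 1 -> 4 <= a ^+ 2 & e2 * e3 = 1 -> 4 <= b ^+ 2]] `&` T).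
Proof.
move=> B0.
have oD1 : open [set v : pt | 0 < v.2].
  apply: (@open_comp _ _ (snd : pt -> R) [set x | 0 < x]); last exact: open_gt.
  by move=> v _; exact: cvg_snd.
have oD2 : open [set v : pt | 0 < v.1].
  apply: (@open_comp _ _ (fst : pt -> R) [set x | 0 < x]); last exact: open_gt.
  by move=> v _; exact: cvg_fst.
have [D1 D2] : C1 [set v : pt | 0 < v.2] fst /\ C1 [set v : pt | 0 < v.2] snd.
  by split; [exact: C1_fst|exact: C1_snd].
have [D3 D4] : C1 [set v : pt | 0 < v.1] fst /\ C1 [set v : pt | 0 < v.1] snd.
  by split; [exact: C1_fst|exact: C1_snd].
have n1 := coord_null e11 e22 e33 sg2 rho0 oD1 (C1_cosinh (e1 * e2) (C1_mul D1 D2))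
  (C1_cosinh (e2 * e3) D2) (C1_mul (C1_cst _ (- e2)) (C1_cosinh (e1 * e3) (C1_add (C1_mul D1 D2) D2))).
have n2 := coord_null e11 e22 e33 sg2 rho0 oD2 (C1_cosinh (e1 * e2) D3)
  (C1_cosinh (e2 * e3) D4) (C1_mul (C1_cst _ (- e2)) (C1_cosinh (e1 * e3) (C1_add D3 D4))).
have nA : mu2.-negligible ([set v | 0 < v.1 /\ v.2 = 0] : set plane).
  by apply: negligibleS (axis_negligible R) => v [].
have {}n1 : null_class [set x | exists2 t, [set v | 0 < v.2 /\ tri (coord_set T) (v.1 * v.2) v.2] t &
    exists2 rho : rep R, \pi_(moduli R) rho = x & tri (coords rho) (t.1 * t.2) t.2].
  apply: n1 B0 _ => [t t0|[th t] [th' t'] /= t0 t0' /param_inj [hs ht hst]|v []//].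
    by apply: param_valid; right; rewrite gt_eqF.
  have tE : t' = t by case: ht => // ?; exfalso; lra.
  rewrite tE in hs hst *; congr (_, _); apply: (mulIf (lt0r_neq0 t0)); case: hst; lra.
have {}n2 : null_class [set x | exists2 t, [set v | 0 < v.1 /\ v.2 = 0] t &
    exists2 rho : rep R, \pi_(moduli R) rho = x & tri (coords rho) t.1 t.2].
  apply: n2 nA _ => [t t0|[s t] [s' t'] /= t0 t0' /param_inj [hs ht hst]|v []//].
    by apply: param_valid; left; rewrite gt_eqF.
  have tE : s' = s by case: hs => // ?; exfalso; lra.
  by rewrite tE in hst *; congr (_, _); case: hst; lra.
apply: null_class_sub (null_class_setU n1 n2) => x [[rho [a [b [c [rE C ha hb]]]]] Tx].
have [s [t [st F]]] := param_surj (coords_valid e11 e22 e33 C) ha hb.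
have C1 := coords_flips F C; have C2 := coords_flips (param_flipsN s t) C1.
have pos s' t' : 0 < t' -> tri (coords rho) s' t' ->
    exists2 t, [set v | 0 < v.2 /\ tri (coord_set T) (v.1 * v.2) v.2] t &
    exists2 rho : rep R, \pi_(moduli R) rho = x & tri (coords rho) (t.1 * t.2) t.2.
  move=> t0 C'; exists (s' / t', t'); rewrite /= divfK ?gt_eqF//; last by exists rho.
  by split=> //; exists rho; rewrite rE.
have [t0|t0|t0] := ltgtP t 0.
- by left; apply: pos C2; rewrite oppr_gt0.
- by left; apply: pos C1.
right; have [s0|s0|s0] := ltgtP s 0.
- by exists (- s, - t) => /=; [rewrite t0 oppr_gt0 oppr0|exists rho].
- by exists (s, t) => //=; exists rho.
- by case: st; rewrite ?s0 ?t0 eqxx.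
Qed.

Theorem odd_zero_one (S : set (moduli R)) (V := [set x | exists rho a b c,
    [/\ \pi_(moduli R) rho = x, coords rho a b c,
    e1 * e2 = 1 -> 4 <= a ^+ 2 & e2 * e3 = 1 -> 4 <= b ^+ 2]]) :
  borel S -> twist_invariant S -> null_class (V `&` S) \/ null_class (V `\` S).
Proof.
move=> bS iS.
have oD1 : open [set v : pt | 0 < v.2].
  apply: (@open_comp _ _ (snd : pt -> R) [set x | 0 < x]); last exact: open_gt.
  by move=> v _; exact: cvg_snd.
have [D1 D2] : C1 [set v : pt | 0 < v.2] fst /\ C1 [set v : pt | 0 < v.2] snd.
  by split; [exact: C1_fst|exact: C1_snd].
have mS := coord_measurable e11 e22 e33 sg2 rho0 oD1 (C1_cosinh (e1 * e2) (C1_mul D1 D2))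
  (C1_cosinh (e2 * e3) D2) (C1_mul (C1_cst _ (- e2)) (C1_cosinh (e1 * e3) (C1_add (C1_mul D1 D2) D2)))
  _ bS.
have := @linear_action_zero_one R (fun s t => tri (coord_set S) s t)
  (fun s t => coord_set_flips e1 e2 e3 (-1) S (param_flipsN s t))
  (twist23_param iS) (twist12_param iS).
case=> [|N0|N0].
- by apply: mS => t t0; apply: param_valid; right; rewrite gt_eqF.
- by left; exact: odd_null.
right; rewrite setDE; apply: odd_null.
apply: negligibleS N0 => v [d [rho [nS C]]] /=; split => // -[_].
by move=> /(coord_setE S C).
Qed.

End OddHyperbolic.

(** * All signs equal: the torus *)

Section OddElliptic.
Variable R : realType.
Local Notation pt := (R * R)%type.
Local Notation plane := (measurableTypeR R * measurableTypeR R)%type.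
Local Notation mu2 := (@lebesgue_measure R \x @lebesgue_measure R)%E.

Let sin_int_period (x : R) (k : int) : sin x = 0 <-> sin (x + k%:~R * pi) = 0.
Proof.
apply: (@period_int R [set x | sin x = 0] pi) => y /=.
by rewrite sinDpi; split=> [->|/eqP]; rewrite ?oppr0// oppr_eq0 => /eqP.
Qed.

Let sin_neq0 (k : int) (x : R) : k%:~R * pi < x < (k + 1)%:~R * pi -> sin x <> 0.
Proof.
move=> /andP[lo hi] /(sin_int_period x (- k)); rewrite mulrNz mulNr => E.
have := @sin_gt0_pi R (x - k%:~R * pi); rewrite E ltxx => h.
by have : false by apply: h; move: hi; rewrite intrD mulrDl mul1r; lra.
Qed.

Let sin_eq0_small (x : R) : `|x| < pi -> sin x = 0 -> x = 0.
Proof.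
rewrite ltr_norml => /andP[lo hi] E; have [x0|x0|//] := ltgtP x 0.
  by have := @sin_gt0_pi R (- x); rewrite sinN E oppr0 ltxx => h; have : false by apply: h; lra.
by have := @sin_gt0_pi R x; rewrite E ltxx => h; have : false by apply: h; lra.
Qed.

Let sinM_cos_sqr (x y : R) : sin (x - y) * sin (x + y) = cos y ^+ 2 - cos x ^+ 2.
Proof.
rewrite !sinD cosN sinN; have := cos2Dsin2 x; have := cos2Dsin2 y => E1 E2.
transitivity ((sin x ^+ 2) * cos y ^+ 2 - cos x ^+ 2 * sin y ^+ 2); first by ring.
have -> : sin x ^+ 2 = 1 - cos x ^+ 2 by lra.
have -> : sin y ^+ 2 = 1 - cos y ^+ 2 by lra.
by ring.
Qed.

Let cos_sqr_eq (x y : R) : cos x ^+ 2 = cos y ^+ 2 -> sin (x - y) = 0 \/ sin (x + y) = 0.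
Proof.
move=> E; have := sinM_cos_sqr x y; rewrite E subrr => /eqP.
by rewrite mulf_eq0 => /orP[] /eqP; [left|right].
Qed.

(** [2 x], [2 x'] and so [x + x'] lie strictly between consecutive zeros of the sine, which gives
    [x' = x]. If [y'] differed from [y], then [sin (y + y') = 0], and the equation for the sums
    would give [sin (2 x) = 0]. *)
Let box_inj (k : int) (x x' y y' : R) :
  k%:~R * pi < 2 * x < (k + 1)%:~R * pi -> k%:~R * pi < 2 * x' < (k + 1)%:~R * pi ->
  `|y' - y| < pi -> cos x' ^+ 2 = cos x ^+ 2 -> cos y' ^+ 2 = cos y ^+ 2 ->
  cos (x' + y') ^+ 2 = cos (x + y) ^+ 2 -> x' = x /\ y' = y.
Proof.
move=> hx hx' hy Ex Ey Exy; have pi0 := pi_gt0 R.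
have xE : x' = x.
  case: (cos_sqr_eq Ex) => [E|E].
    apply/eqP; rewrite -subr_eq0; apply/eqP; apply: sin_eq0_small E.
    by move: hx hx'; rewrite intrD mulrDl mul1r => /andP[? ?] /andP[? ?]; rewrite ltr_norml; lra.
  by exfalso; apply: (@sin_neq0 k _ _ E); lra.
split=> //; rewrite {}xE in Exy.
have [s0|s0] := pselect (sin (y' - y) = 0).
  by apply/eqP; rewrite -subr_eq0; apply/eqP; exact: sin_eq0_small s0.
exfalso; case: (cos_sqr_eq Ey) => // E.
case: (cos_sqr_eq Exy); first by rewrite (_ : x + y' - (x + y) = y' - y)//; ring.
rewrite (_ : x + y' + (x + y) = 2 * x + (y' + y)); last by ring.
rewrite sinD E mulr0 addr0 => /eqP; rewrite mulf_eq0 => /orP[/eqP|/eqP c0].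
  exact: (@sin_neq0 k).
by have := cos2Dsin2 (y' + y); rewrite E c0; lra.
Qed.

Variable d : R.
Hypothesis d2 : d ^+ 2 = 1.
Variable rho0 : rep R.
Local Notation coords := (coords d d d (- 1)).
Local Notation valid := (valid d d d (- 1)).
Local Notation coord_set := (coord_set d d d (- 1)).
Let ca (v : pt) := 2 * cos v.1.
Let cb (v : pt) := 2 * cos v.2.
Let cc (v : pt) := - 2 * d * cos (v.1 + v.2).
Local Notation tri P v := (P (ca v) (cb v) (cc v)).

Let sg2 : (- 1 : R) ^+ 2 = 1. Proof. by rewrite sqrrN expr1n. Qed.
Let dd : d * d = 1. Proof. by rewrite -expr2. Qed.
Let d0 : d != 0. Proof. by rewrite -sqrf_eq0 d2 oner_eq0. Qed.

(** The complement consists of the points whose coordinates are both multiples of [pi / 2], where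
    the triple is not valid. *)
Let dom : set pt := [set v | sin (2 * v.1) != 0 \/ sin (2 * v.2) != 0].

Let trace_eqnE a b c : trace_eqn d d d (- 1) a b c <->
  c ^+ 2 + d * (a * b) * c + a ^+ 2 + b ^+ 2 - 4 = 0.
Proof. by rewrite /trace_eqn !dd !mul1r; split; lra. Qed.

Let factor v c : c ^+ 2 + d * (ca v * cb v) * c + ca v ^+ 2 + cb v ^+ 2 - 4 =
  (c - cc v) * (c - cc (v.1, - v.2)).
Proof.
rewrite /ca /cb /cc /= !cosD cosN sinN; have := cos2Dsin2 v.1; have := cos2Dsin2 v.2 => E1 E2.
transitivity (c ^+ 2 + 4 * d * (cos v.1 * cos v.2) * c +
  4 * d ^+ 2 * ((cos v.1 * cos v.2) ^+ 2 - sin v.1 ^+ 2 * sin v.2 ^+ 2)); last by ring.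
rewrite d2 (_ : sin v.1 ^+ 2 = 1 - cos v.1 ^+ 2); last by lra.
by rewrite (_ : sin v.2 ^+ 2 = 1 - cos v.2 ^+ 2); [ring|lra].
Qed.

Let sin2 (x : R) : sin (2 * x) = 2 * (sin x * cos x).
Proof. by rewrite mulr_natl mulr2n sinD; ring. Qed.

Let ca0 v : (ca v == 0) = (cos v.1 == 0). Proof. by rewrite mulf_eq0 pnatr_eq0. Qed.
Let cb0 v : (cb v == 0) = (cos v.2 == 0). Proof. by rewrite mulf_eq0 pnatr_eq0. Qed.
Let cc0 v : (cc v == 0) = (cos (v.1 + v.2) == 0).
Proof. by rewrite !mulf_eq0 oppr_eq0 pnatr_eq0 (negPf d0). Qed.

Let cos0 (x : R) : cos x = 0 -> sin x != 0.
Proof.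
move=> c0; apply/eqP => s0; have := cos2Dsin2 x; rewrite c0 s0; lra.
Qed.

Let edge (x : R) : (2 * cos x) ^+ 2 = 4 * (d * d) <-> sin x = 0.
Proof.
rewrite dd mulr1 exprMn; have := cos2Dsin2 x => E; split=> [h|h].
  by apply/eqP; rewrite -sqrf_eq0; apply/eqP; move: h; lra.
by move: E; rewrite h; lra.
Qed.

Let dom_valid v : dom v -> tri valid v.
Proof.
rewrite /dom /= !sin2 !mulf_eq0 !pnatr_eq0 !negb_or /= => st.
split.
- by apply/trace_eqnE; rewrite factor subrr mul0r.
- rewrite ca0 cb0 cc0 cosD.
  have [a0|a0] := eqVneq (cos v.1) 0; have [b0|b0] := eqVneq (cos v.2) 0;
    rewrite ?a0 ?b0 ?mul0r ?mulr0 ?sub0r ?oppr_eq0 ?mulf_eq0 ?negb_or //=.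
  + by case: st => /andP[]; rewrite ?a0 ?b0 eqxx.
  + by case: st => /andP[h1 h2]; [move: h2; rewrite a0 eqxx|rewrite h1 (cos0 a0)].
  + by case: st => /andP[h1 h2]; [rewrite h1 (cos0 b0)|move: h2; rewrite b0 eqxx].
- by move=> _; case: st => /andP[/eqP h1 h2]; [left|right]; move=> /edge.
Qed.

Let valid_dom v : tri valid v -> dom v.
Proof.
move=> [_ n0 /(_ erefl) e]; rewrite /dom /= !sin2 !mulf_eq0 !pnatr_eq0 !negb_or /=.
move: n0; rewrite ca0 cb0 cc0 cosD.
have [a0|a0] := eqVneq (sin v.1) 0; have [b0|b0] := eqVneq (sin v.2) 0.
- by exfalso; case: e => h; apply: h; apply/edge.
- by rewrite a0 !mul0r subr0 /=; case/or3P => /andP[h1 h2]; right; rewrite ?h2//;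
    move: h2; rewrite mulf_eq0 negb_or => /andP[].
- by rewrite b0 !mulr0 subr0 /=; case/or3P => /andP[h1 h2]; left; rewrite ?h1//;
    move: h2; rewrite mulf_eq0 negb_or => /andP[].
- by case/or3P => /andP[h1 h2]; rewrite ?h1 ?h2; [left|left|right].
Qed.

Let param_surj a b c : valid a b c -> a ^+ 2 <= 4 -> b ^+ 2 <= 4 ->
  exists v, [/\ a = ca v, b = cb v & c = cc v].
Proof.
move=> [/trace_eqnE E _ _] ha hb.
have solve (x : R) : x ^+ 2 <= 4 -> exists y, x = 2 * cos y.
  by move=> x4; exists (acos (x / 2)); rewrite acosK; [field|rewrite in_itv /=; apply/andP; split; nra].
have [x xE] := solve a ha; have [y yE] := solve b hb.
have := factor (x, y) c; rewrite /ca /cb /= -xE -yE E => /esym/eqP.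
rewrite mulf_eq0 !subr_eq0 => /orP[/eqP cE|/eqP cE]; first by exists (x, y).
by exists (x, - y); rewrite /ca /cb /= cosN.
Qed.

Let param_flips (v w : pt) s t : s ^+ 2 = 1 -> t ^+ 2 = 1 -> cos w.1 = s * cos v.1 ->
  cos w.2 = t * cos v.2 -> cos (w.1 + w.2) = s * t * cos (v.1 + v.2) ->
  tri (tri (@flips R) v) w.
Proof.
move=> s2 t2 E1 E2 E3; exists s, t; rewrite /ca /cb /cc; split=> //.
by rewrite E1 E2 E3; split; ring.
Qed.

Let twist12_param T : twist_invariant T -> forall x y,
  tri (coord_set T) (x, y) <-> tri (coord_set T) (x, y + 2 * x).
Proof.
move=> iT x y; apply: iff_trans (coord_set_twist12 d (-1) d2 d2 _ _ _ iT) _.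
have sE : sin x ^+ 2 = 1 - cos x ^+ 2 by have := cos2Dsin2 x; lra.
apply: coord_set_flips; exists 1, (-1); split; rewrite ?sqrrN ?expr1n//.
have yE : cos (y + 2 * x) = - (cos y + - 2 * cos x * cos (x + y)).
  by rewrite mulr_natl mulr2n !(cosD, sinD); transitivity (cos y * (cos x ^+ 2 - sin x ^+ 2) - 2 * sin y * sin x * cos x); [ring|rewrite sE; ring].
have xyE : cos (x + (y + 2 * x)) = - cos (x + y) + 2 * cos x * cos (y + 2 * x).
  rewrite (_ : x + y = (y + 2 * x) - x); last by ring.
  by rewrite cosB (cosD x); ring.
have bE : cb (x, y) + d * ca (x, y) * cc (x, y) = - cb (x, y + 2 * x).
  rewrite /ca /cb /cc /= yE; transitivity (2 * cos y - 4 * (d * d) * cos x * cos (x + y)); first by ring.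
  by rewrite dd; ring.
rewrite bE /ca /cb /cc /= xyE; split; ring.
Qed.

Let twist23_param T : twist_invariant T -> forall x y,
  tri (coord_set T) (x, y) <-> tri (coord_set T) (x + 2 * y, y).
Proof.
move=> iT x y; apply: iff_sym; apply: iff_trans (coord_set_twist23 d (-1) d2 d2 _ _ _ iT) _.
have dE z : d * d * z = z by rewrite dd mul1r.
apply: coord_set_flips; exists (-1), 1; split; rewrite ?sqrrN ?expr1n//.
have cE : cc (x + 2 * y, y) + d * cb (x + 2 * y, y) * ca (x + 2 * y, y) = 2 * d * cos (x + y).
  rewrite /ca /cb /cc /= (_ : x + y = (x + 2 * y) - y); last by ring.
  by rewrite cosB (cosD (x + 2 * y)); ring.
have xE : cos (x + 2 * y) = - cos x + 2 * cos y * cos (x + y).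
  rewrite (_ : x + 2 * y = (x + y) + y); last by ring.
  by rewrite {2}(_ : x = (x + y) - y); [rewrite cosB (cosD (x + y)); ring|ring].
rewrite cE /ca /cb /cc /= xE; split; try ring.
transitivity (- (2 * (- cos x + 2 * cos y * cos (x + y)) - d * d * (4 * cos y * cos (x + y)))); last by ring.
by rewrite dE; ring.
Qed.

Let ca_C1 D : C1 D ca.
Proof. by apply: C1_mul; [exact: C1_cst|apply: C1_cos; exact: C1_fst]. Qed.

Let cb_C1 D : C1 D cb.
Proof. by apply: C1_mul; [exact: C1_cst|apply: C1_cos; exact: C1_snd]. Qed.

Let cc_C1 D : C1 D cc.
Proof.
apply: C1_mul; first exact: C1_cst.
by apply: C1_cos; apply: C1_add; [exact: C1_fst|exact: C1_snd].
Qed.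

(** One coordinate ranges over a quarter turn and the other over a half turn: small enough for
    injectivity up to [flips], while countably many boxes cover [dom]. *)
Let box (p : bool * (int * int)) : set pt := let k := p.2.1%:~R * pi in let l := p.2.2%:~R * pi in
  if p.1 then [set v | k < 2 * v.1 < k + pi /\ l < 2 * v.2 < l + 2 * pi]
  else [set v | l < 2 * v.1 < l + 2 * pi /\ k < 2 * v.2 < k + pi].

Let box_open p : open (box p).
Proof.
have itv_open (f : pt -> R) (l u : R) : C1 setT f -> open [set v | l < f v < u].
  move=> [cf _]; rewrite (_ : mkset _ = f @^-1` `]l, u[%classic).
    by apply: open_comp; [move=> v _; exact: cf|exact: interval_open].
  by apply/seteqP; split=> v; rewrite /= in_itv.
have [C1x C1y] : C1 setT (fun v : pt => 2 * v.1) /\ C1 setT (fun v : pt => 2 * v.2).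
  by split; apply: C1_mul; [exact: C1_cst|exact: C1_fst|exact: C1_cst|exact: C1_snd].
by case: p => -[] [k l]; apply: openI; exact: itv_open.
Qed.

Let box_dom p : box p `<=` dom.
Proof.
have h (k : int) (x : R) : k%:~R * pi < 2 * x < k%:~R * pi + pi -> sin (2 * x) != 0.
  by move=> hk; apply/eqP; apply: (@sin_neq0 k); rewrite intrD mulrDl mul1r; lra.
by case: p => -[] [k l] v [/= h1 h2]; [left; exact: h h1|right; exact: h h2].
Qed.

Let dom_box v : dom v -> exists p, box p v.
Proof.
have pi0 := pi_gt0 R.
have fl (x : R) : exists k : int, k%:~R * pi <= x < k%:~R * pi + pi.
  exists (Num.floor (x / pi)); have /andP[h1 h2] := floor_itv (x / pi).
  by move: h1 h2; rewrite ler_pdivlMr// ltr_pdivrMr// intrD mulrDl mul1r => -> ->.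
have small (x : R) : exists l : int, l%:~R * pi < x < l%:~R * pi + 2 * pi.
  have [k hk] := fl x; exists (k - 1); rewrite intrD mulrDl mulN1r; lra.
have quarter (x : R) : sin x != 0 -> exists k : int, k%:~R * pi < x < k%:~R * pi + pi.
  move=> s0; have [k /andP[h1 h2]] := fl x; exists k; rewrite h2 andbT lt_neqAle h1 andbT.
  apply/eqP => E; move/eqP: s0; apply; rewrite -E -[X in sin X]add0r.
  by apply/(sin_int_period 0 k); exact: sin0.
case=> /quarter[k hk].
  by have [l hl] := small (2 * v.2); exists (true, (k, l)).
by have [l hl] := small (2 * v.1); exists (false, (k, l)).
Qed.

Let box_flips p v w : box p v -> box p w -> tri (tri (@flips R) v) w -> v = w.
Proof.
move=> bv bw [s [t [s2 t2 [aE bE cE]]]].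
have E1 : cos w.1 ^+ 2 = cos v.1 ^+ 2.
  have : ca w ^+ 2 = ca v ^+ 2 by rewrite aE exprMn s2 mul1r.
  by rewrite /ca !exprMn; lra.
have E2 : cos w.2 ^+ 2 = cos v.2 ^+ 2.
  have : cb w ^+ 2 = cb v ^+ 2 by rewrite bE exprMn t2 mul1r.
  by rewrite /cb !exprMn; lra.
have E3 : cos (w.1 + w.2) ^+ 2 = cos (v.1 + v.2) ^+ 2.
  have : cc w ^+ 2 = cc v ^+ 2 by rewrite cE !exprMn s2 t2 !mul1r.
  by rewrite /cc !exprMn d2; lra.
have half (k : int) (x : R) : k%:~R * pi < 2 * x < k%:~R * pi + pi -> k%:~R * pi < 2 * x < (k + 1)%:~R * pi.
  by move=> hk; rewrite intrD mulrDl mul1r; lra.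
move: v w bv bw E1 E2 E3 {aE bE cE} => [x y] [x' y'].
case: p => -[] [k l] /= [h1 h2] [h3 h4] E1 E2 E3.
  have [|/= -> ->//] := @box_inj k x x' y y' (half _ _ h1) (half _ _ h3) _ E1 E2 E3.
  by rewrite ltr_norml; move: h2 h4 => /=; lra.
have [|| /= -> ->//] := @box_inj k y y' x x' (half _ _ h2) (half _ _ h4) _ E2 E1.
  by rewrite ltr_norml; move: h1 h3 => /=; lra.
by rewrite addrC E3 addrC.
Qed.

Lemma elliptic_null T : mu2.-negligible ([set v | tri (coord_set T) v] : set plane) ->
  null_class ([set x | exists rho a b c, [/\ \pi_(moduli R) rho = x, coords rho a b c,
    a ^+ 2 <= 4 & b ^+ 2 <= 4]] `&` T).
Proof.
move=> B0.
pose N p : set (moduli R) := [set x | exists2 v, (box p `&` [set v | tri (coord_set T) v]) v &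
    exists2 rho : rep R, \pi_(moduli R) rho = x & tri (coords rho) v].
have nN : null_class (\bigcup_n N (odflt (true, (0, 0)) (unpickle n))).
  apply: null_class_bigcup => n; move: (odflt _ _) => p.
  have B1 : mu2.-negligible (box p `&` [set v | tri (coord_set T) v] : set plane).
    by apply: negligibleS B0 => v [].
  have V v : box p v -> tri valid v by move=> /box_dom; exact: dom_valid.
  have n0 := coord_null d2 d2 d2 sg2 rho0 (@box_open p) (ca_C1 _) (cb_C1 _) (cc_C1 _) V.
  by apply: null_class_sub (n0 _ (@box_flips p) B1 _) => [x|v []].
apply: null_class_sub nN => x [[rho [a [b [c [rE C ha hb]]]]] Tx].
have V := coords_valid d2 d2 d2 C; have [v [aE bE cE]] := param_surj V ha hb.
rewrite aE bE cE in V C; have [p bp] := dom_box (valid_dom V).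
exists (pickle p) => //; rewrite pickleK; exists v; last by exists rho.
by split=> //; exists rho; rewrite rE.
Qed.

Theorem elliptic_zero_one (S : set (moduli R)) (V := [set x | exists rho a b c,
    [/\ \pi_(moduli R) rho = x, coords rho a b c, a ^+ 2 <= 4 & b ^+ 2 <= 4]]) :
  borel S -> twist_invariant S -> null_class (V `&` S) \/ null_class (V `\` S).
Proof.
move=> bS iS.
have oD : open dom.
  have cont (f : pt -> R) : C1 setT f -> open [set v | sin (f v) != 0].
    move=> [cf _]; apply: (@open_comp _ _ (fun v => sin (f v)) [set x | x != 0]); last exact: open_neq.
    by move=> v _; apply: continuous_comp; [exact: cf|exact: continuous_sin].
  have [C1x C1y] : C1 setT (fun v : pt => 2 * v.1) /\ C1 setT (fun v : pt => 2 * v.2).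
    by split; apply: C1_mul; [exact: C1_cst|exact: C1_fst|exact: C1_cst|exact: C1_snd].
  by apply: openU; exact: cont.
have mS := coord_measurable d2 d2 d2 sg2 rho0 oD (ca_C1 _) (cb_C1 _) (cc_C1 _) (fun v => @dom_valid v) bS.
have {}mS : measurable ([set v | tri (coord_set S) v] : set plane).
  rewrite (_ : mkset _ = [set t | dom t /\ tri (coord_set S) t])//.
  apply/seteqP; split=> v; last by case.
  by move=> h; split=> //; apply: valid_dom; case: h => rho [_]; exact: coords_valid.
have [||||N0|N0] := torus_zero_one mS (pi_gt0 R).
- by move=> x y /=; exact: (twist12_param iS).
- by move=> x y /=; exact: (twist23_param iS).
- move=> x y; apply: coord_set_flips; apply: (@param_flips _ _ 1 (-1)); rewrite /= ?sqrrN ?expr1n//.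
  + by rewrite mul1r.
  + by rewrite cosDpi mulN1r.
  + by rewrite addrA cosDpi mul1r mulN1r.
- move=> x y; apply: coord_set_flips; apply: (@param_flips _ _ (-1) 1); rewrite /= ?sqrrN ?expr1n//.
  + by rewrite cosDpi mulN1r.
  + by rewrite mul1r.
  + by rewrite addrAC cosDpi mulr1 mulN1r.
- by left; exact: elliptic_null.
right; rewrite setDE; apply: elliptic_null.
apply: negligibleS N0 => v [rho [nS C]] /=.
by move=> /(coord_setE S C).
Qed.

End OddElliptic.

(** * Assembling the sign patterns *)

Section Components.
Variable R : realType.

Lemma par_one (e : R) v : par e v *m par (- e) v = 1%:M.
Proof. by rewrite parD subrr scalar_mx2 /par; congr mx2; ring. Qed.

(** Complementary pairs of parabolics have products that are inverse up to the sign -1; their traces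
    are compared. *)
Lemma odd_traces (e1 e2 e3 e4 : R) v1 v2 v3 v4 :
  par e1 v1 *m par e2 v2 *m (par e3 v3 *m par e4 v4) = (- 1)%:M ->
  e3 * e4 * w2 v3 v4 ^+ 2 = 4 - e1 * e2 * w2 v1 v2 ^+ 2 /\
  e1 * e4 * w2 v1 v4 ^+ 2 = 4 - e2 * e3 * w2 v2 v3 ^+ 2.
Proof.
move=> E; split.
  have : par e1 v1 *m par e2 v2 = - (par (- e4) v4 *m par (- e3) v3).
    have := congr1 (mulmx^~ (par (- e4) v4 *m par (- e3) v3)) E.
    rewrite -!mulmxA (mulmxA (par e4 v4)) par_one mul1mx par_one mulmx1 => ->.
    by rewrite mul_scalar_mx scaleN1r.
  move=> /(congr1 mxtrace); rewrite raddfN /= !par2_tr => h.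
  rewrite (_ : w2 v3 v4 = - w2 v4 v3); last by rewrite /w2; ring.
  by move: h; rewrite sqrrN; lra.
have : par e2 v2 *m par e3 v3 = - (par (- e1) v1 *m par (- e4) v4).
  have := congr1 (mulmx^~ (par (- e4) v4)) E.
  rewrite -!mulmxA par_one mulmx1 => /(congr1 (mulmx (par (- e1) v1))).
  rewrite mulmxA -{2}(opprK e1) par_one mul1mx => ->.
  by rewrite mul_scalar_mx scaleN1r mulmxN.
by move=> /(congr1 mxtrace); rewrite raddfN /= !par2_tr; lra.
Qed.

Lemma typed_odd_traces (e1 e2 e3 e4 : R) (rho : rep R) : typed e1 e2 e3 e4 (- 1) rho ->
  exists a b c p q, [/\ coords e1 e2 e3 (- 1) rho a b c,
    e3 * e4 * p ^+ 2 = 4 - e1 * e2 * a ^+ 2 & e1 * e4 * q ^+ 2 = 4 - e2 * e3 * b ^+ 2].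
Proof.
move=> [[a [b [c C]]] [v4 f4]]; have [v1 [v2 [v3 [F [wa wb wc E]]]]] := C.
have sg2 : (- 1 : R) ^+ 2 = 1 by rewrite sqrrN expr1n.
have [tE _ tP] := total_trace_typed sg2 F f4.
rewrite -wa -wb -wc in E; have [hp hq] := odd_traces (tP (tE.2 E)).
by exists a, b, c, (w2 v3 v4), (w2 v1 v4); rewrite -{2}wa -{2}wb.
Qed.

(** If [x^2 < 4], completing the square in [y] writes the negative number [x^2 - 4] as a sum of
    nonnegative terms. *)
Lemma trace_eqn_mixed (f x y z : R) : f ^+ 2 = 1 ->
  x ^+ 2 - y ^+ 2 - z ^+ 2 - f * (x * y * z) = 4 -> 4 <= x ^+ 2.
Proof.
move=> f2 E; rewrite leNgt; apply/negP => x4.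
have : (y + f * x * z / 2) ^+ 2 + z ^+ 2 * (4 - x ^+ 2) / 4 = x ^+ 2 - 4.
  transitivity (y ^+ 2 + f * (x * y * z) + z ^+ 2 + (f ^+ 2 - 1) * (x * z) ^+ 2 / 4); first by field.
  by rewrite f2 subrr mul0r mul0r addr0; lra.
have h1 := sqr_ge0 (y + f * x * z / 2).
have h2 : 0 <= z ^+ 2 * (4 - x ^+ 2) by apply: mulr_ge0; [exact: sqr_ge0|lra].
lra.
Qed.

(** Either the third sign differs from the first two and [trace_eqn_mixed] applies, or only the
    fourth differs and the trace of [c_3 c_4] gives the bound. *)
Lemma odd_bound (e1 e2 e3 e4 a b c p : R) :
  e1 ^+ 2 = 1 -> e2 ^+ 2 = 1 -> e3 ^+ 2 = 1 -> e4 ^+ 2 = 1 ->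
  ~ (e1 = e2 /\ e2 = e3 /\ e3 = e4) -> e1 * e2 = 1 ->
  e1 * e2 * a ^+ 2 + e2 * e3 * b ^+ 2 + e1 * e3 * c ^+ 2 + e1 * e2 * e3 * (a * b * c) = 2 - 2 * -1 ->
  e3 * e4 * p ^+ 2 = 4 - e1 * e2 * a ^+ 2 -> 4 <= a ^+ 2.
Proof.
move=> q1 q2 q3 q4 ns E12 E hp.
have E2 : e2 = e1 by rewrite -[e2]mul1r -q1 expr2 -mulrA E12 mulr1.
rewrite E12 E2 in E hp ns; have [E3|/eqP E3] := eqVneq e3 e1.
  have [E4|/eqP E4] := eqVneq e4 e1; first by exfalso; apply: ns; rewrite E3 E4.
  move: hp; rewrite E3 (_ : e1 * e4 = -1); first by have := sqr_ge0 p; lra.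
  by move: E4; case: (sign_cases q1) => ->; case: (sign_cases q4) => -> // _; ring.
have E13 : e1 * e3 = -1.
  by move: E3; case: (sign_cases q1) => ->; case: (sign_cases q3) => -> // _; ring.
have E3N : e3 = - e1 by rewrite -[e3]mul1r -q1 expr2 -mulrA E13 mulrN1.
apply: (trace_eqn_mixed (f := e1) (y := b) (z := c)) => //.
by move: E; rewrite E13 mul1r E3N; lra.
Qed.

Lemma typed_zero_one (e1 e2 e3 e4 sg : R) (rho0 : rep R) (S : set (moduli R)) :
  [/\ e1 ^+ 2 = 1, e2 ^+ 2 = 1, e3 ^+ 2 = 1, e4 ^+ 2 = 1 & sg ^+ 2 = 1] ->
  (sg = 1 -> e1 = e2 -> e2 = e3 -> False) -> borel S -> twist_invariant S ->
  let W := [set x | exists2 rho : rep R, \pi_(moduli R) rho = x & typed e1 e2 e3 e4 sg rho] in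
  null_class (W `&` S) \/ null_class (W `\` S).
Proof.
move=> [q1 q2 q3 q4 qs] nsame bS iS W.
have red (V : set (moduli R)) : W `<=` V -> null_class (V `&` S) \/ null_class (V `\` S) ->
    null_class (W `&` S) \/ null_class (W `\` S).
  by move=> WV [h|h]; [left|right]; apply: null_class_sub h => x [Wx Sx]; split=> //; exact: WV.
have neq (x y : R) : x ^+ 2 = 1 -> y ^+ 2 = 1 -> x <> y -> y = - x.
  by move=> /sign_cases[]-> /sign_cases[]->; rewrite ?opprK.
case: (sign_cases qs) => sgE; subst sg.
  have WV : W `<=` [set x | exists (rho : rep R) a b c, \pi_(moduli R) rho = x /\ coords e1 e2 e3 1 rho a b c].
    by move=> x [rho <- [[a [b [c C]]] _]]; exists rho, a, b, c.
  apply: (red _ WV).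
  have [E12|E12] := eqVneq e1 e2.
    have [E23|/eqP E23] := eqVneq e2 e3; first by exfalso; exact: nsame.
    by rewrite (neq _ _ q2 q3 E23) -E12; exact: even_zero_one3.
  have [E23|/eqP E23] := eqVneq e2 e3.
    have -> : e1 = - e2 by rewrite (neq e1 e2)// ?opprK//; exact/eqP.
    by rewrite -E23; exact: even_zero_one1.
  have E2 : e2 = - e1 by apply: neq => //; exact/eqP.
  have -> : e3 = e1 by rewrite (neq _ _ q2 q3 E23) E2 opprK.
  by rewrite E2; exact: even_zero_one2.
have [same|nsame'] := pselect (e1 = e2 /\ e2 = e3 /\ e3 = e4).
  case: same => E12 [E23 E34]; subst e2 e3 e4.
  have WV : W `<=` [set x | exists (rho : rep R) a b c, [/\ \pi_(moduli R) rho = x,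
      coords e1 e1 e1 (-1) rho a b c, a ^+ 2 <= 4 & b ^+ 2 <= 4]].
    move=> x [rho <- /typed_odd_traces[a [b [c [p [q [C hp hq]]]]]]]; exists rho, a, b, c.
    move: hp hq; rewrite -expr2 q1 !mul1r; have := sqr_ge0 p; have := sqr_ge0 q.
    by split=> //; lra.
  by apply: (red _ WV); exact: elliptic_zero_one.
have WV : W `<=` [set x | exists (rho : rep R) a b c, [/\ \pi_(moduli R) rho = x,
    coords e1 e2 e3 (-1) rho a b c, e1 * e2 = 1 -> 4 <= a ^+ 2 & e2 * e3 = 1 -> 4 <= b ^+ 2]].
  move=> x [rho <- /typed_odd_traces[a [b [c [p [q [C hp hq]]]]]]]; exists rho, a, b, c.
  have [E _ _] := coords_valid q1 q2 q3 C; rewrite /trace_eqn in E.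
  split=> // [E12|E23].
    exact: (odd_bound q1 q2 q3 q4 nsame' E12 E hp).
  (* The same bound for [b], by exchanging the first and third vectors. *)
  apply: (odd_bound (e1 := e3) (e2 := e2) (e3 := e1) (e4 := e4) (b := a) (c := c) (p := q)) => //.
  - by move=> [h1 [h2 h3]]; apply: nsame'; rewrite h1 h2 h3.
  - by rewrite mulrC.
  - by rewrite (mulrC e3 e2) (mulrC e2 e1) (mulrC e3 e1); lra.
  - by rewrite (mulrC e3 e2).
apply: (red _ WV); exact: odd_zero_one.
Qed.

End Components.

Theorem theorem1p4 (R : realType) (C : set (moduli R))
    (hC : is_component C) (hne : non_extremal C) :
  ergodic (@mcg_act R) (@borel R) (@goldman_measure R) C.
Proof.
move=> S SC bS iS; have [e1 [e2 [e3 [e4 [sg [signs types]]]]]] := component_typed hC.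
have [x0 CE] := hC; pose rho0 := repr x0.
have Cx : C (\pi_(moduli R) rho0) by rewrite reprK CE; exact: connected_component_refl.
(* This is where non-extremality enters, through the Euler class. *)
have nsame : sg = 1 -> e1 = e2 -> e2 = e3 -> False.
  move=> s1 E12 E23; subst sg e3 e2.
  have [[a [b [c Cr]]] _] := types _ Cx; have [k kE kI] := hne _ Cx.
  by case: signs => q1 _ _ _ _; exact: euler_same_sign q1 Cr kE kI.
have tS : twist_invariant S by move=> phi _ x; rewrite -{2}(iS phi).
have CW x : C x -> exists2 rho : rep R, \pi_(moduli R) rho = x & typed e1 e2 e3 e4 sg rho.
  by rewrite -[x]reprK => Cr; exists (repr x) => //; exact: types.
have [n0|n0] := typed_zero_one rho0 signs nsame bS tS; [left|right]; apply: null_class_measure.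
  by apply: null_class_sub n0 => x Sx; split=> //; exact/CW/SC.
by apply: null_class_sub n0 => x [Cx' nSx]; split=> //; exact: CW.
Qed.
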